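(* Let $A>0$. For all positive real numbers $x$ and $Q$ satisfying $x(\log x)^{-A}\le Q\le x$, \[\sum_{q\le Q}\ \max_{\pi\in\mathcal{P}_x}\ \sum_{\substack{a\le q\\ (a,q)=1}}\ \sum_{I\in\pi}\left(\theta(I;q,a)-\frac{|I|}{\phi(q)}\right)^2 \ll_A xQ\log^2(x),\] where the implied constant depends only on $A$.
   Context: $\phi$ is Euler's totient function and $\log$ is the natural logarithm. For an interval $I$ and positive integers $q,a$, $\theta(I;q,a)=\sum_{p\in I,\ p\equiv a \bmod q}\log p$, the sum over primes $p$. $|I|$ denotes the number of integers contained in $I$. $\mathcal{P}_x$ denotes the set of all partitions of $\{1,2,\ldots,\lfloor x\rfloor\}$ into disjoint intervals (of consecutive integers). *)

(* Defs.v *)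
From HB Require Import structures.
From mathcomp Require Import all_boot all_order all_algebra.
From mathcomp Require Import all_classical all_reals all_analysis.
Set Implicit Arguments. Unset Strict Implicit. Unset Printing Implicit Defensive.
Import Order.TTheory GRing.Theory Num.Theory.
Local Open Scope ring_scope.
Local Open Scope classical_set_scope.

(* An interval of consecutive integers is encoded by a pair (l, r) with
   l <= r, standing for {l, l+1, ..., r}. *)
Definition ival_elems (I : nat * nat) : seq nat := iota I.1 (I.2 - I.1).+1.

Definition ival_card (I : nat * nat) : nat := (I.2 - I.1).+1.

Definition is_ival_partition (N : nat) (pi : seq (nat * nat)) : Prop :=
  all (fun J => (J.1 <= J.2)%N) pi /\
  flatten [seq ival_elems J | J <- pi] = iota 1 N.

Definition theta_ival {R : realType} (I : nat * nat) (q a : nat) : R :=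
  \sum_(p <- ival_elems I | prime p && (p %% q == a %% q)%N) ln (p%:R : R).

Definition var_sum {R : realType} (q : nat) (pi : seq (nat * nat)) : R :=
  \sum_(1 <= a < q.+1 | coprime a q)
    \sum_(J <- pi) (theta_ival J q a - (ival_card J)%:R / (totient q)%:R) ^+ 2.

(* max over all partitions pi in P_x (a finite nonempty set), of var_sum *)
Definition max_var_sum {R : realType} (x : R) (q : nat) : R :=
  sup [set var_sum q pi | pi in [set pi | is_ival_partition (Num.truncn x) pi]].

(* Main.v *)
(* Chaining: a difference T(b) - T(a) splits over dyadic levels k, weighted by r^(K - k) with
   r = 2^(1/m), and pieces shorter than q are bounded trivially. On a dyadic block, Plancherel
   mod q regroups the frequencies as reduced fractions b/d with d | q. Large d fall to the
   large sieve; small d, needed for long blocks only, to Siegel-Walfisz. The latter is derived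
   without contours: lower bounds for L(1 + it, chi) (3-4-1, Siegel's trick at t = 0) feed a
   Tauberian argument with a Fejer kernel. *)

Require Import Defs.
From HB Require Import structures.
From mathcomp Require Import all_boot all_order all_algebra.
From mathcomp Require Import all_classical all_reals all_analysis.
From mathcomp Require Import complex ring lra zify cyclic.
Set Implicit Arguments. Unset Strict Implicit. Unset Printing Implicit Defensive.
Import Order.TTheory GRing.Theory Num.Theory.
Import ComplexField.Normc.
Import numFieldNormedType.Exports.
Local Open Scope ring_scope.

(** The partition may depend on [q], so the bound must hold for all choices of end points at once;
    chaining replaces them by the complete set of dyadic blocks. The weights [r ^+ (K - k)] keep the
    sum of their inverses bounded, whatever the number of levels. In return the level with [2 ^ k]
    about [Q] is charged [(x / Q) ^ (1 / m)], at most a constant times [ln x] because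
    [Q >= x / ln x ^ m]; together with the [x Q ln x] which the large sieve gives at that level this
    is the final bound. Siegel-Walfisz has to win any fixed power of [ln x], uniformly in moduli up
    to another power. No analytic continuation is used: complex series are taken at real [s > 1],
    twisted by [n ^ (-it)], and derivatives in [s] are series weighted by powers of [ln n]. The
    [k]-th derivative of [L'/L] is bounded by [(q (1 + |t|)) ^ e] with a small [e]; dividing by
    [ln x ^ k] at the end gives the saving, since [k] is free. Series with a pole are first
    multiplied by [1 - m ^ (1 - s)]. *)

Lemma ex_named (T : Type) (x : T) : exists y, y = x. Proof. by exists x. Qed.

(** * Order and logarithm *)

Section Order.
Variable R : realType.

Lemma ge1_gt0 (x : R) : 1 <= x -> 0 < x. Proof. exact: lt_le_trans. Qed.

Lemma eq_lew (x y : R) : x = y -> x <= y. Proof. by move->. Qed.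

Lemma ln_ge1_gt0 (x : R) : 1 <= ln x -> 0 < x.
Proof. by move=> L1; rewrite ltNge; apply/negP => /ln0 e; move: L1; rewrite e ler10. Qed.

End Order.

(** * The norm of complex numbers; Cauchy-Schwarz *)

Section ComplexNorm.
Variable R : realType.
Local Notation C := R[i].

Lemma normc_ge0 (z : C) : 0 <= normc z.
Proof. by case: z => a b; exact: sqrtr_ge0. Qed.

Lemma normc_norm (z : C) : (normc z)%:C%C = `|z|.
Proof. by []. Qed.

Lemma normcR (x : R) : normc x%:C%C = `|x|.
Proof. by rewrite /= expr0n addr0 sqrtr_sqr. Qed.

Lemma normcR_ge0 (x : R) : 0 <= x -> normc x%:C%C = x.
Proof. by move=> x0; rewrite normcR ger0_norm. Qed.

Lemma normcX (z : C) n : normc (z ^+ n) = normc z ^+ n.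
Proof. by elim: n => [|n IH]; rewrite ?normc1 // !exprS normcM IH. Qed.

Lemma normc_nat n : normc (n%:R : C) = n%:R.
Proof. by rewrite -(rmorph_nat (real_complex R)) normcR_ge0. Qed.

Lemma normc_sum (I : Type) (r : seq I) (P : pred I) (F : I -> C) :
 normc (\sum_(i <- r | P i) F i) <= \sum_(i <- r | P i) normc (F i).
Proof.
elim/big_rec2: _ => [|i y z _ h]; first by rewrite normc0.
by apply: le_trans (le_normcD _ _) _; rewrite lerD2l.
Qed.

Lemma normcB_le (x y : C) : normc (x - y) <= normc x + normc y.
Proof. by rewrite -(normcN y) le_normcD. Qed.

Lemma ler_normcB (x y : C) : normc x - normc y <= normc (x - y).
Proof. by rewrite lerBlDr -[in normc x](subrK y x) le_normcD. Qed.

Lemma normc_distC (x y : C) : normc (x - y) = normc (y - x).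
Proof. by rewrite -normcN opprB. Qed.

Lemma normc_conj (z : C) : normc (conjc z) = normc z.
Proof. by case: z => a b /=; rewrite sqrrN. Qed.

Lemma mulc_conj (z : C) : z * conjc z = (normc z ^+ 2)%:C%C.
Proof. by rewrite rmorphXn /= normc_norm sqr_normc. Qed.

Lemma normc2E (z : C) : normc z ^+ 2 = complex.Re z ^+ 2 + complex.Im z ^+ 2.
Proof. by case: z => a b; rewrite sqr_sqrtr // addr_ge0 ?sqr_ge0. Qed.

Lemma Re_le_normc (z : C) : `|complex.Re z| <= normc z.
Proof.
case: z => a b; rewrite -sqrtr_sqr ler_sqrt ?lerDl ?sqr_ge0 //.
by rewrite addr_ge0 ?sqr_ge0.
Qed.

Lemma Im_le_normc (z : C) : `|complex.Im z| <= normc z.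
Proof.
case: z => a b; rewrite -sqrtr_sqr ler_sqrt ?lerDr ?sqr_ge0 //.
by rewrite addr_ge0 ?sqr_ge0.
Qed.

Lemma normc_le_ReIm (z : C) : normc z <= `|complex.Re z| + `|complex.Im z|.
Proof.
rewrite -(ler_pXn2r (n := 2)) ?nnegrE ?normc_ge0 //.
rewrite normc2E sqrrD !real_normK ?num_real //.
by rewrite lerD2r lerDl mulrn_wge0 // mulr_ge0.
Qed.

Lemma normc_eq0 (z : C) : (normc z == 0) = (z == 0).
Proof. by apply/eqP/eqP => [/eq0_normc|->] //; rewrite normc0. Qed.

Lemma normc_gt0 (z : C) : (0 < normc z) = (z != 0).
Proof. by rewrite lt_neqAle normc_ge0 andbT eq_sym normc_eq0. Qed.

(** Induction on the list: with [A = u ^ 2] and [B = v ^ 2] the new cross term [2 a b S] is at most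
    [2 |a b| u v <= a ^ 2 v ^ 2 + b ^ 2 u ^ 2]. *)
Lemma cauchy_schwarz_seq (I : Type) (r : seq I) (P : pred I) (a b : I -> R) :
 (\sum_(i <- r | P i) a i * b i) ^+ 2 <=
 (\sum_(i <- r | P i) a i ^+ 2) * (\sum_(i <- r | P i) b i ^+ 2).
Proof.
elim: r => [|x r IH]; first by rewrite !big_nil expr0n mul0r.
rewrite !big_cons; case: (P x) => //.
set S := \sum_(j <- r | P j) _ in IH *; set A := \sum_(j <- r | P j) a j ^+ 2 in IH *.
set B := \sum_(j <- r | P j) b j ^+ 2 in IH *.
have A0 : 0 <= A by apply: sumr_ge0 => i _; exact: sqr_ge0.
have B0 : 0 <= B by apply: sumr_ge0 => i _; exact: sqr_ge0.
have [u [u0 Au]] : exists u, 0 <= u /\ A = u ^+ 2.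
 by exists (Num.sqrt A); rewrite sqrtr_ge0 sqr_sqrtr.
have [v [v0 Bv]] : exists v, 0 <= v /\ B = v ^+ 2.
 by exists (Num.sqrt B); rewrite sqrtr_ge0 sqr_sqrtr.
have S1 : `|S| <= u * v.
 rewrite -(ler_pXn2r (n := 2)) ?nnegrE ?mulr_ge0 //.
 by rewrite real_normK ?num_real // exprMn -Au -Bv.
have h1 : a x * b x * S <= `|a x * b x| * (u * v).
 apply: le_trans (ler_norm _) _; rewrite normrM ler_wpM2l //.
have h2 : `|a x * b x| * (u * v) *+ 2 <= a x ^+ 2 * v ^+ 2 + b x ^+ 2 * u ^+ 2.
 rewrite normrM; have := sqr_ge0 (`|a x| * v - `|b x| * u).
 rewrite -(real_normK (num_real (a x))) -(real_normK (num_real (b x))).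
 by lra.
rewrite Au Bv in IH *.
by lra.
Qed.

End ComplexNorm.

(** * The unit circle *)

Section Expi.
Variable R : realType.
Local Notation C := R[i].

Definition expi (t : R) : C := (cos t +i* sin t)%C.

Lemma expiD a b : expi (a + b) = expi a * expi b.
Proof.
rewrite /expi cosD sinD; apply/eqP; rewrite eq_complex eqxx /=.
by rewrite [sin a * _ + _]addrC.
Qed.

Lemma expi0 : expi 0 = 1.
Proof. by rewrite /expi cos0 sin0. Qed.

Lemma normc_expi t : normc (expi t) = 1.
Proof. by rewrite /= cos2Dsin2 sqrtr1. Qed.

Lemma expiMn t n : expi (n%:R * t) = expi t ^+ n.
Proof.
elim: n => [|n IH]; first by rewrite mul0r expi0.
by rewrite -natr1 mulrDl mul1r expiD IH exprSr.
Qed.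

Lemma conj_expi t : conjc (expi t) = expi (- t).
Proof. by rewrite /expi cosN sinN. Qed.

Lemma sin_le_id (x : R) : 0 <= x -> sin x <= x.
Proof.
move=> x0; rewrite -subr_ge0.
have : {in `]0, x[, forall y : R, is_derive y 1 (fun z : R => z - sin z) (1 - cos y)}.
 by move=> y _; apply: is_derive_eq.
move=> hd; have [->|xn0] := eqVneq x 0; first by rewrite sin0 subrr.
have x_gt0 : 0 < x by lra.
have [|c _] := MVT x_gt0 hd.
 by apply: derivable_within_continuous => y _.
rewrite sin0 !subr0 => ->; rewrite mulr_ge0 // subr_ge0; exact: cos_le1.
Qed.

Lemma norm_sin_le (x : R) : `|sin x| <= `|x|.
Proof.
wlog x0 : x / 0 <= x.
 by move=> h; case: (leP 0 x) => [/h //|/ltW]; rewrite -oppr_ge0 => /h; rewrite sinN !normrN.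
rewrite (ger0_norm x0); have [x2|x2] := leP x 1; last first.
 by apply: le_trans (sin_max _) (ltW x2).
rewrite ger0_norm ?sin_le_id // sin_ge0_pi // x0 (le_trans x2) //.
by apply: le_trans (pi_ge2 R); rewrite ler1n.
Qed.

Lemma normc_expiB1_sqr t : normc (expi t - 1) ^+ 2 = 4 * sin (t / 2) ^+ 2.
Proof.
rewrite normc2E /= oppr0 addr0.
have {1 2}-> : t = (t / 2) *+ 2 by lra.
rewrite cos_mulr2n sin_mulr2n.
by have := cos2Dsin2 (t / 2); nra.
Qed.

Lemma normc_expiB1 t : normc (expi t - 1) <= `|t|.
Proof.
rewrite -(ler_pXn2r (n := 2)) ?nnegrE ?normc_ge0 //.
rewrite normc_expiB1_sqr.
have h := norm_sin_le (t / 2).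
have : `|sin (t / 2)| ^+ 2 <= `|t / 2| ^+ 2 by rewrite ler_pXn2r.
by rewrite !real_normK ?num_real // exprMn; nra.
Qed.

Lemma normc_expiB a b : normc (expi a - expi b) <= `|a - b|.
Proof.
have -> : expi a - expi b = expi b * (expi (a - b) - 1).
 by rewrite mulrBr mulr1 -expiD [b + _]addrC subrK.
by rewrite normcM normc_expi mul1r normc_expiB1.
Qed.

End Expi.

(** * Limits and absolutely convergent series *)

Section Limits.
Variable R : realType.
Local Notation C := R[i].

Definition tends (u : nat -> C) (l : C) := forall e : R, 0 < e ->
 exists N0, forall N, (N0 <= N)%N -> normc (u N - l) <= e.

Lemma tends_cst l : tends (fun=> l) l.
Proof. by move=> e e0; exists 0%N => N _; rewrite subrr normc0 ltW. Qed.

Lemma eq_tends u v l : (forall N, u N = v N) -> tends u l -> tends v l.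
Proof. by move=> h t e /t[N0 hN]; exists N0 => N /hN; rewrite h. Qed.

Lemma tendsD u v l m : tends u l -> tends v m -> tends (fun N => u N + v N) (l + m).
Proof.
move=> hu hv e e0; have e2 : 0 < e / 2 by lra.
have [N1 h1] := hu _ e2; have [N2 h2] := hv _ e2.
exists (maxn N1 N2) => N; rewrite geq_max => /andP[/h1 a /h2 b].
rewrite opprD addrACA; apply: le_trans (le_normcD _ _) _.
by lra.
Qed.

Lemma tendsN u l : tends u l -> tends (fun N => - u N) (- l).
Proof.
by move=> hu e /hu[N0 h]; exists N0 => N /h; rewrite -opprD normcN.
Qed.

Lemma tendsB u v l m : tends u l -> tends v m -> tends (fun N => u N - v N) (l - m).
Proof. by move=> hu /tendsN; exact: tendsD. Qed.

Lemma tends_bounded u l : tends u l ->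
 exists B N0, 0 < B /\ forall N, (N0 <= N)%N -> normc (u N) <= B.
Proof.
move=> /(_ 1 ltr01)[N0 h]; exists (1 + normc l), N0; split.
 by rewrite ltr_pwDl ?normc_ge0.
move=> N /h; rewrite -lerBlDr; apply: le_trans; exact: ler_normcB.
Qed.

Lemma tendsM u v l m : tends u l -> tends v m -> tends (fun N => u N * v N) (l * m).
Proof.
move=> hu hv e e0; have [B [N1 [B0 hB]]] := tends_bounded hu.
have m0 : 0 < 1 + normc m by rewrite ltr_pwDl ?normc_ge0.
have [|N2 h2] := hu (e / 2 / (1 + normc m)); first by rewrite !divr_gt0.
have [|N3 h3] := hv (e / 2 / B); first by rewrite !divr_gt0.
exists (maxn N1 (maxn N2 N3)) => N; rewrite !geq_max => /and3P[/hB a /h2 b /h3 c].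
have -> : u N * v N - l * m = u N * (v N - m) + (u N - l) * m by ring.
apply: le_trans (le_normcD _ _) _; rewrite !normcM (splitr e).
apply: lerD.
 apply: le_trans (ler_pM (normc_ge0 _) (normc_ge0 _) a c) _.
 by rewrite mulrC divfK // gt_eqF.
apply: le_trans (ler_wpM2r (normc_ge0 _) b) _.
rewrite -[leLHS]mulrA -[leRHS]mulr1 ler_wpM2l ?divr_ge0 ?ltW //.
by rewrite ltr_pdivrMl // mulr1 ltrDr.
Qed.

Lemma tends_normc_le u l B N0 : tends u l ->
 (forall N, (N0 <= N)%N -> normc (u N) <= B) -> normc l <= B.
Proof.
move=> hu hB; apply/ler_addgt0Pr => e e0; have [N1 h] := hu _ e0.
have := h _ (leq_maxr N0 N1); have := hB _ (leq_maxl N0 N1).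
set z := u _ => zB ze; have -> : l = z - (z - l) by ring.
by apply: le_trans (normcB_le _ _) _; rewrite lerD.
Qed.

Lemma tends_uniq u l m : tends u l -> tends u m -> l = m.
Proof.
move=> hl hm; apply/eqP; rewrite -subr_eq0 -normc_eq0 eq_le normc_ge0 andbT.
apply: (@tends_normc_le (fun N => u N - u N) (l - m) 0 0%N).
 exact: tendsB.
by move=> N _; rewrite subrr normc0.
Qed.

(** Absolute convergence is stated with an explicit bound, which then also bounds the norm of the
    sum. *)
Definition absum (a : nat -> C) (B : R) :=
 forall N, \sum_(1 <= n < N) normc (a n) <= B.

Lemma abs_series_cvg (v : nat -> R) B :
 (forall N, \sum_(1 <= n < N) `|v n| <= B) ->
 exists l : R, forall e : R, 0 < e -> exists N0, forall N, (N0 <= N)%N ->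
  `|\sum_(1 <= n < N) v n - l| <= e.
Proof.
move=> hB; pose u k := if k is 0%N then 0 else v k.
have su (w : nat -> R) N :
  \sum_(0 <= k < N) (if k is 0%N then 0 else w k) = \sum_(1 <= k < N) w k.
 case: N => [|N]; first by rewrite !big_geq.
 rewrite big_nat_recl // add0r big_add1 //=.
have cn : cvgn (series (fun n => `|u n|) : R^nat).
 apply: nondecreasing_is_cvgn.
  apply/nondecreasing_seqP => n.
  by rewrite /series /= big_nat_recr //= lerDl.
 exists B => _ [N _ <-]; rewrite /series.
 apply: le_trans (hB N); rewrite -su; apply: ler_sum => -[|k] _.
  by rewrite normr0.
 by [].
have := @normed_cvg R R u cn; move/cvg_ex => [l hl]; exists l => e e0.
have /cvgrPdist_le /(_ e e0) [N0 _ h] := hl.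
exists N0 => N /h; rewrite /series /= distrC.
by rewrite -su.
Qed.

Lemma absum_tends a B : absum a B -> exists l, tends (fun N => \sum_(1 <= n < N) a n) l.
Proof.
move=> h.
have [|l1 h1] := @abs_series_cvg (fun n => complex.Re (a n)) B.
 by move=> N; apply: le_trans (h N); apply: ler_sum => i _; exact: Re_le_normc.
have [|l2 h2] := @abs_series_cvg (fun n => complex.Im (a n)) B.
 by move=> N; apply: le_trans (h N); apply: ler_sum => i _; exact: Im_le_normc.
exists (l1 +i* l2)%C => e e0; have e2 : 0 < e / 2 by rewrite divr_gt0.
have [N1 k1] := h1 _ e2; have [N2 k2] := h2 _ e2.
exists (maxn N1 N2) => N; rewrite geq_max => /andP[/k1 b1 /k2 b2].
apply: le_trans (normc_le_ReIm _) _.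
have -> : \sum_(1 <= n < N) a n =
  ((\sum_(1 <= n < N) complex.Re (a n)) +i* (\sum_(1 <= n < N) complex.Im (a n)))%C.
 elim: {b1 b2}N => [|N IH]; first by rewrite !big_geq.
 case: N IH => [|N] IH; first by [].
 by rewrite !(big_nat_recr N.+1) //= IH; case: (a _).
by lra.
Qed.

(** The default 0 for a divergent series only serves to make the sum a total function; its value is
    meaningful under [absum]. *)
Definition dsum (a : nat -> C) : C :=
 xget 0 [set l | tends (fun N => \sum_(1 <= n < N) a n) l]%classic.

Lemma dsum_tends a B : absum a B -> tends (fun N => \sum_(1 <= n < N) a n) (dsum a).
Proof.
move=> /absum_tends[l hl]; rewrite /dsum; case: xgetP => [m -> //|/(_ l)/(_ hl)[]].
Qed.

Lemma dsumE a l : tends (fun N => \sum_(1 <= n < N) a n) l -> dsum a = l.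
Proof.
move=> hl; rewrite /dsum; case: xgetP => [m -> h|/(_ l)/(_ hl)[]].
exact: tends_uniq h hl.
Qed.

Lemma eq_dsum a b : (forall n, (0 < n)%N -> a n = b n) -> dsum a = dsum b.
Proof.
move=> h; rewrite /dsum; congr xget; apply/seteqP.
have e N : \sum_(1 <= n < N) a n = \sum_(1 <= n < N) b n.
 by apply: eq_big_nat => n /andP[/h].
by split => l; apply: eq_tends => N; rewrite e.
Qed.

Lemma eq_absum a b B : (forall n, (0 < n)%N -> a n = b n) -> absum a B -> absum b B.
Proof.
move=> h hB N; apply: le_trans (hB N); apply: eq_lew.
by apply: eq_big_nat => n /andP[/h ->].
Qed.

Lemma absum_le a b B : (forall n, (0 < n)%N -> normc (a n) <= normc (b n)) ->
 absum b B -> absum a B.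
Proof.
by move=> h hB N; apply: le_trans (hB N); apply: ler_sum_nat => n /andP[/h].
Qed.

Lemma normc_dsum_le a B : absum a B -> normc (dsum a) <= B.
Proof.
move=> h; apply: (tends_normc_le (dsum_tends h) (N0 := 0%N)) => N _.
by apply: le_trans (normc_sum _ _ _) (h N).
Qed.

Lemma absumD a b A B : absum a A -> absum b B -> absum (fun n => a n + b n) (A + B).
Proof.
move=> ha hb N; apply: le_trans (lerD (ha N) (hb N)).
by rewrite -big_split; apply: ler_sum => n _; exact: le_normcD.
Qed.

Lemma absumZ k a A : absum a A -> absum (fun n => k * a n) (normc k * A).
Proof.
move=> ha N; under eq_bigr do rewrite normcM.
by rewrite -mulr_sumr ler_wpM2l ?normc_ge0.
Qed.

Lemma dsumD a b A B : absum a A -> absum b B ->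
 dsum (fun n => a n + b n) = dsum a + dsum b.
Proof.
move=> ha hb; apply: dsumE.
apply: (eq_tends _ (tendsD (dsum_tends ha) (dsum_tends hb))) => N.
by rewrite big_split.
Qed.

Lemma dsumZ k a A : absum a A -> dsum (fun n => k * a n) = k * dsum a.
Proof.
move=> ha; apply: dsumE.
apply: (eq_tends _ (tendsM (tends_cst k) (dsum_tends ha))) => N.
by rewrite mulr_sumr.
Qed.

Lemma absum0 : absum (fun=> 0) 0.
Proof. by move=> N; rewrite big1 // => i _; rewrite normc0. Qed.

Lemma dsum_sum (I : Type) (r : seq I) (a : I -> nat -> C) :
 (forall i, exists A, absum (a i) A) ->
 (exists A, absum (fun n => \sum_(i <- r) a i n) A) /\
 dsum (fun n => \sum_(i <- r) a i n) = \sum_(i <- r) dsum (a i).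
Proof.
move=> h; elim: r => [|i r [[A hA] IH]].
 split.
  by exists 0; apply: eq_absum absum0 => n _; rewrite big_nil.
 rewrite big_nil; apply: dsumE; apply: eq_tends (tends_cst 0) => N.
 by rewrite big1 // => n _; rewrite big_nil.
have [Ai hAi] := h i.
have e n : (0 < n)%N -> a i n + \sum_(j <- r) a j n = \sum_(j <- i :: r) a j n.
 by rewrite big_cons.
split; first by exists (Ai + A); apply: eq_absum e (absumD hAi hA).
by rewrite -(eq_dsum e) (dsumD hAi hA) IH big_cons.
Qed.

Lemma absum_tail a A e : absum a A -> 0 < e ->
 exists N0, forall N M, (N0 <= N)%N -> \sum_(N <= n < M) normc (a n) <= e.
Proof.
move=> hA e0.
have [|l hl] := @abs_series_cvg (fun n => normc (a n)) A.
 by move=> N; under eq_bigr do rewrite ger0_norm ?normc_ge0 //.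
have [|N0 h] := hl (e / 2); first by lra.
exists N0.+1 => N M hN; have [NM|NM] := leqP N M; last by rewrite big_geq ?ltW // ltnW.
have -> : \sum_(N <= n < M) normc (a n) =
  (\sum_(1 <= n < M) normc (a n) - l) - (\sum_(1 <= n < N) normc (a n) - l).
 rewrite (big_cat_nat _ (m := 1) (n := N) (p := M)) //=; last by lia.
 by ring.
apply: le_trans (ler_norm _) _; apply: le_trans (ler_normB _ _) _.
by rewrite (splitr e) lerD // h ?(leq_trans _ NM) // (leq_trans _ hN).
Qed.

Lemma normc_dsum_head_tail a A N E : absum a A ->
 (forall M, (N <= M)%N -> normc (\sum_(N <= n < M) a n) <= E) -> (0 < N)%N ->
 normc (dsum a - \sum_(1 <= n < N) a n) <= E.
Proof.
move=> hA hE N0; apply: (@tends_normc_le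
  (fun M => \sum_(1 <= n < M) a n - \sum_(1 <= n < N) a n) _ _ N).
 exact: tendsB (dsum_tends hA) (tends_cst _).
move=> M NM; rewrite (big_cat_nat _ (n := N) (p := M)) //= addrAC subrr add0r.
exact: hE.
Qed.

Definition dconv (a b : nat -> C) (n : nat) : C :=
 \sum_(1 <= d < n.+1 | (d %| n)%N) a d * b (n %/ d)%N.

End Limits.

(** * Dirichlet convolution *)

Section ConvSum.
Variables (V : comRingType).

(** Both sides run over the pairs [(d, m)] with [d * m < N]; the left one groups them by their
    product. *)
Lemma sum_divisors_swap (F : nat -> nat -> V) N :
 \sum_(1 <= n < N) \sum_(1 <= d < n.+1 | (d %| n)%N) F d (n %/ d)%N =
 \sum_(1 <= d < N) \sum_(1 <= m < N | (d * m < N)%N) F d m.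
Proof.
transitivity (\sum_(1 <= n < N) \sum_(1 <= d < N)
  \sum_(1 <= m < N | (d * m == n)%N) F d m).
 apply: eq_big_nat => n /andP[n0 nN].
 rewrite [RHS](big_cat_nat _ (n := n.+1)) //=.
 rewrite [X in _ = _ + X]big_nat_cond [X in _ = _ + X]big1 ?addr0; last first.
  move=> d /andP[/andP[dn dN] _]; rewrite big_nat_cond big1 // => m /andP[/andP[m0 mN] /eqP e].
  by move: dn; rewrite -e ltnNge leq_pmulr.
 rewrite big_mkcond; apply: eq_big_nat => d /andP[d0 dn].
 case: ifP => [dv|ndv].
  have nd : (0 < n %/ d)%N by rewrite divn_gt0 -ltnS.
  rewrite (big_rem (n %/ d)%N) /=; last first.
   by rewrite mem_index_iota nd (leq_ltn_trans _ nN) // leq_div.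
  rewrite mulnC divnK // eqxx big_seq_cond big1 ?addr0 // => m.
  rewrite rem_filter ?iota_uniq // mem_filter => /andP[/andP[/= h _] /eqP e].
  by case/eqP: h; rewrite -e mulKn.
 rewrite big1 // => m /eqP e; move: ndv; rewrite -e dvdn_mulr //.
rewrite exchange_big /=; apply: eq_big_nat => d /andP[d0 dN].
rewrite (exchange_big_dep_nat xpredT) //= [RHS]big_mkcond; apply: eq_big_nat => m /andP[m0 mN].
case: ifP => dm.
 rewrite (big_rem (d * m)%N) /=; last by rewrite mem_index_iota muln_gt0 d0 m0.
 rewrite eqxx big_seq_cond big1 ?addr0 // => n.
 rewrite rem_filter ?iota_uniq // mem_filter => /andP[/andP[/= h _] /eqP e].
 by case/eqP: h.
rewrite big_nat_cond big1 // => n /andP[/andP[_ nN] /eqP e].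
by move: dm; rewrite e nN.
Qed.

End ConvSum.

Section DirichletProduct.
Variable R : realType.
Local Notation C := R[i].

Lemma sum_dconv (a b : nat -> C) N : \sum_(1 <= n < N) dconv a b n =
 \sum_(1 <= d < N) \sum_(1 <= m < N | (d * m < N)%N) a d * b m.
Proof. exact: (sum_divisors_swap (fun d m => a d * b m)). Qed.

Lemma absum_dconv (a b : nat -> C) A B : absum a A -> absum b B ->
 absum (dconv a b) (A * B).
Proof.
move=> ha hb N.
apply: le_trans (_ : \sum_(1 <= n < N) \sum_(1 <= d < n.+1 | (d %| n)%N)
  (normc (a d) * normc (b (n %/ d)%N)) <= _).
 apply: ler_sum => n _; apply: le_trans (normc_sum _ _ _) _.
 by apply: ler_sum => d _; rewrite normcM.
rewrite (sum_divisors_swap (fun d m => normc (a d) * normc (b m))).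
apply: le_trans (_ : \sum_(1 <= d < N) normc (a d) * B <= _).
 apply: ler_sum => d _; rewrite -mulr_sumr ler_wpM2l ?normc_ge0 //.
 apply: le_trans (hb N); rewrite big_mkcond; apply: ler_sum => m _.
 by case: ifP => // _; exact: normc_ge0.
rewrite -mulr_suml ler_wpM2r //.
by apply: le_trans (hb 0%N); rewrite big_geq.
Qed.

(** The partial sum of the convolution and the product of the partial sums differ by the pairs with
    [d * m >= N]. If [N >= K ^ 2], such a pair has [d >= K] or [m >= K], so the difference is at
    most a tail of one series times the full sum of the other, twice. *)
Lemma dsum_dconv (a b : nat -> C) A B : absum a A -> absum b B ->
 dsum (dconv a b) = dsum a * dsum b.
Proof.
move=> ha hb.
have A0 : 0 <= A by apply: le_trans (ha 0%N); rewrite big_geq.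
have B0 : 0 <= B by apply: le_trans (hb 0%N); rewrite big_geq.
have hab := tendsM (dsum_tends ha) (dsum_tends hb).
apply: dsumE.
suff h0 : tends (fun N => \sum_(1 <= n < N) dconv a b n -
  (\sum_(1 <= n < N) a n) * (\sum_(1 <= n < N) b n)) 0.
 have := tendsD h0 hab; rewrite add0r; apply: eq_tends => N.
 by rewrite subrK.
move=> e e0.
have AB : 0 < A + B + 1 by lra.
have ee : 0 < e / (A + B + 1) by rewrite divr_gt0.
have [Na hNa] := absum_tail ha ee; have [Nb hNb] := absum_tail hb ee.
exists ((Na + Nb).+1 ^ 2)%N => N hN.
rewrite subr0 normc_distC sum_dconv mulr_suml -sumrB.
set K := (Na + Nb).+1 in hN.
have KN : (K <= N)%N by apply: leq_trans hN; rewrite expnS expn1 leq_pmulr.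
apply: le_trans (_ : \sum_(1 <= d < N) \sum_(1 <= m < N | (N <= d * m)%N)
  normc (a d) * normc (b m) <= _).
 apply: le_trans (normc_sum _ _ _) _; apply: ler_sum => d _.
 rewrite mulr_sumr (bigID (fun m => (d * m < N)%N)) /= addrC addrK.
 apply: le_trans (normc_sum _ _ _) _.
 under [leRHS]eq_bigl do rewrite leqNgt.
 by apply: ler_sum => m _; rewrite normcM.
rewrite (big_cat_nat _ (n := K)) //=.
apply: le_trans (_ : A * (e / (A + B + 1)) + B * (e / (A + B + 1)) <= _).
 apply: lerD.
  apply: le_trans (_ : \sum_(1 <= d < K) normc (a d) * (e / (A + B + 1)) <= _).
   apply: ler_sum_nat => d /andP[d0 dK]; rewrite -mulr_sumr ler_wpM2l ?normc_ge0 //.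
   apply: le_trans (hNb K N _); last by rewrite /K ltnW // ltnS leq_addl.
   rewrite (big_cat_nat _ (n := K)) //=.
   rewrite big_nat_cond big1 ?add0r; last first.
    move=> m /andP[/andP[m0 mK] h]; move: h; rewrite leqNgt => /negP[].
    apply: leq_trans hN; rewrite expnS expn1.
    by apply: leq_trans (_ : (d * K <= _)%N); rewrite ?ltn_pmul2l // leq_mul2r ltnW.
   rewrite big_mkcond; apply: ler_sum => m _.
   by case: ifP => // _; exact: normc_ge0.
  by rewrite -mulr_suml ler_wpM2r // ltW.
 apply: le_trans (_ : \sum_(K <= d < N) normc (a d) * B <= _).
  apply: ler_sum => d _; rewrite -mulr_sumr ler_wpM2l ?normc_ge0 //.
  apply: le_trans (hb N); rewrite big_mkcond; apply: ler_sum => m _.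
  by case: ifP => // _; exact: normc_ge0.
 rewrite -mulr_suml mulrC ler_wpM2l //; apply: hNa.
 by rewrite /K ltnW // ltnS leq_addr.
rewrite -mulrDl mulrCA ger_pMr // ler_pdivrMr // mul1r; lra.
Qed.

End DirichletProduct.

(** * Dirichlet series and their derivatives at real points *)

Section DirichletSeries.
Variable R : realType.
Local Notation C := R[i].

Definition lnn (n : nat) : R := ln n%:R.

Definition npw (s : R) (n : nat) : R := n%:R `^ (- s).

Lemma lnn_ge0 n : 0 <= lnn n.
Proof.
case: n => [|n]; first by rewrite /lnn ln0.
by apply: ln_ge0; rewrite ler1n.
Qed.

Lemma lnn1 : lnn 1 = 0. Proof. exact: ln1. Qed.

Lemma lnnM m n : (0 < m)%N -> (0 < n)%N -> lnn (m * n) = lnn m + lnn n.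
Proof. by move=> m0 n0; rewrite /lnn natrM lnM // posrE ltr0n. Qed.

Lemma ler_lnn m n : (0 < m)%N -> (m <= n)%N -> lnn m <= lnn n.
Proof.
by move=> m0 mn; rewrite ler_ln ?posrE ?ltr0n ?ler_nat // (leq_trans m0).
Qed.

Lemma lnn_le_nat n : lnn n <= n%:R.
Proof.
case: n => [|n]; first by rewrite /lnn ln0.
have h := @le_ln1Dx R n%:R; rewrite /lnn -nat1r.
apply: le_trans (h _) _; first by apply: lt_le_trans (ler0n _ _); lra.
by lra.
Qed.

Lemma npw_gt0 s n : (0 < n)%N -> 0 < npw s n.
Proof. by move=> n0; rewrite powR_gt0 // ltr0n. Qed.

Lemma npw_ge0 s n : 0 <= npw s n.
Proof. exact: powR_ge0. Qed.

Lemma npw1 s : npw s 1 = 1.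
Proof. by rewrite /npw powR1. Qed.

Lemma npwM s m n : npw s (m * n) = npw s m * npw s n.
Proof. by rewrite /npw natrM powRM. Qed.

Lemma npwD s t n : (0 < n)%N -> npw (s + t) n = npw s n * npw t n.
Proof. by move=> n0; rewrite /npw opprD powRD // pnatr_eq0 -lt0n n0 implybT. Qed.

Lemma npwE s n : (0 < n)%N -> npw s n = expR (- s * lnn n).
Proof. by move=> n0; rewrite /npw /powR pnatr_eq0 eqn0Ngt n0. Qed.

Lemma npw_1 n : npw 1 n = n%:R^-1.
Proof. by rewrite /npw powR_inv1. Qed.

Lemma ler_npw s t n : (0 < n)%N -> s <= t -> npw t n <= npw s n.
Proof. by move=> n0 st; apply: ler_powR; rewrite ?ler1n // lerN2. Qed.

Lemma npw_le_inv s n : (0 < n)%N -> 1 <= s -> npw s n <= n%:R^-1.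
Proof. by move=> n0 s1; rewrite -npw_1 ler_npw. Qed.

Lemma npw_le1 s n : (0 < n)%N -> 0 <= s -> npw s n <= 1.
Proof.
by move=> n0 s0; apply: le_trans (ler_npw n0 s0) _; rewrite /npw oppr0 powRr0.
Qed.

Lemma npw_decr s m n : (0 < m)%N -> (m <= n)%N -> 0 <= s -> npw s n <= npw s m.
Proof.
move=> m0 mn s0; rewrite !npwE ?(leq_trans m0) // ler_expR.
by rewrite !mulNr lerN2 ler_wpM2l // ler_lnn.
Qed.

Lemma lnnS_sub n : (0 < n)%N -> lnn n.+1 - lnn n <= n%:R^-1.
Proof.
move=> n0; have n0' : 0 < (n%:R : R) by rewrite ltr0n.
have -> : lnn n.+1 - lnn n = ln (1 + n%:R^-1).
 rewrite /lnn -ln_div ?posrE //; congr ln.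
 by rewrite -nat1r mulrDl mul1r mulfV ?gt_eqF // addrC.
apply: le_ln1Dx; apply: lt_trans (_ : 0 < _); first by lra.
by rewrite invr_gt0.
Qed.

Lemma lnnS_sub_ge n : (0 < n)%N -> n.+1%:R^-1 <= lnn n.+1 - lnn n.
Proof.
move=> n0.
have -> : lnn n.+1 - lnn n = - ln (1 - n.+1%:R^-1).
 rewrite -opprB; congr (- _); rewrite /lnn -ln_div ?posrE ?ltr0n //; congr ln.
 by rewrite -nat1r; field; rewrite nat1r gt_eqF.
rewrite lerNr; apply: le_ln1Dx.
by rewrite ltrN2 invf_lt1 // ltr1n ltnS.
Qed.

(** Discrete comparison of [n ^ (-1-d)] with the integral of [t ^ (-1-d)]: it follows from
    [expR u >= 1 + u] and from [lnn n.+1 - lnn n >= 1 / n.+1]. *)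
Lemma npw_telescope (d : R) n : 0 < d -> (0 < n)%N ->
 npw (1 + d) n.+1 <= d^-1 * (npw d n - npw d n.+1).
Proof.
move=> d0 n0; rewrite ler_pdivlMl //.
have -> : npw d n = npw d n.+1 * expR (d * (lnn n.+1 - lnn n)).
 rewrite !npwE // -expRD; congr expR; ring.
rewrite npwD // npw_1 [npw d _ * _]mulrC -[X in _ <= _ - X]mul1r -mulrBl.
rewrite mulrA ler_wpM2r ?npw_ge0 // lerBrDl.
by apply: le_trans (expR_ge1Dx _); rewrite lerD2l ler_wpM2l ?(ltW d0) // lnnS_sub_ge.
Qed.

Lemma sum_npw_tail (d : R) N M : 0 < d -> (0 < N)%N ->
 \sum_(N.+1 <= n < M) npw (1 + d) n <= d^-1 * npw d N.
Proof.
move=> d0 N0; have [NM|NM] := leqP M N.+1.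
 by rewrite big_geq // mulr_ge0 ?npw_ge0 // invr_ge0 ltW.
rewrite -[M]prednK ?(leq_trans _ NM) // big_add1 /=.
apply: le_trans (_ : \sum_(N <= n < M.-1) d^-1 * (npw d n - npw d n.+1) <= _).
 apply: ler_sum_nat => n /andP[Nn _]; apply: npw_telescope => //.
 exact: leq_trans Nn.
rewrite -mulr_sumr ler_wpM2l ?invr_ge0 ?(ltW d0) //.
under eq_bigr do rewrite -opprB.
rewrite sumrN telescope_sumr; last by rewrite -ltnS prednK (leq_trans _ NM).
by rewrite opprB gerBl npw_ge0.
Qed.

Lemma sum_npw_le (d : R) N : 0 < d -> \sum_(1 <= n < N) npw (1 + d) n <= 1 + d^-1.
Proof.
move=> d0; have h0 : 0 <= 1 + d^-1 by rewrite addr_ge0 // invr_ge0 ltW.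
case: N => [|[|N]]; [by rewrite big_geq|by rewrite big_geq|].
rewrite big_ltn // npw1 lerD2l.
by have := @sum_npw_tail d 1 N.+2 d0 isT; rewrite npw1 mulr1.
Qed.

Lemma expr_le_expR (j : nat) (u : R) : 0 <= u -> u ^+ j <= j%:R ^+ j * expR u.
Proof.
move=> u0; case: j => [|j].
 by rewrite !expr0 mul1r; apply: le_trans (expR_ge1Dx u); rewrite lerDl.
have -> : expR u = expR (u / j.+1%:R) ^+ j.+1.
 by rewrite -expRM_natr divfK // gt_eqF.
rewrite -exprMn ler_pXn2r ?nnegrE //.
rewrite -ler_pdivrMl // mulrC; apply: le_trans (expR_ge1Dx _).
by rewrite lerDr.
Qed.

Lemma lnnX_le (j : nat) (d : R) n : 0 < d -> (0 < n)%N ->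
 lnn n ^+ j <= (j%:R / d) ^+ j * n%:R `^ d.
Proof.
move=> d0 n0; have h := @expr_le_expR j (d * lnn n) (mulr_ge0 (ltW d0) (lnn_ge0 n)).
rewrite exprMn_comm in h; last exact: mulrC.
rewrite /powR pnatr_eq0 eqn0Ngt n0 expr_div_n mulrAC ler_pdivlMr ?exprn_gt0 //.
by lra.
Qed.

(** Half of the exponent [d] absorbs the power of the logarithm, the other half keeps the series
    convergent. *)
Lemma sum_lnnX_npw (j : nat) (d : R) N : 0 < d ->
 \sum_(1 <= n < N) lnn n ^+ j * npw (1 + d) n <= (2 * j%:R / d) ^+ j * (1 + 2 / d).
Proof.
move=> d0; have d2 : 0 < d / 2 by lra.
have h := @sum_npw_le (d / 2) N d2; rewrite invf_div in h.
have c0 : 0 <= (j%:R / (d / 2)) ^+ j by rewrite exprn_ge0 // divr_ge0 // ltW.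
have -> : 2 * j%:R / d = j%:R / (d / 2) by lra.
apply: le_trans (ler_wpM2l c0 h); rewrite mulr_sumr; apply: ler_sum_nat => n /andP[n0 _].
have -> : 1 + d = d / 2 + (1 + d / 2) by field.
rewrite [X in _ * X](npwD _ _ n0) mulrA ler_wpM2r ?npw_ge0 //.
apply: le_trans (ler_wpM2r (npw_ge0 _ _) (lnnX_le j d2 n0)) _.
by rewrite -mulrA /npw -powRD ?subrr ?powRr0 ?mulr1 // pnatr_eq0 -lt0n n0 implybT.
Qed.

(** Multiplication of the coefficients by [ln n] is minus the derivative in [s], so these are the
    coefficients of the [j]-th derivative of the series of [c], up to sign. Derivatives of Dirichlet
    series appear in this form only. *)
Definition lk (c : nat -> C) (j : nat) (n : nat) : C := c n * (lnn n ^+ j)%:C%C.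

Definition wt (s : R) (c : nat -> C) (n : nat) : C := c n * (npw s n)%:C%C.

Definition DS (c : nat -> C) (s : R) : C := dsum (wt s c).

(** Absolute convergence at [s] of the series together with all its formal derivatives. *)
Definition smb (s : R) (c : nat -> C) := forall j, exists B, absum (wt s (lk c j)) B.

Lemma normc_wt s c n : normc (wt s c n) = normc (c n) * npw s n.
Proof. by rewrite normcM normcR_ge0 // npw_ge0. Qed.

Lemma normc_lk c j n : normc (lk c j n) = normc (c n) * lnn n ^+ j.
Proof. by rewrite normcM normcR_ge0 // exprn_ge0 // lnn_ge0. Qed.

Lemma smb0 s c : smb s c -> exists B, absum (wt s c) B.
Proof.
case/(_ 0%N) => B hB; exists B; apply: eq_absum hB => n _.
by rewrite /wt /lk expr0 mulr1.
Qed.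

Lemma eq_DS c c' s : (forall n, (0 < n)%N -> c n = c' n) -> DS c s = DS c' s.
Proof. by move=> h; apply: eq_dsum => n n0; rewrite /wt h. Qed.

Lemma eq_smb c c' s : (forall n, (0 < n)%N -> c n = c' n) -> smb s c -> smb s c'.
Proof.
move=> h hs j; have [B hB] := hs j; exists B; apply: eq_absum hB => n n0.
by rewrite /wt /lk h.
Qed.

Lemma smb_le s c (B : R) : 1 < s ->
 (forall n, (0 < n)%N -> normc (c n) <= B * (1 + lnn n)) -> smb s c.
Proof.
move=> s1 hc j; have d0 : 0 < s - 1 by lra.
have := sum_lnnX_npw j _ d0; have := sum_lnnX_npw j.+1 _ d0.
set X := _ * (1 + _); set Y := _ * (1 + _) => h1 h2.
exists (B * (X + Y)) => N.
have B0 : 0 <= B.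
 by have := hc 1%N isT; rewrite lnn1 addr0 mulr1; apply: le_trans; exact: normc_ge0.
apply: le_trans (ler_wpM2l B0 (lerD (h1 N) (h2 N))).
rewrite -big_split /= mulr_sumr; apply: ler_sum_nat => n /andP[n0 _].
rewrite [1 + _]addrC subrK normc_wt normc_lk -mulrDl mulrA ler_wpM2r ?npw_ge0 //.
apply: le_trans (ler_wpM2r (exprn_ge0 _ (lnn_ge0 _)) (hc n n0)) _.
by rewrite -mulrA ler_wpM2l // exprS mulrDl mul1r addrC.
Qed.

Lemma smb_lk s c k : smb s c -> smb s (lk c k).
Proof.
move=> h j; have [A hA] := h (k + j)%N; exists A; apply: eq_absum hA => n _.
by rewrite /wt /lk exprD rmorphM mulrA.
Qed.

Lemma dconv_wt s a b n : dconv (wt s a) (wt s b) n = wt s (dconv a b) n.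
Proof.
rewrite /dconv /wt mulr_suml; apply: eq_bigr => d dn.
by rewrite mulrACA -rmorphM -npwM [(d * _)%N]mulnC divnK.
Qed.

(** As [lnn n = lnn d + lnn (n / d)], the logarithm acts as a derivation on Dirichlet convolution;
    the binomial theorem then gives the rule of Leibniz. *)
Lemma leibniz_dconv (f c : nat -> C) k n : (0 < n)%N -> lk (dconv f c) k n =
 \sum_(j < k.+1) ('C(k, j))%:R * dconv (lk f (k - j)) (lk c j) n.
Proof.
move=> n0; rewrite /lk /dconv mulr_suml.
under [RHS]eq_bigr do rewrite mulr_sumr.
rewrite exchange_big /= big_nat_cond [RHS]big_nat_cond.
apply: eq_bigr => d /andP[/andP[d0 dn] dv].
have m0 : (0 < n %/ d)%N by rewrite divn_gt0.
have -> : lnn n = lnn d + lnn (n %/ d) by rewrite -lnnM // mulnC divnK.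
rewrite exprDn rmorph_sum /= mulr_sumr.
apply: eq_bigr => j _; rewrite -mulr_natr !rmorphM rmorph_nat /=.
rewrite [LHS]mulrC; ring.
Qed.

Lemma smb_dconv s f c : smb s f -> smb s c -> smb s (dconv f c).
Proof.
move=> hf hc k.
have [|[A hA] _] := @dsum_sum R _ (index_enum 'I_k.+1) (fun j n =>
  ('C(k, j))%:R * wt s (dconv (lk f (k - j)) (lk c j)) n).
 move=> j; have [A hA] := hf (k - j)%N; have [B hB] := hc j.
 eexists; apply: absumZ; apply: eq_absum (absum_dconv hA hB) => n _.
 exact: dconv_wt.
exists A; apply: eq_absum hA => n n0.
by rewrite /wt leibniz_dconv // mulr_suml; apply: eq_bigr => j _; rewrite mulrA.
Qed.

Lemma DS_dconv s f c : smb s f -> smb s c -> DS (dconv f c) s = DS f s * DS c s.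
Proof.
move=> /smb0[A hA] /smb0[B hB]; rewrite /DS -(dsum_dconv hA hB).
by apply: eq_dsum => n _; rewrite dconv_wt.
Qed.

Lemma DS_leibniz s f c k : smb s f -> smb s c -> DS (lk (dconv f c) k) s =
 \sum_(j < k.+1) ('C(k, j))%:R * (DS (lk f (k - j)) s * DS (lk c j) s).
Proof.
move=> hf hc.
have [|_ h] := @dsum_sum R _ (index_enum 'I_k.+1) (fun j n =>
  ('C(k, j))%:R * wt s (dconv (lk f (k - j)) (lk c j)) n).
 move=> j; have [A hA] := smb0 (smb_dconv (smb_lk (k - j) hf) (smb_lk j hc)).
 by eexists; apply: absumZ hA.
transitivity (dsum (fun n => \sum_(j < k.+1)
  ('C(k, j))%:R * wt s (dconv (lk f (k - j)) (lk c j)) n)).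
 apply: eq_dsum => n n0; rewrite /wt leibniz_dconv // mulr_suml.
 by apply: eq_bigr => j _; rewrite mulrA.
rewrite h; apply: eq_bigr => j _.
have sm := smb_dconv (smb_lk (k - j) hf) (smb_lk j hc).
by have [A hA] := smb0 sm; rewrite (dsumZ _ hA) -/(DS _ _) DS_dconv //; exact: smb_lk.
Qed.

(** Derivatives of a quotient: the rule of Leibniz is solved for its term [F i * G 0], so every
    order costs one more division by [G 0], the only quantity bounded from below. The constant [K]
    depends on the order alone, since [W] and [U] will depend on the modulus and on [t]. *)
Lemma leibniz_recursion_bound k : exists2 K : R, 1 <= K &
 forall (F G P : nat -> C) (W U : R), 1 <= W -> 1 <= U ->
 (forall i, (i <= k)%N ->
   P i = \sum_(j < i.+1) ('C(i, j))%:R * (F (i - j)%N * G j)) ->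
 W^-1 <= normc (G 0%N) ->
 (forall i, (0 < i <= k)%N -> normc (G i) <= U) ->
 (forall i, (i <= k)%N -> normc (P i) <= U) ->
 forall i, (i <= k)%N -> normc (F i) <= K * (W * U) ^+ i.+1.
Proof.
elim: k => [|k [K K1 IH]].
 exists 1 => // F G P W U W1 U1 hP hG _ hU [] // _.
 have e : P 0%N = F 0%N * G 0%N by rewrite hP // big_ord1 bin0 mul1r subn0.
 have W0 : 0 < W by lra.
 have hU0 := hU 0%N isT; rewrite e normcM in hU0.
 rewrite mul1r expr1 -ler_pdivrMl //; apply: le_trans hU0.
 by rewrite mulrC ler_wpM2l ?normc_ge0.
exists (1 + 2 ^+ k.+1 * K).
 by rewrite lerDl mulr_ge0 // (le_trans _ K1).
move=> F G P W U W1 U1 hP hG hGU hU i.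
have W0 : 0 < W by lra.
have U0 : 0 < U by lra.
have WU1 : 1 <= W * U by rewrite mulr_ege1.
have WU0 : 0 < W * U by lra.
have IH' j : (j <= k)%N -> normc (F j) <= K * (W * U) ^+ j.+1.
 apply: (IH F G P) => // [m mk|m /andP[m0 mk]|m mk].
 - by apply: hP; rewrite leqW.
 - by apply: hGU; rewrite m0 leqW.
 - by apply: hU; rewrite leqW.
rewrite leq_eqVlt => /predU1P[->|]; last first.
 rewrite ltnS => ik; apply: le_trans (IH' _ ik) _.
 rewrite ler_wpM2r ?exprn_ge0 ?(ltW WU0) //.
 apply: (@le_trans _ _ (2 ^+ k.+1 * K)); last by lra.
 by rewrite ler_peMl ?(le_trans _ K1) // exprn_ege1 // ler1n.
have e := hP k.+1 (leqnn _); rewrite big_ord_recl bin0 mul1r subn0 in e.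
have e2 : F k.+1 * G 0%N = P k.+1 -
  \sum_(j < k.+1) ('C(k.+1, j.+1))%:R * (F (k - j)%N * G j.+1).
 by rewrite e addrK.
have h : normc (F k.+1 * G 0%N) <= U + U * (2 ^+ k.+1 * (K * (W * U) ^+ k.+1)).
 rewrite e2; apply: le_trans (normcB_le _ _) _; rewrite lerD ?hU //.
 apply: le_trans (normc_sum _ _ _) _.
 apply: (@le_trans _ _ (\sum_(j < k.+1) ('C(k.+1, j.+1))%:R * (K * (W * U) ^+ k.+1 * U))).
  apply: ler_sum => j _; rewrite !normcM normc_nat ler_wpM2l //.
  apply: ler_pM; rewrite ?normc_ge0 //.
   apply: le_trans (IH' _ (leq_subr _ _)) _.
   rewrite ler_wpM2l ?(le_trans _ K1) // ler_weXn2l // ltnS leq_subr //.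
  by apply: hGU; rewrite ltn_ord.
 rewrite -mulr_suml -natr_sum mulrC [_ * U]mulrC -mulrA ler_wpM2l ?(ltW U0) //.
 rewrite mulrC ler_wpM2r ?mulr_ge0 ?exprn_ge0 ?(ltW WU0) ?(le_trans _ K1) //.
 rewrite -natrX ler_nat.
 have := Pascal 1 1 k.+1; rewrite addn1 => ->.
 by rewrite [leqRHS]big_ord_recl; under [X in (_ <= _ + X)%N]eq_bigr do rewrite !exp1n !muln1; rewrite leq_addl.
have h2 : normc (F k.+1) <= W * (U + U * (2 ^+ k.+1 * (K * (W * U) ^+ k.+1))).
 rewrite -ler_pdivrMl //; apply: le_trans h; rewrite normcM mulrC.
 by rewrite ler_wpM2l ?normc_ge0.
apply: le_trans h2 _.
have -> : W * (U + U * (2 ^+ k.+1 * (K * (W * U) ^+ k.+1))) =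
 W * U + 2 ^+ k.+1 * K * (W * U) ^+ k.+2 by rewrite [(W * U) ^+ k.+2]exprS; ring.
rewrite mulrDl mul1r lerD2r.
by rewrite -[leLHS]expr1 ler_weXn2l.
Qed.

Lemma DS_recursion_bound k : exists2 K : R, 1 <= K &
 forall (s : R) (f c p : nat -> C) (W U : R), 1 <= W -> 1 <= U ->
 smb s f -> smb s c -> (forall n, (0 < n)%N -> dconv f c n = p n) ->
 W^-1 <= normc (DS c s) ->
 (forall i, (0 < i <= k)%N -> normc (DS (lk c i) s) <= U) ->
 (forall i, (i <= k)%N -> normc (DS (lk p i) s) <= U) ->
 normc (DS (lk f k) s) <= K * (W * U) ^+ k.+1.
Proof.
have [K K1 h] := leibniz_recursion_bound k.
exists K => // s f c p W U W1 U1 sf sc e hW hc hp.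
apply: (h (fun i => DS (lk f i) s) (fun i => DS (lk c i) s) (fun i => DS (lk p i) s)) => //.
 move=> i _; rewrite -DS_leibniz //; apply: eq_DS => n n0.
 by rewrite /lk e.
by rewrite (_ : DS (lk c 0) s = DS c s) //; apply: eq_DS => n _; rewrite /lk expr0 mulr1.
Qed.

End DirichletSeries.
Arguments lnn {R}.
Arguments npw {R}.

(** * Partial summation *)

Section PartialSummation.
Variable R : realType.
Local Notation C := R[i].
Local Notation lnn := (@lnn R).
Local Notation npw := (@npw R).

Lemma abel_sum (c g : nat -> C) M :
 \sum_(1 <= n < M.+1) c n * g n =
 (\sum_(1 <= n < M.+1) c n) * g M.+1 +
 \sum_(1 <= n < M.+1) (\sum_(1 <= m < n.+1) c m) * (g n - g n.+1).
Proof.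
elim: M => [|M IH]; first by rewrite !big_geq // mul0r addr0.
rewrite (big_nat_recr M.+1) //= IH [X in _ = _ + X](big_nat_recr M.+1) //=.
by rewrite [\sum_(1 <= n < M.+2) c n](big_nat_recr M.+1) //=; ring.
Qed.

Lemma abel_sum_range (c g : nat -> C) N M : (N <= M)%N ->
 \sum_(N.+1 <= n < M.+1) c n * g n =
 (\sum_(1 <= n < M.+1) c n) * g M.+1 - (\sum_(1 <= n < N.+1) c n) * g N.+1 +
 \sum_(N.+1 <= n < M.+1) (\sum_(1 <= m < n.+1) c m) * (g n - g n.+1).
Proof.
move=> NM; have := abel_sum c g M; have := abel_sum c g N.
rewrite (big_cat_nat _ (n := N.+1) (p := M.+1)) //=.
rewrite [X in _ -> _ = _ + X -> _](big_cat_nat _ (n := N.+1) (p := M.+1)) //=.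
set a := \sum_(1 <= n < N.+1) _ * _; set b := \sum_(1 <= n < N.+1) _ * (_ - _).
move=> e1 e2; apply: (addrI a); rewrite e2 e1; ring.
Qed.

Definition sqb (c : nat -> C) (Y : R) :=
 forall M : nat, normc (\sum_(1 <= n < M.+1) c n) <= Y * Num.sqrt M%:R.

(** Controls the head of a series near [s = 1]. The second power of the logarithm leaves room for
    the divisor function. *)
Definition hdb (c : nat -> C) (K : R) := forall N : nat, (0 < N)%N ->
 \sum_(1 <= n < N.+1) normc (c n) / n%:R <= K * (1 + lnn N) ^+ 2.

Lemma sqb_ge0 c Y : sqb c Y -> 0 <= Y.
Proof. by move=> /(_ 1%N); rewrite sqrtr1 mulr1; apply: le_trans; exact: normc_ge0. Qed.

Lemma hdb_ge0 c K : hdb c K -> 0 <= K.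
Proof.
move=> /(_ 1%N isT); rewrite lnn1 addr0 expr1n mulr1 big_nat1 divr1.
by apply: le_trans; exact: normc_ge0.
Qed.

Lemma sqrt_npw (n : nat) : Num.sqrt n%:R = npw (- 2^-1) n :> R.
Proof. by rewrite /npw opprK powR12_sqrt. Qed.

(** Partial sums of order [sqrt n] meet a weight of order [n ^ (-3/4)] with differences of order
    [n ^ (-7/4)]. Two boundary terms of order [N ^ (-1/4)] and a sum of [n ^ (-5/4)], at most four
    times as large, make the constant 6. *)
Lemma abel_tail_bound (c g : nat -> C) (Y G : R) N M : sqb c Y -> 0 <= G ->
 (forall n, (0 < n)%N -> normc (g n) <= G * npw (3 / 4) n) ->
 (forall n, (0 < n)%N -> normc (g n - g n.+1) <= G * npw (7 / 4) n) ->
 (0 < N <= M)%N ->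
 normc (\sum_(N.+1 <= n < M.+1) c n * g n) <= 6 * Y * G * npw (1 / 4) N.
Proof.
move=> hY G0 hg hd /andP[N0 NM]; rewrite abel_sum_range //.
have Y0 := sqb_ge0 hY.
have bd n : (0 < n)%N -> normc ((\sum_(1 <= m < n.+1) c m) * g n.+1) <=
  Y * G * npw (1 / 4) n.
 move=> n0; rewrite normcM; apply: le_trans (ler_pM _ _ (hY n) (hg n.+1 isT)) _;
  rewrite ?normc_ge0 //.
 rewrite mulrACA ler_wpM2l ?mulr_ge0 // sqrt_npw.
 have -> : 1 / 4 = - 2^-1 + 3 / 4 :> R by field.
 rewrite npwD // ler_wpM2l ?npw_ge0 // npw_decr //; lra.
have NM4 : npw (1 / 4) M <= npw (1 / 4) N by apply: npw_decr => //; lra.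
have M0 := leq_trans N0 NM.
have h3 : normc (\sum_(N.+1 <= n < M.+1) (\sum_(1 <= m < n.+1) c m) * (g n - g n.+1))
  <= Y * G * (4 * npw (1 / 4) N).
 apply: le_trans (normc_sum _ _ _) _.
 apply: le_trans (_ : \sum_(N.+1 <= n < M.+1) Y * G * npw (1 + 1 / 4) n <= _).
  apply: ler_sum_nat => n /andP[Nn _]; have n0 := leq_trans (ltn0Sn _) Nn.
  rewrite normcM; apply: le_trans (ler_pM _ _ (hY n) (hd n n0)) _; rewrite ?normc_ge0 //.
  rewrite mulrACA sqrt_npw.
  have -> : 1 + 1 / 4 = - 2^-1 + 7 / 4 :> R by field.
  by rewrite npwD.
 rewrite -mulr_sumr ler_wpM2l ?mulr_ge0 //.
 have := @sum_npw_tail R (1 / 4) N M.+1 _ N0.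
 by lra.
have h1 := bd M M0; have h2 := bd N N0.
have YG : 0 <= Y * G by rewrite mulr_ge0.
have lin (a b z w v u : R) :
 a <= v -> b <= u -> z <= 4 * u -> w <= a + b -> v <= u -> w + z <= 6 * u by lra.
apply: le_trans (le_normcD _ _) _; rewrite -[6 * Y * G]mulrA -[leRHS]mulrA.
apply: lin h1 h2 _ (normcB_le _ _) (ler_wpM2l YG NM4).
by lra.
Qed.

Lemma exprB_le (a b : R) j : 0 <= b <= a -> a ^+ j - b ^+ j <= j%:R * a ^+ j.-1 * (a - b).
Proof.
move=> /andP[b0 ba]; have a0 := le_trans b0 ba.
case: j => [|j]; first by lra.
rewrite subrXX mulrC ler_wpM2r ?subr_ge0 //=.
rewrite -[j.+1 in leRHS]card_ord mulr_natl -sumr_const; apply: ler_sum => i _.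
have ij : (i <= j)%N by rewrite -ltnS ltn_ord.
rewrite -[leRHS](_ : a ^+ (j - i) * a ^+ i = _); last by rewrite -exprD subnK.
by rewrite ler_wpM2l ?exprn_ge0 // lerXn2r.
Qed.

Lemma npwB_le s n : (0 < n)%N -> 1 <= s <= 2 -> npw s n - npw s n.+1 <= 2 * npw 2 n :> R.
Proof.
move=> n0 /andP[s1 s2].
have -> : npw s n.+1 = npw s n * expR (- s * (lnn n.+1 - lnn n)).
 by rewrite !npwE // -expRD; congr expR; ring.
rewrite -[X in X - _]mulr1 -mulrBr.
have e1 : 1 - expR (- s * (lnn n.+1 - lnn n)) <= 2 * npw 1 n.
 have := expR_ge1Dx (- s * (lnn n.+1 - lnn n)).
 have := @lnnS_sub R n n0; rewrite npw_1.
 have : 0 <= lnn n.+1 - lnn n :> R by rewrite subr_ge0 ler_lnn.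
 by set u := lnn n.+1 - lnn n; set v := _^-1; nra.
apply: le_trans (ler_wpM2l (npw_ge0 _ _) e1) _.
have -> : 2 = 1 + 1 :> R by [].
rewrite [npw (1 + 1) n]npwD // mulrCA ler_wpM2l // ler_wpM2r ?npw_ge0 //.
exact: ler_npw.
Qed.

Lemma lnnX_quarter j : exists2 L : R, 0 <= L &
 forall n, (0 < n)%N -> lnn n ^+ j <= L * npw (- (1 / 4)) n.
Proof.
exists ((j%:R / (1 / 4)) ^+ j); first by rewrite exprn_ge0 // divr_ge0.
by move=> n n0; rewrite /npw opprK; apply: lnnX_le => //; lra.
Qed.

Lemma npw_quarterS n : (0 < n)%N -> npw (- (1 / 4)) n.+1 <= 2 * npw (- (1 / 4)) n :> R.
Proof.
move=> n0; rewrite !npwE // opprK.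
have -> : 1 / 4 * lnn n.+1 = 1 / 4 * (lnn n.+1 - lnn n) + 1 / 4 * lnn n :> R by ring.
rewrite expRD ler_wpM2r //.
apply: le_trans (_ : expR (1/4) <= _).
 rewrite ler_expR ler_piMr //; apply: le_trans (lnnS_sub R n0) _.
 by rewrite invf_le1 ?ltr0n // ler1n.
have h : expR (- (1 / 4)) >= 1 / 2 :> R.
 by apply: le_trans (expR_ge1Dx _); lra.
by rewrite -[expR (1/4)]invrK -expRN invf_ple ?posrE // -div1r.
Qed.

(** A quarter of the exponent pays for the powers of [ln n]; this is the origin of [3/4] and [7/4].
    The constant is uniform in [s] down to 1. *)
Lemma lnn_weight_bounds j : exists2 G : R, 0 <= G & forall s, 1 <= s <= 2 ->
 forall n, (0 < n)%N ->
 normc ((lnn n ^+ j * npw s n)%:C%C : C) <= G * npw (3 / 4) n /\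
 normc ((lnn n ^+ j * npw s n)%:C%C - (lnn n.+1 ^+ j * npw s n.+1)%:C%C : C)
   <= G * npw (7 / 4) n.
Proof.
have [L L0 hL] := lnnX_quarter j; have [L' L'0 hL'] := lnnX_quarter j.-1.
exists (4 * L + j%:R * L' * 2); first by rewrite addr_ge0 ?mulr_ge0.
move=> s s12 n n0; have [s1 s2] := andP s12.
have e0 i : 0 <= lnn n ^+ i by rewrite exprn_ge0 // lnn_ge0.
have q x : npw (- (1 / 4)) n * npw x n = npw (x - 1 / 4) n by rewrite -npwD // addrC.
split.
 rewrite normcR_ge0 ?mulr_ge0 ?npw_ge0 //.
 apply: le_trans (ler_pM (e0 j) (npw_ge0 _ _) (hL n n0) (ler_npw n0 s1)) _.
 rewrite -[leLHS]mulrA q; have -> : 1 - 1 / 4 = 3 / 4 :> R by field.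
 rewrite ler_wpM2r ?npw_ge0 //; have := mulr_ge0 (ler0n R j) L'0; nra.
rewrite -rmorphB normcR.
set a := lnn n.+1; set b := lnn n; set u := npw s n; set v := npw s n.+1.
have ba : b <= a by apply: ler_lnn.
have b0 : 0 <= b by exact: lnn_ge0.
have -> : b ^+ j * u - a ^+ j * v = a ^+ j * (u - v) - (a ^+ j - b ^+ j) * u by ring.
have vu : v <= u by apply: npw_decr => //; lra.
have aj : b ^+ j <= a ^+ j by rewrite lerXn2r ?nnegrE // (le_trans b0).
apply: le_trans (ler_normB _ _) _; rewrite ger0_norm ?mulr_ge0 ?subr_ge0 ?exprn_ge0 ?(le_trans b0) //.
rewrite ger0_norm ?mulr_ge0 ?subr_ge0 ?npw_ge0 //.
have qS := npw_quarterS n0.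
have Haj : a ^+ j <= L * (2 * npw (- (1 / 4)) n).
 by apply: le_trans (hL n.+1 isT) _; rewrite ler_wpM2l.
have Haj' : a ^+ j.-1 <= L' * (2 * npw (- (1 / 4)) n).
 by apply: le_trans (hL' n.+1 isT) _; rewrite ler_wpM2l.
have h1 : a ^+ j * (u - v) <= 4 * L * npw (7 / 4) n.
 apply: le_trans (ler_pM _ _ Haj (npwB_le n0 s12)) _; rewrite ?subr_ge0 ?exprn_ge0 ?(le_trans b0) //.
 have -> : 7 / 4 = 2 - 1 / 4 :> R by field.
 rewrite -q; set x := npw _ n; set y := npw _ n; apply: eq_lew; ring.
have h2 : (a ^+ j - b ^+ j) * u <= j%:R * L' * 2 * npw (7 / 4) n.
 have ba' : 0 <= b <= a by rewrite b0.
 have d1 : a - b <= npw 1 n by rewrite npw_1; exact: lnnS_sub.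
 have h3 : a ^+ j - b ^+ j <= j%:R * (L' * (2 * npw (- (1 / 4)) n)) * npw 1 n.
  apply: le_trans (exprB_le j ba') _; apply: ler_pM => //.
  - by rewrite mulr_ge0 // exprn_ge0 // (le_trans b0).
  - by rewrite subr_ge0.
  - by rewrite ler_wpM2l.
 apply: le_trans (ler_pM _ _ h3 (ler_npw n0 s1)) _; rewrite ?subr_ge0 ?npw_ge0 //.
 have -> : 7 / 4 = (1 + 1) - 1 / 4 :> R by field.
 rewrite -q [npw (1 + 1) n]npwD //; set x := npw _ n; set y := npw _ n; apply: eq_lew; ring.
by rewrite [X in _ <= X]mulrDl lerD.
Qed.

Lemma lk_wt_tail_bound j : exists2 G : R, 0 <= G & forall c Y s N M,
 sqb c Y -> 1 <= s <= 2 -> (0 < N <= M)%N ->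
 normc (\sum_(N.+1 <= n < M.+1) wt s (lk c j) n) <= G * Y * npw (1 / 4) N.
Proof.
have [G G0 hG] := lnn_weight_bounds j; exists (6 * G); first by lra.
move=> c Y s N M hY s12 NM.
have := abel_tail_bound hY G0 _ _ NM.
move=> /(_ (fun n => (lnn n ^+ j * npw s n)%:C%C)) h.
have -> : \sum_(N.+1 <= n < M.+1) wt s (lk c j) n =
  \sum_(N.+1 <= n < M.+1) c n * (lnn n ^+ j * npw s n)%:C%C.
 by apply: eq_bigr => n _; rewrite /wt /lk rmorphM mulrA.
apply: le_trans (h _ _) _ => [n n0|n n0|]; try by case: (hG s s12 n n0).
by lra.
Qed.

Lemma ln_powR_le (m : nat) (e : R) : 0 < e -> exists2 K : R, 0 < K &
 forall y, 1 <= y -> (1 + ln y) ^+ m <= K * y `^ e.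
Proof.
move=> e0; exists ((m%:R / e) ^+ m * expR e + 1).
 by rewrite ltr_wpDl // mulr_ge0 // exprn_ge0 // divr_ge0 // ltW.
move=> y y1; have y0 : 0 < y by lra.
have l0 : 0 <= 1 + ln y by rewrite addr_ge0 // ln_ge0.
have := @expr_le_expR R m (e * (1 + ln y)) (mulr_ge0 (ltW e0) l0).
rewrite exprMn mulrDr mulr1 expRD => h.
rewrite /powR gt_eqF //= mulrDl; apply: le_trans (_ : (m%:R / e) ^+ m * expR e * expR (e * ln y) <= _).
 rewrite expr_div_n -mulrA mulrAC ler_pdivlMr ?exprn_gt0 // mulrC.
 by [].
by rewrite lerDl mul1r expR_ge0.
Qed.

End PartialSummation.

(** * Twists by [n ^ (-it)] *)

Section Twist.
Variable R : realType.
Local Notation C := R[i].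
Local Notation lnn := (@lnn R).
Local Notation npw := (@npw R).

(** This is [n ^ (-it)], so that [DS (tw t c) s] is the series of [c] at the point [s + it]. *)
Definition nit (t : R) (n : nat) : C := expi (- (t * lnn n)).

Definition tw (t : R) (c : nat -> C) (n : nat) : C := c n * nit t n.

Lemma normc_nit t n : normc (nit t n) = 1. Proof. exact: normc_expi. Qed.

Lemma normc_tw t c n : normc (tw t c n) = normc (c n).
Proof. by rewrite normcM normc_nit mulr1. Qed.

Lemma nit0 n : nit 0 n = 1. Proof. by rewrite /nit mul0r oppr0 expi0. Qed.

Lemma nit1 t : nit t 1 = 1. Proof. by rewrite /nit lnn1 mulr0 oppr0 expi0. Qed.

Lemma nitM t m n : (0 < m)%N -> (0 < n)%N -> nit t (m * n) = nit t m * nit t n.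
Proof. by move=> m0 n0; rewrite /nit lnnM // mulrDr opprD expiD. Qed.

Lemma nitD t u n : nit (t + u) n = nit t n * nit u n.
Proof. by rewrite /nit mulrDl opprD expiD. Qed.

Lemma nit_step t n : (0 < n)%N -> normc (nit t n - nit t n.+1) <= `|t| / n%:R.
Proof.
move=> n0; apply: le_trans (normc_expiB _ _) _.
have -> : - (t * lnn n) - - (t * lnn n.+1) = t * (lnn n.+1 - lnn n) by ring.
rewrite normrM ler_wpM2l // ger0_norm ?subr_ge0 ?ler_lnn //.
exact: lnnS_sub.
Qed.

Lemma nitB1 t n : normc (1 - nit t n) <= `|t| * lnn n.
Proof.
rewrite -(nit0 n); apply: le_trans (normc_expiB _ _) _.
by rewrite mul0r oppr0 sub0r opprK normrM (ger0_norm (lnn_ge0 _ _)).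
Qed.

Lemma hdb_tw t c K : hdb c K -> hdb (tw t c) K.
Proof. by move=> h N N0; under eq_bigr do rewrite normc_tw; exact: h. Qed.

Lemma lk_tw t c j n : lk (tw t c) j n = tw t (lk c j) n.
Proof. by rewrite /lk /tw mulrAC. Qed.

Lemma smb_tw s t c : smb s c -> smb s (tw t c).
Proof.
move=> h j; have [B hB] := h j; exists B; apply: absum_le hB => n _.
by rewrite !normc_wt !normc_lk normc_tw.
Qed.

Lemma dconv_tw t a b n : (0 < n)%N -> dconv (tw t a) (tw t b) n = tw t (dconv a b) n.
Proof.
move=> n0; rewrite /dconv /tw mulr_suml big_nat_cond [RHS]big_nat_cond.
apply: eq_bigr => d /andP[/andP[d0 dn] dv].
by rewrite mulrACA -nitM ?divn_gt0 // [(d * _)%N]mulnC divnK.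
Qed.

Lemma sum_sqrt_inv M : \sum_(1 <= n < M.+1) npw (1 / 2) n <= 2 * Num.sqrt M%:R.
Proof.
elim: M => [|M IH]; first by rewrite big_geq // sqrtr0 mulr0.
rewrite big_nat_recr //=; apply: le_trans (lerD IH (lexx _)) _.
rewrite !sqrt_npw; have := sqrtr_ge0 (M%:R : R); rewrite sqrt_npw => a0.
have b0 : 0 < npw (- 2^-1) M.+1 by rewrite npw_gt0.
have -> : npw (1 / 2) M.+1 = (npw (- 2^-1) M.+1)^-1.
 by rewrite /npw opprK -powRN div1r.
have e : npw (- 2^-1) M.+1 ^+ 2 = npw (- 2^-1) M ^+ 2 + 1.
 by rewrite -!sqrt_npw !sqr_sqrtr // -natr1.
move: a0 b0 e; set a := npw _ M; set b := npw _ M.+1 => a0 b0 e.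
rewrite -lerBrDl -mulrBr -[_^-1]mul1r ler_pdivrMr; nra.
Qed.

(** Partial summation against [n ^ (-it)], whose steps are at most [|t| / n]; the sum of
    [n ^ (-1/2)] up to [M] contributes the factor 2. *)
Lemma sqb_tw t c Y : sqb c Y -> sqb (tw t c) (Y * (1 + 2 * `|t|)).
Proof.
move=> hY M; have Y0 := sqb_ge0 hY; rewrite /tw abel_sum.
apply: le_trans (le_normcD _ _) _; rewrite normcM normc_nit mulr1.
rewrite mulrDr mulr1 mulrDl lerD //.
apply: le_trans (normc_sum _ _ _) _.
apply: le_trans (_ : \sum_(1 <= n < M.+1) Y * `|t| * npw (1 / 2) n <= _).
 apply: ler_sum_nat => n /andP[n0 _]; rewrite normcM.
 apply: le_trans (ler_pM _ _ (hY n) (nit_step t n0)) _; rewrite ?normc_ge0 //.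
 rewrite mulrACA; apply: ler_wpM2l; rewrite ?mulr_ge0 //.
 rewrite sqrt_npw -(@npw_1 R n) -npwD // (_ : - 2^-1 + 1 = 1 / 2) //; by field.
rewrite -mulr_sumr.
have -> : Y * (2 * `|t|) * Num.sqrt M%:R = Y * `|t| * (2 * Num.sqrt M%:R) by ring.
by rewrite ler_wpM2l ?mulr_ge0 //; exact: sum_sqrt_inv.
Qed.

Lemma ler_wpowR (a b r : R) : 0 <= r -> 0 <= a -> a <= b -> a `^ r <= b `^ r.
Proof.
by move=> r0 a0 ab; apply: ge0_ler_powR; rewrite ?nnegrE // (le_trans a0).
Qed.

Lemma truncn_gtS (x : R) : x < (Num.truncn x).+1%:R.
Proof.
have [x0|x0] := leP 0 x; first by have /andP[] := truncn_itv x0.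
by apply: lt_le_trans x0 (ler0n _ _).
Qed.

(** Truncation point for a tail of order [y * N ^ (-1/4)]: about [y ^ 4] terms make it bounded while
    [ln N] stays comparable to [ln y]. *)
Lemma natS_pow4 (y : R) : 1 <= y -> exists2 N : nat, (0 < N)%N &
 npw (1 / 4) N <= y^-1 /\ N%:R <= 2 * y ^+ 4.
Proof.
move=> y1; have y0 : 0 < y by lra.
have y41 : 1 <= y ^+ 4 by rewrite exprn_ege1.
exists (Num.truncn (y ^+ 4)).+1 => //; split; last first.
 rewrite -natr1 mulr_natl mulr2n lerD //.
 by have /andP[] := @truncn_itv R (y ^+ 4) (exprn_ge0 _ (ltW y0)).
have h := ltW (truncn_gtS (y ^+ 4)).
rewrite /npw powRN lef_pV2 ?posrE //.
have <- : (y ^+ 4) `^ (1 / 4) = y.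
 rewrite -powR_mulrn ?(ltW y0) // -powRrM (_ : 4%:R * (1 / 4) = 1) ?powRr1 ?(ltW y0); by field.
have <- : y ^+ 4 = ((y ^+ 4) `^ (1 / 4)) ^+ 4.
 congr (_ ^+ 4); rewrite -powR_mulrn ?(ltW y0) // -powRrM.
 by rewrite (_ : 4%:R * (1 / 4) = 1) ?powRr1 ?(ltW y0); field.
by apply: ler_wpowR => //; rewrite ?exprn_ge0 ?(ltW y0).
Qed.

Lemma sum_head_bound c K0 N (j : nat) s : hdb c K0 -> (0 < N)%N -> 1 <= s ->
 \sum_(1 <= n < N.+1) normc (c n) * lnn n ^+ j * npw s n <= K0 * (1 + lnn N) ^+ (j + 2).
Proof.
move=> hK N0 s1; have := hK N N0 => h.
apply: le_trans (_ : (1 + lnn N) ^+ j * (K0 * (1 + lnn N) ^+ 2) <= _); last first.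
 by rewrite exprD mulrCA.
apply: le_trans (ler_wpM2l _ h); last by rewrite exprn_ge0 // addr_ge0 // lnn_ge0.
rewrite mulr_sumr; apply: ler_sum_nat => n /andP[n0 nN].
rewrite [leRHS]mulrCA -[leLHS]mulrA; apply: ler_wpM2l; first exact: normc_ge0.
apply: ler_pM; rewrite ?exprn_ge0 ?npw_ge0 ?lnn_ge0 //; last exact: npw_le_inv.
rewrite lerXn2r ?nnegrE ?addr_ge0 ?lnn_ge0 //.
by apply: le_trans (ler_lnn R n0 (ltnSE nN)) _; rewrite lerDr.
Qed.

Lemma DS_tail_bound j : exists2 G : R, 0 <= G & forall c Y s N,
 1 < s <= 2 -> sqb c Y -> smb s c -> (0 < N)%N ->
 normc (DS (lk c j) s - \sum_(1 <= n < N.+1) wt s (lk c j) n) <= G * Y * npw (1 / 4) N.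
Proof.
have [G G0 hG] := lk_wt_tail_bound R j; exists G => // c Y s N /andP[s1 s2] hY hs N0.
have [B hB] := hs j; apply: normc_dsum_head_tail hB _ _ => // -[//|M].
rewrite ltnS => NM; apply: hG => //; last by rewrite N0.
by lra.
Qed.

Lemma lnn_nat_le (m : nat) (e : R) : 0 < e -> exists2 K : R, 0 < K &
 forall (N : nat) y, (0 < N)%N -> 1 <= y -> N%:R <= 2 * y ^+ 4 ->
 (1 + lnn N) ^+ m <= K * y `^ e.
Proof.
move=> e0; have e4 : 0 < e / 4 by lra.
have [K K0 hK] := ln_powR_le m e4; exists (K * 2 `^ (e / 4)).
 by rewrite mulr_gt0 // powR_gt0.
move=> N y N0 y1 Ny; have y0 : 0 < y by lra.
apply: le_trans (hK N%:R _) _; first by rewrite ler1n.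
rewrite -mulrA ler_wpM2l ?(ltW K0) //.
apply: le_trans (_ : (2 * y ^+ 4) `^ (e / 4) <= _).
 by apply: ler_wpowR => //; exact: ltW.
rewrite powRM ?exprn_ge0 ?(ltW y0) // -powR_mulrn ?(ltW y0) // -powRrM.
by rewrite (_ : 4%:R * (e / 4) = e) //; field.
Qed.

(** The series is cut at [N] about [Y ^ 4]. The tail is bounded, and the head is a power of [ln N],
    hence at most a constant times [Y ^ e]. *)
Lemma DS_lk_bound j (e : R) : 0 < e -> exists2 K : R, 0 < K & forall c Y K0 s,
 1 < s <= 2 -> 1 <= Y -> sqb c Y -> hdb c K0 -> smb s c ->
 normc (DS (lk c j) s) <= K * (1 + K0) * Y `^ e.
Proof.
move=> e0; have [G G0 hG] := DS_tail_bound j.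
have [L L0 hL] := lnn_nat_le (j + 2) e0.
exists (L + G); first by rewrite ltr_wpDr.
move=> c Y K0 s s12 Y1 hY hK hs; have Y0 : 0 < Y by lra.
have K00 := hdb_ge0 hK; have [s1 s2] := andP s12.
have [N N0 [hN1 hN2]] := natS_pow4 Y1.
have ht := hG c Y s N s12 hY hs N0.
have hh : normc (\sum_(1 <= n < N.+1) wt s (lk c j) n) <= K0 * (L * Y `^ e).
 apply: le_trans (normc_sum _ _ _) _.
 under eq_bigr do rewrite normc_wt normc_lk.
 apply: le_trans (sum_head_bound j hK N0 (ltW s1)) _.
 by rewrite ler_wpM2l // hL.
have h1 : G * Y * npw (1 / 4) N <= G.
 rewrite -mulrA -[leRHS]mulr1 ler_wpM2l //.
 by apply: le_trans (ler_wpM2l (ltW Y0) hN1) _; rewrite mulfV ?lt0r_neq0.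
have Ye : 1 <= Y `^ e by rewrite -(powRr0 Y) ler_powR // ltW.
have := ler_normcB (DS (lk c j) s) (\sum_(1 <= n < N.+1) wt s (lk c j) n).
move=> h2; move: (le_trans ht h1) h2 hh.
have lin (a b d y : R) : d <= G -> a - b <= d -> b <= K0 * (L * y) -> 1 <= y ->
 a <= (L + G) * (1 + K0) * y.
 move=> h3 h4 h5 h6; have : 0 <= G * (y - 1) by rewrite mulr_ge0 // subr_ge0.
 have : 0 <= G * K0 * y by rewrite !mulr_ge0 // (le_trans _ h6).
 have : 0 <= L * y by rewrite !mulr_ge0 ?(ltW L0) // (le_trans _ h6).
 by nra.
by move=> h3 h4 h5; exact: lin h3 h4 h5 Ye.
Qed.

(** Both [n ^ (-s)] and [n ^ (-it)] vary at a rate of at most [ln n] times their size. *)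
Lemma npw_nit_diff s s' t n : (0 < n)%N -> 1 <= s -> 1 <= s' ->
 normc ((npw s n)%:C%C - nit t n * (npw s' n)%:C%C) <= (`|s - s'| + `|t|) * lnn n / n%:R.
Proof.
move=> n0 s1 s'1.
have -> : (npw s n)%:C%C - nit t n * (npw s' n)%:C%C =
  (npw s n - npw s' n)%:C%C + (1 - nit t n) * (npw s' n)%:C%C by rewrite rmorphB; ring.
apply: le_trans (le_normcD _ _) _; rewrite -mulrA [leRHS]mulrDl !mulrA lerD //; last first.
 rewrite normcM (normcR_ge0 (npw_ge0 _ _)); apply: ler_pM; rewrite ?normc_ge0 ?npw_ge0 //.
 exact: nitB1.
 exact: npw_le_inv.
rewrite normcR; wlog ss : s s' s1 s'1 / s <= s'.
 by move=> h; case: (leP s s') => [|/ltW] /h; [|rewrite distrC [`|s' - _|]distrC]; apply.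
have -> : `|npw s n - npw s' n| = npw s n - npw s' n by rewrite ger0_norm // subr_ge0 ler_npw.
have -> : `|s - s'| = s' - s by rewrite ler0_norm ?subr_le0 // opprB.
have -> : npw s' n = npw s n * expR (- ((s' - s) * lnn n)).
 by rewrite !npwE // -expRD; congr expR; ring.
rewrite -[X in X - _]mulr1 -mulrBr mulrC; apply: ler_pM; rewrite ?npw_ge0 ?npw_le_inv //.
 by rewrite subr_ge0 -[leRHS]expR0 ler_expR oppr_le0 mulr_ge0 ?subr_ge0 ?lnn_ge0.
have := expR_ge1Dx (- ((s' - s) * lnn n)); lra.
Qed.

(** With [k = |s - s'| + |t|] both series are cut at [N] about [(Y / k) ^ 4]: each tail is at most a
    multiple of [k], and terms of the heads differ by at most [k * lnn n / n] times the coefficient.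
    The logarithms cost [(Y / k) ^ e'] with [e' <= 1/8], so the exponent [7/8] of [k] remains. It
    has to exceed [3/4], the exponent which the 3-4-1 inequality attaches to [s - 1]. *)
Lemma DS_lipschitz (e : R) : 0 < e -> exists2 K : R, 0 < K & forall c Y K0 s s' t,
 1 < s <= 2 -> 1 < s' <= 2 -> 0 < `|s - s'| + `|t| <= 1 -> 1 <= Y ->
 sqb c Y -> hdb c K0 -> smb s c -> smb s' c ->
 normc (DS c s - DS (tw t c) s') <=
 K * (1 + K0) * Y `^ e * (`|s - s'| + `|t|) `^ (7 / 8).
Proof.
move=> e0; have [G G0 hG] := DS_tail_bound 0.
pose e' := Num.min e (1 / 8).
have e'0 : 0 < e' by rewrite lt_min e0 /=; lra.
have e'e : e' <= e by rewrite ge_min lexx.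
have e'8 : e' <= 1 / 8 by rewrite ge_min lexx orbT.
have [L L0 hL] := lnn_nat_le 3 e'0.
exists (L + 4 * G); first by rewrite ltr_wpDr // mulr_ge0.
move=> c Y K0 s s' t s12 s'12 /andP[k0 k1] Y1 hY hK hs hs'.
set k := `|s - s'| + `|t| in k0 k1 *.
have Y0 : 0 < Y by apply: lt_le_trans Y1.
have K00 := hdb_ge0 hK; have [s1 s2] := andP s12; have [s'1 s'2] := andP s'12.
have Yk1 : 1 <= Y / k by rewrite ler_pdivlMr // mul1r (le_trans k1).
have [N N0 [hN1 hN2]] := natS_pow4 Yk1.
have t1 : `|t| <= 1 by apply: le_trans k1; rewrite /k lerDr.
have eq0 (d : nat -> C) : lk d 0 =1 d by move=> n; rewrite /lk expr0 mulr1.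
have ht := hG c Y s N s12 hY hs N0.
have ht' := hG (tw t c) (Y * (1 + 2 * `|t|)) s' N s'12 (sqb_tw t hY) (smb_tw t hs') N0.
have Ds (d : nat -> C) u : DS (lk d 0) u = DS d u by apply: eq_DS => n _; rewrite eq0.
have Sw (d : nat -> C) u : \sum_(1 <= n < N.+1) wt u (lk d 0) n = \sum_(1 <= n < N.+1) wt u d n.
 by apply: eq_bigr => n _; rewrite /wt eq0.
rewrite Ds Sw in ht; rewrite Ds Sw in ht'.
have NY : npw (1 / 4) N <= k / Y by rewrite -[k / Y]invf_div.
have b1 : G * Y * npw (1 / 4) N <= G * k.
 rewrite -mulrA ler_wpM2l //; apply: le_trans (ler_wpM2l (ltW Y0) NY) _.
 by rewrite mulrCA mulfV ?gt_eqF // mulr1.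
have b2 : G * (Y * (1 + 2 * `|t|)) * npw (1 / 4) N <= 3 * (G * k).
 apply: le_trans (_ : (1 + 2 * `|t|) * (G * k) <= _).
  rewrite mulrA [G * Y * _]mulrC -mulrA ler_wpM2l //.

 by rewrite ler_wpM2r ?mulr_ge0 ?(ltW k0) //; lra.
have hh : normc (\sum_(1 <= n < N.+1) wt s c n - \sum_(1 <= n < N.+1) wt s' (tw t c) n)
  <= k * (K0 * (L * (Y / k) `^ e')).
 rewrite -sumrB; apply: le_trans (normc_sum _ _ _) _.
 have := sum_head_bound 1 hK N0 (lexx 1); rewrite (_ : (1 + 2 = 3)%N) // => h1.
 have h2 : K0 * (1 + lnn N) ^+ 3 <= K0 * (L * (Y / k) `^ e') by rewrite ler_wpM2l // hL.
 apply: le_trans (ler_wpM2l (ltW k0) (le_trans h1 h2)).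
 rewrite mulr_sumr; apply: ler_sum_nat => n /andP[n0 _].
 have -> : wt s c n - wt s' (tw t c) n = c n * ((npw s n)%:C%C - nit t n * (npw s' n)%:C%C).
  by rewrite /wt /tw; ring.
 rewrite normcM npw_1 expr1.
 have -> : k * (normc (c n) * lnn n / n%:R) = normc (c n) * (k * lnn n / n%:R) by ring.
 rewrite ler_wpM2l ?normc_ge0 //.
 by apply: npw_nit_diff => //; exact: ltW.
have kk : k <= k `^ (7 / 8) by rewrite -[leLHS]powRr1 ?(ltW k0) //; apply: ger_powR; rewrite ?k0 //; lra.
have Ye : 1 <= Y `^ e by rewrite -(powRr0 Y) ler_powR // ltW.
have ky : k * (Y / k) `^ e' <= Y `^ e * k `^ (7 / 8).
 rewrite powRM ?invr_ge0 ?(ltW k0) ?(ltW Y0) // mulrCA; apply: ler_pM.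
 - exact: powR_ge0.
 - by rewrite mulr_ge0 ?powR_ge0 // ltW.
 - exact: ler_powR.
 rewrite -(powR_inv1 (ltW k0)) -powRrM mulN1r -{1}(powRr1 (ltW k0)).
 rewrite -powRD ?(lt0r_neq0 k0) ?implybT //; apply: ger_powR; rewrite ?k0 //; lra.
have h8 := powR_ge0 k (7 / 8).
set z := k `^ (7 / 8) in kk ky h8 *; set y := Y `^ e in Ye ky *.
have lin (a b d x w : R) : a <= G * k -> b <= 3 * (G * k) -> d <= K0 * (L * w) ->
  w <= y * z -> x <= a + d + b -> x <= (L + 4 * G) * (1 + K0) * y * z.
 move=> h1 h2 h3 h4 h5.
 have g1 : G * k <= G * (y * z).
  by rewrite ler_wpM2l // (le_trans kk) // ler_peMl.
 have g2 : K0 * (L * w) <= K0 * (L * (y * z)) by rewrite !ler_wpM2l // ltW.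
 have g3 : 0 <= y * z by rewrite mulr_ge0 // (le_trans _ Ye).
 have g4 : 0 <= G * K0 * (y * z) by rewrite mulr_ge0 // mulr_ge0.
 have g5 : 0 <= L * (y * z) by rewrite mulr_ge0 // ltW.
 by move: h1 h2 h3 h5 g1 g2 g4 g5; lra.
rewrite mulrCA [k * (L * _)]mulrCA in hh.
apply: (lin _ _ _ _ _ (le_trans ht b1) (le_trans ht' b2) hh ky).
set S1 := \sum_(1 <= n < N.+1) _; set S2 := \sum_(1 <= n < N.+1) wt s' _ _.
have -> : DS c s - DS (tw t c) s' = (DS c s - S1) + (S1 - S2) - (DS (tw t c) s' - S2) by ring.
apply: le_trans (normcB_le _ _) _; rewrite lerD2r; exact: le_normcD.
Qed.

End Twist.

(** * Euler factors and the 3-4-1 inequality *)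

Section EulerProduct.
Variable R : realType.
Local Notation C := R[i].
Local Notation npw := (@npw R).

Lemma sum_dvd_pick (n k : nat) (F : nat -> C) : (0 < n)%N -> (0 < k)%N ->
 \sum_(1 <= d < n.+1 | (d %| n)%N) (d == k)%:R * F d = if (k %| n)%N then F k else 0.
Proof.
move=> n0 k0; case: ifP => kn.
 rewrite big_mkcond (bigD1_seq k) /= ?iota_uniq ?mem_index_iota ?k0 ?ltnS ?(dvdn_leq n0) //.
 rewrite kn eqxx mul1r big1 ?addr0 // => d /negbTE ->.
 by rewrite mul0r if_same.
rewrite big1 // => d dn; case: eqP => [dk|]; last by rewrite mul0r.
by rewrite -dk dn in kn.
Qed.

(** The coefficients of the Euler factor [1 - a p ^ (-s)]. *)
Definition edp (p : nat) (a : C) (n : nat) : C := (n == 1%N)%:R - a * (n == p)%:R.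

Lemma dconv_edp p a g n : (0 < p)%N -> (0 < n)%N ->
 dconv (edp p a) g n = g n - (if (p %| n)%N then a * g (n %/ p)%N else 0).
Proof.
move=> p0 n0; rewrite /dconv /edp.
under eq_bigr do rewrite mulrBl -mulrA [a * _]mulrCA.
rewrite sumrB (sum_dvd_pick (fun d => g (n %/ d)%N)) // dvd1n divn1.
by rewrite (sum_dvd_pick (fun d => a * g (n %/ d)%N)).
Qed.

Lemma dsum_finite (a : nat -> C) N : (forall n, (N <= n)%N -> a n = 0) ->
 dsum a = \sum_(1 <= n < N) a n.
Proof.
move=> h; apply: dsumE => e e0; exists N => M NM.
have [N0|N0] := posnP N.
 rewrite N0 [X in _ - X]big_geq // subr0 big1 ?normc0 ?ltW // => n _.
 by rewrite h // N0.
rewrite (big_cat_nat _ (n := N) (p := M)) //= addrAC subrr add0r.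
by rewrite big_nat_cond big1 ?normc0 ?ltW // => n /andP[/andP[/h]].
Qed.

Lemma smb_bounded s (c : nat -> C) (B : R) : 1 < s ->
 (forall n, (0 < n)%N -> normc (c n) <= B) -> smb s c.
Proof.
move=> s1 h; apply: (smb_le (B := B)) => // n n0; apply: le_trans (h n n0) _.
have B0 : 0 <= B by apply: le_trans (h n n0); exact: normc_ge0.
by rewrite ler_peMr // lerDl lnn_ge0.
Qed.

Lemma smb_edp s p a : 1 < s -> smb s (edp p a).
Proof.
move=> s1; apply: (smb_bounded (B := 1 + normc a)) => // n _.
apply: le_trans (normcB_le _ _) _; rewrite normcM lerD //.
 by case: (n == 1%N); rewrite ?normc1 ?normc0.
by case: (n == p); rewrite ?normc1 ?normc0 ?mulr1 ?mulr0 ?normc_ge0.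
Qed.

Lemma DS_edp s p a : (1 < p)%N -> DS (edp p a) s = 1 - a * (npw s p)%:C%C.
Proof.
move=> p1; rewrite /DS (@dsum_finite _ p.+1); last first.
 move=> n pn; rewrite /wt /edp (gtn_eqF pn) mulr0 subr0.
 by rewrite (gtn_eqF (ltn_trans p1 pn)) mul0r.
rewrite (big_nat_recr p) ?(ltnW p1) //= big_ltn // big1_seq ?addr0; last first.
 move=> n /andP[_]; rewrite mem_index_iota => /andP[n1 np].
 by rewrite /wt /edp (gtn_eqF n1) (ltn_eqF np) mulr0 subr0 mul0r.
rewrite /wt /edp eqxx (gtn_eqF p1) (ltn_eqF p1) eqxx npw1 !mulr0 subr0 !mulr1 sub0r mulNr.
by [].
Qed.

Definition cmul (f : nat -> C) := [/\ f 1%N = 1,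
 forall m n, (0 < m)%N -> (0 < n)%N -> f (m * n)%N = f m * f n
 & forall n, normc (f n) <= 1].

Lemma cmul_tw t f : cmul f -> cmul (tw t f).
Proof.
case=> f1 fM fn; split; first by rewrite /tw f1 nit1 mulr1.
 by move=> m n m0 n0; rewrite /tw fM // nitM // mulrACA.
by move=> n; rewrite normc_tw.
Qed.

Lemma cmul_one : cmul (fun=> 1 : C).
Proof. by split=> *; rewrite ?mulr1 ?normc1. Qed.

Definition rough (y n : nat) := all (fun p => ~~ (p %| n)%N) [seq p <- iota 0 y.+1 | prime p].

Lemma roughP y n : reflect (forall p, prime p -> (p <= y)%N -> ~~ (p %| n)%N) (rough y n).
Proof.
apply: (iffP allP) => h p.
 by move=> pp py; apply: h; rewrite mem_filter pp mem_iota.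
by rewrite mem_filter mem_iota => /andP[pp /andP[_]]; exact: h.
Qed.

(** The series of [roughf f y] is the series of [f] multiplied by [1 - f p * p ^ (-s)] for all
    primes [p <= y], and it tends to 1. Deleting one prime at a time replaces infinite products and
    logarithms of [L]. *)
Definition roughf (f : nat -> C) y n : C := if rough y n then f n else 0.

Lemma normc_roughf f y n : cmul f -> normc (roughf f y n) <= 1.
Proof. by case=> _ _ h; rewrite /roughf; case: ifP => // _; rewrite normc0. Qed.

Lemma smb_roughf s f y : 1 < s -> cmul f -> smb s (roughf f y).
Proof.
by move=> s1 cf; apply: (smb_bounded (B := 1)) => // n _; exact: normc_roughf.
Qed.

Lemma DS_roughf0 s f : DS (roughf f 0) s = DS f s.
Proof.
apply: eq_DS => n n0; rewrite /roughf.
by have -> : rough 0 n by [].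
Qed.

Lemma DS_roughfS_nprime s f y : ~~ prime y.+1 -> DS (roughf f y.+1) s = DS (roughf f y) s.
Proof.
move=> np; apply: eq_DS => n n0; rewrite /roughf; congr (if _ then _ else _).
apply/roughP/roughP => h p pp py; apply: h => //; first exact: leqW.
move: py; rewrite leq_eqVlt => /predU1P[e|//]; by rewrite -e pp in np.
Qed.

(** Convolution with the factor at [p = y.+1] subtracts [f p] times the term at [n / p]. For a
    multiple [n] of [p] this cancels the term exactly, since [n] and [n / p] have the same prime
    divisors up to [y]. *)
Lemma DS_roughfS s f y : 1 < s -> cmul f -> prime y.+1 ->
 DS (roughf f y.+1) s = (1 - f y.+1 * (npw s y.+1)%:C%C) * DS (roughf f y) s.
Proof.
move=> s1 cf pp; rewrite -DS_edp ?prime_gt1 // -DS_dconv; first last.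
- exact: smb_roughf.
- exact: smb_edp.
apply: eq_DS => n n0; rewrite dconv_edp //; have [_ fM _] := cf.
rewrite /roughf; have [pn|pn] := boolP (y.+1 %| n)%N.
 have -> : rough y.+1 n = false.
  by apply/negbTE/negP => /roughP /(_ _ pp (leqnn _)); rewrite pn.
 have m0 : (0 < n %/ y.+1)%N by rewrite divn_gt0 dvdn_leq.
 have -> : rough y (n %/ y.+1) = rough y n.
  apply/roughP/roughP => h p p' py; apply: contra (h p p' py).
   rewrite -{1}(divnK pn) Euclid_dvdM // => /orP[//|].
   by rewrite dvdn_prime2 // => /eqP e; rewrite e ltnn in py.
  by move=> h1; rewrite -(divnK pn) dvdn_mulr.
 case: ifP => _; last by rewrite mulr0 subrr.
 by rewrite -fM // mulnC divnK // subrr.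
rewrite subr0; congr (if _ then _ else _).
apply/roughP/roughP => h p p' py; first by apply: h => //; exact: leqW.
move: py; rewrite leq_eqVlt => /predU1P[->|py]; first by [].
exact: h.
Qed.

(** Among [n <= y] only [n = 1] survives, and the tail beyond [y] is at most
    [y ^ (1 - s) / (s - 1)]. *)
Lemma DS_roughf_near1 s f (e : R) : 1 < s -> cmul f -> 0 < e ->
 exists y0, forall y, (y0 <= y)%N -> normc (DS (roughf f y) s - 1) <= e.
Proof.
move=> s1 cf e0; have d0 : 0 < s - 1 by lra.
have de : 0 < (s - 1) * e by rewrite mulr_gt0.
exists (Num.truncn (((s - 1) * e)^-1 `^ (s - 1)^-1)).+1 => y hy.
have y0 : (0 < y)%N by apply: leq_trans hy.
have [B hB] := smb0 (smb_roughf y s1 cf).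
have hd : \sum_(1 <= n < y.+1) wt s (roughf f y) n = 1.
 rewrite big_ltn // big1_seq ?addr0; last first.
  move=> n /andP[_]; rewrite mem_index_iota => /andP[n1 ny]; rewrite /wt /roughf.
  have -> : rough y n = false; last by rewrite mul0r.
  apply/negbTE/negP => /roughP /(_ (pdiv n) (pdiv_prime n1)).
  by move=> /(_ (leq_trans (pdiv_leq (ltnW n1)) (ltnSE ny))); rewrite pdiv_dvd.
 have r1 : rough y 1 by apply/roughP => p pp _; rewrite dvdn1 gtn_eqF ?prime_gt1.
 by case: cf => e1 _ _; rewrite /wt /roughf r1 e1 npw1 mulr1.
rewrite -hd; apply: (normc_dsum_head_tail hB) => // M yM.
apply: le_trans (normc_sum _ _ _) _.
apply: le_trans (_ : \sum_(y.+1 <= n < M) npw (1 + (s - 1)) n <= _).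
 apply: ler_sum => n _; rewrite normc_wt [1 + _]addrC subrK.
 by rewrite ler_piMl ?npw_ge0 // normc_roughf.
apply: le_trans (sum_npw_tail _ d0 y0) _; rewrite ler_pdivrMl //.
rewrite /npw powRN -[leRHS]invrK lef_pV2 ?posrE ?invr_gt0 ?powR_gt0 ?ltr0n //.
have -> : ((s - 1) * e)^-1 = (((s - 1) * e)^-1 `^ (s - 1)^-1) `^ (s - 1).
 by rewrite -powRrM mulVf ?lt0r_neq0 // powRr1 // invr_ge0 ltW.
apply: ler_wpowR; rewrite ?(ltW d0) ?powR_ge0 //.
by apply: le_trans (ltW (truncn_gtS _)) _; rewrite ler_nat.
Qed.

(** AM-GM for [x, x, x, y]. The remaining inequality [x ^ 3 (4 - 3 x) <= 1] has a double root at
    1. *)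
Lemma cube_prod_le1 (x y : R) : 0 <= x -> 0 <= y -> 3 * x + y <= 4 -> x ^+ 3 * y <= 1.
Proof.
move=> x0 y0 h; apply: le_trans (_ : x ^+ 3 * (4 - 3 * x) <= _).
 by rewrite ler_wpM2l ?exprn_ge0; lra.
have : 0 <= (1 - x) ^+ 2 * (1 + 2 * x + 3 * x ^+ 2).
 by rewrite mulr_ge0 ?sqr_ge0 // !addr_ge0 ?mulr_ge0.
by lra.
Qed.

(* AM-GM on [ab, ab, ab, bd], where [a, b, d] are the squared moduli of
  [1 - r], [1 - rz], [1 - rz^2]; the remaining quadratic inequality in [1 + c]
  needs [r <= 1/8]. *)
Lemma factor_341_le1 (r : R) (z : C) : 0 <= r <= 1 / 8 -> normc z = 1 ->
 (1 - r) ^+ 3 * normc (1 - z * r%:C%C) ^+ 4 * normc (1 - z ^+ 2 * r%:C%C) <= 1.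
Proof.
move=> /andP[r0 r8] z1.
pose b := normc (1 - z * r%:C%C) ^+ 2; pose d := normc (1 - z ^+ 2 * r%:C%C) ^+ 2.
have : (complex.Re z) ^+ 2 + (complex.Im z) ^+ 2 = 1 by rewrite -normc2E z1 expr1n.
have eb : b = 1 - 2 * r * complex.Re z + r ^+ 2 * (complex.Re z ^+ 2 + complex.Im z ^+ 2).
 by rewrite /b normc2E; case: (z) => u v /=; ring.
have ed : d = 1 - 2 * r * (complex.Re z ^+ 2 - complex.Im z ^+ 2) +
  r ^+ 2 * (complex.Re z ^+ 2 + complex.Im z ^+ 2) ^+ 2.
 by rewrite /d normc2E; case: (z) => u v /=; ring.
set c := complex.Re z in eb ed *; set v := complex.Im z in eb ed * => cv.
have v2 : v ^+ 2 = 1 - c ^+ 2 by lra.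
rewrite v2 in eb ed.
have c1 : -1 <= c <= 1.
 have := Re_le_normc z; rewrite z1 ler_norml //.
have b0 : 0 <= b by rewrite exprn_ge0 // normc_ge0.
have d0 : 0 <= d by rewrite exprn_ge0 // normc_ge0.
set X := (1 - r) ^+ 3 * _ * _.
have X0 : 0 <= X by rewrite !mulr_ge0 ?normc_ge0 //; lra.
have X2 : X ^+ 2 = ((1 - r) ^+ 2 * b) ^+ 3 * (b * d) by rewrite /X /b /d; ring.
have : X ^+ 2 <= 1.
 have ab0 : 0 <= (1 - r) ^+ 2 * b by apply: mulr_ge0 => //; exact: sqr_ge0.
 have bd0 : 0 <= b * d by apply: mulr_ge0.
 rewrite X2; apply: cube_prod_le1 => //.
 have [w [w0 w2 cw]] : exists w, [/\ 0 <= w, w <= 2 & c = w - 1].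
  by exists (c + 1); split; lra.
 have -> : 3 * ((1 - r) ^+ 2 * b) + b * d =
  4 + 4 * r * (- 2 * r + r ^+ 3 + 8 * r * w - w ^+ 2 * (1 + 6 * r + r ^+ 2) + 2 * r * w ^+ 3).
  by rewrite eb ed cw; ring.
 have : - 2 * r + r ^+ 3 + 8 * r * w - w ^+ 2 * (1 + 6 * r + r ^+ 2) + 2 * r * w ^+ 3 <= 0.
  have h1 : 2 * r * w ^+ 3 <= 4 * r * w ^+ 2.
   have -> : 2 * r * w ^+ 3 = 2 * r * w ^+ 2 * w by ring.
   have -> : 4 * r * w ^+ 2 = 2 * r * w ^+ 2 * 2 by ring.
   by rewrite ler_wpM2l // !mulr_ge0.
  have h2 : 16 * r ^+ 2 <= (1 + r) ^+ 2 * (2 * r - r ^+ 3).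
   have -> : (1 + r) ^+ 2 * (2 * r - r ^+ 3) = r * ((1 + r) ^+ 2 * (2 - r ^+ 2)) by ring.
   rewrite expr2 mulrCA ler_wpM2l //.
   have : 0 <= r * r by rewrite mulr_ge0.
   have : r * r <= r / 8 by rewrite ler_wpM2l //; lra.
   have : r * (r * r) <= r * (r / 8) by rewrite !ler_wpM2l //; lra.
   have : r * (r * (r * r)) <= r * (r * (r / 8)) by rewrite !ler_wpM2l //; lra.
   by lra.
  have h3 : (1 + r) ^+ 2 * (- 2 * r + r ^+ 3 + 8 * r * w - w ^+ 2 * (1 + r) ^+ 2) <= 0.
   have -> : (1 + r) ^+ 2 * (- 2 * r + r ^+ 3 + 8 * r * w - w ^+ 2 * (1 + r) ^+ 2) =
    (16 * r ^+ 2 - (1 + r) ^+ 2 * (2 * r - r ^+ 3)) - ((1 + r) ^+ 2 * w - 4 * r) ^+ 2 by ring.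
   by have := sqr_ge0 ((1 + r) ^+ 2 * w - 4 * r); lra.
  have p0 : 0 < (1 + r) ^+ 2 by rewrite exprn_gt0 //; lra.
  rewrite pmulr_rle0 // in h3; apply: le_trans h3.
  have -> : w ^+ 2 * (1 + r) ^+ 2 = w ^+ 2 * (1 + 6 * r + r ^+ 2) - 4 * r * w ^+ 2 by ring.
  by move: h1; clear; lra.
 by move: r0; set Q := - 2 * r + _ + _ - _ + _; nra.
by rewrite -[leRHS](expr1n R 2) ler_pXn2r ?nnegrE.
Qed.

(** Crude bound for the smallest primes, where [r] may exceed [1/8]: the factors are at most [1],
    [2 ^ 4] and [2]. *)
Lemma factor_341_le32 (r : R) (z z2 : C) : 0 <= r <= 1 -> normc z <= 1 -> normc z2 <= 1 ->
 (1 - r) ^+ 3 * normc (1 - z * r%:C%C) ^+ 4 * normc (1 - z2 * r%:C%C) <= 32.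
Proof.
move=> /andP[r0 r1] z1 z21.
have h (u : C) : normc u <= 1 -> normc (1 - u * r%:C%C) <= 2.
 move=> u1; apply: le_trans (normcB_le _ _) _; rewrite normc1 normcM normcR_ge0 //.
 by have := ler_pM (normc_ge0 u) r0 u1 r1; lra.
have -> : 32 = 1 ^+ 3 * 2 ^+ 4 * 2 :> R by ring.
apply: ler_pM; rewrite ?mulr_ge0 ?normc_ge0 ?h ?subr_ge0 //.
apply: ler_pM; rewrite ?exprn_ge0 ?normc_ge0 ?subr_ge0 //.
 by rewrite lerXn2r ?nnegrE ?subr_ge0 // gerBl.
by rewrite lerXn2r ?nnegrE ?normc_ge0 ?h.
Qed.

(** The case [f1 p = 0], in which [f2 p] is arbitrary of norm at most 1: this happens at primes
    dividing the modulus when [f2] is the constant 1. Three factors [1 - r] outweigh one factor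
    [1 + r]. *)
Lemma factor_341_zero (r : R) (z : C) : 0 <= r <= 1 -> normc z <= 1 ->
 (1 - r) ^+ 3 * normc (1 - z * r%:C%C) <= 1.
Proof.
move=> /andP[r0 r1] z1.
have h : normc (1 - z * r%:C%C) <= 1 + r.
 apply: le_trans (normcB_le _ _) _; rewrite normc1 normcM normcR_ge0 // lerD2l.
 by rewrite ler_piMl.
apply: le_trans (_ : (1 - r) * (1 + r) <= _); last by nra.
apply: ler_pM; rewrite ?exprn_ge0 ?normc_ge0 ?subr_ge0 //.
by rewrite exprS ler_piMr ?subr_ge0 // exprn_ile1 ?subr_ge0 // gerBl.
Qed.

Definition phi341 (f1 f2 : nat -> C) s y : R :=
 normc (DS (roughf (fun=> 1) y) s) ^+ 3 * normc (DS (roughf f1 y) s) ^+ 4 *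
 normc (DS (roughf f2 y) s).

Lemma phi341_bound (f1 f2 : nat -> C) s : 1 < s -> cmul f1 -> cmul f2 ->
 (forall p, prime p -> f1 p = 0 \/ normc (f1 p) = 1 /\ f2 p = f1 p ^+ 2) ->
 forall y, phi341 f1 f2 s y <= 32 ^+ minn y 8 * phi341 f1 f2 s 0.
Proof.
move=> s1 c1 c2 hp.
have p0 y : 0 <= phi341 f1 f2 s y by rewrite !mulr_ge0 ?normc_ge0.
elim=> [|y IH]; first by rewrite min0n mul1r.
have [pp|np] := boolP (prime y.+1); last first.
 rewrite {1}/phi341 !DS_roughfS_nprime // -/(phi341 _ _ _ _).
 apply: le_trans IH _; rewrite ler_wpM2r // ler_weXn2l ?ler1n //.
 by rewrite leq_min geq_minr andbT (leq_trans (geq_minl _ _)).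
pose r := npw s y.+1.
have r0 : 0 <= r by exact: npw_ge0.
have r1 : r <= 1 by apply: npw_le1 => //; exact: ltW (lt_trans ltr01 s1).
have n1 (c : nat -> C) n : cmul c -> normc (c n) <= 1 by case.
have -> : phi341 f1 f2 s y.+1 = ((1 - r) ^+ 3 * normc (1 - f1 y.+1 * r%:C%C) ^+ 4 *
  normc (1 - f2 y.+1 * r%:C%C)) * phi341 f1 f2 s y.
 rewrite /phi341 !DS_roughfS //; last exact: cmul_one.
 rewrite !normcM mul1r.
 have -> : normc (1 - r%:C%C) = 1 - r.
  by rewrite -(rmorph1 (real_complex R)) -rmorphB normcR_ge0 // subr_ge0.
 by lra.
have [y8|y8] := ltnP y 8.
 have -> : minn y.+1 8 = (minn y 8).+1 by rewrite (minn_idPl y8) (minn_idPl (ltnW y8)).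
 rewrite [32 ^+ _]exprS -[leRHS]mulrA; apply: ler_pM => //.
  by rewrite !mulr_ge0 ?normc_ge0 ?subr_ge0.
 by apply: factor_341_le32; rewrite ?r0 ?n1.
apply: le_trans (_ : 1 * (32 ^+ minn y 8 * phi341 f1 f2 s 0) <= _); last first.
 by rewrite mul1r (minn_idPr y8) (minn_idPr (leqW y8)).
apply: ler_pM => //; first by rewrite !mulr_ge0 ?normc_ge0 ?subr_ge0.
have [->|[z1 ->]] := hp _ pp.
 rewrite mul0r subr0 normc1 expr1n mulr1; apply: factor_341_zero; rewrite ?r0 ?n1 //.
apply: factor_341_le1 => //; rewrite r0 /=.
apply: le_trans (npw_le_inv (ltn0Sn y) (ltW s1)) _.
by rewrite div1r lef_pV2 ?posrE // ler_nat (leq_trans y8).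
Qed.

(** For large [y] the three rough series are within [1/16] of 1, so their product is at least
    [1/32]; restoring the deleted primes costs at most [32 ^ 8]. *)
Lemma bound_341 (f1 f2 : nat -> C) s : 1 < s -> cmul f1 -> cmul f2 ->
 (forall p, prime p -> f1 p = 0 \/ normc (f1 p) = 1 /\ f2 p = f1 p ^+ 2) ->
 (32 ^+ 9)^-1 <= normc (DS (fun=> 1) s) ^+ 3 * normc (DS f1 s) ^+ 4 * normc (DS f2 s).
Proof.
move=> s1 c1 c2 hp; have e0 : 0 < 1 / 16 :> R by lra.
have [y0 h0] := DS_roughf_near1 s1 cmul_one e0.
have [y1 h1] := DS_roughf_near1 s1 c1 e0.
have [y2 h2] := DS_roughf_near1 s1 c2 e0.
pose y := maxn y0 (maxn y1 y2).
have := phi341_bound s1 c1 c2 hp y; rewrite {2}/phi341 !DS_roughf0 => hb.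
have lb (z : C) : normc (z - 1) <= 1 / 16 -> 15 / 16 <= normc z.
 have := ler_normcB 1 z; rewrite normc1 normc_distC; lra.
have l0 := lb _ (h0 y (leq_maxl _ _)).
have l1 := lb _ (h1 y (leq_trans (leq_maxl _ _) (leq_maxr _ _))).
have l2 := lb _ (h2 y (leq_trans (leq_maxr _ _) (leq_maxr _ _))).
have hl : 1 / 32 <= phi341 f1 f2 s y.
 apply: le_trans (_ : (15 / 16) ^+ 3 * (15 / 16) ^+ 4 * (15 / 16) <= _).
  by rewrite !exprS expr0; lra.
 have p0 : 0 <= 15 / 16 :> R by lra.
 rewrite /phi341; apply: ler_pM; rewrite ?mulr_ge0 ?exprn_ge0 //.
 by apply: ler_pM; rewrite ?exprn_ge0 // lerXn2r ?nnegrE ?normc_ge0.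
set P := _ * _ * normc _ in hb *.
have P0 : 0 <= P by rewrite !mulr_ge0 ?exprn_ge0 ?normc_ge0.
have : 1 / 32 <= 32 ^+ 8 * P.
 apply: le_trans hl (le_trans hb _); rewrite ler_wpM2r // ler_weXn2l ?ler1n //.
 exact: geq_minr.
by rewrite [32 ^+ 9]exprS invfM div1r ler_pdivrMr ?exprn_gt0 // mulrC.
Qed.

End EulerProduct.

(** * Lower bounds from the 3-4-1 inequality; the zeta function on the line [1 + it] *)

Section LowerBounds.
Variable R : realType.
Local Notation C := R[i].
Local Notation lnn := (@lnn R).
Local Notation npw := (@npw R).
Local Notation one := (fun=> 1 : C).

Lemma one_le_powR (a r : R) : 1 <= a -> 0 <= r -> 1 <= a `^ r.
Proof. by move=> a1 r0; have := ler_powR a1 r0; rewrite powRr0. Qed.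

Lemma powR_exprn (x e : R) n : 0 <= x -> (x ^+ n) `^ e = (x `^ e) ^+ n.
Proof.
by move=> x0; rewrite -(powR_mulrn _ x0) -(powR_mulrn _ (powR_ge0 x e)) -!powRrM mulrC.
Qed.

Lemma sum_inv_le N : (0 < N)%N -> \sum_(1 <= n < N.+1) (n%:R^-1 : R) <= 1 + lnn N.
Proof.
case: N => // N _; elim: N => [|N IH]; first by rewrite big_nat1 invr1 lnn1 addr0.
rewrite big_nat_recr //=; apply: le_trans (lerD IH (lnnS_sub_ge R (ltn0Sn N))) _.
by rewrite -addrA [lnn N.+1 + _]addrC subrK.
Qed.

Lemma hdb_bounded (f : nat -> C) : (forall n, (0 < n)%N -> normc (f n) <= 1) -> hdb f 1.
Proof.
move=> h N N0; rewrite mul1r; apply: le_trans (_ : 1 + lnn N <= _); last first.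
 by rewrite expr2 ler_peMr ?lerDl ?addr_ge0 ?lnn_ge0.
apply: le_trans (sum_inv_le N0); apply: ler_sum_nat => n /andP[n0 _].
by rewrite ler_piMl ?invr_ge0 // h.
Qed.

Lemma normc_zeta_le s : 1 < s <= 2 -> normc (DS one s) <= 2 / (s - 1).
Proof.
move=> /andP[s1 s2]; have d0 : 0 < s - 1 by rewrite subr_gt0.
apply: le_trans (_ : 1 + (s - 1)^-1 <= _); last first.
 by rewrite mulr2n mulrDl mul1r lerD2r -[leLHS]invr1 lef_pV2 ?posrE //; lra.
apply: normc_dsum_le => N; under eq_bigr do rewrite normc_wt normc1 mul1r.
by have := @sum_npw_le R (s - 1) N d0; rewrite [1 + (s - 1)]addrC subrK.
Qed.

(** At distance at least [Z ^- 8] from 1 the 3-4-1 inequality with [zeta s <= 2 / (s - 1)] gives a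
    lower bound of order [Z ^- 6]. Closer to 1 the series is compared with its value at
    [s' = 1 + Z ^- 8]; by [DS_lipschitz] this costs a term of order [Z ^- 7]. The series [c] stands
    in for [f1], because for [f1 = n ^ (-it)] the pole must be removed before partial sums can be
    controlled; [a] measures the loss. *)
Lemma lower_341 (e : R) : 0 < e -> exists2 K : R, 1 <= K &
 forall (f1 f2 c : nat -> C) (Y V a K0 s : R),
 1 < s <= 2 -> 1 <= Y -> 1 <= V -> 0 < a <= 1 -> cmul f1 -> cmul f2 ->
 (forall p, prime p -> f1 p = 0 \/ normc (f1 p) = 1 /\ f2 p = f1 p ^+ 2) ->
 sqb c Y -> hdb c K0 -> (forall s', 1 < s' -> smb s' c) ->
 (forall s', 1 < s' <= 2 -> normc (DS f2 s') <= V) ->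
 (forall s', 1 < s' <= 2 -> a * normc (DS f1 s') <= normc (DS c s')) ->
 (K * ((1 + K0) * Y `^ e * V / a) ^+ 7)^-1 <= normc (DS c s).
Proof.
move=> e0; have [L L0 hL] := DS_lipschitz e0.
pose b : R := (32 ^+ 9)^-1 / 8.
have b0 : 0 < b by rewrite divr_gt0 // invr_gt0 exprn_gt0.
have b1 : b <= 1.
 rewrite /b ler_pdivrMr // mul1r; apply: (@le_trans _ _ 1); last by lra.
 by rewrite invf_le1 ?exprn_gt0 // exprn_ege1 // ler1n.
pose L' := L + 1.
have L'1 : 1 <= L' by rewrite /L' lerDr ltW.
have L'0 : 0 < L' by apply: lt_le_trans L'1.
exists (2 / b * (2 * L' / b) ^+ 6).
 have b2 : 1 <= 2 / b by rewrite ler_pdivlMr // mul1r; lra.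
 rewrite mulr_ege1 // exprn_ege1 // ler_pdivlMr // mul1r; lra.
move=> f1 f2 c Y V a K0 s s12 Y1 V1 /andP[a0 a1] c1 c2 hp hY hK hs hV ha.
have Y0 : 0 < Y by apply: lt_le_trans Y1.
have V0 : 0 < V by apply: lt_le_trans V1.
have K00 := hdb_ge0 hK.
have Ye : 1 <= Y `^ e by rewrite -(powRr0 Y) ler_powR // ltW.
have [X XE] := ex_named ((1 + K0) * Y `^ e * V / a).
have X1 : 1 <= X.
 rewrite XE ler_pdivlMr // mul1r (le_trans a1) // !mulr_ege1 //; lra.
have X0 : 0 < X by apply: lt_le_trans X1.
(* With this [Z] the Lipschitz error [L' (1 + K0) Y ^ e Z ^- 7] is exactly half of the lower bound
   [b a / (Z ^ 6 V)]. *)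
have [Z ZE] := ex_named (2 * L' * X / b).
have Z1 : 1 <= Z.
 rewrite ZE ler_pdivlMr // mul1r (le_trans b1) // mulr_ege1 // mulr_ege1 // ler1n //.
have Z0 : 0 < Z by apply: lt_le_trans Z1.
have lbZ s' : 1 < s' <= 2 -> Z ^- 8 <= s' - 1 -> b * a / (Z ^+ 6 * V) <= normc (DS c s').
 move=> s'12 hZ; have [s'1 s'2] := andP s'12.
 have d0 : 0 < s' - 1 by rewrite subr_gt0.
 apply: le_trans (ha _ s'12); rewrite [b * a]mulrC -mulrA ler_wpM2l ?(ltW a0) //.
 have h3 := bound_341 s'1 c1 c2 hp.
 have z3 : normc (DS one s') ^+ 3 <= (2 / (s' - 1)) ^+ 3.
  by rewrite lerXn2r ?nnegrE ?normc_ge0 ?divr_ge0 ?(ltW d0) // normc_zeta_le.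
 have z4 : (2 / (s' - 1)) ^+ 3 <= 8 * Z ^+ 24.
  have -> : 8 * Z ^+ 24 = (2 * Z ^+ 8) ^+ 3 by ring.
  rewrite lerXn2r ?nnegrE ?divr_ge0 ?mulr_ge0 ?exprn_ge0 ?(ltW d0) ?(ltW Z0) //.
  by rewrite ler_wpM2l // -[leRHS]invrK lef_pV2 ?posrE ?invr_gt0 ?exprn_gt0.
 set F := normc (DS f1 s') in h3 *.
 have F0 : 0 <= F by exact: normc_ge0.
 have h4 : (32 ^+ 9)^-1 <= 8 * Z ^+ 24 * F ^+ 4 * V.
  apply: le_trans h3 _; apply: ler_pM; rewrite ?mulr_ge0 ?exprn_ge0 ?normc_ge0 //.
   by apply: ler_wpM2r; rewrite ?exprn_ge0 // (le_trans z3).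
  exact: hV.
 rewrite -(ler_pXn2r (n := 4)) ?nnegrE ?divr_ge0 ?mulr_ge0 ?exprn_ge0 ?(ltW b0) ?(ltW Z0) ?(ltW V0) //.
 rewrite expr_div_n ler_pdivrMr ?exprn_gt0 ?mulr_gt0 ?exprn_gt0 //.
 apply: le_trans (_ : b <= _).
  by rewrite exprS ler_piMr ?(ltW b0) // exprn_ile1 // ltW.
 rewrite /b ler_pdivrMr //; apply: le_trans h4 _.
 have -> : F ^+ 4 * (Z ^+ 6 * V) ^+ 4 * 8 = 8 * Z ^+ 24 * F ^+ 4 * V * V ^+ 3 by ring.
 by rewrite ler_peMr ?exprn_ege1 // !mulr_ge0 ?exprn_ge0 ?(ltW Z0) ?(ltW V0).
have goal_le : (2 / b * (2 * L' / b) ^+ 6 * X ^+ 7)^-1 <= b * a / (Z ^+ 6 * V) / 2.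
 have -> : 2 / b * (2 * L' / b) ^+ 6 * X ^+ 7 = 2 / b * Z ^+ 6 * X by rewrite ZE; ring.
 have -> : b * a / (Z ^+ 6 * V) / 2 = (2 / b * Z ^+ 6 * (V / a))^-1.
  by field; rewrite !lt0r_neq0.
 rewrite lef_pV2 ?posrE ?mulr_gt0 ?exprn_gt0 ?invr_gt0 //.
 rewrite ler_wpM2l ?mulr_ge0 ?exprn_ge0 ?invr_ge0 ?(ltW Z0) ?(ltW b0) //.
 rewrite XE -mulrA ler_peMl ?divr_ge0 ?(ltW V0) ?(ltW a0) //.
 by rewrite mulr_ege1 // lerDl.
have [s1 s2] := andP s12.
rewrite -XE; apply: le_trans goal_le _.
have [hs8|hs8] := leP (Z ^- 8) (s - 1).
 apply: le_trans (lbZ s s12 hs8); rewrite ler_pdivrMr //.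
 by rewrite ler_peMr ?ler1n // divr_ge0 ?mulr_ge0 ?exprn_ge0 ?(ltW b0) ?(ltW a0) ?(ltW Z0) ?(ltW V0).
pose s' := 1 + Z ^- 8.
have Z8 : 0 < Z ^- 8 by rewrite invr_gt0 exprn_gt0.
have Z81 : Z ^- 8 <= 1 by rewrite invf_le1 ?exprn_gt0 // exprn_ege1.
have s'12 : 1 < s' <= 2 by rewrite /s'; lra.
have l1 : b * a / (Z ^+ 6 * V) <= normc (DS c s').
 by apply: lbZ => //; rewrite /s' addrAC subrr add0r.
have k1 : `|s - s'| + `|0 : R| = s' - s.
 by rewrite normr0 addr0 ler0_norm ?opprB // /s'; move: hs8; clear; lra.
have kp : 0 < `|s - s'| + `|0 : R| <= 1 by rewrite k1 /s'; move: hs8 s1 Z81; clear; lra.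
have [s'1 s'2] := andP s'12.
have := hL c Y K0 s s' 0 s12 s'12 kp Y1 hY hK (hs s s1) (hs s' s'1).
have -> : DS (tw 0 c) s' = DS c s' by apply: eq_DS => n _; rewrite /tw nit0 mulr1.
rewrite k1 => hd.
have kk : (s' - s) `^ (7 / 8) <= Z ^- 7.
 apply: le_trans (_ : (Z ^- 8) `^ (7 / 8) <= _).
  by apply: ler_wpowR; rewrite /s'; move: hs8 s1 Z8; clear; lra.
 rewrite -powR_invn ?(ltW Z0) // -powRrM -powR_invn ?(ltW Z0) //.
 by rewrite (_ : - 8%:R * (7 / 8) = - 7%:R) //; field.
have hd2 : normc (DS c s - DS c s') <= b * a / (Z ^+ 6 * V) / 2.
 apply: le_trans hd _.
 apply: le_trans (_ : L' * (1 + K0) * Y `^ e * Z ^- 7 <= _).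
  apply: ler_pM; rewrite ?powR_ge0 ?mulr_ge0 ?(ltW L0) ?powR_ge0 ?addr_ge0 //.
  by rewrite !ler_wpM2r ?powR_ge0 ?addr_ge0 // /L' lerDl.
 have -> : L' * (1 + K0) * Y `^ e * Z ^- 7 = L' * (1 + K0) * Y `^ e / Z / Z ^+ 6.
  by rewrite [Z ^+ 7]exprS invfM mulrA.
 have -> : L' * (1 + K0) * Y `^ e / Z = a * b / V / 2.
  rewrite ZE XE; field; rewrite !lt0r_neq0 ?powR_gt0 //; move: K00; clear; lra.
 by apply: eq_lew; field; rewrite !lt0r_neq0.
have := ler_normcB (DS c s') (DS c s); rewrite normc_distC in hd2.
move: l1 hd2; set u := b * a / _; set v := normc (DS c s'); set w := normc (DS c s).
by clear; lra.
Qed.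

Lemma sum_const_nat1 (a : C) M : \sum_(1 <= n < M.+1) a = a *+ M.
Proof. by rewrite sumr_const_nat subn1. Qed.

(** The coefficients of [(1 - m ^ (1 - s)) * zeta s]: the factor vanishes at the pole, and the
    partial sums become bounded. *)
Definition cm (m n : nat) : C := 1 - (if (m %| n)%N then m%:R else 0).

Lemma sum_cm m M : (0 < m)%N -> \sum_(1 <= n < M.+1) cm m n = (M %% m)%N%:R.
Proof.
move=> m0; rewrite sumrB sum_const_nat1.
suff -> : \sum_(1 <= n < M.+1) (if (m %| n)%N then m%:R else 0 : C) = (M %/ m * m)%N%:R.
 by rewrite {1}(divn_eq M m) natrD addrC addKr.
elim: M => [|M IH]; first by rewrite big_geq // div0n.
rewrite big_nat_recr //= IH divnS // mulnDl natrD addrC; congr (_ + _).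
by case: ifP => _; rewrite ?mul1n ?mul0n.
Qed.

Lemma sqb_bounded (c : nat -> C) (Y : R) :
 (forall M, normc (\sum_(1 <= n < M.+1) c n) <= Y) -> sqb c Y.
Proof.
move=> h M; have Y0 : 0 <= Y by apply: le_trans (h 0%N); exact: normc_ge0.
case: M => [|M]; first by rewrite big_geq // normc0 sqrtr0 mulr0.
apply: le_trans (h M.+1) _; rewrite ler_peMr // -[leLHS](@sqrtr1 R) ler_sqrt ?ler1n ?ler0n //.
Qed.

Lemma sqb_cm m : (0 < m)%N -> sqb (cm m) m%:R.
Proof.
move=> m0; apply: sqb_bounded => M; rewrite sum_cm // normc_nat ler_nat ltnW //.
by rewrite ltn_mod.
Qed.

Lemma sum_mult_div (F : nat -> R) m N : (0 < m)%N ->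
 \sum_(1 <= n < N.+1) (if (m %| n)%N then F (n %/ m)%N else 0) =
 \sum_(1 <= k < (N %/ m).+1) F k.
Proof.
move=> m0; elim: N => [|N IH]; first by rewrite div0n !big_geq.
rewrite big_nat_recr //= IH divnS //; case: ifP => mN; last by rewrite addr0 add0n.
by rewrite mN !add1n [RHS]big_nat_recr.
Qed.

Lemma hdb_cm m : (0 < m)%N -> hdb (cm m) 2.
Proof.
move=> m0 N N0.
have m0' : 0 < (m%:R : R) by rewrite ltr0n.
apply: le_trans (_ : \sum_(1 <= n < N.+1) (n%:R^-1 +
  (if (m %| n)%N then ((n %/ m)%N%:R)^-1 else 0)) <= _).
 apply: ler_sum_nat => n /andP[n0 _].
 have n0' : 0 < (n%:R : R) by rewrite ltr0n.
 rewrite /cm; case: ifP => mn; last by rewrite subr0 normc1 mul1r addr0.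
 apply: le_trans (ler_wpM2r _ (normcB_le _ _)) _; first by rewrite invr_ge0 ltW.
 rewrite normc1 normc_nat mulrDl mul1r lerD2l -{1}(divnK mn) natrM invfM mulrA mulrAC.
 by rewrite mulfV ?lt0r_neq0 // mul1r.
rewrite big_split /= (sum_mult_div (fun k => k%:R^-1)) //.
have l0 := @lnn_ge0 R N.
have h : \sum_(1 <= k < (N %/ m).+1) (k%:R^-1 : R) <= 1 + lnn N.
 have [->|d0] := posnP (N %/ m); first by rewrite big_geq // addr_ge0.
 by apply: le_trans (sum_inv_le d0) _; rewrite lerD2l ler_lnn // leq_div.
apply: le_trans (lerD (sum_inv_le N0) h) _; rewrite expr2; nra.
Qed.

Lemma smb_cm s m : 1 < s -> smb s (cm m).
Proof.
move=> s1; apply: (smb_bounded (B := 1 + m%:R)) => // n _; rewrite /cm.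
apply: le_trans (normcB_le _ _) _; rewrite normc1 lerD2l.
by case: ifP => _; rewrite ?normc_nat ?normc0.
Qed.

Lemma DS_tw_cm s t m : 1 < s -> (1 < m)%N ->
 DS (tw t (cm m)) s = (1 - nit t m * (npw (s - 1) m)%:C%C) * DS (tw t one) s.
Proof.
move=> s1 m1; have m0 := ltnW m1.
have -> : 1 - nit t m * (npw (s - 1) m)%:C%C = DS (edp m (m%:R * nit t m)) s.
 rewrite DS_edp //; congr (1 - _); rewrite -mulrA mulrCA; congr (_ * _).
 have {2}-> : s = (s - 1) + 1 by rewrite subrK.
 rewrite (npwD _ 1 m0) npw_1 rmorphM /= mulrCA.
 rewrite -(rmorph_nat (real_complex R)) -rmorphM /= mulfV ?mulr1 // pnatr_eq0 -lt0n //.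
rewrite -DS_dconv; last 2 first.
- exact: smb_edp.
- by apply: (smb_bounded (B := 1)) => // n _; rewrite normc_tw normc1.
apply: eq_DS => n n0; rewrite dconv_edp // /tw /cm mulrBl mul1r; congr (_ - _).
case: ifP => mn; last by rewrite mul0r.
have d0 : (0 < n %/ m)%N by rewrite divn_gt0 // dvdn_leq.
have -> : nit t n = nit t m * nit t (n %/ m) by rewrite -(nitM t m0 d0) mulnC divnK.
by rewrite mul1r mulrA.
Qed.

Lemma sin_ge_half (x : R) : 0 <= x <= 1 -> x / 2 <= sin x.
Proof.
move=> /andP[x0 x1]; have [->|xn0] := eqVneq x 0; first by rewrite sin0 mul0r.
have xp : 0 < x by rewrite lt_neqAle eq_sym xn0.
have hd : {in `]0, x[, forall y : R, is_derive y 1 (@sin R) (cos y)} by move=> y _; exact: is_derive_sin.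
have [|c cx] := MVT xp hd; first by apply: derivable_within_continuous => y _.
rewrite sin0 !subr0 => ->; rewrite mulrC ler_wpM2r //.
have [c0 cx1] : 0 < c /\ c < x by move: cx; rewrite in_itv /= => /andP.
have h1 := normc_expiB1_sqr c; rewrite normc2E /= oppr0 addr0 in h1.
have h2 := cos2Dsin2 c.
have h3 : sin (c / 2) ^+ 2 <= (c / 2) ^+ 2.
 rewrite -(real_normK (num_real (sin _))) -(real_normK (num_real (c / 2))).
 by rewrite lerXn2r ?nnegrE // norm_sin_le.
have h4 : (c / 2) ^+ 2 <= (1 / 2) ^+ 2 by rewrite lerXn2r ?nnegrE ?divr_ge0 ?(ltW c0) //; lra.
by move: h1 h2 h3 h4; rewrite !expr2; clear; nra.
Qed.

Lemma normc_expiB1_ge (x : R) : `|x| <= 1 -> `|x| / 2 <= normc (1 - expi x).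
Proof.
move=> x1; apply: le_trans (_ : `|sin x| <= _).
 wlog x0 : x x1 / 0 <= x.
  move=> h; case: (leP 0 x) => [/h|/ltW]; first exact.
  by rewrite -oppr_ge0 => /h; rewrite sinN !normrN; apply.
 rewrite (ger0_norm x0) in x1 *; apply: le_trans (ler_norm _).
 by apply: sin_ge_half; rewrite x0.
apply: le_trans (Im_le_normc _); by rewrite /= sub0r normrN.
Qed.

Lemma lnn2_ge : 1 / 2 <= lnn 2.
Proof. by have := @lnnS_sub_ge R 1 isT; rewrite lnn1 subr0 div1r. Qed.

Lemma lnn2_le : lnn 2 <= 1.
Proof. by have := @lnnS_sub R 1 isT; rewrite lnn1 subr0 invr1. Qed.

(* For [|t| >= 1] the arguments of [M^{-it}] and [(M+1)^{-it}] with [M ~ |t|] differ by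
  a quantity of order [1], so one of the two is far from [1]. *)
Lemma exists_nit_far (t : R) : t != 0 -> exists2 m : nat, (1 < m)%N &
 m%:R <= 3 * (1 + `|t|) /\ Num.min 1 `|t| / 12 <= normc (1 - nit t m).
Proof.
move=> t0; have tp : 0 < `|t| by rewrite normr_gt0.
have [t1|t1] := leP `|t| 1.
 exists 2%N => //; split; first by lra.
 apply: le_trans (_ : `|- (t * lnn 2)| / 2 <= _).
  rewrite normrN normrM (ger0_norm (lnn_ge0 _ _)).
  have := lnn2_ge; set l := lnn 2; set u := `|t| in tp *; nra.
 apply: normc_expiB1_ge; rewrite normrN normrM (ger0_norm (lnn_ge0 _ _)).
 have := lnn2_le; have := @lnn_ge0 R 2; set l := lnn 2; set u := `|t| in tp t1 *; nra.
pose M := (Num.truncn `|t|).+1.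
have M1 : (1 < M)%N by rewrite /M ltnS truncn_gt0 ltW.
have tM : `|t| < M%:R by exact: truncn_gtS.
have Mt : M%:R <= 1 + `|t|.
 rewrite /M -nat1r lerD2l; by have /andP[] := truncn_itv (ltW tp).
have M0 : 0 < (M%:R : R) by rewrite ltr0n ltnW.
have d1 := lnnS_sub R (ltnW M1); have d2 := lnnS_sub_ge R (ltnW M1).
have hx : `|t * (lnn M.+1 - lnn M)| <= 1.
 rewrite normrM [X in _ * X]ger0_norm ?subr_ge0 ?ler_lnn ?(ltnW M1) //.
 apply: le_trans (ler_wpM2l (ltW tp) d1) _; by rewrite ler_pdivrMr // mul1r ltW.
have hy : 1 / 3 <= `|t * (lnn M.+1 - lnn M)|.
 rewrite normrM [X in _ <= _ * X]ger0_norm ?subr_ge0 ?ler_lnn ?(ltnW M1) //.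
 apply: le_trans (ler_wpM2l (ltW tp) d2); rewrite ler_pdivlMr ?ltr0n //.
 by rewrite -[M.+1%:R]nat1r; move: Mt t1; clear; lra.
have hz : 1 / 6 <= normc (nit t M - nit t M.+1).
 have -> : nit t M - nit t M.+1 = nit t M.+1 * - (1 - expi (t * (lnn M.+1 - lnn M))).
  rewrite opprB mulrBr mulr1; congr (_ - _); rewrite /nit -expiD; congr expi; ring.
 rewrite normcM normc_nit [X in _ <= X]mul1r normcN; apply: le_trans (normc_expiB1_ge hx).
 by move: hy; clear; lra.
have [h|h] := leP (1 / 12) (normc (1 - nit t M)).
 by exists M => //; split=> //; move: Mt t1; clear; lra.
exists M.+1; first exact: ltnW.
split; first by rewrite -[M.+1%:R]nat1r; move: Mt t1; clear; lra.
have e : nit t M - nit t M.+1 = (1 - nit t M.+1) - (1 - nit t M) by ring.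
have := normcB_le (1 - nit t M.+1) (1 - nit t M); rewrite -e.
by move: hz h; clear; set x := normc _; set y := normc _; set z := normc _; lra.
Qed.

(** [|1 - z| <= |1 - z r| + (1 - r)], and [1 - r] is itself at most [|1 - z r|]. *)
Lemma normc_one_sub_scale (r : R) (z : C) : 0 <= r <= 1 -> normc z = 1 ->
 normc (1 - z) / 2 <= normc (1 - z * r%:C%C).
Proof.
move=> /andP[r0 r1] z1.
have h1 : normc (z * r%:C%C) = r by rewrite normcM z1 mul1r normcR_ge0.
have h2 := ler_normcB 1 (z * r%:C%C); rewrite normc1 h1 in h2.
have h3 : normc (z * r%:C%C - z) = 1 - r.
 have -> : z * r%:C%C - z = z * (- (1 - r)%:C%C) by rewrite rmorphB rmorph1; ring.
 by rewrite normcM z1 mul1r normcN normcR_ge0 // subr_ge0.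
have h4 : normc (1 - z) <= normc (1 - z * r%:C%C) + normc (z * r%:C%C - z).
 by apply: le_trans (le_normcD _ _); rewrite addrA subrK.
by move: h2 h3 h4; clear; set x := normc _; set y := normc _; set w := normc _; lra.
Qed.

Lemma DS_tw_cm_ge s t m : 1 < s <= 2 -> (1 < m)%N ->
 normc (1 - nit t m) / 2 * normc (DS (tw t one) s) <= normc (DS (tw t (cm m)) s).
Proof.
move=> /andP[s1 s2] m1; rewrite DS_tw_cm // normcM ler_wpM2r ?normc_ge0 //.
apply: normc_one_sub_scale; rewrite ?normc_nit // npw_ge0 npw_le1 ?(ltnW m1) //.
by rewrite subr_ge0 ltW.
Qed.

Lemma DS_lk0 (c : nat -> C) s : DS (lk c 0) s = DS c s.
Proof. by apply: eq_DS => n _; rewrite /lk expr0 mulr1. Qed.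

Lemma zeta_tw_upper (e : R) : 0 < e -> exists2 K : R, 1 <= K & forall t s,
 t != 0 -> 1 < s <= 2 ->
 normc (DS (tw t one) s) <= K * (1 + `|t|) `^ e / Num.min 1 `|t|.
Proof.
move=> e0; have e2 : 0 < e / 2 by rewrite divr_gt0.
have [K K0 hK] := DS_lk_bound 0 e2.
exists (K * 3 * 6 `^ (e / 2) * 24 + 1).
 by rewrite lerDr !mulr_ge0 ?powR_ge0 // ltW.
move=> t s t0 s12; have [s1 s2] := andP s12.
have [m m1 [mt hm]] := exists_nit_far t0.
have tp : 0 < `|t| by rewrite normr_gt0.
have mp : 0 < Num.min 1 `|t| by rewrite lt_min ltr01.
have hs : smb s (tw t (cm m)) by apply: smb_tw; exact: smb_cm.
have m0 := ltnW m1.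
pose Y := m%:R * (1 + 2 * `|t|) : R.
have Y1 : 1 <= Y by rewrite mulr_ege1 ?ler1n // lerDl mulr_ge0.
have := hK _ Y 2 s s12 Y1 (sqb_tw t (sqb_cm m0)) (hdb_tw t (hdb_cm m0)) hs.
rewrite DS_lk0 => h1.
have h2 := le_trans (DS_tw_cm_ge t s12 m1) h1.
have hY : Y `^ (e / 2) <= 6 `^ (e / 2) * (1 + `|t|) `^ e.
 apply: le_trans (_ : (6 * (1 + `|t|) ^+ 2) `^ (e / 2) <= _).
  apply: ler_wpowR; rewrite ?(ltW e2) ?(le_trans _ Y1) //.
  have := mulr_ge0 (ltW tp) (ltW tp).
  by move: mt tp; rewrite /Y; clear; set u := `|t|; set v := m%:R; nra.
 rewrite powRM ?exprn_ge0 ?addr_ge0 // -powR_mulrn ?addr_ge0 // -powRrM.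
 by rewrite (_ : 2%:R * (e / 2) = e) //; field.
rewrite ler_pdivlMr // mulrDl.
apply: le_trans (_ : K * 3 * 6 `^ (e / 2) * 24 * (1 + `|t|) `^ e <= _); last first.
 by rewrite lerDl mul1r powR_ge0.
set D := normc (DS (tw t one) s) in h2 *.
have D0 : 0 <= D by exact: normc_ge0.
apply: le_trans (_ : 24 * (K * (1 + 2) * Y `^ (e / 2)) <= _).
 apply: le_trans (ler_wpM2l _ h2) => //.
 have := ler_wpM2l D0 hm; set q := normc _; set p := Num.min _ _; clear; lra.
have k3 : 0 <= 24 * (K * 3) by rewrite !mulr_ge0 // ltW.
have -> : 1 + 2 = 3 :> R by ring.
by have := ler_wpM2l k3 hY; clear; lra.
Qed.

(** For [m = 2] the series is [1 - 2 ^ (-s) + 3 ^ (-s) - ...], whose partial sums over whole pairs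
    increase. *)
Lemma alternating_sum_ge s N : 0 <= s -> exists2 x : R, 1 - npw s 2 <= x &
 \sum_(1 <= n < (N.+1).*2.+1) wt s (cm 2) n = x%:C%C.
Proof.
move=> s0; elim: N => [|N [x x1 e]].
 exists (1 - npw s 2) => //; rewrite big_nat_recr //= big_nat1 /wt /cm /= npw1.
 by rewrite rmorphB rmorph1 /= subr0 mul1r; ring.
exists (x + npw s (N.+1).*2.+1 - npw s (N.+1).*2.+2).
 have := @npw_decr R s (N.+1).*2.+1 (N.+1).*2.+2 isT (leqnSn _) s0.
 by move: x1; clear; set a := npw _ _; set b := npw _ _; set c := npw _ _; lra.
rewrite doubleS big_nat_recr //= big_nat_recr //= e /wt /cm /=.
by rewrite !dvdn2 /= !negbK !odd_double /= rmorphB rmorphD /= subr0 mul1r; ring.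
Qed.

Lemma DS_cm2_ge s : 1 < s <= 2 -> 1 / 2 <= normc (DS (cm 2) s).
Proof.
move=> /andP[s1 s2]; have [B hB] := smb0 (smb_cm 2 s1).
apply/ler_addgt0Pr => e e0; have [N0 h] := dsum_tends hB e0.
have [x x1 ex] := alternating_sum_ge N0 (ltW (lt_trans ltr01 s1)).
have := h (N0.+1).*2.+1; rewrite ex => /(_ _) hN.
have {}hN : normc (x%:C%C - DS (cm 2) s) <= e by apply: hN; rewrite -addnn; lia.
have x2 : 1 / 2 <= x.
 apply: le_trans x1; have := npw_le_inv (ltn0Sn 1) (ltW s1).
 by clear; set a := npw _ _; lra.
have := ler_normcB (x%:C%C) (DS (cm 2) s); rewrite normcR_ge0; last by move: x2; clear; lra.
by move: hN x2; clear; set a := normc _; set b := normc _; lra.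
Qed.

(** For [|t| <= t1] the alternating series at a real point is at least [1/2], and moving by [t]
    costs at most [1/4]. For larger [|t|] the 3-4-1 inequality applies to [n ^ (-it)] and
    [n ^ (-2it)], with [m] depending on [t] so as to keep [1 - m ^ (1 - s - it)] away from 0. *)
Lemma zeta_cm_lower (e : R) : 0 < e -> exists2 K : R, 1 <= K & forall t,
 exists2 m : nat, (1 < m)%N & m%:R <= 3 * (1 + `|t|) /\
 forall s, 1 < s <= 2 -> (K * (1 + `|t|) `^ e)^-1 <= normc (DS (tw t (cm m)) s).
Proof.
(* Exponent count: three powers of [1 + |t|] with exponent [e / 21], two from [Y] and one from the
   bound for the series at [2 * t], are raised to the seventh. *)
move=> e0; have e1 : 0 < e / 21 by rewrite divr_gt0.
have [L L0 hL] := DS_lipschitz (@ltr01 R).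
have [V V1 hV] := zeta_tw_upper e1.
have [K K1 hK] := lower_341 e1.
(* This makes the Lipschitz error [6 L |t| ^ (7/8)] at most [1/4], by way of
   [|t| ^ (7/8) <= |t| ^ (1/2)]. *)
pose t1 : R := Num.min 1 ((12 * (2 * L + 1))^-1 ^+ 2).
have L1 : 0 < 12 * (2 * L + 1) by move: L0; clear; lra.
have t10 : 0 < t1 by rewrite lt_min ltr01 exprn_gt0 // invr_gt0.
have t11 : t1 <= 1 by rewrite ge_min lexx.
pose D : R := K * (3 * 6 `^ (e / 21) * V * 2 `^ (e / 21) * 24 / t1 ^+ 2) ^+ 7.
have D0 : 0 <= D.
 rewrite mulr_ge0 ?(le_trans ler01 K1) // exprn_ge0 //.
 by rewrite divr_ge0 ?exprn_ge0 ?(ltW t10) // !mulr_ge0 ?powR_ge0 ?(le_trans ler01 V1).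
exists (4 + D); first by move: D0; clear; lra.
move=> t; have tn : 1 <= (1 + `|t|) `^ e.
 by rewrite one_le_powR ?lerDl // ltW.
have T1 : 1 <= 1 + `|t| by rewrite lerDl.
have T0 : 0 < 1 + `|t| by apply: lt_le_trans T1.
have [ht|ht] := leP `|t| t1.
 exists 2%N => //; split; first by move: T1; clear; lra.
 move=> s s12; apply: le_trans (_ : 1 / 4 <= _).
  rewrite div1r lef_pV2 ?posrE ?mulr_gt0 ?powR_gt0 //; last by move: D0; clear; lra.
  by move: D0 tn; clear; set y := _ `^ _; nra.
 have h2 := DS_cm2_ge s12.
 have [->|t0] := eqVneq t 0.
  rewrite (_ : DS (tw 0 (cm 2)) s = DS (cm 2) s); first by move: h2; clear; lra.
  by apply: eq_DS => n _; rewrite /tw nit0 mulr1.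
 have tp : 0 < `|t| by rewrite normr_gt0.
 have [s1 s2] := andP s12.
 have kp : 0 < `|s - s| + `|t| <= 1 by rewrite subrr normr0 add0r tp (le_trans ht).
 have := hL (cm 2) 2 2 s s t s12 s12 kp _ (sqb_cm (ltn0Sn 1)) (hdb_cm (ltn0Sn 1)) (smb_cm 2 s1) (smb_cm 2 s1).
 rewrite ler1n => /(_ isT); rewrite subrr normr0 add0r powRr1 // => hd.
 have hp : `|t| `^ (7 / 8) <= (12 * (2 * L + 1))^-1.
  apply: le_trans (_ : `|t| `^ (1 / 2) <= _).
   apply: ger_powR; rewrite ?tp ?(le_trans ht) //; clear; lra.
  have -> : (12 * (2 * L + 1))^-1 = ((12 * (2 * L + 1))^-1 ^+ 2) `^ (1 / 2).
   rewrite -powR_mulrn ?invr_ge0 ?(ltW L1) // -powRrM.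
   by rewrite (_ : 2%:R * (1 / 2) = 1) ?powRr1 ?invr_ge0 ?(ltW L1) //; field.
  apply: ler_wpowR => //; apply: le_trans ht _; by rewrite ge_min lexx orbT.
 have hq : L * (1 + 2) * 2 * `|t| `^ (7 / 8) <= 1 / 4.
  apply: le_trans (ler_wpM2l _ hp) _; first by rewrite !mulr_ge0 ?(ltW L0).
  by rewrite ler_pdivrMr //; move: L0; clear; lra.
 have := ler_normcB (DS (cm 2) s) (DS (tw t (cm 2)) s).
 by move: h2 (le_trans hd hq); clear; set a := normc _; set b := normc _; set d := normc _; lra.
have tp : 0 < `|t| by apply: lt_trans ht.
have t0 : t != 0 by rewrite -normr_gt0.
have [m m1 [mt hm]] := exists_nit_far t0.
exists m => //; split => // s s12; have m0 := ltnW m1.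
have mp : t1 <= Num.min 1 `|t| by rewrite le_min t11 ltW.
pose Y := m%:R * (1 + 2 * `|t|) : R.
have Y1 : 1 <= Y by rewrite mulr_ege1 ?ler1n // lerDl mulr_ge0.
pose U := V * (2 * (1 + `|t|)) `^ (e / 21) / t1.
have U1 : 1 <= U.
 rewrite ler_pdivlMr // mul1r (le_trans t11) // mulr_ege1 //.
 by rewrite one_le_powR ?(ltW e1) //; move: T1; clear; lra.
have a01 : 0 < t1 / 24 <= 1 by rewrite divr_gt0 //=; move: t11; clear; lra.
have := hK (tw t one) (tw (2 * t) one) (tw t (cm m)) Y U (t1 / 24) 2 s s12 Y1 U1 a01
  (cmul_tw t (cmul_one R)) (cmul_tw (2 * t) (cmul_one R)) _ (sqb_tw t (sqb_cm m0))
  (hdb_tw t (hdb_cm m0)) _ _ _.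
move=> h; apply: le_trans (h _ _ _ _) => {h}; last first.
- move=> s' s'12; apply: le_trans (DS_tw_cm_ge t s'12 m1); rewrite ler_wpM2r ?normc_ge0 //.
 by move: hm mp; clear; set a := normc _; set b := Num.min _ _; lra.
- move=> s' s'12; apply: le_trans (hV (2 * t) s' _ s'12) _; first by rewrite mulf_neq0 ?pnatr_eq0.
 rewrite normrM ger0_norm //; apply: ler_pM.
 + by rewrite mulr_ge0 ?powR_ge0 // (le_trans ler01 V1).
 + by rewrite invr_ge0 le_min ler01 mulr_ge0.
 + rewrite ler_wpM2l ?(le_trans ler01 V1) //; apply: ler_wpowR; first exact: ltW.
   by rewrite addr_ge0 // mulr_ge0.
  by clear; lra.
 rewrite lef_pV2 ?posrE // ?lt_min ?ltr01 ?mulr_gt0 //.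
 by rewrite le_min t11 /=; move: ht tp; clear; set u := `|t|; lra.
- by move=> s' s'1; apply: smb_tw; exact: smb_cm.
- move=> p _; right; rewrite normc_tw normc1 /tw !mul1r; split=> //.
 by rewrite mulr2n mulrDl mul1r nitD expr2.
rewrite lef_pV2 ?posrE; last 2 first.
- by rewrite mulr_gt0 ?powR_gt0 //; move: D0; clear; lra.
- rewrite mulr_gt0 ?(lt_le_trans ltr01 K1) // exprn_gt0 // divr_gt0 ?(andP a01).1 //.
 apply: mulr_gt0; last exact: lt_le_trans ltr01 U1.
 by apply: mulr_gt0 => //; apply: powR_gt0; exact: lt_le_trans ltr01 Y1.
apply: le_trans (_ : D * (1 + `|t|) `^ e <= _); last first.
 by rewrite ler_wpM2r ?powR_ge0 //; move: D0; clear; lra.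
have hY : Y `^ (e / 21) <= 6 `^ (e / 21) * (1 + `|t|) `^ (e / 21) ^+ 2.
 apply: le_trans (_ : (6 * (1 + `|t|) ^+ 2) `^ (e / 21) <= _).
  apply: ler_wpowR; rewrite ?(ltW e1) ?(le_trans _ Y1) //.
  have := mulr_ge0 (ltW tp) (ltW tp).
  by move: mt tp; rewrite /Y; clear; set u := `|t|; set v := m%:R; nra.
 by rewrite (powRM _ _ (exprn_ge0 _ (ltW T0))) // (powR_exprn _ _ (ltW T0)).
have -> : D * (1 + `|t|) `^ e =
 K * (3 * 6 `^ (e / 21) * V * 2 `^ (e / 21) * 24 / t1 ^+ 2 * (1 + `|t|) `^ (e / 21) ^+ 3) ^+ 7.
 rewrite exprMn mulrA; congr (_ * _); rewrite -exprM -powR_mulrn ?powR_ge0 // -powRrM.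
 by congr powR; field.
rewrite ler_wpM2l ?(le_trans ler01 K1) //.
have P0 : 0 <= (1 + 2) * Y `^ (e / 21) * U / (t1 / 24).
 rewrite divr_ge0 ?(ltW (andP a01).1) //; apply: mulr_ge0; last exact: le_trans ler01 U1.
 by apply: mulr_ge0 => //; exact: powR_ge0.
suff hP : (1 + 2) * Y `^ (e / 21) * U / (t1 / 24) <=
  3 * 6 `^ (e / 21) * V * 2 `^ (e / 21) * 24 / t1 ^+ 2 * (1 + `|t|) `^ (e / 21) ^+ 3.
 by rewrite lerXn2r ?nnegrE // (le_trans P0).
rewrite /U (powRM _ (ler0n R 2) (ltW T0)); set T := (1 + `|t|) `^ (e / 21) in hY *.
have -> : (1 + 2) * Y `^ (e / 21) * (V * (2 `^ (e / 21) * T) / t1) / (t1 / 24) =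
 Y `^ (e / 21) * (3 * V * 2 `^ (e / 21) * T * 24 / t1 ^+ 2) by field; rewrite lt0r_neq0.
have -> : 3 * 6 `^ (e / 21) * V * 2 `^ (e / 21) * 24 / t1 ^+ 2 * T ^+ 3 =
 6 `^ (e / 21) * T ^+ 2 * (3 * V * 2 `^ (e / 21) * T * 24 / t1 ^+ 2) by field; rewrite lt0r_neq0.
rewrite ler_wpM2r // divr_ge0 ?exprn_ge0 ?(ltW t10) // !mulr_ge0 ?powR_ge0 //.
exact: le_trans ler01 V1.
Qed.

End LowerBounds.

(** * Lower bounds for [L(s + it, chi)] as [s] tends to 1 *)

Section CharacterLowerBounds.
Variable R : realType.
Local Notation C := R[i].
Local Notation one := (fun=> 1 : C).

Definition bsum (c : nat -> C) (q : R) := forall M, normc (\sum_(1 <= n < M.+1) c n) <= q.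

Lemma powR_mul_bound (a b e K : R) : 0 <= e -> 0 <= K -> 0 <= a -> a <= K * b -> 0 <= b ->
 a `^ e <= K `^ e * b `^ e.
Proof. by move=> e0 K0 a0 ab b0; rewrite -powRM //; apply: ler_wpowR. Qed.

Lemma smb_cmul s (f : nat -> C) : 1 < s -> cmul f -> smb s f.
Proof. by move=> s1 [_ _ h]; apply: (smb_bounded (B := 1)). Qed.

Lemma tw_pow2 t (f : nat -> C) p : tw (2 * t) (fun n => f n ^+ 2) p = tw t f p ^+ 2.
Proof. by rewrite /tw exprMn mulr2n mulrDl mul1r nitD expr2. Qed.

Lemma cmul_sqr (f : nat -> C) : cmul f -> cmul (fun n => f n ^+ 2).
Proof.
case=> f1 fM fn; split; first by rewrite f1 expr1n.
 by move=> m n m0 n0; rewrite fM // exprMn.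
by move=> n; rewrite normcX exprn_ile1 // normc_ge0.
Qed.

(** Here [f ^ 2] has bounded partial sums too, so its series is at most a small power of
    [q (1 + |t|)] and can take the last place in the 3-4-1 inequality. *)
Lemma chi_lower_complex (e : R) : 0 < e -> exists2 K : R, 1 <= K &
 forall (f : nat -> C) (q t s : R), 1 < s <= 2 -> 1 <= q -> cmul f ->
 (forall p, prime p -> f p = 0 \/ normc (f p) = 1) ->
 bsum f q -> bsum (fun n => f n ^+ 2) q ->
 (K * (q * (1 + `|t|)) `^ e)^-1 <= normc (DS (tw t f) s).
Proof.
(* Two powers with exponent [e / 14], from [Y] and from [V], are raised to the seventh. *)
move=> e0; have e1 : 0 < e / 14 by lra.
have [K K1 hK] := lower_341 e1; have [L L0 hL] := DS_lk_bound 0 e1.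
have K0 := ge1_gt0 K1.
have [A AE] := ex_named (2 * 2 `^ (e / 14) * ((L + 1) * 2 * 4 `^ (e / 14))).
have A1 : 1 <= A.
 rewrite AE mulr_ege1 // mulr_ege1 ?one_le_powR ?ler1n ?(ltW e1) //.
 by lra.
exists (K * A ^+ 7); first by rewrite mulr_ege1 // exprn_ege1.
move=> f q t s s12 q1 cf f01 bf bf2.
have q0 := ge1_gt0 q1.
have T1 : 1 <= 1 + `|t| by rewrite lerDl.
have [X XE] := ex_named (q * (1 + `|t|)).
have X1 : 1 <= X by rewrite XE mulr_ege1.
have X0 := ge1_gt0 X1.
have [Y YE] := ex_named (q * (1 + 2 * `|t|)).
have Y1 : 1 <= Y by rewrite YE mulr_ege1 // lerDl mulr_ge0.
have [Z ZE] := ex_named (q * (1 + 2 * `|2 * t|)).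
have Z1 : 1 <= Z by rewrite ZE mulr_ege1 // lerDl mulr_ge0.
have tq : 0 <= q * `|t| by rewrite mulr_ge0 // ltW.
have YX : Y <= 2 * X by rewrite YE XE; move: tq q0; clear; nra.
have ZX : Z <= 4 * X.
 by rewrite ZE XE normrM ger0_norm; move: tq q0; clear; nra.
have Ye : Y `^ (e / 14) <= 2 `^ (e / 14) * X `^ (e / 14).
 by apply: powR_mul_bound; rewrite ?(ltW e1) ?(ltW X0) ?(le_trans ler01 Y1).
have Ze : Z `^ (e / 14) <= 4 `^ (e / 14) * X `^ (e / 14).
 by apply: powR_mul_bound; rewrite ?(ltW e1) ?(ltW X0) ?(le_trans ler01 Z1).
have [V VE] := ex_named ((L + 1) * 2 * Z `^ (e / 14)).
have V1 : 1 <= V.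
 rewrite VE mulr_ege1 ?one_le_powR ?(ltW e1) //; by move: L0; clear; lra.
have hp p : prime p -> tw t f p = 0 \/ normc (tw t f p) = 1 /\
  tw (2 * t) (fun n => f n ^+ 2) p = tw t f p ^+ 2.
 move=> /f01[h|h]; [left; by rewrite /tw h mul0r|right; by rewrite normc_tw tw_pow2].
have sY : sqb (tw t f) Y by rewrite YE; apply: sqb_tw; exact: sqb_bounded.
have a01 : 0 < (1 : R) <= 1 by rewrite ltr01 lexx.
have hd1 (g : nat -> C) : cmul g -> hdb g 1 by case=> _ _ h; apply: hdb_bounded => n _.
have hV s' : 1 < s' <= 2 -> normc (DS (tw (2 * t) (fun n => f n ^+ 2)) s') <= V.
 move=> s'12; rewrite -DS_lk0; apply: le_trans (hL _ Z 1 s' s'12 Z1 _ _ _) _.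
 - by rewrite ZE; apply: sqb_tw; exact: sqb_bounded.
 - by apply/hd1/cmul_tw/cmul_sqr.
 - by apply: smb_tw; apply: smb_cmul; [case/andP: s'12|exact: cmul_sqr].
 by rewrite VE ler_wpM2r ?powR_ge0 // ler_wpM2r // lerDl.
have := hK (tw t f) (tw (2 * t) (fun n => f n ^+ 2)) (tw t f) Y V 1 1 s s12 Y1 V1 a01
 (cmul_tw t cf) (cmul_tw (2 * t) (cmul_sqr cf)) hp sY (hd1 _ (cmul_tw t cf)) _ hV _.
move=> h; apply: le_trans (h _ _) => {h}; last first.
- by move=> s' _; rewrite mul1r.
- by move=> s' s'1; apply: smb_tw; exact: smb_cmul.
have Y0 := ge1_gt0 Y1; have V0 := ge1_gt0 V1.
have A0 := ge1_gt0 A1.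
rewrite divr1 -XE lef_pV2 ?posrE ?mulr_gt0 ?powR_gt0 //.
rewrite -[leRHS]mulrA ler_wpM2l ?(ltW K0) //.
have -> : X `^ e = (X `^ (e / 14) ^+ 2) ^+ 7.
 rewrite -exprM -powR_mulrn ?powR_ge0 // -powRrM; congr powR; by field.
have B0 : 0 <= (1 + 1) * Y `^ (e / 14) * V.
 by apply: mulr_ge0; [rewrite mulr_ge0 ?powR_ge0|exact: ltW].
suff hB : (1 + 1) * Y `^ (e / 14) * V <= A * X `^ (e / 14) ^+ 2.
 by rewrite -exprMn lerXn2r ?nnegrE // (le_trans B0).
have -> : A * X `^ (e / 14) ^+ 2 =
 2 * (2 `^ (e / 14) * X `^ (e / 14)) * ((L + 1) * 2 * (4 `^ (e / 14) * X `^ (e / 14))).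
 by rewrite AE; ring.
apply: ler_pM; rewrite ?mulr_ge0 ?powR_ge0 ?(ltW V0) //.
 by have -> : 1 + 1 = 2 :> R by []; rewrite ler_wpM2l.
by rewrite VE ler_wpM2l // mulr_ge0 // addr_ge0 // ltW.
Qed.

(* Close to the real axis the lower bound comes from the value on the real axis, elsewhere
  from the 3-4-1 inequality, where [f^2] is replaced by the trivial character. *)
Lemma chi_lower_real (e : R) : 0 < e -> exists2 K : R, 1 <= K &
 forall (f : nat -> C) (q t s l : R), 1 < s <= 2 -> 1 <= q -> cmul f ->
 (forall p, prime p -> f p = 0 \/ f p ^+ 2 = 1) ->
 bsum f q -> 0 < l <= 1 -> (forall s', 1 < s' <= 2 -> l <= normc (DS f s')) ->
 (K * (q * (1 + `|t|)) `^ e / l ^+ 14)^-1 <= normc (DS (tw t f) s).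
Proof.
move=> e0; have e1 : 0 < e / 28 by lra.
have [K K1 hK] := lower_341 e1; have [L L0 hL] := DS_lipschitz e1.
have [U U1 hU] := zeta_tw_upper e1.
have K0 := ge1_gt0 K1; have U0 := ge1_gt0 U1.
have [L' [L'1 LL']] : exists L', 1 <= L' /\ L <= L'.
 by exists (L + 1); move: L0; clear; lra.
have L'0 := ge1_gt0 L'1.
have [A AE] : exists A, A = 2 * 2 `^ (e / 28) * (U * 2 `^ (e / 28) * (4 * L') ^+ 2).
 by eexists.
have A1 : 1 <= A.
 rewrite AE mulr_ege1 // mulr_ege1 ?one_le_powR ?ler1n ?(ltW e1) //.
  by rewrite mulr_ege1 // one_le_powR ?ler1n ?(ltW e1).
 by rewrite exprn_ege1; move: L'1; clear; lra.
have A0 := ge1_gt0 A1.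
exists (2 + K * A ^+ 7); first by rewrite ler_wpDr ?ler1n // mulr_ge0 ?exprn_ge0 ?(ltW K0) ?(ltW A0).
move=> f q t s l s12 q1 cf f01 bf /andP[l0 l1] hl.
have q0 := ge1_gt0 q1.
have T1 : 1 <= 1 + `|t| by rewrite lerDl.
have T0 := ge1_gt0 T1.
have [X XE] := ex_named (q * (1 + `|t|)).
have X1 : 1 <= X by rewrite XE mulr_ege1.
have X0 := ge1_gt0 X1.
have Xe1 : 1 <= X `^ (e / 28) by rewrite one_le_powR ?(ltW e1).
have sq : sqb f q by exact: sqb_bounded.
have hdf : hdb f 1 by case: cf => _ _ h; apply: hdb_bounded => n _.
have sm s' : 1 < s' -> smb s' f by move=> s'1; exact: smb_cmul.
have [s1 s2] := andP s12.
have qX : q <= X by rewrite XE ler_peMr // ltW.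
have TX : 1 + `|t| <= X by rewrite XE ler_peMl // ltW.
have [x xE] := ex_named (X `^ (e / 28)).
rewrite -xE in Xe1; have x0 := ge1_gt0 Xe1.
have qe : q `^ (e / 28) <= x by rewrite xE; apply: ler_wpowR; rewrite ?(ltW e1) ?(ltW q0).
have Te : (1 + `|t|) `^ (e / 28) <= x.
 by rewrite xE; apply: ler_wpowR; rewrite ?(ltW e1).
have Xe : X `^ e = x ^+ 28.
 rewrite xE -powR_mulrn ?powR_ge0 // -powRrM; congr powR; by field.
rewrite -XE Xe.
(* For [|t| <= r ^ 2] the Lipschitz error is at most [l / 2]. Beyond that, [1 / |t| <= r ^- 2]
   enters the bound [V] for the series of [n ^ (-2it)]; the seventh power of [V], with [r]
   proportional to [l / x], is the origin of [l ^ 14], and together with [Y] of [x ^ 28]. *)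
have [r rE] := ex_named (l / (4 * L' * x)).
have r0 : 0 < r by rewrite rE divr_gt0 // !mulr_gt0.
have r1 : r <= 1.
 rewrite rE ler_pdivrMr ?mulr_gt0 // mul1r (le_trans l1) // !mulr_ege1 //.
 by clear; lra.
have lX : 2 / l <= (2 + K * A ^+ 7) * x ^+ 28 / l ^+ 14.
 rewrite ler_pdivlMr ?exprn_gt0 //.
 have -> : 2 / l * l ^+ 14 = 2 * l ^+ 13 by rewrite exprSr; field; rewrite lt0r_neq0.
 apply: ler_pM; rewrite ?exprn_ge0 ?(ltW l0) //.
  by rewrite lerDl mulr_ge0 ?exprn_ge0 ?(ltW K0) ?(ltW A0).
 apply: le_trans (exprn_ile1 _ (ltW l0) l1) _; exact: exprn_ege1.
have X0' : 0 < (2 + K * A ^+ 7) * x ^+ 28 / l ^+ 14.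
 by apply: lt_le_trans lX; rewrite divr_gt0.
have [ht|ht] := leP `|t| (r ^+ 2).
 apply: le_trans (_ : l / 2 <= _).
  by rewrite -[l / 2]invf_div lef_pV2 ?posrE // divr_gt0.
 have [->|t0] := eqVneq t 0.
  rewrite (_ : DS (tw 0 f) s = DS f s); last by apply: eq_DS => n _; rewrite /tw nit0 mulr1.
  by apply: le_trans (hl s s12); move: l0; clear; lra.
 have tp : 0 < `|t| by rewrite normr_gt0.
 have t1 : `|t| <= 1 by apply: le_trans ht _; rewrite exprn_ile1 // ltW.
 have kp : 0 < `|s - s| + `|t| <= 1 by rewrite subrr normr0 add0r tp.
 have := hL f q 1 s s t s12 s12 kp q1 sq hdf (sm s s1) (sm s s1).
 rewrite subrr normr0 add0r => hd.
 have hr : `|t| `^ (7 / 8) <= r.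
  apply: le_trans (_ : `|t| `^ (1 / 2) <= _).
   by apply: ger_powR; rewrite ?tp //; clear; lra.
  have -> : r = (r ^+ 2) `^ (1 / 2).
   rewrite -powR_mulrn ?(ltW r0) // -powRrM.
   by rewrite (_ : 2%:R * (1 / 2) = 1) ?powRr1 ?(ltW r0) //; field.
  by apply: ler_wpowR.
 have hq : L * (1 + 1) * q `^ (e / 28) * `|t| `^ (7 / 8) <= l / 2.
  apply: le_trans (_ : L' * 2 * x * r <= _).
   apply: ler_pM; rewrite ?mulr_ge0 ?powR_ge0 ?(ltW L0) //.
   apply: ler_pM; rewrite ?mulr_ge0 ?powR_ge0 ?(ltW L0) //.
   by rewrite ler_wpM2r.
  by rewrite rE le_eqVlt; apply/orP; left; apply/eqP; field; rewrite !lt0r_neq0.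
 have := ler_normcB (DS f s) (DS (tw t f) s).
 move: (hl s s12) (le_trans hd hq).
 by clear; set a := normc _; set b := normc _; set d := normc _; lra.
have r20 : 0 < r ^+ 2 by rewrite exprn_gt0.
have tp : 0 < `|t| by apply: lt_trans ht.
have t0 : t != 0 by rewrite -normr_gt0.
have t20 : 2 * t != 0 by rewrite mulf_neq0.
have [Y YE] := ex_named (q * (1 + 2 * `|t|)).
have Y1 : 1 <= Y by rewrite YE mulr_ege1 // lerDl mulr_ge0.
have tq : 0 <= q * `|t| by rewrite mulr_ge0 // ltW.
have YX : Y <= 2 * X by rewrite YE XE; move: tq q0; clear; nra.
have Ye : Y `^ (e / 28) <= 2 `^ (e / 28) * x.
 by rewrite xE; apply: powR_mul_bound; rewrite ?(ltW e1) ?(ltW X0) ?(le_trans ler01 Y1).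
have [V VE] := ex_named (U * (2 `^ (e / 28) * x) / r ^+ 2).
have V1 : 1 <= V.
 rewrite VE ler_pdivlMr // mul1r; apply: le_trans (exprn_ile1 2 (ltW r0) r1) _.
 by rewrite mulr_ege1 // mulr_ege1 // one_le_powR ?ler1n ?(ltW e1).
have hp p : prime p -> tw t f p = 0 \/ normc (tw t f p) = 1 /\
  tw (2 * t) one p = tw t f p ^+ 2.
 move=> /f01[h|h]; [left; by rewrite /tw h mul0r|right].
 rewrite -tw_pow2 normc_tw /tw h; split=> //.
 have /eqP : normc (f p) ^+ 2 = 1 by rewrite -normcX h normc1.
 by rewrite sqrf_eq1 => /orP[/eqP //|/eqP h1]; have := normc_ge0 (f p); rewrite h1; lra.
have sY : sqb (tw t f) Y by rewrite YE; exact: sqb_tw.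
have a01 : 0 < (1 : R) <= 1 by rewrite ltr01 lexx.
have hV s' : 1 < s' <= 2 -> normc (DS (tw (2 * t) one) s') <= V.
 move=> s'12; apply: le_trans (hU (2 * t) s' t20 s'12) _.
 rewrite VE normrM ger0_norm //; apply: ler_pM.
 - by rewrite mulr_ge0 // ltW.
 - by [].
 - rewrite ler_wpM2l ?(ltW U0) // xE; apply: powR_mul_bound; rewrite ?(ltW e1) ?(ltW X0) //.
  by move: TX; clear; lra.
 rewrite lef_pV2 ?posrE ?lt_min ?ltr01 ?mulr_gt0 //.
 rewrite le_min exprn_ile1 ?(ltW r0) //=; by move: ht tp; clear; set u := `|t|; lra.
have := hK (tw t f) (tw (2 * t) one) (tw t f) Y V 1 1 s s12 Y1 V1 a01
 (cmul_tw t cf) (cmul_tw (2 * t) (cmul_one R)) hp sY (hdb_tw t hdf) _ hV _.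
move=> h; apply: le_trans (h _ _) => {h}; last first.
- by move=> s' _; rewrite mul1r.
- by move=> s' s'1; apply: smb_tw; exact: smb_cmul.
have Y0 := ge1_gt0 Y1; have V0 := ge1_gt0 V1.
have P0 : 0 < K * ((1 + 1) * Y `^ (e / 28) * V / 1) ^+ 7.
 by rewrite mulr_gt0 // exprn_gt0 // divr1 mulr_gt0 // mulr_gt0 // powR_gt0.
rewrite lef_pV2 //.
apply: le_trans (_ : K * A ^+ 7 * x ^+ 28 / l ^+ 14 <= _); last first.
 by rewrite ler_wpM2r ?invr_ge0 ?exprn_ge0 ?(ltW l0) // ler_wpM2r ?exprn_ge0 ?(ltW x0) // lerDr.
have -> : K * A ^+ 7 * x ^+ 28 / l ^+ 14 = K * (A * x ^+ 4 / l ^+ 2) ^+ 7.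
 by rewrite expr_div_n exprMn -!exprM !mulrA.
rewrite ler_wpM2l ?(ltW K0) // divr1.
have B0 : 0 <= (1 + 1) * Y `^ (e / 28) * V.
 by apply: mulr_ge0; [rewrite mulr_ge0 ?powR_ge0|exact: ltW].
suff hB : (1 + 1) * Y `^ (e / 28) * V <= A * x ^+ 4 / l ^+ 2.
 by rewrite lerXn2r ?nnegrE // (le_trans B0).
have -> : A * x ^+ 4 / l ^+ 2 = (1 + 1) * (2 `^ (e / 28) * x) * V.
 by rewrite AE VE rE; field; rewrite !lt0r_neq0.
rewrite ler_wpM2r ?(ltW V0) // ler_wpM2l //.
Qed.

End CharacterLowerBounds.

(** * The hyperbola method; the value of zeta to the left of 1 *)

Section Hyperbola.
Variable R : realType.
Local Notation lnn := (@lnn R).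
Local Notation npw := (@npw R).

Definition rconv (a b : nat -> R) (n : nat) : R :=
 \sum_(1 <= d < n.+1 | (d %| n)%N) a d * b (n %/ d)%N.

Lemma sum_filter_leq (F : nat -> R) (P : pred nat) m n k : (k <= n)%N ->
 (forall i, (m <= i < n)%N -> P i = (i < k)%N) ->
 \sum_(m <= i < n | P i) F i = \sum_(m <= i < k) F i.
Proof.
move=> kn h; have [mk|mk] := leqP m k; last first.
 rewrite [RHS]big_geq ?(ltnW mk) // big_nat_cond big1 // => i /andP[hi].
 by rewrite h; move: hi mk; lia.
rewrite (big_cat_nat _ (n := k)) //= [X in _ + X]big_nat_cond [X in _ + X]big1 ?addr0; last first.
 move=> i /andP[/andP[ki ni]]; have -> : P i = (i < k)%N by rewrite h // (leq_trans mk ki).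
 by rewrite ltnNge ki.
rewrite big_nat_cond [RHS]big_nat_cond; apply: eq_bigl => i.
case: (boolP (m <= i < k)%N) => //= /andP[mi ik]; rewrite h // mi /=.
exact: leq_trans kn.
Qed.

(** Pairs with [d <= u] are summed over [m] first. The remaining pairs have [m <= y / (u + 1)] and
    are summed over [d] first. *)
Lemma hyperbola (a b : nat -> R) u y : (u <= y)%N ->
 \sum_(1 <= n < y.+1) rconv a b n =
 \sum_(1 <= d < u.+1) a d * \sum_(1 <= m < (y %/ d).+1) b m +
 \sum_(1 <= m < (y %/ u.+1).+1) b m * \sum_(u.+1 <= d < (y %/ m).+1) a d.
Proof.
move=> uy; rewrite (sum_divisors_swap (fun d m => a d * b m)).
have inner d : (0 < d)%N -> \sum_(1 <= m < y.+1 | (d * m < y.+1)%N) a d * b m =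
  a d * \sum_(1 <= m < (y %/ d).+1) b m.
 move=> d0; rewrite mulr_sumr; apply: sum_filter_leq; first by rewrite ltnS leq_div.
 by move=> i _; rewrite !ltnS leq_divRL // mulnC.
rewrite (big_cat_nat _ (n := u.+1)) //=; congr (_ + _).
 by apply: eq_big_nat => d /andP[d0 _]; rewrite inner.
rewrite (exchange_big_dep_nat xpredT) //=.
rewrite (big_cat_nat _ (n := (y %/ u.+1).+1)) //=; last by rewrite ltnS leq_div.
rewrite [X in _ + X]big_nat_cond [X in _ + X]big1 ?addr0; last first.
 move=> m /andP[/andP[m1 m2] _]; rewrite big_nat_cond big1 // => d /andP[/andP[d1 d2]].
 move: m1; rewrite ltn_divLR // => m1 h.
 have : (u.+1 * m <= d * m)%N by rewrite leq_mul2r d1 orbT.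
 by move: m1 h; rewrite mulnC ltnS; lia.
apply: eq_big_nat => m /andP[m0 _]; rewrite mulr_sumr.
rewrite -(sum_filter_leq (fun d => b m * a d) (P := fun d => (d * m < y.+1)%N) (n := y.+1)).
- by apply: eq_bigr => d _; rewrite mulrC.
- by rewrite ltnS leq_div.
- by move=> i _; rewrite !ltnS leq_divRL.
Qed.

Lemma abel_sumR (c g : nat -> R) N M : (N <= M)%N ->
 \sum_(N.+1 <= n < M.+1) c n * g n =
 (\sum_(1 <= n < M.+1) c n) * g M.+1 - (\sum_(1 <= n < N.+1) c n) * g N.+1 +
 \sum_(N.+1 <= n < M.+1) (\sum_(1 <= m < n.+1) c m) * (g n - g n.+1).
Proof.
move=> NM; have := abel_sum_range (fun n => (c n)%:C%C) (fun n => (g n)%:C%C) NM.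
have e (F : nat -> R) i j : \sum_(i <= n < j) (F n)%:C%C = (\sum_(i <= n < j) F n)%:C%C.
 by rewrite rmorph_sum.
under eq_bigr do rewrite -rmorphM.
under [X in _ = _ + X]eq_bigr do rewrite e -rmorphB -rmorphM.
by rewrite !e -!rmorphM -rmorphB -rmorphD => /complexI.
Qed.

Definition rbsum (c : nat -> R) (q : R) := forall M, `|\sum_(1 <= n < M.+1) c n| <= q.

Definition rsqb (c : nat -> R) (Y : R) :=
 forall M : nat, `|\sum_(1 <= n < M.+1) c n| <= Y * Num.sqrt M%:R.

Lemma rbsum_ge0 c q : rbsum c q -> 0 <= q.
Proof. by move=> /(_ 0%N); rewrite big_geq // normr0. Qed.

Lemma rbsum_tail c q s N M : rbsum c q -> 0 <= s -> (0 < N)%N ->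
 `|\sum_(N.+1 <= n < M.+1) c n * npw s n| <= 2 * q * npw s N.
Proof.
move=> hq s0 N0; have q0 := rbsum_ge0 hq.
have [NM|NM] := leqP N M; last first.
 by rewrite big_geq ?normr0 ?mulr_ge0 ?npw_ge0 // ltnW.
rewrite abel_sumR //.
have h3 : `|\sum_(N.+1 <= n < M.+1) (\sum_(1 <= m < n.+1) c m) * (npw s n - npw s n.+1)|
  <= q * (npw s N.+1 - npw s M.+1).
 apply: le_trans (ler_norm_sum _ _ _) _.
 apply: le_trans (_ : \sum_(N.+1 <= n < M.+1) q * (npw s n - npw s n.+1) <= _).
  apply: ler_sum_nat => n /andP[Nn _]; rewrite normrM.
  have d0 : 0 <= npw s n - npw s n.+1.
   by rewrite subr_ge0 npw_decr // (leq_trans _ Nn).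
  by rewrite (ger0_norm d0) ler_wpM2r.
 rewrite -mulr_sumr; under eq_bigr do rewrite -opprB.
 by rewrite sumrN telescope_sumr // opprB.
have d1 : npw s N.+1 <= npw s N by exact: npw_decr.
have h1 : `|(\sum_(1 <= n < M.+1) c n) * npw s M.+1| <= q * npw s M.+1.
 by rewrite normrM (ger0_norm (npw_ge0 _ _)) ler_wpM2r ?npw_ge0.
have h2 : `|(\sum_(1 <= n < N.+1) c n) * npw s N.+1| <= q * npw s N.+1.
 by rewrite normrM (ger0_norm (npw_ge0 _ _)) ler_wpM2r ?npw_ge0.
apply: le_trans (ler_normD _ _) _.
have h4 := ler_normB ((\sum_(1 <= n < M.+1) c n) * npw s M.+1) ((\sum_(1 <= n < N.+1) c n) * npw s N.+1).
have h5 := ler_wpM2l q0 d1.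
by lra.
Qed.

Lemma rsqb_tail c Y s N M : rsqb c Y -> 3 / 4 <= s <= 1 -> (0 < N)%N ->
 `|\sum_(N.+1 <= n < M.+1) c n * npw s n| <= 6 * Y * npw (1 / 4) N.
Proof.
move=> hY /andP[s1 s2] N0.
have Y0 : 0 <= Y by have := hY 1%N; rewrite sqrtr1 mulr1; apply: le_trans.
have [NM|NM] := leqP N M; last first.
 by rewrite big_geq ?normr0 ?mulr_ge0 ?npw_ge0 // ltnW.
have := @abel_tail_bound R (fun n => (c n)%:C%C) (fun n => (npw s n)%:C%C) Y 1 N M.
under eq_bigr do rewrite -rmorphM.
rewrite -rmorph_sum normcR mulr1; apply.
- by move=> K; rewrite -rmorph_sum normcR; exact: hY.
- by [].
- by move=> n n0; rewrite normcR_ge0 ?npw_ge0 // mul1r ler_npw.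
- move=> n n0; rewrite -rmorphB normcR mul1r ger0_norm; last first.
  by rewrite subr_ge0 npw_decr //; move: s1; clear; lra.
 have -> : npw s n.+1 = npw s n * expR (- s * (lnn n.+1 - lnn n)).
  by rewrite !npwE // -expRD; congr expR; ring.
 rewrite -[X in X - _]mulr1 -mulrBr.
 have e1 : 1 - expR (- s * (lnn n.+1 - lnn n)) <= npw 1 n.
  have := expR_ge1Dx (- s * (lnn n.+1 - lnn n)).
  have := @lnnS_sub R n n0; rewrite npw_1.
  have : 0 <= lnn n.+1 - lnn n :> R by rewrite subr_ge0 ler_lnn.
  by move: s1 s2; clear; set u := lnn n.+1 - lnn n; set v := _^-1; nra.
 apply: le_trans (ler_wpM2l (npw_ge0 _ _) e1) _; rewrite -npwD //.
 by apply: ler_npw => //; move: s1; clear; lra.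
- by rewrite N0.
Qed.

(** [l] is the supremum of the left ends of the pairwise intersecting intervals
    [[u N - tau N, u N + tau N]]; the limit thus comes with its error term. *)
Lemma cauchy_limit (u tau : nat -> R) :
 (forall N M, (0 < N <= M)%N -> `|u M - u N| <= tau N) ->
 exists l, forall N, (0 < N)%N -> `|u N - l| <= tau N.
Proof.
move=> h; pose E := [set u N - tau N | N in [set N | (0 < N)%N]]%classic.
have ub M : (0 < M)%N -> ubound E (u M + tau M).
 move=> M0 _ [N N0 <-]; have [NM|NM] := leqP N M.
  have t0 : 0 <= tau M by have := h M M; rewrite M0 leqnn subrr normr0; apply.
  have := h N M; rewrite N0 NM => /(_ isT); rewrite ler_norml => /andP[h1 h2].
  by lra.
 have t0 : 0 <= tau N.
  by have := h N N; rewrite (N0 : (0 < N)%N) leqnn subrr normr0; apply.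
 have := h M N; rewrite M0 (ltnW NM) => /(_ isT); rewrite ler_norml => /andP[h1 h2].
 by lra.
have hsE : has_sup E.
 by split; [exists (u 1%N - tau 1%N), 1%N|exists (u 1%N + tau 1%N); exact: ub].
exists (sup E) => N N0; rewrite ler_norml; apply/andP; split.
 have := ge_sup hsE.1 (ub N N0); by clear; lra.
have := sup_ubound hsE.2 (ex_intro2 _ _ N N0 (erefl _)).
by lra.
Qed.

(** The inequality of Young for [y ^ d * 1] with weights [d] and [1 - d]. *)
Lemma bernoulli_powR (d y : R) : 0 < d < 1 -> 0 <= y -> y `^ d <= 1 + d * (y - 1).
Proof.
move=> /andP[d0 d1] y0.
have d10 : 0 < 1 - d by lra.
have di : 0 < d^-1 by rewrite invr_gt0.
have di1 : 0 < (1 - d)^-1 by rewrite invr_gt0.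
have := conjugate_powR (powR_ge0 y d) (@ler01 R) di di1.
rewrite !invrK addrC subrK => /(_ erefl).
by rewrite mulr1 -powRrM mulfV ?lt0r_neq0 // powRr1 // powR1 mul1r; lra.
Qed.

(** Comparison of [n ^ (d - 1)] with the increment of its primitive [n ^ d / d]; both sides are the
    Bernoulli inequality, once for [n / (n + 1)] and once for [(n + 1) / n]. *)
Lemma npw_neg_step (d : R) n : 0 < d < 1 -> (0 < n)%N ->
 npw (1 - d) n.+1 <= (npw (- d) n.+1 - npw (- d) n) / d <= npw (1 - d) n.
Proof.
move=> d01 n0; have [d0 d1] := andP d01.
have n0' : 0 < (n%:R : R) by rewrite ltr0n.
have n1' : 0 < (n.+1%:R : R) by [].
rewrite ler_pdivlMr // ler_pdivrMr //; apply/andP; split.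
 have := bernoulli_powR d01 (divr_ge0 (ltW n0') (ltW n1')).
 have -> : n%:R / n.+1%:R - 1 = - n.+1%:R^-1 :> R.
  by rewrite -[n.+1%:R]nat1r; field; rewrite nat1r lt0r_neq0.
 rewrite powRM // -(powR_inv1 (ltW n1')) -powRrM mulN1r.
 have e : npw (1 - d) n.+1 = npw (- d) n.+1 * n.+1%:R^-1 by rewrite addrC npwD // npw_1.
 rewrite (powR_inv1 (ltW n1')) e /npw opprK.
 have p0 : 0 < n.+1%:R `^ d by [].
 have e2 : n.+1%:R `^ (- d) = (n.+1%:R `^ d)^-1 by rewrite powRN.
 rewrite e2; set a := n%:R `^ d; set b := n.+1%:R `^ d in p0 *; set c := n.+1%:R^-1.
 rewrite ler_pdivrMr // => h.
 by lra.
have := bernoulli_powR d01 (divr_ge0 (ltW n1') (ltW n0')).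
have -> : n.+1%:R / n%:R - 1 = n%:R^-1 :> R.
 by rewrite -[n.+1%:R]nat1r; field; rewrite lt0r_neq0.
rewrite powRM // -(powR_inv1 (ltW n0')) -powRrM mulN1r.
have e : npw (1 - d) n = npw (- d) n * n%:R^-1 by rewrite addrC npwD // npw_1.
rewrite (powR_inv1 (ltW n0')) e /npw opprK.
have p0 : 0 < n%:R `^ d by exact: powR_gt0.
rewrite powRN; set a := n.+1%:R `^ d; set b := n%:R `^ d in p0 *; set c := n%:R^-1.
by rewrite ler_pdivrMr // => h; move: h; clear; lra.
Qed.

(** [z] is [zeta (1 - d)], obtained without continuation as the limit of a decreasing sequence that
    starts at [1 - 1 / d <= 0]. Its sign is decisive in Siegel's argument. *)
Lemma zeta_sum_limit (d : R) : 0 < d < 1 -> exists z, - d^-1 <= z <= 0 /\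
 forall N, (0 < N)%N ->
 `|\sum_(1 <= n < N.+1) npw (1 - d) n - npw (- d) N / d - z| <= npw (1 - d) N.
Proof.
move=> d01; have [d0 d1] := andP d01.
pose u N := \sum_(1 <= n < N.+1) npw (1 - d) n - npw (- d) N / d.
have step n : (0 < n)%N -> npw (1 - d) n.+1 - npw (1 - d) n <= u n.+1 - u n <= 0.
 move=> n0; have /andP[h1 h2] := npw_neg_step d01 n0.
 rewrite /u big_nat_recr //=; set S := \sum_(1 <= i < n.+1) _.
 rewrite mulrBl in h1 h2.
 by lra.
have dif N k : (0 < N)%N -> npw (1 - d) (N + k) - npw (1 - d) N <= u (N + k)%N - u N <= 0.
 move=> N0; elim: k => [|k /andP[h1 h2]]; first by rewrite addn0 !subrr lexx.
 have Nk : (0 < N + k)%N by rewrite addn_gt0 N0.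
 have /andP[g1 g2] := step _ Nk; rewrite addnS.
 by lra.
have [|z hz] := @cauchy_limit u (npw (1 - d)).
 move=> N M /andP[N0 NM]; have := dif N (M - N)%N N0; rewrite subnKC // => /andP[h1 h2].
 rewrite ler_norml; apply/andP; split; last first.
  by apply: le_trans h2 _; exact: npw_ge0.
 by apply: le_trans h1; have := npw_ge0 (1 - d) M; clear; lra.
exists z; split=> //.
have u1 : u 1%N = 1 - d^-1 by rewrite /u big_nat1 !npw1 mul1r.
have := hz 1%N isT; rewrite npw1 u1 ler_norml => /andP[h1 h2].
apply/andP; split; first by lra.
rewrite leNgt; apply/negP => z0.
have [y0 [y00 hy]] : exists N, (0 < N)%N /\ npw (1 - d) N < z.
 have dd : 0 < 1 - d by lra.
 exists (Num.truncn (z^-1 `^ (1 - d)^-1)).+1; split=> //.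
 rewrite /npw powRN -[ltRHS]invrK ltf_pV2 ?posrE ?invr_gt0 //.
 have {1}-> : z^-1 = (z^-1 `^ (1 - d)^-1) `^ (1 - d).
  by rewrite -powRrM mulVf ?lt0r_neq0 // powRr1 // invr_ge0 ltW.
 rewrite gt0_ltr_powR ?nnegrE ?powR_ge0 //; exact: truncn_gtS.
have := hz _ y00; rewrite ler_norml => /andP[h3 h4].
have := dif 1%N y0.-1 isT; rewrite add1n prednK // => /andP[_ h5].
have : 1 <= d^-1 by rewrite invf_ge1 // ltW.
rewrite u1 in h5; by move: h3 h5 hy; clear; lra.
Qed.

End Hyperbola.

(** * Multiplicative functions and real characters *)

Section Multiplicative.
Variable R : realType.
Local Notation npw := (@npw R).

Definition mfun (a : nat -> R) := a 1%N = 1 /\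
 forall m n, (0 < m)%N -> (0 < n)%N -> coprime m n -> a (m * n)%N = a m * a n.

Lemma big_dvd_divisors (F : nat -> R) n : (0 < n)%N ->
 \sum_(1 <= d < n.+1 | (d %| n)%N) F d = \sum_(d <- divisors n) F d.
Proof.
move=> n0; rewrite -big_filter; apply: perm_big; apply: uniq_perm.
- by rewrite filter_uniq // iota_uniq.
- exact: divisors_uniq.
move=> d; rewrite mem_filter mem_index_iota -dvdn_divisors // ltnS.
by case dn: (d %| n)%N => //=; rewrite (dvdn_gt0 n0 dn) dvdn_leq.
Qed.

Lemma divisors_coprime_perm m n : (0 < m)%N -> (0 < n)%N -> coprime m n ->
 perm_eq (divisors (m * n)) [seq (d * e)%N | d <- divisors m, e <- divisors n].
Proof.
move=> m0 n0 cmn; apply: uniq_perm; first exact: divisors_uniq.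
 apply: allpairs_uniq; rewrite ?divisors_uniq // => -[d e] [d' e'] /=.
 move=> /allpairsPdep[x [y [hx hy [-> ->]]]] /allpairsPdep[x' [y' [hx' hy' [-> ->]]]] E.
 rewrite -!dvdn_divisors // in hx hy hx' hy'.
 have gm u v : (u %| m)%N -> (v %| n)%N -> gcdn (u * v) m = u.
  move=> um vn; rewrite -{1}(divnK um) [(_ %/ u * u)%N]mulnC -muln_gcdr.
  have : coprime v (m %/ u).
   by apply: coprime_dvdl vn _; rewrite coprime_sym; apply: coprime_dvdl cmn; rewrite dvdn_div.
  by rewrite /coprime => /eqP ->; rewrite muln1.
 have ex : x = x' by rewrite -(gm x y) // E gm.
 rewrite ex in E hx *; congr (_, _).
 have x0 : (0 < x')%N by apply: dvdn_gt0 hx'.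
 by move/eqP: E; rewrite eqn_pmul2l // => /eqP.
move=> d; rewrite -dvdn_divisors ?muln_gt0 ?m0 //.
apply/idP/allpairsPdep => [dmn|[x [y [hx hy ->]]]]; last first.
 by rewrite -!dvdn_divisors // in hx hy; exact: dvdn_mul.
exists (gcdn d m), (gcdn d n); rewrite -!dvdn_divisors ?dvdn_gcdr //; split=> //.
have g0 : (0 < gcdn d m)%N by rewrite gcdn_gt0 m0 orbT.
apply/eqP; rewrite eqn_dvd; apply/andP; split; last first.
 rewrite Gauss_dvd ?dvdn_gcdl //.
 by apply: coprime_dvdl (dvdn_gcdr d m) _; apply: coprime_dvdr (dvdn_gcdr d n) cmn.
rewrite -{1}(divnK (dvdn_gcdl d m)) mulnC dvdn_pmul2l // dvdn_gcd.
rewrite dvdn_div ?dvdn_gcdl //=.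
have c1 : coprime (d %/ gcdn d m) (m %/ gcdn d m).
 rewrite /coprime -(eqn_pmul2l g0) muln_gcdr muln1 ![(gcdn d m * _)%N]mulnC.
 by rewrite !divnK ?dvdn_gcdl ?dvdn_gcdr.
rewrite -(Gauss_dvdr _ c1) -(dvdn_pmul2l g0) mulnA ![(gcdn d m * (_ %/ _))%N]mulnC.
by rewrite !divnK ?dvdn_gcdl ?dvdn_gcdr.
Qed.

Lemma mfun_rconv a b : mfun a -> mfun b -> mfun (rconv a b).
Proof.
move=> [a1 aM] [b1 bM]; split.
 by rewrite /rconv big_mkcond big_nat1 dvdn1 eqxx divn1 a1 b1 mulr1.
move=> m n m0 n0 cmn; rewrite /rconv !big_dvd_divisors ?muln_gt0 ?m0 //.
rewrite (perm_big _ (divisors_coprime_perm m0 n0 cmn)) big_allpairs_dep /=.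
rewrite mulr_suml; apply: eq_big_seq => d; rewrite -dvdn_divisors // => dm.
rewrite mulr_sumr; apply: eq_big_seq => e; rewrite -dvdn_divisors // => en.
have d0 := dvdn_gt0 m0 dm; have e0 := dvdn_gt0 n0 en.
have cde : coprime d e by apply: coprime_dvdl dm _; apply: coprime_dvdr en cmn.
have cde' : coprime (m %/ d) (n %/ e).
 by apply: coprime_dvdl (dvdn_div dm) _; apply: coprime_dvdr (dvdn_div en) cmn.
rewrite aM //.
have -> : (m * n %/ (d * e) = m %/ d * (n %/ e))%N.
 by rewrite -{1}(divnK dm) -{1}(divnK en) mulnACA mulnK // muln_gt0 d0.
have m0' : (0 < m %/ d)%N by rewrite divn_gt0 dvdn_leq.
have n0' : (0 < n %/ e)%N by rewrite divn_gt0 dvdn_leq.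
by rewrite (bM _ _ m0' n0' cde') mulrACA.
Qed.

(** Strong induction: the full power of the least prime divisor is split off, and the cofactor is
    smaller. *)
Lemma mfun_ind (P : R -> Prop) (a : nat -> R) : mfun a -> P 1 ->
 (forall x y, P x -> P y -> P (x * y)) ->
 (forall p k, prime p -> P (a (p ^ k)%N)) -> forall n, (0 < n)%N -> P (a n).
Proof.
move=> [a1 aM] P1 PM hp n; elim/ltn_ind: n => n IH n0.
have [n1|n1] := leqP n 1.
 by have -> : n = 1%N; [lia|rewrite a1].
have pp := pdiv_prime n1; set p := pdiv n in pp.
have e := partnC p n0; rewrite p_part in e.
rewrite -e aM ?part_gt0 ?expn_gt0 ?prime_gt0 //; last first.
 by rewrite -p_part; exact: coprime_partC.
apply: PM; first exact: hp.
apply: IH; last exact: part_gt0.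
have l0 : (0 < logn p n)%N by rewrite logn_gt0 mem_primes pp n0 pdiv_dvd.
rewrite -{2}e ltn_Pmull //.
by rewrite -(exp1n (logn p n)) ltn_exp2r // prime_gt1.
Qed.

Lemma rconv_pfactor (a b : nat -> R) p k : prime p ->
 rconv a b (p ^ k)%N = \sum_(j < k.+1) a (p ^ j)%N * b (p ^ (k - j))%N.
Proof.
move=> pp; have p0 := prime_gt0 pp; have p1 := prime_gt1 pp.
rewrite /rconv big_dvd_divisors ?expn_gt0 ?p0 //.
rewrite (perm_big [seq (p ^ j)%N | j <- iota 0 k.+1]); last first.
 apply: uniq_perm; first exact: divisors_uniq.
  by rewrite map_inj_uniq ?iota_uniq // => i j /eqP; rewrite eqn_exp2l // => /eqP.
 move=> d; rewrite -dvdn_divisors ?expn_gt0 ?p0 //.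
 apply/idP/mapP => [/(dvdn_pfactor _ _ pp)[j jk ->]|[j]].
  by exists j; rewrite ?mem_iota.
 by rewrite mem_iota => /andP[_ jk] ->; rewrite dvdn_exp2l.
rewrite big_map -(big_mkord xpredT (fun j => a (p ^ j)%N * b (p ^ (k - j))%N)) /index_iota subn0.
apply: eq_big_seq => j; rewrite mem_iota => /andP[_ jk].
by rewrite -expnB.
Qed.

Definition rchar (g : nat -> R) := [/\ g 1%N = 1,
 forall m n, (0 < m)%N -> (0 < n)%N -> g (m * n)%N = g m * g n
 & forall n, [\/ g n = 0, g n = 1 | g n = -1]].

Lemma rchar_mfun g : rchar g -> mfun g.
Proof. by case=> g1 gM _; split=> // m n m0 n0 _; exact: gM. Qed.

Lemma rchar_one : rchar (fun=> 1).
Proof. by split=> // *; [rewrite mulr1|apply: Or32]. Qed.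

Lemma rchar_mul g h : rchar g -> rchar h -> rchar (fun n => g n * h n).
Proof.
case=> g1 gM gv [h1 hM hv]; split; first by rewrite g1 h1 mulr1.
 by move=> m n m0 n0; rewrite gM // hM // mulrACA.
move=> n; case: (gv n) (hv n) => -> [] ->; rewrite ?mul0r ?mulr0 ?mul1r ?mulN1r ?opprK;
 by [exact: Or31|exact: Or32|exact: Or33].
Qed.

Lemma rcharX g p j : rchar g -> prime p -> g (p ^ j)%N = g p ^+ j.
Proof.
case=> g1 gM _ pp; elim: j => [|j IH]; first by [].
by rewrite expnS gM ?expn_gt0 ?prime_gt0 // IH exprS.
Qed.

Lemma rchar_norm g n : rchar g -> `|g n| <= 1.
Proof. by case=> _ _ /(_ n)[] ->; rewrite ?normr0 ?normrN ?normr1. Qed.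

(** The local factor [1 / (1 - c X)] truncated after [X ^ k]. A convolution at [p ^ j] becomes a
    coefficient of a product of such polynomials; only coefficients up to [k] are meaningful, whence
    the range in [nnp]. *)
Definition geo (k : nat) (c : R) : {poly R} := \poly_(j < k.+1) c ^+ j.

Definition nnp (k : nat) (p : {poly R}) := forall i, (i <= k)%N -> 0 <= p`_i.

Lemma nnpM k p q : nnp k p -> nnp k q -> nnp k (p * q).
Proof.
move=> hp hq i ik; rewrite coefM sumr_ge0 // => j _; apply: mulr_ge0.
 by apply: hp; rewrite (leq_trans _ ik) // -ltnS.
by apply: hq; rewrite (leq_trans (leq_subr _ _)).
Qed.

Lemma rconv_geo g h k p j : rchar g -> rchar h -> prime p -> (j <= k)%N ->
 rconv g h (p ^ j)%N = (geo k (g p) * geo k (h p))`_j.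
Proof.
move=> hg hh pp jk; rewrite rconv_pfactor // coefM; apply: eq_bigr => i _.
have ik : (i < k.+1)%N by rewrite (leq_trans (ltn_ord i)).
rewrite !rcharX // !coef_poly ik ifT //.
by apply: leq_ltn_trans (leq_subr _ _) _.
Qed.

Lemma sum_sign k : \sum_(j < k.+1) (-1 : R) ^+ j = if odd k then 0 else 1.
Proof.
elim: k => [|k IH]; first by rewrite big_ord1.
by rewrite big_ord_recr IH -signr_odd /=; case: (odd k); rewrite ?add0r ?subrr.
Qed.

Lemma geo_mul1_ge0 k c : [\/ c = 0, c = 1 | c = -1] -> nnp k (geo k c * geo k 1).
Proof.
move=> hc i ik; rewrite coefM.
have -> : \sum_(j < i.+1) (geo k c)`_j * (geo k 1)`_(i - j) = \sum_(j < i.+1) c ^+ j.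
 apply: eq_bigr => j _; rewrite !coef_poly expr1n.
 have ji : (j <= i)%N by rewrite -ltnS.
 by rewrite !ifT ?mulr1 // ltnS ?(leq_trans ji) // (leq_trans (leq_subr _ _)).
case: hc => ->; first by rewrite sumr_ge0 // => j _; exact: exprn_ge0.
 by rewrite sumr_ge0 // => j _; exact: exprn_ge0.
by rewrite sum_sign; case: ifP.
Qed.

Lemma rho_pfactor_ge g p k : rchar g -> prime p -> 0 <= rconv g (fun=> 1) (p ^ k)%N.
Proof.
move=> hg pp; rewrite rconv_pfactor //.
under eq_bigr do rewrite mulr1 rcharX //.
case: hg => _ _ /(_ p)[] ->.
- by rewrite sumr_ge0 // => i _; rewrite exprn_ge0.
- by rewrite sumr_ge0 // => i _; rewrite exprn_ge0.
by rewrite sum_sign; case: ifP.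
Qed.

Lemma rho_ge0 g n : rchar g -> (0 < n)%N -> 0 <= rconv g (fun=> 1) n.
Proof.
move=> hg; apply: (mfun_ind (P := fun x => 0 <= x)) => //.
- by apply: mfun_rconv; apply: rchar_mfun => //; exact: rchar_one.
- by move=> x y; exact: mulr_ge0.
- by move=> p k pp; exact: rho_pfactor_ge.
Qed.

(** At an even power of [p] the value is [1 + c + ... + c ^ (2 k)] with [c = g p], which is at least
    1 for [c = 0], [c = 1] and [c = -1]. *)
Lemma rho_sqr_ge1 g n : rchar g -> (0 < n)%N -> 1 <= rconv g (fun=> 1) (n ^ 2)%N.
Proof.
move=> hg; have [m1 mM] : mfun (rconv g (fun=> 1)).
 by apply: mfun_rconv; apply: rchar_mfun => //; exact: rchar_one.
apply: (mfun_ind (P := fun x => 1 <= x) (a := fun n => rconv g (fun=> 1) (n ^ 2)%N)) => //.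
- split; first by rewrite exp1n.
 by move=> m k m0 k0 c; rewrite expnMn mM ?expn_gt0 ?m0 ?k0 // coprime_pexpl // coprime_pexpr.
- by move=> x y x1 y1; rewrite mulr_ege1.
move=> p k pp; rewrite -expnM rconv_pfactor //.
under eq_bigr do rewrite mulr1 rcharX //.
case: (hg) => _ _ /(_ p)[] ->.
- rewrite big_ord_recl expr0 lerDl sumr_ge0 // => i _; by [].
- rewrite big_ord_recl expr0 lerDl sumr_ge0 // => i _; by [].
by rewrite muln2 sum_sign odd_double.
Qed.

(* In every case one of the three ways of pairing the four local factors
  [1, g, h, gh] has nonnegative coefficients. *)
Lemma four_pfactor_ge0 g h p k : rchar g -> rchar h -> prime p ->
 0 <= rconv (rconv g (fun n => g n * h n)) (rconv h (fun=> 1)) (p ^ k)%N.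
Proof.
move=> hg hh pp; have hgh := rchar_mul hg hh.
rewrite rconv_pfactor //.
have -> : \sum_(j < k.+1) rconv g (fun n => g n * h n) (p ^ j)%N *
   rconv h (fun=> 1) (p ^ (k - j))%N =
  (geo k (g p) * geo k (g p * h p) * (geo k (h p) * geo k 1))`_k.
 rewrite coefM; apply: eq_bigr => j _.
 rewrite (rconv_geo (k := k) hg hgh pp) ?(rconv_geo (k := k) hh rchar_one pp) ?leq_subr //.
 by rewrite -ltnS.
have hv : [\/ h p = 0, h p = 1 | h p = -1] by case: hh.
have h2 := @geo_mul1_ge0 k _ hv.
have g0 : nnp k (geo k 0).
 by move=> i ik; rewrite coef_poly; case: ifP => // _; exact: exprn_ge0.
have hm := @geo_mul1_ge0 k (-1) (Or33 _ _ erefl).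
suff : nnp k (geo k (g p) * geo k (g p * h p) * (geo k (h p) * geo k 1)) by exact.
case: (hg) => _ _ /(_ p)[] ->; rewrite ?mul0r ?mul1r ?mulN1r.
- by apply: nnpM => //; exact: nnpM.
- by rewrite [geo k 1 * _]mulrC; apply: nnpM.
case: hv => ->; rewrite ?oppr0 ?opprK.
- have -> : geo k (-1) * geo k 0 * (geo k 0 * geo k 1) =
  geo k (-1) * geo k 1 * (geo k 0 * geo k 0) by ring.
 by apply: nnpM => //; exact: nnpM.
- have -> : geo k (-1) * geo k (-1) * (geo k 1 * geo k 1) =
  geo k (-1) * geo k 1 * (geo k (-1) * geo k 1) by ring.
 exact: nnpM.
- by apply: nnpM.
Qed.

Lemma four_ge0 g h n : rchar g -> rchar h -> (0 < n)%N ->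
 0 <= rconv (rconv g (fun n => g n * h n)) (rconv h (fun=> 1)) n.
Proof.
move=> hg hh; apply: (mfun_ind (P := fun x => 0 <= x)) => //.
- apply: mfun_rconv; apply: mfun_rconv; apply: rchar_mfun => //.
  exact: rchar_mul.
 exact: rchar_one.
- by move=> x y; exact: mulr_ge0.
- by move=> p k pp; exact: four_pfactor_ge0.
Qed.

Lemma rconv_npw s a b n :
 rconv (fun m => a m * npw s m) (fun m => b m * npw s m) n = rconv a b n * npw s n.
Proof.
rewrite /rconv mulr_suml; apply: eq_bigr => d dn.
by rewrite mulrACA -npwM [(d * _)%N]mulnC divnK.
Qed.

Lemma rconv1 (a b : nat -> R) : rconv a b 1 = a 1%N * b 1%N.
Proof. by rewrite /rconv big_mkcond big_nat1 dvdn1 eqxx divn1. Qed.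

Lemma rconv_norm_le (a b : nat -> R) n : (forall m, `|a m| <= 1) -> (forall m, `|b m| <= 1) ->
 `|rconv a b n| <= n%:R.
Proof.
move=> ha hb; apply: le_trans (ler_norm_sum _ _ _) _.
apply: le_trans (_ : \sum_(1 <= d < n.+1) 1 <= _); last first.
 by rewrite sumr_const_nat subn1.
rewrite big_mkcond; apply: ler_sum => d _; case: ifP => // _.
by rewrite normrM mulr_ile1.
Qed.

End Multiplicative.

(** * The series [L(s, g)] for real [s > 0] *)

Section RealLSeries.
Variable R : realType.
Local Notation npw := (@npw R).

Definition SP (g : nat -> R) (s : R) (N : nat) : R := \sum_(1 <= n < N.+1) g n * npw s n.

Lemma npw_small (s e : R) : 0 < s -> 0 < e ->
 exists2 N0 : nat, (0 < N0)%N & forall N, (N0 <= N)%N -> npw s N <= e.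
Proof.
move=> s0 e0; exists (Num.truncn (e^-1 `^ s^-1)).+1 => // N hN.
apply: le_trans (npw_decr _ hN (ltW s0)) _ => //.
rewrite /npw powRN -[leRHS]invrK lef_pV2 ?posrE ?invr_gt0 //.
have {1}-> : e^-1 = (e^-1 `^ s^-1) `^ s.
 by rewrite -powRrM mulVf ?lt0r_neq0 // powRr1 // invr_ge0 ltW.
by apply: ler_wpowR; rewrite ?powR_ge0 // ltW // truncn_gtS.
Qed.

(** The value is characterised by the rate at which the partial sums approach it. For [s > 0] at
    most one number has this property; 0 is the default. *)
Definition Lr (g : nat -> R) (s : R) : R := xget 0 [set l | exists q : R,
 forall N, (0 < N)%N -> `|SP g s N - l| <= q * npw s N]%classic.

Lemma LrP g q s : rbsum g q -> 0 < s ->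
 forall N, (0 < N)%N -> `|SP g s N - Lr g s| <= 2 * q * npw s N.
Proof.
move=> hq s0; have q0 := rbsum_ge0 hq.
have [|l hl] := @cauchy_limit R (SP g s) (fun N => 2 * q * npw s N).
 move=> N M /andP[N0 NM]; rewrite /SP.
 rewrite (big_cat_nat _ (m := 1) (n := N.+1) (p := M.+1)) //= addrAC subrr add0r.
 by apply: rbsum_tail => //; exact: ltW.
suff -> : Lr g s = l by [].
rewrite /Lr; case: xgetP => [_ -> |/(_ l)[]]; last by exists (2 * q).
set l' := xget _ _ => -[q' hl'].
apply/eqP; rewrite -subr_eq0 -normr_le0; apply/ler_addgt0Pr => e e0; rewrite add0r.
have K0 : 0 < `|q'| + 2 * q + 1 by rewrite ltr_wpDl // addr_ge0 // mulr_ge0.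
have [N N0 hN] := npw_small s0 (divr_gt0 e0 K0).
have := hl N N0; have := hl' N N0; have {hN} := hN N (leqnn _).
rewrite ler_pdivlMr // => h1 h2 h3.
have -> : l' - l = (SP g s N - l) - (SP g s N - l') by ring.
apply: le_trans (ler_normB _ _) _.
have h4 : q' * npw s N <= `|q'| * npw s N by rewrite ler_wpM2r ?npw_ge0 // ler_norm.
have h5 := npw_ge0 s N.
by move: h1 h2 h3 h4 h5; clear; set a := `|_ - _|; set b := `|_ - _|; nra.
Qed.

Lemma eq_Lr g h s : (forall n, (0 < n)%N -> g n = h n) -> Lr g s = Lr h s.
Proof.
move=> e; rewrite /Lr; congr xget; apply/seteqP.
have eS N : SP g s N = SP h s N by apply: eq_big_nat => n /andP[n0 _]; rewrite e.
by split=> l [q hq]; exists q => N /hq; rewrite eS.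
Qed.

Lemma exists_sqrtn y : exists u : nat, (u ^ 2 <= y < u.+1 ^ 2)%N.
Proof.
elim: y => [|y [u /andP[h1 h2]]]; first by exists 0%N.
have [h|h] := leqP (u.+1 ^ 2) y.+1.
 by exists u.+1; rewrite h; move: h2 h; rewrite !expnS !expn0; nia.
by exists u; rewrite h andbT leqW.
Qed.

Lemma npw2_ge_half (s : R) : 0 <= s <= 1 -> 1 / 2 <= npw s 2.
Proof.
move=> /andP[s0 s1]; rewrite div1r -[2^-1](npw_1 R 2); exact: ler_npw.
Qed.

Lemma npw_sqrtn_le (s : R) u y : 0 <= s <= 1 -> (0 < u)%N -> (y < u.+1 ^ 2)%N -> (0 < y)%N ->
 npw s u <= 2 * npw (s / 2) y.
Proof.
move=> s01 u0 hy y0; have [s0 s1] := andP s01.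
have h : (y <= 2 * u * (2 * u))%N by move: hy u0; rewrite !expnS !expn0; nia.
have := npw_decr y0 h (divr_ge0 s0 (ler0n R 2)).
rewrite npwM -npwD ?muln_gt0 // -splitr npwM.
have := npw2_ge_half s01; have := npw_ge0 s u.
by clear; set a := npw s u; set b := npw s 2; set c := npw _ y; nra.
Qed.

Lemma npw_divn_le (s : R) k y : 0 <= s <= 1 -> (0 < k <= y)%N ->
 npw s (y %/ k) <= 2 * npw s y * npw (- s) k.
Proof.
move=> s01 /andP[k0 ky]; have [s0 s1] := andP s01.
have w0 : (0 < y %/ k)%N by rewrite divn_gt0.
have h : (y <= 2 * k * (y %/ k))%N.
 have := ltn_ceil y k0; move: w0 k0; set w := (y %/ k)%N; nia.
have y0 := leq_trans k0 ky.
have := npw_decr y0 h s0; rewrite !npwM.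
have e : npw s k * npw (- s) k = 1 by rewrite -npwD // subrr /npw oppr0 powRr0.
have := npw2_ge_half s01; have := npw_gt0 s k0; have := npw_ge0 s (y %/ k).
have := npw_gt0 (- s) k0; have := npw_ge0 s y.
move: e; clear; set a := npw s k; set a' := npw _ k; set b := npw s 2; set c := npw s (_ %/ _).
set d := npw s y => e d0 a'0 c0 a0 b2 h.
have h1 : 1 / 2 * (a * c) <= d.
 by apply: le_trans h; rewrite -[b * a * c]mulrA ler_wpM2r // mulr_ge0 // ltW.
have : a' * (1 / 2 * (a * c)) <= a' * d by rewrite ler_wpM2l // ltW.
have -> : a' * (1 / 2 * (a * c)) = 1 / 2 * c * (a * a') by ring.
by rewrite e; lra.
Qed.

Lemma npw_neg_divn (d : R) k y : 0 < d < 1 -> (0 < k <= y)%N ->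
 `|npw (- d) (y %/ k) - npw (- d) y * npw d k| <= d * npw (1 - d) (y %/ k).
Proof.
move=> d01 /andP[k0 ky]; have [d0 d1] := andP d01.
have w0 : (0 < y %/ k)%N by rewrite divn_gt0.
have /andP[_] := npw_neg_step d01 w0; rewrite ler_pdivrMr // mulrC => h.
have incr m n : (0 < m)%N -> (m <= n)%N -> npw (- d) m <= npw (- d) n.
 move=> m0 mn; rewrite /npw opprK; apply: ler_wpowR; rewrite ?ler_nat ?(ltW d0) //.
have e : npw (- d) k * npw d k = 1 by rewrite -npwD // addNr /npw oppr0 powRr0.
have p := npw_gt0 d k0.
have l1 : npw (- d) (y %/ k) <= npw (- d) y * npw d k.
 have := incr (y %/ k * k)%N y; rewrite muln_gt0 w0 k0 leq_trunc_div => /(_ isT isT).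
 rewrite npwM; move: e p; clear; set a := npw _ k; set b := npw d k; set c := npw _ (_ %/ _).
 by set x := npw _ y => e p h; have := ler_wpM2r (ltW p) h; rewrite -mulrA e mulr1.
have l2 : npw (- d) y * npw d k <= npw (- d) (y %/ k).+1.
 have := incr y ((y %/ k).+1 * k)%N (leq_trans k0 ky) (ltnW (ltn_ceil y k0)).
 rewrite npwM; move: e p; clear; set a := npw _ k; set b := npw d k; set c := npw _ (_ %/ _).+1.
 by set x := npw _ y => e p h; have := ler_wpM2r (ltW p) h; rewrite -mulrA e mulr1.
rewrite ler0_norm ?subr_le0 // opprB.
by move: h l2; clear; set a := npw _ _; set b := npw _ _; set c := npw _ _; lra.
Qed.

Lemma zeta_sum_le (d : R) N : 0 < d < 1 -> \sum_(1 <= n < N.+1) npw (1 - d) n <= 2 / d * npw (- d) N.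
Proof.
move=> d01; have [d0 d1] := andP d01; case: N => [|N].
 by rewrite big_geq // mulr_ge0 ?divr_ge0 ?npw_ge0 // ltW.
have [z [/andP[z1 z2] hz]] := zeta_sum_limit d01.
have := hz N.+1 isT; rewrite ler_norml => /andP[_ h].
have h1 : npw (1 - d) N.+1 <= 1 by rewrite npw_le1 // subr_ge0 ltW.
have h2 : 1 <= npw (- d) N.+1 by rewrite /npw opprK one_le_powR ?ler1n // ltW.
have di : 1 <= d^-1 by rewrite invf_ge1 // ltW.
by move: h h1 h2 di z2; clear; set a := npw _ _; set b := npw _ _; set S := \sum_(_ <= _ < _) _; nra.
Qed.

(** The coefficients of [zeta * L(g)] are summed by the hyperbola method cut at the square root of
    [y]. One main term comes from the pole of zeta, the other is [zeta (1 - d) * L(1 - d, g)]; [z]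
    depends on [d] only. The constant 20 is 8 for the second hyperbola sum and 4 for each of three
    errors in the first. *)
Lemma rho_sum (d : R) : 0 < d <= 1 / 2 -> exists2 z : R, - d^-1 <= z <= 0 &
 forall g q y, rchar g -> rbsum g q -> 1 <= q -> (0 < y)%N ->
 `|\sum_(1 <= n < y.+1) rconv g (fun=> 1) n * npw (1 - d) n -
  (Lr g 1 * (npw (- d) y / d) + z * Lr g (1 - d))| <= 20 * (q / d) * npw (1 / 2 - d) y.
Proof.
move=> /andP[d0 d2]; have d01 : 0 < d < 1 by lra.
have [z [/andP[z1 z2] hz]] := zeta_sum_limit d01; exists z; first by rewrite z1.
move=> g q y hg hq q1 y0.
have [u /andP[u1 u2]] := exists_sqrtn y.
have u0 : (0 < u)%N by case: u u2 {u1} => //; rewrite exp1n; lia.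
have uy : (u <= y)%N by apply: leq_trans u1; rewrite expnS expn1 leq_pmulr.
have b0 : 0 <= 1 - d by lra.
have q0 := ge1_gt0 q1.
under eq_bigr do rewrite -(rconv_npw _ g (fun=> 1)).
rewrite (hyperbola _ _ uy).
pose E := npw (1 / 2 - d) y.
have E0 : 0 <= E by exact: npw_ge0.
have g1 n : `|g n| <= 1 by exact: rchar_norm.
have qd : 0 < q / d by rewrite divr_gt0.
have T2 : `|\sum_(1 <= m < (y %/ u.+1).+1) 1 * npw (1 - d) m *
  \sum_(u.+1 <= k < (y %/ m).+1) g k * npw (1 - d) k| <= 8 * (q / d) * E.
 apply: le_trans (ler_norm_sum _ _ _) _.
 apply: le_trans (_ : \sum_(1 <= m < (y %/ u.+1).+1) npw (1 - d) m * (2 * q * npw (1 - d) u) <= _).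
  apply: ler_sum => m _; rewrite mul1r normrM (ger0_norm (npw_ge0 _ _)).
  by rewrite ler_wpM2l ?npw_ge0 // rbsum_tail.
 rewrite -mulr_suml.
 apply: le_trans (_ : 2 / d * npw (- d) u * (2 * q * npw (1 - d) u) <= _).
  rewrite ler_wpM2r ?mulr_ge0 ?npw_ge0 ?(ltW q0) //.
  apply: le_trans (zeta_sum_le _ d01) _; rewrite ler_wpM2l ?divr_ge0 ?(ltW d0) //.
  have [->|v0] := posnP (y %/ u.+1).
   by rewrite /npw opprK powR0 ?lt0r_neq0 // powR_ge0.
  rewrite /npw opprK; apply: ler_wpowR; rewrite ?ler_nat ?(ltW d0) //.
  by rewrite -ltnS ltn_divLR // -expn2.
 have -> : 2 / d * npw (- d) u * (2 * q * npw (1 - d) u) = 4 * (q / d) * npw (1 - 2 * d) u.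
  have -> : 1 - 2 * d = - d + (1 - d) by ring.
  by rewrite [npw (- d + _) u]npwD //; ring.
 have := @npw_sqrtn_le (1 - 2 * d) u y _ u0 u2 y0.
 have -> : (1 - 2 * d) / 2 = 1 / 2 - d by field.
 rewrite -/E => h; have {h} := ler_wpM2l (ltW qd) (h _).
 have i01 : 0 <= 1 - 2 * d <= 1 by move: d0 d2; clear; lra.
 by move=> /(_ i01); clear; set a := q / d; set b := npw _ _; lra.
(* Error made when the inner sum is replaced by [y ^ d * k ^ (-d) / d + z]. Rounding [y / k] down to
   an integer costs no more than the error of [zeta_sum_limit] itself. *)
pose err k := \sum_(1 <= m < (y %/ k).+1) npw (1 - d) m - (npw (- d) y * npw d k / d + z).
have herr k : (0 < k <= u)%N -> `|err k| <= 4 * npw (1 - d) y * npw (- (1 - d)) k.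
 move=> /andP[k0 ku]; have ky := leq_trans ku uy.
 have kk : (0 < k <= y)%N by rewrite k0.
 have w0 : (0 < y %/ k)%N by rewrite divn_gt0.
 have h1 := hz _ w0; have h2 := npw_neg_divn d01 kk.
 have i01 : 0 <= 1 - d <= 1 by move: d0 d2; clear; lra.
 have h3 := npw_divn_le i01 kk.
 have e : err k = (\sum_(1 <= m < (y %/ k).+1) npw (1 - d) m - npw (- d) (y %/ k) / d - z) +
   (npw (- d) (y %/ k) - npw (- d) y * npw d k) / d by rewrite /err; ring.
 rewrite e; apply: le_trans (ler_normD _ _) _.
 rewrite normrM [`|d^-1|]ger0_norm ?invr_ge0 ?(ltW d0) //.
 have h4 : `|npw (- d) (y %/ k) - npw (- d) y * npw d k| / d <= npw (1 - d) (y %/ k).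
  by rewrite ler_pdivrMr // [_ * d]mulrC.
 by move: h1 h3 h4; clear; set a := `|_|; set b := _ / d; set c := npw _ _; set x := npw _ _;
  set w := npw _ _; lra.
have T1 : \sum_(1 <= k < u.+1) g k * npw (1 - d) k * \sum_(1 <= m < (y %/ k).+1) 1 * npw (1 - d) m
  = SP g 1 u * (npw (- d) y / d) + z * SP g (1 - d) u + \sum_(1 <= k < u.+1) g k * npw (1 - d) k * err k.
 rewrite /SP mulr_suml mulr_sumr -!big_split /=; apply: eq_big_nat => k /andP[k0 _].
 under eq_bigr do rewrite mul1r.
 have -> : npw 1 k = npw (1 - d) k * npw d k by rewrite -npwD // subrK.
 by rewrite /err; ring.
rewrite T1.
have herrs : `|\sum_(1 <= k < u.+1) g k * npw (1 - d) k * err k| <= 4 * E.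
 apply: le_trans (ler_norm_sum _ _ _) _.
 apply: le_trans (_ : \sum_(1 <= k < u.+1) 4 * npw (1 - d) y <= _).
  apply: ler_sum_nat => k /andP[k0 ku]; rewrite !normrM (ger0_norm (npw_ge0 _ _)).
  have e : npw (1 - d) k * npw (- (1 - d)) k = 1.
   by rewrite -npwD // subrr /npw oppr0 powRr0.
  apply: le_trans (_ : 1 * npw (1 - d) k * (4 * npw (1 - d) y * npw (- (1 - d)) k) <= _).
   apply: ler_pM; rewrite ?mulr_ge0 ?npw_ge0 //.
    by rewrite ler_wpM2r ?npw_ge0.
   by apply: herr; rewrite k0.
  by rewrite mul1r mulrCA e mulr1.
 rewrite sumr_const_nat subn1 -[_ *+ u]mulr_natr -mulrA ler_wpM2l //.
 have hu : (u%:R : R) <= npw (- 2^-1) y.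
  rewrite -sqrt_npw -(ler_pXn2r (n := 2)) ?nnegrE // sqr_sqrtr //.
  by rewrite -natrX ler_nat.
 apply: le_trans (ler_wpM2l (npw_ge0 _ _) hu) _; rewrite -npwD //.
 by rewrite /E; have -> : 1 - d + - 2^-1 = 1 / 2 - d by field.
have s1 := LrP hq (@ltr01 R) u0.
have b1 : 0 < 1 - d by move: d2; clear; lra.
have s2 := LrP hq b1 u0.
have p1 : npw (- d) y / d * npw 1 u <= 2 / d * E.
 have i01 : 0 <= (1 : R) <= 1 by rewrite ler01 lexx.
 have := @npw_sqrtn_le 1 u y i01 u0 u2 y0 => h.
 apply: le_trans (ler_wpM2l _ h) _; first by rewrite divr_ge0 ?npw_ge0 // ltW.
 rewrite /E; have -> : 1 / 2 - d = - d + 1 / 2 by ring.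
 by rewrite [npw (- d + _) y]npwD //; clear; set a := npw _ _; set b := npw _ _; lra.
have p2 : npw (1 - d) u <= 2 * E.
 have i01 : 0 <= 1 - d <= 1 by move: d0 d2; clear; lra.
 apply: le_trans (npw_sqrtn_le i01 u0 u2 y0) _; rewrite ler_wpM2l // /E ler_npw //.
 by move: d0; clear; lra.
set S := \sum_(1 <= k < u.+1) _ in herrs *; set T := \sum_(1 <= m < _) _ in T2 *.
have -> : SP g 1 u * (npw (- d) y / d) + z * SP g (1 - d) u + S + T -
  (Lr g 1 * (npw (- d) y / d) + z * Lr g (1 - d)) =
  (SP g 1 u - Lr g 1) * (npw (- d) y / d) + z * (SP g (1 - d) u - Lr g (1 - d)) + (S + T) by ring.
apply: le_trans (ler_normD _ _) _; apply: le_trans (lerD (ler_normD _ _) (ler_normD _ _)) _.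
rewrite !normrM [`|npw _ _|]ger0_norm ?npw_ge0 // [`|d^-1|]ger0_norm ?invr_ge0 ?(ltW d0) //.
have a1 : `|SP g 1 u - Lr g 1| * (npw (- d) y / d) <= 4 * (q / d) * E.
 apply: le_trans (ler_wpM2r _ s1) _; first by rewrite divr_ge0 ?npw_ge0 // ltW.
 have := ler_wpM2l (ltW q0) p1; move: (npw (- d) y / d) => a.
 by clear; set b := npw 1 u; lra.
have a2 : `|z| * `|SP g (1 - d) u - Lr g (1 - d)| <= 4 * (q / d) * E.
 apply: le_trans (_ : d^-1 * (2 * q * (2 * E)) <= _); last by clear; lra.
 apply: ler_pM => //; first by rewrite ler0_norm // lerNl.
 by apply: le_trans s2 _; rewrite ler_wpM2l // mulr_ge0 // ltW.
have a3 : 4 * E <= 4 * (q / d) * E.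
 rewrite ler_wpM2r // ler_peMr // ler_pdivlMr // mul1r (le_trans _ q1) //.
 by move: d2; clear; lra.
move: a1 a2 a3 herrs T2; rewrite -/E.
by clear; set a := _ * (_ / d); set b := `|z| * _; set c := `|S|; set e := `|T|; set f := q / d * E; lra.
Qed.

End RealLSeries.

(** * Real zeros and the value [L(1, g)] *)

Section SiegelZeros.
Variable R : realType.
Local Notation lnn := (@lnn R).
Local Notation npw := (@npw R).

Lemma npw_dist (s t : R) n : (0 < n)%N -> 0 <= s -> 0 <= t ->
 `|npw s n - npw t n| <= `|s - t| * lnn n.
Proof.
move=> n0; wlog st : s t / s <= t.
 move=> h s0 t0; have [st|/ltW ts] := leP s t; first exact: h.
 by rewrite distrC [`|s - t|]distrC; apply: h.
move=> s0 t0; rewrite ger0_norm ?subr_ge0 ?ler_npw // ler0_norm ?subr_le0 // opprB.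
have -> : npw t n = npw s n * expR (- (t - s) * lnn n).
 by rewrite !npwE // -expRD; congr expR; ring.
have := @npw_le1 R s n n0 s0; have := npw_ge0 s n.
have := expR_ge1Dx (- (t - s) * lnn n); have := expR_ge0 (- (t - s) * lnn n).
have : 0 <= (t - s) * lnn n by rewrite mulr_ge0 ?lnn_ge0 ?subr_ge0.
have -> : - (t - s) * lnn n = - ((t - s) * lnn n) by ring.
clear; set a := (t - s) * _; set e := expR _; set p := npw _ _ => a0 _ h p0 p1.
have := ler_wpM2l p0 h; have := ler_wpM2r a0 p1; lra.
Qed.

(** The tail is small uniformly for [s >= 1/2], and the finite sum up to [N] is Lipschitz in [s]. *)
Lemma Lr_modulus g (q e : R) : rbsum g q -> (forall n, `|g n| <= 1) -> 0 < e ->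
 exists2 d : R, 0 < d & forall s t, 1 / 2 <= s -> 1 / 2 <= t -> `|s - t| <= d ->
 `|Lr g s - Lr g t| <= e.
Proof.
move=> hq g1 e0; have q0 := rbsum_ge0 hq.
have K0 : 0 < 4 * q + 1 by lra.
have h2 : 0 < 1 / 2 :> R by lra.
have [N N0 hN] := npw_small h2 (divr_gt0 (divr_gt0 e0 (ltr0n R 2)) K0).
have {hN} := hN N (leqnn _); rewrite ler_pdivlMr // => hN.
have NN : 0 < (N%:R * N%:R : R) by rewrite mulr_gt0 // ltr0n.
exists (e / 2 / (N%:R * N%:R)); first by rewrite !divr_gt0.
move=> s t s2 t2; rewrite ler_pdivlMr // => hst.
have s0 : 0 < s by lra.
have t0 : 0 < t by lra.
have h3 := LrP hq s0 N0; have h4 := LrP hq t0 N0.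
have h5 := @ler_npw R _ _ N N0 s2; have h6 := @ler_npw R _ _ N N0 t2.
have h7 : `|SP g s N - SP g t N| <= `|s - t| * (N%:R * N%:R).
 rewrite /SP -sumrB; apply: le_trans (ler_norm_sum _ _ _) _.
 apply: le_trans (_ : \sum_(1 <= n < N.+1) `|s - t| * N%:R <= _).
  apply: ler_sum_nat => n /andP[n0 nN]; rewrite -mulrBr normrM.
  apply: le_trans (_ : 1 * (`|s - t| * lnn n) <= _).
   by apply: ler_pM => //; apply: npw_dist => //; exact: ltW.
  rewrite mul1r ler_wpM2l // (le_trans (lnn_le_nat _ _)) // ler_nat -ltnS //.
 by rewrite sumr_const_nat subn1 /= -[_ *+ N]mulr_natr mulrA.
have -> : Lr g s - Lr g t = (SP g s N - SP g t N) - (SP g s N - Lr g s) + (SP g t N - Lr g t) by ring.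
apply: le_trans (ler_normD _ _) _; apply: le_trans (lerD (ler_normB _ _) (lexx _)) _.
move: h3 h4 h5 h6 h7 hst hN q0; clear; set a := `|_|; set b := `|_|; set c := `|_|; set p := npw _ _.
set p1 := npw _ _; set p2 := npw _ _; set x := `|s - t| * _ => h3 h4 h5 h6 h7 hst hN q0.
have := ler_wpM2l q0 h5; have := ler_wpM2l q0 h6; have : 0 <= p2 by exact: npw_ge0.
lra.
Qed.

Lemma dist_maxl (a s t : R) : `|Num.max a s - Num.max a t| <= `|s - t|.
Proof.
wlog st : s t / s <= t.
 move=> h; have [st|/ltW ts] := leP s t; first exact: h.
 by rewrite distrC [`|s - t|]distrC; apply: h.
rewrite (ler0_norm (_ : s - t <= 0)) ?subr_le0 // opprB.
have [h1|h1] := leP a s; have [h2|h2] := leP a t; rewrite ler_norml; lra.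
Qed.

Lemma npwX (s : R) n k : npw s (n ^ k) = npw (k%:R * s) n.
Proof.
by rewrite /npw natrX -powR_mulrn // -powRrM mulrN.
Qed.

(** The function is continued as a constant to the left of [a], where nothing is known about it,
    which makes it continuous on the whole line. *)
Lemma IVT_modulus (f : R -> R) a b : a <= b ->
 (forall e, 0 < e -> exists2 d, 0 < d & forall s t, a <= s -> a <= t -> `|s - t| <= d ->
   `|f s - f t| <= e) ->
 f a <= 0 -> 0 <= f b -> exists2 c, a <= c <= b & f c = 0.
Proof.
move=> ab hf fa fb; pose F s := f (Num.max a s).
have cF : continuous F.
 move=> s; apply/cvgrPdist_le => e e0; have [d d0 hd] := hf e e0.
 near=> t; apply: hd; rewrite ?le_max ?lexx //.
 apply: le_trans (_ : `|s - t| <= d); last first.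
  near: t; apply: (@cvgr_dist_le _ _ _ _ _ id s) => //; exact: cvg_id.
 exact: dist_maxl.
have [c cab Fc] : exists2 c, c \in `[a, b] & F c = 0.
 apply: IVT => //; first exact: continuous_subspaceT.
 by rewrite /F maxxx (max_r ab); rewrite ge_min fa le_max fb orbT.
exists c; first by rewrite in_itv in cab.
by move: Fc; rewrite /F max_r; move: cab; rewrite in_itv => /andP[].
Unshelve. all: by end_near.
Qed.

Lemma lnn_le_sum_inv N : lnn N.+1 <= \sum_(1 <= n < N.+1) (n%:R^-1 : R).
Proof.
elim: N => [|N IH]; first by rewrite lnn1 big_geq.
rewrite big_nat_recr //=; have := @lnnS_sub R N.+1 isT; move: IH.
by clear; set S := \sum_(_ <= _ < _) _; set x := _^-1; lra.
Qed.

Lemma sum_sqr_le (F : nat -> R) u y : (u ^ 2 <= y)%N -> (forall n, (0 < n)%N -> 0 <= F n) ->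
 \sum_(1 <= n < u.+1) F (n ^ 2)%N <= \sum_(1 <= n < y.+1) F n.
Proof.
elim: u y => [|u IH] y hy F0.
 by rewrite big_geq // big_nat sumr_ge0 // => n /andP[n0 _]; exact: F0.
rewrite big_nat_recr //=.
rewrite [leRHS](big_cat_nat _ (n := (u ^ 2).+1)) //=; last first.
 by rewrite ltnS (leq_trans _ hy) // leq_exp2r.
apply: lerD; first exact: IH.
have hu : (u ^ 2 < u.+1 ^ 2)%N by rewrite ltn_exp2r.
rewrite (bigD1_seq (u.+1 ^ 2)%N) ?iota_uniq ?mem_index_iota ?hu //=.
rewrite lerDl big_nat_cond sumr_ge0 // => n /andP[/andP[n0 _] _]; apply: F0.
exact: leq_ltn_trans n0.
Qed.

(** With [d = 1/2] the error in [rho_sum] is bounded by [40 q]. The sum up to [u ^ 2] is at least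
    its part over squares, hence at least the harmonic sum up to [u], which is unbounded. If
    [L(1, g) <= 0], everything on the other side is at most the constant [B]. *)
Lemma Lr1_gt0 (g : nat -> R) q : rchar g -> rbsum g q -> 1 <= q -> 0 < Lr g 1.
Proof.
move=> hg hq q1; rewrite ltNge; apply/negP => L0.
have d2 : 0 < (1 / 2 : R) <= 1 / 2 by lra.
have [z /andP[z1 z0] hz] := rho_sum d2.
pose B := `|z * Lr g (1 - 1 / 2)| + 40 * q.
have [u hu] : exists u : nat, B < lnn u.+1.
 exists (Num.truncn (expR B)).
 by rewrite -[ltLHS](expRK B) /lnn ltr_ln ?posrE ?expR_gt0 // truncn_gtS.
have u0 : (0 < u)%N.
 case: u hu => // ; rewrite lnn1 => h; suff : 0 <= B by lra.
 by rewrite /B addr_ge0 // mulr_ge0 // (le_trans ler01).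
have y0 : (0 < u ^ 2)%N by rewrite expn_gt0 u0.
have := hz g q (u ^ 2)%N hg hq q1 y0.
rewrite ler_norml => /andP[_]; have -> : npw (1 / 2 - 1 / 2) (u ^ 2) = 1.
 by rewrite subrr /npw oppr0 powRr0.
have := @sum_sqr_le (fun n => rconv g (fun=> 1) n * npw (1 - 1 / 2) n) u (u ^ 2) (leqnn _) _.
have F0 n : (0 < n)%N -> 0 <= rconv g (fun=> 1) n * npw (1 - 1 / 2) n.
 by move=> n0; rewrite mulr_ge0 ?npw_ge0 ?rho_ge0.
move=> /(_ F0) h1 h2.
have h3 : lnn u.+1 <= \sum_(1 <= n < u.+1) rconv g (fun=> 1) (n ^ 2)%N * npw (1 - 1 / 2) (n ^ 2).
 apply: le_trans (lnn_le_sum_inv u) _; apply: ler_sum_nat => n /andP[n0 _].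
 have -> : npw (1 - 1 / 2) (n ^ 2) = n%:R^-1.
  rewrite expnS expn1 npwM -npwD //; have -> : 1 - 1 / 2 + (1 - 1 / 2) = 1 :> R by lra.
  exact: npw_1.
 by rewrite ler_peMl // rho_sqr_ge1.
have h4 : Lr g 1 * (npw (- (1 / 2)) (u ^ 2) / (1 / 2)) <= 0.
 by rewrite mulr_le0_ge0 // divr_ge0 ?npw_ge0 //; lra.
have h5 := ler_norm (z * Lr g (1 - 1 / 2)).
move: hu h1 h2 h3 h4 h5; rewrite /B; clear.
set a := `|_|; set b := lnn _; set S := \sum_(_ <= _ < _) _; set T := \sum_(_ <= _ < _) _.
set c := z * _; set e := Lr g 1 * _; lra.
Qed.

Lemma rho_sum_ge1 g s y : rchar g -> (0 < y)%N ->
 1 <= \sum_(1 <= n < y.+1) rconv g (fun=> 1) n * npw s n.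
Proof.
move=> hg y0; rewrite big_nat_recl // rconv1 npw1 mulr1 mulr1.
case: (hg) => -> _ _; rewrite lerDl big_nat sumr_ge0 // => n _.
by rewrite mulr_ge0 ?npw_ge0 ?rho_ge0.
Qed.

Lemma npwN (s : R) n : npw (- s) n = n%:R `^ s.
Proof. by rewrite /npw opprK. Qed.

(** The term [z * Lr g (1 - d)] is at most 0 because [z <= 0], while the sum is at least its first
    term 1. At [y = M ^ 4] with [M] about [40 q / d] the error is at most [1/2], so
    [L(1, g) * y ^ d / d] is at least [1/2]; hence the exponent [4 d]. *)
Lemma Lr1_lower_nonneg (d : R) : 0 < d <= 1 / 4 -> exists2 c : R, 0 < c &
 forall g q, rchar g -> rbsum g q -> 1 <= q -> 0 <= Lr g (1 - d) -> c / q `^ (4 * d) <= Lr g 1.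
Proof.
move=> /andP[d0 d4]; have d02 : 0 < d <= 1 / 2 by lra.
have [z /andP[z1 z0] hz] := rho_sum d02.
have p0 : 0 < (41 / d) `^ (4 * d) by rewrite powR_gt0 // divr_gt0.
exists (d / 2 / (41 / d) `^ (4 * d)); first by rewrite !divr_gt0.
move=> g q hg hq q1 L0; have q0 := ge1_gt0 q1.
have qd1 : 1 <= q / d by rewrite ler_pdivlMr // mul1r (le_trans _ q1) //; lra.
pose M := (Num.truncn (40 * (q / d))).+1.
have M1 : 40 * (q / d) <= M%:R by exact/ltW/truncn_gtS.
have M2 : M%:R <= 41 * (q / d).
 rewrite /M -nat1r; have : (Num.truncn (40 * (q / d)))%:R <= 40 * (q / d).
  by rewrite truncn_le; lra.
 lra.
have y0 : (0 < M ^ 4)%N by [].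
have := hz g q _ hg hq q1 y0; rewrite ler_norml => /andP[_].
have h1 := rho_sum_ge1 (1 - d) hg y0.
have h2 : 20 * (q / d) * npw (1 / 2 - d) (M ^ 4) <= 1 / 2.
 have : npw (1 / 2 - d) (M ^ 4) <= M%:R^-1.
  apply: le_trans (ler_npw y0 (_ : 1 / 4 <= 1 / 2 - d)) _; first by lra.
  by rewrite npwX div1r divff // npw_1.
 have : M%:R * M%:R^-1 = 1 :> R by rewrite divff // lt0r_neq0.
 have : 0 < (M%:R^-1 : R) by rewrite invr_gt0.
 move: M1 qd1; clear; set a := npw _ _; set b := _^-1; set m := _%:R; set x := q / d => M1 x1 b0 e ab.
 have := ler_wpM2r (ltW b0) M1; have := ler_wpM2l (le_trans ler01 x1) ab; rewrite e; lra.
have h3 : z * Lr g (1 - d) <= 0 by exact: mulr_le0_ge0.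
have h4 : npw (- d) (M ^ 4) <= (41 / d) `^ (4 * d) * q `^ (4 * d).
 rewrite npwN natrX -powRM ?divr_ge0 ?(ltW d0) ?(ltW q0) //.
 rewrite -powR_mulrn // -powRrM; apply: ler_wpowR; rewrite ?mulr_ge0 ?(ltW d0) //.
 by lra.
have Q0 : 0 < q `^ (4 * d) by rewrite powR_gt0.
have L1 := Lr1_gt0 hg hq q1.
move=> h5; rewrite !ler_pdivrMr //.
have : 1 / 2 <= Lr g 1 * (npw (- d) (M ^ 4) / d).
 by move: h1 h2 h3 h5; clear; set a := \sum_(_ <= _ < _) _; set b := _ * npw _ _; set c := z * _; lra.
rewrite mulrA ler_pdivlMr // => h6.
have := ler_wpM2l (ltW L1) h4; move: h6; clear.
by lra.
Qed.

Lemma SP1 (g : nat -> R) s : SP g s 1 = g 1%N.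
Proof. by rewrite /SP big_nat1 npw1 mulr1. Qed.

(** The hyperbola method at [u = sqrt M] has at most [u] inner sums of size [Q] and at most [u] of
    size [2 Q]. *)
Lemma rsqb_rconv (g h : nat -> R) (Q : R) : (forall n, `|g n| <= 1) -> (forall n, `|h n| <= 1) ->
 rbsum g Q -> rbsum h Q -> rsqb (rconv g h) (3 * Q).
Proof.
move=> g1 h1 hg hh M; have Q0 := rbsum_ge0 hg.
have [u /andP[u1 u2]] := exists_sqrtn M.
have uM : (u <= M)%N by case: u u1 {u2} => // u; apply: leq_trans; rewrite expnS expn1 leq_pmulr.
rewrite (hyperbola _ _ uM); apply: le_trans (ler_normD _ _) _.
apply: le_trans (_ : u%:R * Q + u%:R * (2 * Q) <= _).
 apply: lerD; apply: le_trans (ler_norm_sum _ _ _) _.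
  apply: le_trans (_ : \sum_(1 <= k < u.+1) Q <= _).
   by apply: ler_sum => k _; rewrite normrM -[Q]mul1r ler_pM.
  by rewrite sumr_const_nat subn1 mulr_natl.
 apply: le_trans (_ : \sum_(1 <= k < (M %/ u.+1).+1) 2 * Q <= _).
  apply: ler_sum => m _; rewrite normrM -[2 * Q]mul1r ler_pM //.
  have [hm|hm] := leqP u.+1 (M %/ m).+1; last by rewrite big_geq ?normr0 ?mulr_ge0 // ltnW.
  have -> : \sum_(u.+1 <= d < (M %/ m).+1) g d =
    \sum_(1 <= d < (M %/ m).+1) g d - \sum_(1 <= d < u.+1) g d.
   by rewrite [X in _ = X - _](big_cat_nat _ (n := u.+1)) //= addrAC subrr add0r.
  apply: le_trans (ler_normB _ _) _; rewrite mulr_natl mulr2n; exact: lerD.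
 rewrite sumr_const_nat subn1 -[_ *+ _]mulr_natl ler_wpM2r ?mulr_ge0 // ler_nat.
 by rewrite -ltnS ltn_divLR // -expn2.
have : u%:R <= Num.sqrt (M%:R : R).
 by rewrite -(ler_pXn2r (n := 2)) ?nnegrE // sqr_sqrtr // -natrX ler_nat.
move=> /(ler_wpM2l Q0); clear; set a := _%:R; set b := Num.sqrt _; lra.
Qed.

Lemma Lr_norm_le (h : nat -> R) (Q : R) s : (forall n, `|h n| <= 1) -> rbsum h Q -> 1 <= Q -> 0 < s ->
 `|Lr h s| <= 3 * Q.
Proof.
move=> h1 hQ Q1 s0; have := LrP hQ s0 (ltn0Sn 0); rewrite SP1 npw1 mulr1 => k.
have := h1 1%N; have := ler_normB (h 1%N) (h 1%N - Lr h s).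
have -> : h 1%N - (h 1%N - Lr h s) = Lr h s by ring.
move: k; clear -Q1; lra.
Qed.

(** A harmonic sum up to [N] about [Q], after which the tail is bounded. *)
Lemma Lr1_norm_le (h : nat -> R) (Q : R) : (forall n, `|h n| <= 1) -> rbsum h Q -> 1 <= Q ->
 `|Lr h 1| <= 4 * (1 + ln Q).
Proof.
move=> h1 hQ Q1; have Q0 := ge1_gt0 Q1.
pose N := (Num.truncn Q).+1; have N0 : (0 < N)%N by [].
have N1 : Q <= N%:R by exact/ltW/truncn_gtS.
have N2 : N%:R <= 2 * Q.
 rewrite /N -nat1r; have : (Num.truncn Q)%:R <= Q by rewrite truncn_le ltW.
 lra.
have := LrP hQ (@ltr01 R) N0; rewrite npw_1 => a1.
have a2 : 2 * Q * N%:R^-1 <= 2 by rewrite ler_pdivrMr //; lra.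
have a3 : `|SP h 1 N| <= 1 + lnn N.
 apply: le_trans (ler_norm_sum _ _ _) _; apply: le_trans (sum_inv_le R N0).
 apply: ler_sum => n _; rewrite normrM [`|npw _ _|]ger0_norm ?npw_ge0 // npw_1.
 by rewrite ler_piMl.
have a4 : lnn N <= 1 + ln Q.
 apply: le_trans (_ : ln (2 * Q) <= _); first by rewrite ler_ln ?posrE ?mulr_gt0.
 by rewrite lnM ?posrE // lerD2r; exact: lnn2_le.
have a5 : 0 <= ln Q by exact: ln_ge0.
have := ler_normB (SP h 1 N) (SP h 1 N - Lr h 1).
have -> : SP h 1 N - (SP h 1 N - Lr h 1) = Lr h 1 by ring.
by lra.
Qed.

(** The hyperbola method cut at [M ^ 8]; working with powers of an integer [M] makes all quantities
    powers of [w = 1 / M]. One power of [w] is given up to absorb the logarithm of a harmonic sum,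
    and 28 is [4 + 18 + 6]. *)
Lemma SP_rconv (g h : nat -> R) (Q : R) M : (forall n, `|g n| <= 1) -> (forall n, `|h n| <= 1) ->
 rbsum g Q -> rbsum h Q -> 1 <= Q -> (0 < M)%N ->
 `|SP (rconv g h) 1 (M ^ 16) - Lr g 1 * Lr h 1| <= 28 * Q ^+ 2 * M%:R^-1 ^+ 7.
Proof.
move=> g1 h1 hg hh Q1 M0; have Q0 := ge1_gt0 Q1.
have M1 : 1 <= (M%:R : R) by rewrite ler1n.
set w := M%:R^-1; have w0 : 0 <= w by rewrite invr_ge0 ler0n.
have w1 : w <= 1 by rewrite invf_le1 // (lt_le_trans ltr01).
have npw1X k : npw 1 (M ^ k) = w ^+ k by rewrite npw_1 natrX exprVn.
pose U := (M ^ 8)%N; pose D := (M ^ 16)%N.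
have U0 : (0 < U)%N by rewrite expn_gt0 M0.
have UD : (U <= D)%N by rewrite leq_pexp2l.
have DU : D = (U * U)%N by rewrite /D /U -expnD.
rewrite /SP; under eq_bigr do rewrite -rconv_npw.
rewrite (hyperbola _ _ UD).
have T1 : `|\sum_(1 <= k < U.+1) g k * npw 1 k * SP h 1 (D %/ k) - SP g 1 U * Lr h 1| <=
  4 * Q * w ^+ 8.
 rewrite /SP mulr_suml -sumrB; apply: le_trans (ler_norm_sum _ _ _) _.
 apply: le_trans (_ : \sum_(1 <= k < U.+1) 4 * Q * npw 1 D <= _).
  apply: ler_sum_nat => k /andP[k0 kU]; rewrite -mulrBr !normrM [`|npw _ _|]ger0_norm ?npw_ge0 //.
  have kk : (0 < k <= D)%N by rewrite k0 (leq_trans _ UD).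
  have i01 : 0 <= (1 : R) <= 1 by rewrite ler01 lexx.
  have d0 : (0 < D %/ k)%N by rewrite divn_gt0; case/andP: kk.
  have := LrP hh (@ltr01 R) d0; rewrite -/(SP h 1 _).
  have e : npw 1 k * npw (- 1) k = 1 by rewrite -npwD // subrr /npw oppr0 powRr0.
  have := npw_divn_le i01 kk; have := g1 k; have : 0 <= npw 1 k by exact: npw_ge0.
  move: e Q0; clear.
  set a := npw 1 k; set a' := npw _ k; set b := npw _ _; set c := npw 1 D; set x := `|g k|.
  set y := `|_ - _| => e Q0 a0 x1 b2 y2.
  apply: le_trans (_ : 1 * a * y <= _).
   by rewrite ler_wpM2r ?normr_ge0 // ler_wpM2r.
  rewrite mul1r; apply: le_trans (ler_wpM2l a0 y2) _.
  have := ler_wpM2l (mulr_ge0 a0 (ltW Q0)) b2.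
  have -> : a * Q * (2 * c * a') = 2 * Q * c * (a * a') by ring.
  by rewrite e; lra.
 rewrite sumr_const_nat subn1 /= -[_ *+ _]mulr_natr -mulrA ler_wpM2l ?mulr_ge0 ?(ltW Q0) //.
 rewrite DU npwM -mulrA [npw 1 U]npw_1 mulVf ?mulr1; last by rewrite pnatr_eq0 -lt0n.
 by rewrite -npw_1 npw1X.
have T2 : `|\sum_(1 <= m < (D %/ U.+1).+1) h m * npw 1 m *
  \sum_(U.+1 <= k < (D %/ m).+1) g k * npw 1 k| <= 18 * Q * w ^+ 7.
 apply: le_trans (ler_norm_sum _ _ _) _.
 apply: le_trans (_ : \sum_(1 <= m < (D %/ U.+1).+1) m%:R^-1 * (2 * Q * npw 1 U) <= _).
  apply: ler_sum => m _; rewrite !normrM [`|npw _ _|]ger0_norm ?npw_ge0 // -npw_1.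
  apply: ler_pM; rewrite ?mulr_ge0 ?npw_ge0 //; first by rewrite ler_piMl ?npw_ge0.
  exact: rbsum_tail.
 rewrite -mulr_suml npw1X.
 have : \sum_(1 <= m < (D %/ U.+1).+1) (m%:R^-1 : R) <= 9 * M%:R.
  have [->|v0] := posnP (D %/ U.+1); first by rewrite big_geq // mulr_ge0.
  apply: le_trans (sum_inv_le R v0) _.
  have vU : (D %/ U.+1 <= U)%N by rewrite -ltnS ltn_divLR // DU; nia.
  have := ler_lnn R v0 vU; have -> : lnn U = 8 * lnn M.
   by rewrite /lnn /U natrX lnXn ?ltr0n // mulr_natl.
  have := @lnn_le_nat R M; move: M1; clear; set a := lnn _; set b := lnn _; lra.
 have p0 : 0 <= 2 * Q * w ^+ 8 by rewrite !mulr_ge0 // ltW.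
 move=> /(ler_wpM2r p0) hs; apply: le_trans hs _.
 have -> : 9 * M%:R * (2 * Q * w ^+ 8) = 18 * Q * w ^+ 7 * (M%:R * w).
  by lra.
 by rewrite divff ?mulr1 // lt0r_neq0 // (lt_le_trans ltr01).
have T3 : `|(SP g 1 U - Lr g 1) * Lr h 1| <= 6 * Q ^+ 2 * w ^+ 8.
 rewrite normrM; apply: le_trans (_ : 2 * Q * w ^+ 8 * (3 * Q) <= _); last by lra.
 apply: ler_pM => //; last exact: Lr_norm_le.
 by rewrite -npw1X; exact: LrP.
set A := \sum_(_ <= _ < U.+1) _; set B := \sum_(_ <= _ < (D %/ _).+1) _ in T2 *.
have -> : A + B - Lr g 1 * Lr h 1 = (A - SP g 1 U * Lr h 1) + B + (SP g 1 U - Lr g 1) * Lr h 1 by ring.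
apply: le_trans (ler_normD _ _) _; apply: le_trans (lerD (ler_normD _ _) (lexx _)) _.
have w8 : w ^+ 8 <= w ^+ 7 by rewrite exprS ler_piMl ?exprn_ge0.
have w70 : 0 <= w ^+ 7 by rewrite exprn_ge0.
move: T1 T2 T3 w8 w70; rewrite -/A.
clear -Q1; set a := `|_|; set b := `|B|; set c := `|_ * _|; set x := w ^+ 8; set y := w ^+ 7.
move=> T1 T2 T3 xy y0.
have h1 : Q <= Q ^+ 2 by rewrite expr2 ler_peMl // (le_trans ler01).
have := ler_wpM2r y0 h1; have := ler_wpM2l (le_trans ler01 Q1) xy.
by have := ler_wpM2l (sqr_ge0 Q) xy; lra.
Qed.

End SiegelZeros.

(** * Siegel's theorem: the effect of one exceptional zero *)

Section Siegel.
Variable R : realType.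
Local Notation npw := (@npw R).

(* The coefficients of zeta L(g1) L(g) L(g g1) are nonnegative and start with 1;
  the zero of L(g1) removes the secondary main term of their partial sums. *)
Lemma Lr1_lower_zero (g1 : nat -> R) (q1 d : R) : rchar g1 -> rbsum g1 q1 -> 1 <= q1 ->
 0 < d <= 1 / 128 -> Lr g1 (1 - d) = 0 -> exists2 c : R, 0 < c &
 forall g q, rchar g -> rbsum g q -> 1 <= q -> rbsum (fun n => g n * g1 n) (q * q1) ->
  c / q `^ (257 * d) <= Lr g 1.
Proof.
move=> hg1 hq1 q11 /andP[d0 d128] L0.
have d01 : 0 < d < 1 by rewrite d0 /=; lra.
have d02 : 0 < d <= 1 / 2 by rewrite d0 /=; lra.
have [z _ hz] := rho_sum d02.
have q10 := ge1_gt0 q11.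
have lam0 := Lr1_gt0 hg1 hq1 q11; set lam1 := Lr g1 1 in lam0.
have [K K0 hK] := ln_powR_le 1 d0.
have [C1 C1E] := ex_named (20 * (q1 / d) + lam1 / d).
have C11 : 1 <= C1.
 rewrite C1E; have : 1 <= q1 / d by rewrite ler_pdivlMr // mul1r (le_trans _ q11); lra.
 have : 0 < lam1 / d by rewrite divr_gt0.
 lra.
have C10 := ge1_gt0 C11.
have X0 : 0 < (101 * C1 * q1) `^ (256 * d) by rewrite powR_gt0 // !mulr_gt0.
have q1d : 0 < q1 `^ d by rewrite powR_gt0.
have c0 : 0 < 2 * C1 * (101 * C1 * q1) `^ (256 * d) * (4 * K * q1 `^ d) by rewrite !mulr_gt0.
exists (2 * C1 * (101 * C1 * q1) `^ (256 * d) * (4 * K * q1 `^ d))^-1; first by rewrite invr_gt0.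
move=> g q hg hq qge1 hqq.
have q0 := ge1_gt0 qge1.
have [Q QE] := ex_named (q * q1).
have Q1 : 1 <= Q by rewrite QE mulr_ege1.
have Q0 := ge1_gt0 Q1.
have hgQ : rbsum g Q by move=> M; apply: le_trans (hq M) _; rewrite QE ler_peMr // ltW.
rewrite -QE in hqq.
have hgg := rchar_mul hg hg1.
set h := (fun n => g n * g1 n) in hqq hgg.
have gle n : `|g n| <= 1 by exact: rchar_norm.
have hle n : `|h n| <= 1 by exact: rchar_norm.
have bsq := rsqb_rconv gle hle hgQ hqq.
(* The scales are [M] about [100 C1 Q], [D = M ^ 16] and [x = M ^ 256]. As [d <= 1/128], the factor
   [X = x ^ d] is at most [M ^ 2] and is absorbed by two powers of [w] in the error terms that carry
   it. In the result [257 d] is [256 d] from [X] plus [d] from the bound for [L(1, g g1)]. *)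
have [M M1 M2] : exists2 M : nat, 100 * (C1 * Q) <= M%:R & M%:R <= 101 * (C1 * Q).
 exists (Num.truncn (100 * (C1 * Q))).+1; first exact/ltW/truncn_gtS.
 have CQ1 : 1 <= C1 * Q by rewrite mulr_ege1.
 rewrite -nat1r; have : (Num.truncn (100 * (C1 * Q)))%:R <= 100 * (C1 * Q).
  by rewrite truncn_le; lra.
 lra.
have M0' : 0 < (M%:R : R) by apply: lt_le_trans M1; rewrite !mulr_gt0.
have M0 : (0 < M)%N by rewrite -(ltr0n R).
have bQ := SP_rconv gle hle hgQ hqq Q1 M0.
set w := M%:R^-1 in bQ.
have w0 : 0 < w by rewrite invr_gt0.
have wM : C1 * Q * w <= 1 / 100.
 by rewrite ler_pdivrMr // ; move: M1; lra.
have w1 : w <= 1 by rewrite invf_le1 // ler1n.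
have [D DE] := ex_named ((M ^ 16)%N).
have [x xE] := ex_named ((D ^ 16)%N).
have D0 : (0 < D)%N by rewrite DE expn_gt0 M0.
have x0 : (0 < x)%N by rewrite xE expn_gt0 D0.
have Dx : (D <= x)%N by rewrite xE -{1}[D]expn1 leq_pexp2l.
rewrite -DE in bQ.
have npwM_ s k : npw (s%:R) (M ^ k) = w ^+ (k * s).
 by rewrite npwX /npw -natrM -powR_mulrn ?invr_ge0 ?ler0n // /w -powR_inv1 ?ler0n // -powRrM mulN1r.
have [X XE] := ex_named (npw (- d) x).
have X1 : 1 <= X by rewrite XE npwN one_le_powR ?ler1n // ltW.
have Xw : X * w ^+ 2 <= 1.
 have -> : w ^+ 2 = npw 2 M by have := npwM_ 2%N 1%N; rewrite expn1 mul1n => <-.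
 rewrite XE xE DE -expnM npwX -npwD // npw_le1 //.
 by move: d128; clear; lra.
pose P y : R := \sum_(1 <= n < y.+1) rconv g1 (fun=> 1) n * npw (1 - d) n.
have hP y : (0 < y)%N -> `|P y - lam1 / d * npw (- d) y| <= 20 * (q1 / d) * npw (1 / 4) y.
 move=> y0; have := hz g1 q1 y hg1 hq1 q11 y0; rewrite L0 mulr0 addr0.
 have -> : lam1 / d * npw (- d) y = Lr g1 1 * (npw (- d) y / d) by rewrite /lam1; ring.
 move=> h1; apply: le_trans h1 _; rewrite ler_wpM2l ?mulr_ge0 ?invr_ge0 ?(ltW d0) ?(ltW q10) //.
 by apply: ler_npw => //; move: d128; clear; lra.
have P0 y : 0 <= P y.
 by rewrite /P big_nat sumr_ge0 // => n /andP[n0 _]; rewrite mulr_ge0 ?npw_ge0 ?rho_ge0.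
have S1 : 1 <= \sum_(1 <= n < x.+1) rconv (rconv g h) (rconv g1 (fun=> 1)) n * npw (1 - d) n.
 rewrite big_nat_recl // npw1 mulr1 !rconv1 mulr1 /h.
 case: (hg) => -> _ _; case: (hg1) => -> _ _; rewrite !mulr1 lerDl big_nat sumr_ge0 // => n _.
 by rewrite mulr_ge0 ?npw_ge0 ?four_ge0.
move: S1; under eq_bigr do rewrite -rconv_npw; rewrite (hyperbola _ _ Dx).
set b := rconv g h in bsq bQ *.
have T2 : `|\sum_(1 <= m < (x %/ D.+1).+1) rconv g1 (fun=> 1) m * npw (1 - d) m *
  \sum_(D.+1 <= k < (x %/ m).+1) b k * npw (1 - d) k| <= 18 * C1 * Q * X * w ^+ 4.
 apply: le_trans (ler_norm_sum _ _ _) _.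
 apply: le_trans (_ : P (x %/ D.+1)%N * (6 * (3 * Q) * npw (1 / 4) D) <= _).
  rewrite /P mulr_suml; apply: ler_sum_nat => m /andP[m0 _].
  rewrite normrM ger0_norm ?mulr_ge0 ?npw_ge0 ?rho_ge0 //.
  rewrite ler_wpM2l ?mulr_ge0 ?npw_ge0 ?rho_ge0 //; apply: rsqb_tail => //.
  by move: d0 d128; clear; lra.
 have -> : npw (1 / 4) D = w ^+ 4.
  rewrite -(npwM_ 4%N 1%N) expn1 DE npwX; congr npw; clear; lra.
 have hPx : P (x %/ D.+1)%N <= C1 * X.
  have [->|v0] := posnP (x %/ D.+1)%N.
   by rewrite /P big_geq // mulr_ge0 ?(ltW C10) // (le_trans ler01).
  have := hP _ v0; rewrite ler_norml => /andP[_].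
  have n1 : npw (1 / 4) (x %/ D.+1) <= 1 by rewrite npw_le1 //; lra.
  have n2 : npw (- d) (x %/ D.+1) <= X.
   rewrite XE !npwN; apply: ler_wpowR; rewrite ?ler0n ?(ltW d0) // ler_nat.
   exact: leq_div.
  have ld : 0 <= lam1 / d by rewrite divr_ge0 // ltW.
  have qd : 0 <= q1 / d by rewrite divr_ge0 // ltW.
  have := ler_wpM2l ld n2; have := ler_wpM2l qd n1; have := ler_wpM2l qd X1.
  rewrite C1E; clear; set l := lam1 / d; set r := q1 / d; set p := P _.
  by set n3 := npw _ _; set n4 := npw _ _; lra.
 apply: le_trans (ler_wpM2r _ hPx) _.
  by rewrite !mulr_ge0 ?exprn_ge0 // ltW.
 by apply: eq_lew; ring.
(* There is no constant term [z] to subtract here: it is multiplied by [Lr g1 (1 - d) = 0] in the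
   sums [P]. *)
pose err k := P (x %/ k)%N - lam1 / d * X * npw d k.
have herr k : (0 < k <= D)%N -> `|b k * npw (1 - d) k * err k| <= k%:R * (2 * C1 * w ^+ 64 * k%:R).
 move=> /andP[k0 kD].
 have kk : (0 < k <= x)%N by rewrite k0 (leq_trans _ Dx).
 have v0 : (0 < x %/ k)%N by rewrite divn_gt0 //; case/andP: kk.
 rewrite !normrM [`|npw _ _|]ger0_norm ?npw_ge0 //.
 apply: ler_pM; rewrite ?mulr_ge0 ?npw_ge0 //.
  rewrite -[k%:R]mulr1; apply: ler_pM; rewrite ?npw_ge0 //; first exact: rconv_norm_le.
  by rewrite npw_le1 //; move: d128; clear; lra.
 have := hP _ v0; have := npw_neg_divn d01 kk; rewrite -XE => a1 a2.
 have a3 : npw (1 / 4) (x %/ k) <= 2 * w ^+ 64 * k%:R.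
  have i01 : 0 <= (1 / 4 : R) <= 1 by clear; lra.
  apply: le_trans (npw_divn_le i01 kk) _.
  have -> : npw (1 / 4) x = w ^+ 64.
   rewrite -(npwM_ 64%N 1%N) expn1 xE DE -expnM npwX; congr npw; clear; lra.
  rewrite (ler_wpM2l (mulr_ge0 (ler0n R 2) (exprn_ge0 64 (ltW w0)))) //.
  by rewrite npwN -[leRHS]powRr1 ?ler0n //; apply: ler_powR; rewrite ?ler1n //; clear; lra.
 have a4 : npw (1 - d) (x %/ k) <= npw (1 / 4) (x %/ k).
  by apply: ler_npw => //; move: d128; clear; lra.
 have -> : err k = (P (x %/ k)%N - lam1 / d * npw (- d) (x %/ k)) +
   lam1 / d * (npw (- d) (x %/ k) - X * npw d k) by rewrite /err; ring.
 apply: le_trans (ler_normD _ _) _; rewrite normrM [`|lam1 / d|]ger0_norm; last first.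
  by rewrite divr_ge0 // ltW.
 have ld : 0 <= lam1 / d by rewrite divr_ge0 // ltW.
 have a5 := ler_wpM2l ld a1.
 have e5 : lam1 / d * (d * npw (1 - d) (x %/ k)) <= lam1 / d * npw (1 - d) (x %/ k).
  by rewrite ler_wpM2l // ler_piMl ?npw_ge0 // ltW //; case/andP: d01.
 have a6 := ler_wpM2l ld a4.
 apply: le_trans (_ : C1 * npw (1 / 4) (x %/ k) <= _).
  rewrite C1E mulrDl; apply: lerD => //.
  exact: le_trans a5 (le_trans e5 a6).
 by have := ler_wpM2l (ltW C10) a3; clear; set p := npw _ _; lra.
have T1 : \sum_(1 <= k < D.+1) b k * npw (1 - d) k * P (x %/ k)%N =
  lam1 / d * X * SP b 1 D + \sum_(1 <= k < D.+1) b k * npw (1 - d) k * err k.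
 rewrite /SP mulr_sumr -big_split /=; apply: eq_big_nat => k /andP[k0 _].
 have -> : npw 1 k = npw (1 - d) k * npw d k by rewrite -npwD // subrK.
 by rewrite /err; ring.
have E1 : `|\sum_(1 <= k < D.+1) b k * npw (1 - d) k * err k| <= 2 * C1 * w ^+ 16.
 apply: le_trans (ler_norm_sum _ _ _) _.
 apply: le_trans (_ : \sum_(1 <= k < D.+1) D%:R * (2 * C1 * w ^+ 64 * D%:R) <= _).
  apply: ler_sum_nat => k /andP[k0 kD].
  apply: le_trans (herr k _) _; first by rewrite k0.
  have kD' : (k%:R : R) <= D%:R by rewrite ler_nat -ltnS.
  have p0 := mulr_ge0 (mulr_ge0 (ler0n R 2) (ltW C10)) (exprn_ge0 64 (ltW w0)).
  apply: ler_pM; [exact: ler0n|by rewrite (mulr_ge0 p0) ?ler0n|by []|].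
  exact: ler_wpM2l.
 rewrite sumr_const_nat subn1 /= -[_ *+ _]mulr_natr.
 have eD : D%:R * w ^+ 16 = 1.
  by rewrite DE natrX -exprMn divff ?expr1n // lt0r_neq0.
 have -> : D%:R * (2 * C1 * w ^+ 64 * D%:R) * D%:R = 2 * C1 * w ^+ 16 * (D%:R * w ^+ 16) ^+ 3.
  have -> : w ^+ 64 = (w ^+ 16) ^+ 4 by rewrite -exprM.
  by clear; set v := w ^+ 16; set D' := D%:R; ring.
 by rewrite eD expr1n mulr1.
rewrite T1; move: E1 T2 bQ.
set E := \sum_(_ <= _ < D.+1) _; set F := \sum_(_ <= _ < _) _; set S := SP b 1 D => E1 T2 bQ S1.
have lamg : 0 < Lr g 1 by exact: Lr1_gt0 hg hq qge1.
have L' := Lr1_norm_le hle hqq Q1; set l' := Lr h 1 in bQ L'; set lam := Lr g 1 in bQ lamg *.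
have hl' : `|l'| <= 4 * K * Q `^ d by have := hK _ Q1; rewrite expr1; move: L'; clear; lra.
have C1X : 0 <= C1 * X by rewrite mulr_ge0 ?(ltW C10) // (le_trans ler01).
have X0' := le_trans ler01 X1.
have main : 1 / 2 <= C1 * X * (lam * `|l'|).
 have s1 : lam1 / d * X * S <= C1 * X * (lam * `|l'| + 28 * Q ^+ 2 * w ^+ 7).
  apply: le_trans (ler_norm _) _; rewrite normrM; apply: ler_pM => //.
   rewrite ger0_norm ?mulr_ge0 ?invr_ge0 ?(ltW lam0) ?(ltW d0) ?(le_trans ler01 X1) //.
   rewrite ler_wpM2r ?(le_trans ler01) // C1E lerDr.
   by rewrite !mulr_ge0 ?invr_ge0 // ltW.
  have -> : S = (S - lam * l') + lam * l' by ring.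
  apply: le_trans (ler_normD _ _) _; rewrite addrC; apply: lerD => //.
  by rewrite normrM (ger0_norm (ltW lamg)).
 have e1 : C1 * X * (28 * Q ^+ 2 * w ^+ 7) <= 28 / 10000.
  have -> : C1 * X * (28 * Q ^+ 2 * w ^+ 7) = 28 * ((X * w ^+ 2) * (C1 * Q * w) * (Q * w) * w ^+ 3).
   by ring.
  have a1 : Q * w <= 1 / 100.
   by apply: le_trans wM; rewrite -mulrA ler_peMl // mulr_ge0 // ltW.
  have a2 : w ^+ 3 <= 1 by rewrite exprn_ile1 // ltW.
  have n1 : 0 <= X * w ^+ 2 by rewrite (mulr_ge0 X0') ?exprn_ge0 // ltW.
  have n2 : 0 <= C1 * Q * w by rewrite !mulr_ge0 // ltW.
  have n3 : 0 <= Q * w by rewrite !mulr_ge0 // ltW.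
  have -> : 28 / 10000 = 28 * (1 * (1 / 100) * (1 / 100) * 1) :> R by clear; lra.
  have n4 := ler_pM n1 n2 Xw wM.
  have n5 := ler_pM (mulr_ge0 n1 n2) n3 n4 a1.
  have n6 : 0 <= w ^+ 3 by rewrite exprn_ge0 // ltW.
  by rewrite ler_wpM2l // (ler_pM (mulr_ge0 (mulr_ge0 n1 n2) n3) n6).
 have e2 : 2 * C1 * w ^+ 16 <= 2 / 100.
  have a1 : C1 * w <= 1 / 100.
   by apply: le_trans wM; rewrite mulrAC ler_peMr // mulr_ge0 // ltW.
  have a2 : w ^+ 15 <= 1 by rewrite exprn_ile1 // ltW.
  have n1 : 0 <= C1 * w by rewrite mulr_ge0 // ltW.
  have := ler_wpM2l n1 a2; have -> : 2 * C1 * w ^+ 16 = 2 * (C1 * w * w ^+ 15) by rewrite [w ^+ 16]exprS; ring.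
  by move: a1; clear; set y := _ * w ^+ 15; set v := C1 * w; lra.
 have e3 : 18 * C1 * Q * X * w ^+ 4 <= 18 / 100.
  have -> : 18 * C1 * Q * X * w ^+ 4 = 18 * ((X * w ^+ 2) * (C1 * Q * w) * w) by ring.
  have n1 : 0 <= X * w ^+ 2 by rewrite (mulr_ge0 X0') ?exprn_ge0 // ltW.
  have n2 : 0 <= C1 * Q * w by rewrite !mulr_ge0 // ltW.
  have -> : 18 / 100 = 18 * (1 * (1 / 100) * 1) :> R by clear; lra.
  have n4 := ler_pM n1 n2 Xw wM.
  by rewrite ler_wpM2l // (ler_pM (mulr_ge0 n1 n2) (ltW w0)).
 move: E1 T2 s1 S1 e1 e2 e3 (ler_norm E) (ler_norm F); clear; rewrite mulrDr.
 set a := C1 * X * _; set c := C1 * X * _; set e := `|E|; set f := `|F|; set s := _ * S.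
 by set u := 2 * C1 * _; set v := 18 * C1 * _ * _ * _; lra.
have hX : X <= (101 * C1 * q1) `^ (256 * d) * q `^ (256 * d).
 rewrite -powRM ?mulr_ge0 ?(ltW q0) ?(ltW C10) ?(ltW q10) //.
 rewrite XE xE DE -expnM npwX mulrN npwN; apply: ler_wpowR; rewrite ?ler0n ?mulr_ge0 ?(ltW d0) //.
 by move: M2; rewrite QE; clear; lra.
have hl2 : `|l'| <= 4 * K * q1 `^ d * q `^ d.
 by apply: le_trans hl' _; rewrite QE powRM ?(ltW q0) ?(ltW q10) // [q `^ d * _]mulrC mulrA.
have -> : q `^ (257 * d) = q `^ (256 * d) * q `^ d.
 rewrite -powRD; last by rewrite (lt0r_neq0 q0) implybT.
 by congr powR; ring.
have Y0 : 0 < q `^ (256 * d) * q `^ d by rewrite mulr_gt0 ?powR_gt0.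
have k1 : 0 <= C1 * lam by rewrite mulr_ge0 // ltW.
have := ler_wpM2l k1 (ler_pM X0' (normr_ge0 l') hX hl2).
rewrite ler_pdivrMr // -[_^-1]mul1r ler_pdivrMr //.
move: main; clear; set y1 := _ `^ (256 * d); set y2 := q `^ (256 * d).
by set y3 := q1 `^ d; set y4 := q `^ d; set l := `|l'|; lra.
Qed.

End Siegel.

(** * Siegel's theorem for a family of real characters *)

Section SiegelFamily.
Variable R : realType.
Local Notation npw := (@npw R).
Local Notation C := R[i].

(** Abstracts the family of real primitive characters: two members coincide, or their product is
    non-principal, which is expressed by bounded partial sums. The number [q] plays the part of the
    conductor. *)
Definition siegel_family (F : (nat -> R) -> R -> Prop) :=
 (forall g q, F g q -> [/\ rchar g, rbsum g q & 1 <= q]) /\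
 (forall g q h r, F g q -> F h r -> (forall n, (0 < n)%N -> g n = h n) \/
   rbsum (fun n => g n * h n) (q * r)).

Lemma le_div_powR (c q e f : R) : 0 <= c -> 1 <= q -> e <= f -> c / q `^ f <= c / q `^ e.
Proof.
move=> c0 q1 ef; rewrite ler_wpM2l // lef_pV2 ?posrE ?powR_gt0 ?(lt_le_trans ltr01) //.
exact: ler_powR.
Qed.

(** The ineffective alternative. If no member has a negative value at [1 - d], the bound for the
    non-negative case applies to all of them. Otherwise one member with a zero in [[1 - d, 1]] is
    fixed once and for all; its zero bounds all other members, and its own positive value at 1 goes
    into the constant. *)
Lemma siegel_Lr F (e : R) : siegel_family F -> 0 < e -> exists2 c : R, 0 < c &
 forall g q, F g q -> c / q `^ e <= Lr g 1.
Proof.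
move=> [hF hFF] e0.
have [d dE] := ex_named (Num.min (e / 257) (1 / 128)).
have d0 : 0 < d by rewrite dE lt_min (divr_gt0 e0) ?ltr0n // (divr_gt0 ltr01) // ltr0n.
have de : d <= e / 257 by rewrite dE ge_min lexx.
have {}de : 257 * d <= e by lra.
have d128 : d <= 1 / 128 by rewrite dE ge_min lexx orbT.
have [hall|] := pselect (forall g q, F g q -> 0 <= Lr g (1 - d)).
 have d4 : 0 < d <= 1 / 4 by lra.
 have [c c0 hc] := Lr1_lower_nonneg d4; exists c => // g q Fg.
 have [hg hq q1] := hF _ _ Fg.
 apply: le_trans (hc g q hg hq q1 (hall _ _ Fg)); apply: le_div_powR; rewrite ?(ltW c0) //.
 by move: de d0; clear; lra.
move=> /existsNP[g1 /existsNP[q1 /not_implyP[Fg1 /negP]]]; rewrite -ltNge => L1.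
have [hg1 hq1 q11] := hF _ _ Fg1.
have Lp := Lr1_gt0 hg1 hq1 q11.
have [b /andP[b1 b2] Lb] : exists2 b, 1 - d <= b <= 1 & Lr g1 b = 0.
 apply: (@IVT_modulus R (Lr g1)); rewrite ?(ltW L1) ?(ltW Lp) //; first by rewrite gerBl ltW.
 move=> x x0; have g1le n : `|g1 n| <= 1 by exact: rchar_norm.
 have [y y0 hy] := Lr_modulus hq1 g1le x0; exists y => // s t s1 t1; apply: hy.
  by move: s1 d128; clear; lra.
 by move: t1 d128; clear; lra.
have b1' : b != 1 by apply/eqP => be; rewrite be in Lb; rewrite Lb ltxx in Lp.
have d1 : 0 < 1 - b <= 1 / 128.
 have : b < 1 by rewrite lt_neqAle b1'.
 by move: b1 d128; clear; lra.
have Lb' : Lr g1 (1 - (1 - b)) = 0 by rewrite opprB addrC subrK.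
have [c c0 hc] := Lr1_lower_zero hg1 hq1 q11 d1 Lb'.
exists (Num.min c (Lr g1 1)); first by rewrite lt_min c0.
move=> g q Fg; have [hg hq qge1] := hF _ _ Fg.
have qe : 0 < q `^ e by rewrite powR_gt0 // (lt_le_trans ltr01).
have [eqg|hgg] := hFF _ _ _ _ Fg Fg1.
 rewrite (eq_Lr _ eqg) ler_pdivrMr //; apply: le_trans (_ : Lr g1 1 * 1 <= _).
  by rewrite mulr1 ge_min lexx orbT.
 by rewrite ler_wpM2l ?(ltW Lp) // one_le_powR // ltW.
apply: le_trans (_ : c / q `^ e <= _).
 by rewrite ler_wpM2r ?invr_ge0 ?(ltW qe) // ge_min lexx.
apply: le_trans (hc g q hg hq qge1 hgg); apply: le_div_powR; rewrite ?(ltW c0) //.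
by move: de b1; clear; lra.
Qed.

Lemma DS_Lr (g : nat -> R) (q s : R) : (forall n, `|g n| <= 1) -> rbsum g q -> 1 < s ->
 DS (fun n => (g n)%:C%C) s = (Lr g s)%:C%C.
Proof.
move=> g1 hq s1; apply: dsumE => e e0; have s0 : 0 < s by lra.
have q0 := rbsum_ge0 hq; have K0 : 0 < 2 * q + 1 by lra.
have [N N0 hN] := npw_small s0 (divr_gt0 e0 K0).
exists N.+1 => -[//|M] NM; have := hN M NM; rewrite ler_pdivlMr // => h.
have M0 : (0 < M)%N by rewrite -ltnS (leq_trans _ NM).
have := LrP hq s0 M0.
have -> : \sum_(1 <= n < M.+1) wt s (fun n => (g n)%:C%C) n = (SP g s M)%:C%C.
 by rewrite /SP rmorph_sum; apply: eq_bigr => n _; rewrite /wt rmorphM.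
rewrite -rmorphB normcR => h'; apply: le_trans h' _; apply: le_trans h.
by rewrite mulrC ler_wpM2l ?npw_ge0 // lerDl.
Qed.

Lemma rsum_bsum (g : nat -> R) q : rbsum g q -> bsum (fun n => (g n)%:C%C) q.
Proof. by move=> h M; rewrite -rmorph_sum normcR; exact: h. Qed.

(** The series [zeta * L(g)] has non-negative coefficients and first coefficient 1, and
    [zeta s <= 2 / (s - 1)]. *)
Lemma zeta_Lr_ge1 (g : nat -> R) (q s : R) : rchar g -> rbsum g q -> 1 < s <= 2 ->
 (s - 1) / 2 <= normc (DS (fun n => (g n)%:C%C) s).
Proof.
move=> hg hq /andP[s1 s2]; set f := fun n => (g n)%:C%C; pose one := fun _ : nat => 1 : C.
have fle n : (0 < n)%N -> normc (f n) <= 1 by move=> _; rewrite normcR rchar_norm.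
have sf : smb s f by exact: smb_bounded fle.
have so : smb s one by apply: (smb_bounded (B := 1)) => // n _; rewrite normc1.
have h1 : 1 <= normc (DS (dconv f one) s).
 apply: le_trans (_ : complex.Re (DS (dconv f one) s) <= _); last first.
  exact: le_trans (ler_norm _) (Re_le_normc _).
 have [B hB] := smb0 (smb_dconv sf so).
 rewrite leNgt; apply/negP => h.
 have e0 : 0 < (1 - complex.Re (DS (dconv f one) s)) / 2 by lra.
 have [N0 hN] := dsum_tends hB e0.
 have {hN} := hN (maxn N0 2) (leq_maxl _ _).
 have := leq_maxr N0 2; set N := maxn _ _; case: N => // N N2 h2.
 have := le_trans (ler_norm _) (le_trans (Re_le_normc _) h2).
 have -> : \sum_(1 <= n < N.+1) wt s (dconv f one) n =
   (\sum_(1 <= n < N.+1) rconv g (fun=> 1) n * npw s n)%:C%C.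
  rewrite rmorph_sum; apply: eq_bigr => n _; rewrite /wt rmorphM /dconv /rconv rmorph_sum.
  by congr (_ * _); apply: eq_bigr => k _; rewrite rmorphM.
 rewrite raddfB /= -/(DS _ s); have := rho_sum_ge1 s hg N2; move: h; clear.
 by lra.
rewrite DS_dconv // normcM in h1.
have s12 : 1 < s <= 2 by rewrite s1.
have := normc_zeta_le s12; rewrite -/one => hz.
have d0 : 0 < s - 1 by lra.
have := le_trans h1 (ler_wpM2l (normc_ge0 _) hz).
by rewrite mulrA ler_pdivlMr //; clear; lra.
Qed.

(** Near 1 the Lipschitz bound carries Siegel's bound over from the point 1; farther away
    [zeta_Lr_ge1] is enough. The ranges meet where [s - 1] is about [q ^ (-e)]. *)
Lemma siegel_DS F (e : R) : siegel_family F -> 0 < e -> exists2 c : R, 0 < c &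
 forall g q s, F g q -> 1 < s <= 2 -> c / q `^ e <= normc (DS (fun n => (g n)%:C%C) s).
Proof.
move=> FF e0; have e4 : 0 < e / 4 by rewrite divr_gt0.
have [c c0 hc] := siegel_Lr FF e4; have [K K0 hK] := DS_lipschitz e4.
pose K1 := 2 * K + c + 1.
have K10 : 0 < K1 by rewrite /K1; lra.
exists (Num.min (c / 2) ((c / (4 * K1)) ^+ 2 / 2)).
 by rewrite lt_min !divr_gt0 ?exprn_gt0 ?divr_gt0 ?mulr_gt0.
move=> g q s Fg s12; have [s1 s2] := andP s12.
have [hg hq q1] := FF.1 _ _ Fg; have q0 := ge1_gt0 q1.
have gle n : `|g n| <= 1 by exact: rchar_norm.
set f := fun n => (g n)%:C%C.
have fle n : (0 < n)%N -> normc (f n) <= 1 by move=> _; rewrite normcR.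
have qe : 0 < q `^ (e / 4) by rewrite powR_gt0.
have dist : normc (DS f s - (Lr g 1)%:C%C) <= 2 * K * q `^ (e / 4) * (s - 1) `^ (7 / 8).
 (* [DS_lipschitz] compares points to the right of 1. The point 1 itself is reached through a nearby
    [t > 1] and the continuity of [Lr g]. *)
 apply/ler_addgt0Pr => x x0.
 have [y y0 hy] := Lr_modulus hq gle x0.
 pose t := 1 + Num.min ((s - 1) / 2) y.
 have m0 : 0 < Num.min ((s - 1) / 2) y by rewrite lt_min y0 andbT divr_gt0 // subr_gt0.
 have m1 : Num.min ((s - 1) / 2) y <= (s - 1) / 2 by rewrite ge_min lexx.
 have t1 : 1 < t by rewrite /t ltrDl.
 have ts : t < s by move: m1; rewrite /t; lra.
 have := @hK f q 1 s t 0 s12 _ _ q1 _ _ _ _.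
 have -> : DS (tw 0 f) t = DS f t by apply: eq_DS => n _; rewrite /tw nit0 mulr1.
 rewrite normr0 addr0 => h.
 have -> : DS f s - (Lr g 1)%:C%C = (DS f s - DS f t) + (DS f t - (Lr g 1)%:C%C) by ring.
 apply: le_trans (le_normcD _ _) _; apply: lerD; last first.
  rewrite (DS_Lr gle hq t1) -rmorphB normcR; apply: hy; rewrite /t; try lra.
  rewrite addrAC subrr add0r ger0_norm ?(ltW m0) //; by rewrite ge_min lexx orbT.
 have st0 : 0 < s - t by rewrite subr_gt0.
 rewrite (ger0_norm (ltW st0)) in h.
 apply: le_trans (h _ _ _ _ _ _) _.
 - by rewrite t1 /=; lra.
 - by rewrite st0 /=; lra.
 - exact: sqb_bounded (rsum_bsum hq).
 - exact: hdb_bounded.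
 - exact: smb_bounded fle.
 - exact: smb_bounded fle.
 have -> : 1 + 1 = 2 :> R by lra.
 rewrite [K * 2]mulrC ler_wpM2l ?mulr_ge0 ?(ltW K0) ?(ltW qe) //.
 by apply: ler_wpowR; lra.
have L1 := hc g q Fg.
have qe2 : q `^ e = (q `^ (e / 4)) ^+ 4.
 by rewrite -powR_mulrn ?(ltW qe) // -powRrM; congr powR; field.
have qp1 : 1 <= q `^ (e / 4) by rewrite one_le_powR // ltW.
rewrite qe2; move: qe qp1 dist L1; move: (q `^ (e / 4)) => p p0 p1 dist L1.
have [hs|hs] := leP ((c / (4 * K1)) ^+ 2 / p ^+ 4) (s - 1).
 apply: le_trans (zeta_Lr_ge1 hg hq s12).
 have := ler_wpM2r (ltW (exprn_gt0 4 (_ : 0 < p^-1))) ((_ : Num.min (c / 2) ((c / (4 * K1)) ^+ 2 / 2) <= (c / (4 * K1)) ^+ 2 / 2)).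
 rewrite invr_gt0 ge_min lexx orbT exprVn => /(_ p0 isT) h; apply: le_trans h _.
 by move: hs; clear; set a := _ ^+ 2; set b := _^-1; lra.
have sm : (s - 1) `^ (7 / 8) <= c / (4 * K1) / p ^+ 2.
 have cK : 0 < c / (4 * K1) by rewrite divr_gt0 ?mulr_gt0.
 have cK1 : c / (4 * K1) <= 1 by rewrite ler_pdivrMr ?mulr_gt0 // /K1; lra.
 have x1 : 0 < c / (4 * K1) / p ^+ 2 by rewrite divr_gt0 ?exprn_gt0.
 have x2 : c / (4 * K1) / p ^+ 2 <= 1.
  by rewrite ler_pdivrMr ?exprn_gt0 // mul1r (le_trans cK1) // exprn_ege1.
 apply: le_trans (_ : ((c / (4 * K1) / p ^+ 2) ^+ 2) `^ (7 / 8) <= _).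
  apply: ler_wpowR; rewrite ?divr_ge0 //; first by lra.
  by apply: le_trans (ltW hs) _; rewrite [leRHS]exprMn exprVn -exprM.
 move: x1 x2; clear; set y := _ / p ^+ 2 => x1 x2.
 rewrite -powR_mulrn ?(ltW x1) // -powRrM -[leRHS](@lnK R) ?posrE // /powR gt_eqF //.
 by rewrite ler_expR; have := ln_le0 x2; lra.
have h2 : normc (DS f s - (Lr g 1)%:C%C) <= c / 2 / p.
 apply: le_trans dist _; apply: le_trans (ler_wpM2l _ sm) _.
  by rewrite !mulr_ge0 // ltW.
 have -> : 2 * K * p * (c / (4 * K1) / p ^+ 2) = (c / 2 / p) * (K / K1).
  by field; rewrite !lt0r_neq0.
 rewrite ler_piMr ?divr_ge0 ?(ltW c0) ?(ltW p0) // ler_pdivrMr // mul1r /K1.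
 by move: K0 c0; clear; lra.
have h3 := ler_normcB (Lr g 1)%:C%C (DS f s).
rewrite normc_distC normcR in h3.
apply: le_trans (_ : c / 2 / p <= _).
 apply: ler_pM; rewrite ?invr_ge0 ?exprn_ge0 ?(ltW p0) ?le_min ?divr_ge0 ?exprn_ge0 ?(ltW c0) //.
 - by rewrite divr_ge0 ?mulr_ge0 // ltW.
 - by rewrite ge_min lexx.
 by rewrite lef_pV2 ?posrE ?exprn_gt0 // exprS ler_peMr ?(ltW p0) // exprn_ege1.
have L0 : 0 < Lr g 1 by exact: Lr1_gt0 hg hq q1.
rewrite (ger0_norm (ltW L0)) in h3.
move: h2 h3 L1; clear; set a := normc _; set b := normc _.
have -> : c / 2 / p = c / p / 2 by ring.
by set x := c / p; lra.
Qed.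

End SiegelFamily.

(** * A discrete Fejer kernel *)

Section Fejer.
Variable R : realType.
Local Notation C := R[i].

Lemma cos_ge_sqr (y : R) : 1 - y ^+ 2 / 2 <= cos y.
Proof.
have := normc_expiB1_sqr y; rewrite normc2E /= oppr0 addr0 => h1.
have : normc (expi y - 1) ^+ 2 <= y ^+ 2.
 rewrite -[leRHS]real_normK ?num_real //; apply: lerXn2r; rewrite ?nnegrE ?normc_ge0 //.
 exact: normc_expiB1.
rewrite normc2E /= oppr0 addr0; have := cos2Dsin2 y; clear; lra.
Qed.

Lemma sin_ge_cube (x : R) : 0 <= x -> x - x ^+ 3 / 6 <= sin x.
Proof.
move=> x0; have [->|xn0] := eqVneq x 0; first by rewrite sin0 expr0n mul0r subrr.
have xp : 0 < x by lra.
pose f := fun z : R => sin z - z + z ^+ 3 / 6.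
have hd : {in `]0, x[, forall y : R, is_derive y 1 f (cos y - 1 + y ^+ 2 / 2)}.
 by move=> y _; apply: is_derive_eq; rewrite !scaler0 add0r /GRing.scale /=; field.
have [|c _] := MVT xp hd; first by apply: derivable_within_continuous => y _.
rewrite /f sin0 expr0n mul0r !subr0 addr0 subr0 => e.
have := mulr_ge0 (_ : 0 <= cos c - 1 + c ^+ 2 / 2) x0; rewrite -e.
have -> : 0 <= cos c - 1 + c ^+ 2 / 2 by have := cos_ge_sqr c; lra.
by lra.
Qed.

Lemma norm_sin_ge (x : R) : `|x| <= 21 / 10 -> `|x| / 4 <= `|sin x|.
Proof.
wlog x0 : x / 0 <= x.
 move=> h; case: (leP 0 x) => [/h|/ltW]; first exact.
 by rewrite -oppr_ge0 => /h; rewrite sinN !normrN.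
rewrite (ger0_norm x0) => x2; apply: le_trans (ler_norm _).
apply: le_trans (sin_ge_cube x0).
have : x ^+ 2 <= (21 / 10) ^+ 2 by apply: lerXn2r; rewrite ?nnegrE; lra.
move=> /(ler_wpM2l x0); rewrite -exprS; lra.
Qed.

Lemma normc_expiB1_lower (x : R) : `|x| <= 42 / 10 -> `|x| / 4 <= normc (expi x - 1).
Proof.
move=> hx; rewrite -(ler_pXn2r (n := 2)) ?nnegrE ?normc_ge0 //.
rewrite normc_expiB1_sqr; have h : `|x / 2| <= 21 / 10.
 by rewrite normrM [`|2^-1|]ger0_norm; lra.
have := norm_sin_ge h; rewrite normrM [`|2^-1|]ger0_norm // => h2.
have : (`|x| / 2 / 4) ^+ 2 <= `|sin (x / 2)| ^+ 2.
 by apply: lerXn2r; rewrite ?nnegrE.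
rewrite [`|sin _| ^+ 2]real_normK ?num_real; lra.
Qed.

Lemma expi_2pin (n : nat) : expi (2 * pi * n%:R) = 1 :> C.
Proof.
rewrite mulrC expiMn; have -> : expi (2 * pi) = 1 :> C.
 by rewrite /expi [2 * pi]mulr_natl cos2pi sin2pi.
by rewrite expr1n.
Qed.

Lemma expi_2pi_neq1 (r : R) : 0 < r < 1 -> expi (2 * pi * r) != 1 :> C.
Proof.
move=> /andP[r0 r1]; rewrite -subr_eq0 -normc_gt0 -(ltr_pXn2r (n := 2)) ?nnegrE ?normc_ge0 //.
rewrite expr0n normc_expiB1_sqr; have -> : 2 * pi * r / 2 = pi * r :> R by field.
rewrite mulr_gt0 // exprn_gt0 // sin_gt0_pi // mulr_gt0 ?pi_gt0 //=.
by rewrite -[ltRHS]mulr1 ltr_pM2l ?pi_gt0.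
Qed.

Lemma sum_geo_root (z : C) M : z ^+ M = 1 -> z != 1 -> \sum_(j < M) z ^+ j = 0.
Proof.
move=> zM z1; have := subrX1 z M; rewrite zM subrr => /esym/eqP.
by rewrite mulf_eq0 subr_eq0 (negPf z1) => /eqP.
Qed.

Lemma sum_geo_bound (z : C) M : normc z = 1 -> normc (\sum_(j < M) z ^+ j) * normc (z - 1) <= 2.
Proof.
move=> z1; rewrite -normcM mulrC -subrX1; apply: le_trans (normcB_le _ _) _.
by rewrite normcX z1 expr1n normc1 -[2]/(1 + 1).
Qed.

Lemma conjc_sum (I : Type) (r : seq I) (P : pred I) (F : I -> C) :
 conjc (\sum_(i <- r | P i) F i) = \sum_(i <- r | P i) conjc (F i).
Proof. by apply: (big_morph (@conjc R)); [exact: rmorphD|exact: rmorph0]. Qed.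

Lemma realcM (x y : R) : (x * y)%:C%C = x%:C%C * y%:C%C :> C.
Proof. exact: rmorphM. Qed.

Lemma realc_sum (I : Type) (r : seq I) (P : pred I) (F : I -> R) :
 (\sum_(i <- r | P i) F i)%:C%C = \sum_(i <- r | P i) (F i)%:C%C :> C.
Proof. exact: rmorph_sum. Qed.

Lemma realc_nat n : n%:R%:C%C = n%:R :> C.
Proof. exact: rmorph_nat. Qed.

(** Normalised to be 1 at [u = 0]. Its frequencies are multiples of [d] of modulus below [M * d],
    and its period is [2 pi / d]. *)
Definition fejer (d : R) (M : nat) (u : R) : R :=
 normc (\sum_(j < M) expi (j%:R * (d * u))) ^+ 2 / M%:R ^+ 2.

Lemma fejer_ge0 d M u : 0 <= fejer d M u.
Proof. by rewrite divr_ge0 ?exprn_ge0 ?normc_ge0. Qed.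

Lemma fejerN d M u : fejer d M (- u) = fejer d M u.
Proof.
rewrite /fejer; congr (_ ^+ 2 / _); rewrite -[RHS]normc_conj conjc_sum; congr normc.
by apply: eq_bigr => j _; rewrite conj_expi !mulrN.
Qed.

Lemma fejer_expand d M u : (fejer d M u)%:C%C =
 \sum_(j < M) \sum_(l < M) (M%:R ^- 2)%:C%C * expi ((j%:R - l%:R) * (d * u)) :> C.
Proof.
rewrite /fejer realcM -mulc_conj conjc_sum mulr_suml mulr_suml; apply: eq_bigr => j _.
rewrite mulr_sumr mulr_suml; apply: eq_bigr => l _.
by rewrite conj_expi -expiD mulrC; congr (_ * expi _); ring.
Qed.

(** The geometric sum is at most [2 / |exp (i d u) - 1|]. The range [|d u| <= 42 / 10] covers a half
    period with some room and stays below [2 pi], where the kernel would rise again. *)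
Lemma fejer_tail d M u : (0 < M)%N -> 0 < d -> u != 0 -> `|d * u| <= 42 / 10 ->
 fejer d M u <= 64 / (M%:R * d * u) ^+ 2.
Proof.
move=> M0 d0 u0 hu; have M0' : 0 < (M%:R : R) by rewrite ltr0n.
have up : 0 < `|d * u| by rewrite normr_gt0 mulf_neq0 // lt0r_neq0.
have h1 := normc_expiB1_lower hu.
have h2 := @sum_geo_bound (expi (d * u)) M (normc_expi _).
have h3 : normc (\sum_(j < M) expi (j%:R * (d * u))) <= 8 / `|d * u|.
 rewrite ler_pdivlMr //; under eq_bigr do rewrite expiMn.
 have := ler_wpM2l (normc_ge0 (\sum_(j < M) expi (d * u) ^+ j)) h1; move: h2.
 by clear; set a := normc _; set b := normc _; lra.
have -> : 64 / (M%:R * d * u) ^+ 2 = 64 / (d * u) ^+ 2 / M%:R ^+ 2.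
 by lra.
rewrite ler_wpM2r //.
apply: le_trans (_ : (8 / `|d * u|) ^+ 2 <= _).
 by apply: lerXn2r; rewrite ?nnegrE ?normc_ge0 // divr_ge0.
by rewrite exprMn exprVn real_normK ?num_real //; lra.
Qed.

(** The translates form a partition of unity: in the expanded square, summation over the shifts
    turns every off-diagonal pair into a complete sum of roots of unity, which vanishes. *)
Lemma fejer_parseval d M (u h : R) : (0 < M)%N -> d * h * M%:R = 2 * pi ->
 \sum_(m < M) fejer d M (u - m%:R * h) = 1.
Proof.
move=> M0 dh; have M0' : (M%:R : R) != 0 by rewrite pnatr_eq0 -lt0n.
apply: (@complexI R); rewrite realc_sum; under eq_bigr do rewrite fejer_expand.
rewrite exchange_big /=; under eq_bigr do rewrite exchange_big /=.
have dhE : d * h = 2 * pi / M%:R by rewrite -dh mulfK.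
have inner (j l : 'I_M) : \sum_(m < M) (M%:R ^- 2)%:C%C * expi ((j%:R - l%:R) * (d * (u - m%:R * h))) =
  if l == j then (M%:R^-1)%:C%C else 0 :> C.
 have [->|lj] := eqVneq l j.
  under eq_bigr do rewrite subrr mul0r expi0 mulr1.
  rewrite sumr_const card_ord -[_ *+ M]mulr_natr -realc_nat -realcM.
  by congr (_%:C%C); field.
 rewrite -mulr_sumr; have e (m : 'I_M) : expi ((j%:R - l%:R) * (d * (u - m%:R * h))) =
   expi ((j%:R - l%:R) * (d * u)) * (expi (- ((j%:R - l%:R) * (d * h)))) ^+ m :> C.
  by rewrite -expiMn -expiD; congr expi; ring.
 under eq_bigr do rewrite e; rewrite -mulr_sumr sum_geo_root ?mulr0 //.
  rewrite -expiMn dhE; have -> : M%:R * - ((j%:R - l%:R) * (2 * pi / M%:R)) =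
    2 * pi * l%:R - 2 * pi * j%:R :> R by field.
  by rewrite expiD expi_2pin mul1r -conj_expi expi_2pin rmorph1.
 clear e; wlog lj' : j l lj / (l < j)%N.
  move=> H; case: (ltngtP l j) => [/H|jl|/val_inj eq]; first by apply.
   have := H l j _ jl; rewrite eq_sym lj => /(_ isT).
   apply: contraNneq => e1; rewrite -[expi _]conjcK conj_expi opprK.
   have -> : (l%:R - j%:R) * (d * h) = - ((j%:R - l%:R) * (d * h)) by ring.
   by rewrite e1 rmorph1.
  by rewrite eq eqxx in lj.
 apply/negP => /eqP/(congr1 (@conjc R)); rewrite conj_expi opprK rmorph1 => /eqP.
 rewrite dhE; have -> : (j%:R - l%:R) * (2 * pi / M%:R) = 2 * pi * ((j - l)%N%:R / M%:R) :> R.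
  by rewrite natrB ?(ltnW lj'); ring.
 apply/negP/expi_2pi_neq1; rewrite divr_gt0 ?ltr0n ?subn_gt0 //=.
 rewrite ltr_pdivrMr ?ltr0n // mul1r ltr_nat (leq_ltn_trans (leq_subr _ _)) //.
transitivity (\sum_(j < M) (M%:R^-1)%:C%C : C).
 apply: eq_bigr => j _; rewrite (bigD1 j) //= inner eqxx big1 ?addr0 // => l lj.
 by rewrite inner (negPf lj).
by rewrite sumr_const card_ord -[_ *+ M]mulr_natr -realc_nat -realcM mulVf.
Qed.

(** The first term plus an integral; consecutive points [x < x'] satisfy
    [1 / x' ^ 2 <= (1 / x - 1 / x') / h], which telescopes. *)
Lemma sum_arith_inv2 (x0 h r : R) M : 0 < h -> 0 < r ->
 \sum_(0 <= i < M | r <= x0 + i%:R * h) ((x0 + i%:R * h) ^+ 2)^-1 <= (r ^+ 2)^-1 + (h * r)^-1.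
Proof.
move=> h0 r0; set x := fun i : nat => x0 + i%:R * h.
have xS i : x i.+1 = x i + h by rewrite /x -natr1; ring.
have rr : 0 < (r ^+ 2)^-1 by rewrite invr_gt0 exprn_gt0.
have hr : 0 < (h * r)^-1 by rewrite invr_gt0 mulr_gt0.
case: M => [|M]; first by rewrite big_geq // addr_ge0 // ltW.
suff [H1 H2] : (x M < r -> \sum_(0 <= i < M.+1 | r <= x i) (x i ^+ 2)^-1 = 0) /\
  (r <= x M -> \sum_(0 <= i < M.+1 | r <= x i) (x i ^+ 2)^-1 <=
   (r ^+ 2)^-1 + (h * r)^-1 - (h * x M)^-1).
 have [h3|/H1 ->] := leP r (x M); last by lra.
 apply: le_trans (H2 h3) _; rewrite gerBl invr_ge0 mulr_ge0 ?(ltW h0) //.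
 exact: le_trans (ltW r0) h3.
have inv_le a : r <= a -> (a ^+ 2)^-1 <= (r ^+ 2)^-1 /\ (h * a)^-1 <= (h * r)^-1.
 move=> ra; have a0 := lt_le_trans r0 ra; split.
  by rewrite lef_pV2 ?posrE ?exprn_gt0 //; apply: lerXn2r; rewrite ?nnegrE ?(ltW r0) ?(ltW a0).
 by rewrite lef_pV2 ?posrE ?mulr_gt0 // ler_pM2l.
elim: M => [|M [IH1 IH2]].
 rewrite big_mkcond big_nat1; split=> [|ra]; first by rewrite ltNge => /negPf ->.
 by rewrite ra; have [] := inv_le _ ra; move: hr; clear; lra.
rewrite big_mkcond big_nat_recr //= -big_mkcond; split=> [hx|ra].
 rewrite leNgt hx addr0 IH1 //; apply: lt_trans hx; by rewrite xS ltrDl.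
rewrite ra; have [i1 i2] := inv_le _ ra; have [hM|hM] := leP r (x M); last first.
 rewrite IH1 // add0r; move: i1 i2; clear; lra.
have := IH2 hM; have xM0 := lt_le_trans r0 hM; have xM1 := lt_le_trans r0 ra.
have : (x M.+1 ^+ 2)^-1 <= (h * x M)^-1 - (h * x M.+1)^-1.
 have -> : (h * x M)^-1 - (h * x M.+1)^-1 = (x M * x M.+1)^-1.
  by rewrite xS; field; rewrite -xS !lt0r_neq0.
 by rewrite lef_pV2 ?posrE ?mulr_gt0 // expr2 ler_pM2r // xS lerDl ltW.
by lra.
Qed.

End Fejer.

(** * A Tauberian theorem with a sharp cut *)

Section FejerTauber.
Variable R : realType.
Local Notation C := R[i].
Local Notation lnn := (@lnn R).
Implicit Types a : nat -> C.

(** The expanded kernel is a mean of [M ^ 2] functions [n ^ (-it)] with [|t| <= M d], up to factors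
    of norm 1. *)
Lemma fejer_window a (A B d v : R) M : absum a A -> (0 < M)%N ->
 (forall t, `|t| <= M%:R * d -> normc (dsum (tw t a)) <= B) -> 0 < d ->
 normc (dsum (fun n => a n * (fejer d M (lnn n - v))%:C%C)) <= B.
Proof.
move=> hA M0 hB d0; have M0' : 0 < (M%:R : R) by rewrite ltr0n.
pose c (j l : 'I_M) : C := (M%:R ^- 2)%:C%C * expi (- ((j%:R - l%:R) * (d * v))).
pose b (j l : 'I_M) (n : nat) : C := c j l * tw (- ((j%:R - l%:R) * d)) a n.
have hb j l : exists A', absum (b j l) A'.
 exists (normc (c j l) * A); apply: absumZ; apply: absum_le hA => n _; by rewrite normc_tw.
have e n : a n * (fejer d M (lnn n - v))%:C%C = \sum_(j < M) \sum_(l < M) b j l n.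
 rewrite fejer_expand mulr_sumr; apply: eq_bigr => j _; rewrite mulr_sumr; apply: eq_bigr => l _.
 rewrite /b /c /tw /nit; have -> : expi ((j%:R - l%:R) * (d * (lnn n - v))) =
   expi (- ((j%:R - l%:R) * (d * v))) * expi (- (- ((j%:R - l%:R) * d) * lnn n)) :> C.
  by rewrite -expiD; congr expi; ring.
 by set e1 := expi _; set e2 := expi _; ring.
rewrite (eq_dsum (fun n _ => e n)).
have [_ ->] := dsum_sum (index_enum 'I_M) (fun j => (dsum_sum (index_enum 'I_M) (hb j)).1).
apply: le_trans (normc_sum _ _ _) _.
apply: le_trans (_ : \sum_(j < M) \sum_(l < M) M%:R ^- 2 * B <= _); last first.
 rewrite !sumr_const !card_ord -mulrnA -[_ *+ (M * M)]mulr_natr natrM.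
 by have -> : M%:R ^- 2 * B * (M%:R * M%:R) = B by field; rewrite lt0r_neq0.
apply: ler_sum => j _; have [_ ->] := dsum_sum (index_enum 'I_M) (hb j).
apply: le_trans (normc_sum _ _ _) _; apply: ler_sum => l _.
rewrite /b (@dsumZ _ _ _ A); last by apply: absum_le hA => n _; rewrite normc_tw.
rewrite normcM normcM normc_expi mulr1 normcR_ge0 // ler_wpM2l //; apply: hB.
rewrite normrN normrM (ger0_norm (ltW d0)) ler_wpM2r ?(ltW d0) //.
have h1 : (j%:R : R) <= M%:R by rewrite ler_nat ltnW.
have h2 : (l%:R : R) <= M%:R by rewrite ler_nat ltnW.
by rewrite ler_norml; have := ler0n R j; have := ler0n R l; move: h1 h2; clear; lra.
Qed.

(** Kernel mass of the centres lying at least [1 / s] above [u]: at distance [x] the kernel is at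
    most [64 / (T x) ^ 2], the centres are [2 pi / T] apart, and [T = s ^ 2] makes the sum of order
    [1 / s]. *)
Lemma fejer_up (d h T s u : R) m (P : pred nat) : 1 <= s -> T = s ^+ 2 -> 0 < d ->
 (2 * m).+1%:R * d = T -> h * T = 2 * pi ->
 (forall i, (i < (2 * m).+1)%N -> P i -> s^-1 <= (i%:R - m%:R) * h - u) ->
 (forall i, (i < (2 * m).+1)%N -> `|d * (u - (i%:R - m%:R) * h)| <= 42 / 10) ->
 \sum_(0 <= i < (2 * m).+1 | P i) fejer d (2 * m).+1 (u - (i%:R - m%:R) * h) <= 128 / s.
Proof.
move=> s1 TE d0 Md hT hP hd; set M := (2 * m).+1.
have s0 := ge1_gt0 s1; have si0 : 0 < s^-1 by rewrite invr_gt0.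
have T0 : 0 < T by rewrite TE exprn_gt0.
have h0 : 0 < h by rewrite -(pmulr_lgt0 _ T0) hT mulr_gt0 ?pi_gt0.
pose x i : R := - m%:R * h - u + i%:R * h.
have xE i : (i%:R - m%:R) * h - u = x i by rewrite /x; ring.
apply: le_trans (_ : 64 / T ^+ 2 * \sum_(0 <= i < M | s^-1 <= x i) (x i ^+ 2)^-1 <= _).
 rewrite mulr_sumr big_mkcond [leRHS]big_mkcond; apply: ler_sum_nat => i /andP[_ iM].
 case: ifPn => [Pi|_]; last first.
  by case: ifP => // _; rewrite mulr_ge0 ?invr_ge0 ?sqr_ge0 // divr_ge0 // sqr_ge0.
 have hx := hP i iM Pi; rewrite xE in hx; rewrite hx.
 have x0 := lt_le_trans si0 hx.
 rewrite -fejerN opprB xE.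
 have := @fejer_tail R d M (x i) isT d0 (lt0r_neq0 x0) _.
 rewrite -xE -[X in d * X]opprB mulrN normrN => /(_ (hd i iM)) h1; apply: le_trans h1 _.
 by rewrite Md exprMn invfM mulrA.
have := @sum_arith_inv2 R (- m%:R * h - u) h s^-1 M h0 si0.
have pos : 0 <= 64 / T ^+ 2 by rewrite divr_ge0 ?sqr_ge0.
move=> /(ler_wpM2l pos) h1; apply: le_trans h1 _.
have e1 : (s^-1 ^+ 2)^-1 = T by rewrite exprVn invrK TE.
have e2 : (h * s^-1)^-1 <= T * s.
 rewrite invfM invrK ler_wpM2r ?(ltW s0) //.
 rewrite -[T]mul1r -ler_pdivrMr // -invfM hT invf_le1 ?mulr_gt0 ?pi_gt0 //.
 by have := pi_ge2 R; lra.
apply: le_trans (_ : 64 / T ^+ 2 * (T + T * s) <= _).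
 by rewrite ler_wpM2l // e1 lerD2l.
have -> : 64 / T ^+ 2 * (T + T * s) = 64 / s * (s^-1 + 1).
 by rewrite TE; field; rewrite lt0r_neq0.
have -> : 128 / s = 64 / s * 2 by ring.
rewrite ler_wpM2l ?divr_ge0 ?(ltW s0) //.
by have : s^-1 <= 1 by [rewrite invf_le1]; lra.
Qed.

Lemma fejer_down (d h T s u : R) m (P : pred nat) : 1 <= s -> T = s ^+ 2 -> 0 < d ->
 (2 * m).+1%:R * d = T -> h * T = 2 * pi ->
 (forall i, (i < (2 * m).+1)%N -> P i -> s^-1 <= u - (i%:R - m%:R) * h) ->
 (forall i, (i < (2 * m).+1)%N -> `|d * (u - (i%:R - m%:R) * h)| <= 42 / 10) ->
 \sum_(0 <= i < (2 * m).+1 | P i) fejer d (2 * m).+1 (u - (i%:R - m%:R) * h) <= 128 / s.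
Proof.
move=> s1 TE d0 Md hT hP hd; rewrite big_nat_rev /= add0n.
have rE i : (i < (2 * m).+1)%N -> ((2 * m).+1 - i.+1)%:R - m%:R = - (i%:R - m%:R) :> R.
 by rewrite ltnS => im; rewrite subSS natrB // natrM; ring.
have e i : (i < (2 * m).+1)%N -> u - (((2 * m).+1 - i.+1)%:R - m%:R) * h = - (- u - (i%:R - m%:R) * h).
 by move=> im; rewrite rE //; ring.
rewrite big_nat_cond; under eq_bigr => i /andP[/andP[_ im] _] do rewrite e // fejerN.
rewrite -big_nat_cond.
apply: (@fejer_up d h T s (- u) m (fun i => P ((2 * m).+1 - i.+1)%N)) => // i im.
 move=> /hP; rewrite e // subSS ltnS leq_subr => /(_ isT).
 by lra.
have := hd ((2 * m).+1 - i.+1)%N; rewrite e // subSS ltnS leq_subr => /(_ isT).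
by rewrite mulrN normrN.
Qed.

(** The cut [n <= y] is replaced by [H n], the sum of the kernel translates centred between
    [- m0 h <= -1] and [ln y]. There are at most [3 T (1 + ln y)] of them, each costing [B]. Where
    [ln n] is at least [1 / s] away from [ln y], the partition of unity shows that [H] differs from
    the indicator by at most [256 / s]; in the remaining window the trivial bound [S] is used. *)
Lemma fejer_tauber a (A B T S : R) y : absum a A -> 1 <= T -> (0 < y)%N ->
 (forall t, `|t| <= T -> normc (dsum (tw t a)) <= B) ->
 (forall N, \sum_(1 <= n < N | `|lnn n - lnn y| < (Num.sqrt T)^-1) normc (a n) <= S) ->
 normc (\sum_(1 <= n < y.+1) a n) <= 3 * T * (1 + lnn y) * B + 256 * A / Num.sqrt T + S.
Proof.
move=> hA T1 y0 hB hS; set s := Num.sqrt T in hS *.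
have T0 := ge1_gt0 T1.
have TE : T = s ^+ 2 by rewrite sqr_sqrtr // ltW.
have s1 : 1 <= s by rewrite -sqrtr1 ler_wsqrtr.
have s0 := ge1_gt0 s1; have si0 : 0 < s^-1 by rewrite invr_gt0.
have si1 : s^-1 <= 1 by rewrite invf_le1.
have A0 : 0 <= A by apply: le_trans (hA 0%N); rewrite big_geq.
have B0 : 0 <= B by apply: le_trans (hB 0 _); rewrite ?normc_ge0 // normr0 ltW.
have ly := @lnn_ge0 R y.
have p0 := pi_gt0 R; have p2 := pi_ge2 R.
have p4 : pi <= 4 :> R by have /andP[_] := pihalf_02 R; lra.
apply/ler_addgt0Pr => e e0; have [N0 hN0] := absum_tail hA e0.
pose N := maxn N0 y.+1; have N1 : (0 < N)%N by rewrite leq_max orbT.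
pose h : R := 2 * pi / T.
have h0 : 0 < h by rewrite divr_gt0 ?mulr_gt0.
have hT : h * T = 2 * pi by rewrite /h mulfVK // lt0r_neq0.
have hi : h^-1 <= T / 4.
 rewrite /h invf_div ler_pM2l // lef_pV2 ?posrE ?mulr_gt0 //; move: p2; clear; lra.
pose m0 := (Num.truncn h^-1).+1; pose m1 := (Num.truncn (lnn y / h)).+1.
have m0h : 1 <= m0%:R * h by rewrite -ler_pdivrMr // mul1r; exact/ltW/truncn_gtS.
have m1h : lnn y <= m1%:R * h by rewrite -ler_pdivrMr //; exact/ltW/truncn_gtS.
have m1h' : (m1%:R - 1) * h <= lnn y.
 rewrite -ler_pdivlMr // /m1 -natr1 addrK truncn_le //; by rewrite divr_ge0 // ltW.
have m0m1 : m0%:R + m1%:R <= 3 * T * (1 + lnn y).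
 have t1 : (Num.truncn h^-1)%:R <= h^-1 by rewrite truncn_le // invr_ge0 ltW.
 have t2 : (Num.truncn (lnn y / h))%:R <= lnn y / h by rewrite truncn_le // divr_ge0 // ltW.
 rewrite /m0 /m1 -!natr1.
 have := ler_wpM2l ly hi; have := mulr_ge0 (ltW T0) ly; move: t1 t2 hi T1 ly; clear.
 by set a1 := _%:R; set a2 := _%:R; lra.
(* The period [2 pi / d] grows with [M = 2 m + 1]; [m] is so large that no [ln n] with [n < N] comes
   near the next period. The bounds [d * ln N <= 1/5] and [d * m * h <= pi <= 4] add up to
   [42 / 10]. *)
have [m [mm0 mm1 mL]] : exists m : nat, [/\ (m0 <= m)%N, (m1 <= m)%N & 5 * T * lnn N <= (2 * m).+1%:R].
 exists (m0 + m1 + (Num.truncn (5 * T * lnn N)).+1)%N; split; first by rewrite -addnA leq_addr.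
  by rewrite addnAC leq_addl.
 apply: le_trans (ltW (truncn_gtS _)) _; rewrite ler_nat.
 by move: (m0) (m1) (Num.truncn _); clear => b1 b2 b3; lia.
pose M := (2 * m).+1; have M0 : 0 < (M%:R : R) by rewrite ltr0n.
pose d := T / M%:R; have d0 : 0 < d by rewrite divr_gt0.
have Md : M%:R * d = T by rewrite /d mulrC divfK // lt0r_neq0.
pose v i : R := (i%:R - m%:R) * h.
have hd n i : (0 < n < N)%N -> (i < M)%N -> `|d * (lnn n - v i)| <= 42 / 10.
 move=> /andP[n0 nN] iM; rewrite normrM (ger0_norm (ltW d0)).
 have ln := @lnn_ge0 R n; have lnN := ler_lnn R n0 (ltnW nN).
 have vb : `|v i| <= m%:R * h.
  rewrite /v normrM (ger0_norm (ltW h0)) ler_wpM2r ?(ltW h0) // ler_norml.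
  have : (i%:R : R) <= (2 * m)%:R by rewrite ler_nat -ltnS.
  by rewrite natrM; have := ler0n R i; lra.
 have b1 : `|lnn n - v i| <= lnn N + m%:R * h.
  by apply: le_trans (ler_normB _ _) _; rewrite (ger0_norm ln) lerD.
 apply: le_trans (ler_wpM2l (ltW d0) b1) _; rewrite mulrDr.
 have b2 : d * lnn N <= 1 / 5.
  by rewrite /d mulrAC ler_pdivrMr //; move: mL; rewrite -/M; clear; lra.
 have b3 : d * (m%:R * h) <= 4.
  have -> : d * (m%:R * h) = 2 * m%:R * pi / M%:R.
   by rewrite -[_ * pi]mulrAC -hT /d; ring.
  rewrite ler_pdivrMr //; have : 2 * m%:R <= (M%:R : R) by rewrite -natrM ler_nat.
  by have := ler0n R m; move: p0 p4; clear; set a := m%:R; set b := M%:R; nra.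
 by move: b2 b3; clear; lra.
pose i0 := (m - m0)%N; pose i1 := (m + m1)%N.
have i1M : (i1 < M)%N by rewrite /i1 /M ltnS mul2n -addnn leq_add2l.
have i01 : (i0 <= i1)%N by rewrite /i0 /i1 (leq_trans (leq_subr _ _)) ?leq_addr.
have fE n i : fejer d M (lnn n - v i) = fejer d M (lnn n - (i%:R - m%:R) * h) by [].
pose H n : R := \sum_(i0 <= i < i1) fejer d M (lnn n - v i).
have full n : \sum_(0 <= i < M) fejer d M (lnn n - v i) = 1.
 rewrite big_mkord -(@fejer_parseval R d M (lnn n + m%:R * h) h) //; last first.
  by rewrite mulrAC [d * _]mulrC Md mulrC.
 by apply: eq_bigr => i _; congr fejer; rewrite /v; ring.
have split n : 1 = \sum_(0 <= i < i0) fejer d M (lnn n - v i) + H n +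
  \sum_(i1 <= i < M) fejer d M (lnn n - v i).
 rewrite -(full n) (big_cat_nat _ (n := i1)) //=; last exact: ltnW.
 by rewrite (big_cat_nat _ (n := i0) (p := i1)).
have pos n j k : 0 <= \sum_(j <= i < k) fejer d M (lnn n - v i).
 by apply: sumr_ge0 => i _; exact: fejer_ge0.
have H0 n : 0 <= H n by exact: pos.
have H1 n : H n <= 1.
 by have := split n; have := pos n 0%N i0; have := pos n i1 M; clear; lra.
have subP n (P : pred nat) j k : (k <= M)%N -> (forall i, (j <= i < k)%N -> P i) ->
  \sum_(j <= i < k) fejer d M (lnn n - v i) <= \sum_(0 <= i < M | P i) fejer d M (lnn n - v i).
 move=> kM hP; have [jk|jk] := leqP j k; last first.
  by rewrite big_geq ?(ltnW jk) // sumr_ge0 // => i _; exact: fejer_ge0.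
 rewrite [leRHS]big_mkcond (big_cat_nat _ (n := j)) ?(leq_trans jk) //=.
 rewrite [in leRHS](big_cat_nat _ (m := j) (n := k)) //=.
 have nn l r : 0 <= \sum_(l <= i < r) (if P i then fejer d M (lnn n - v i) else 0).
  by apply: sumr_ge0 => i _; case: ifP => // _; exact: fejer_ge0.
 rewrite -[leLHS]add0r lerD // -[leLHS]addr0 lerD //.
 by apply: ler_sum_nat => i ik; rewrite hP.
have low n : (0 < n < N)%N -> lnn n <= lnn y - s^-1 -> 1 - H n <= 256 / s.
 move=> nN hn.
 have a1 : \sum_(0 <= i < i0) fejer d M (lnn n - v i) <= 128 / s.
  apply: le_trans (subP n (fun i => (i < i0)%N) 0%N i0 _ _) _.
  - by rewrite (leq_trans i01) // ltnW.
  - by move=> i /andP[].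
  apply: (@fejer_down d h T s) => // i iM; last exact: hd.
  rewrite /i0 => ii; have : i%:R + m0%:R <= m%:R :> R.
   by rewrite -natrD ler_nat; move: (m0) ii; clear => b1; lia.
  move=> im; have : (i%:R - m%:R) * h <= - m0%:R * h by rewrite ler_wpM2r ?(ltW h0) //; move: im; clear; lra.
  by have := @lnn_ge0 R n; move: m0h si1; clear; lra.
 have a2 : \sum_(i1 <= i < M) fejer d M (lnn n - v i) <= 128 / s.
  apply: le_trans (subP n (fun i => (i1 <= i)%N) i1 M _ _) _ => //.
   by move=> i /andP[].
  apply: (@fejer_up d h T s) => // i iM; last exact: hd.
  rewrite /i1 => ii; have im : m%:R + m1%:R <= i%:R :> R by rewrite -natrD ler_nat.
  have : m1%:R * h <= (i%:R - m%:R) * h by rewrite ler_wpM2r ?(ltW h0) //; move: im; clear; lra.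
  by move: m1h hn; clear; lra.
 by have := split n; move: a1 a2; clear; set b1 := \sum_(_ <= _ < _) _; set b2 := \sum_(_ <= _ < _) _; lra.
have high n : (0 < n < N)%N -> lnn y + s^-1 <= lnn n -> H n <= 256 / s.
 move=> nN hn; apply: le_trans (_ : 128 / s <= _); last by rewrite ler_wpM2r ?(ltW si0) //; lra.
 apply: le_trans (subP n (fun i => (i < i1)%N) i0 i1 _ _) _.
 - exact: ltnW.
 - by move=> i /andP[].
 apply: (@fejer_down d h T s) => // i iM; last exact: hd.
 rewrite /i1 => ii; have im : i%:R + 1 <= m%:R + m1%:R :> R by rewrite natr1 -natrD ler_nat.
 have : (i%:R - m%:R) * h <= (m1%:R - 1) * h by rewrite ler_wpM2r ?(ltW h0) //; move: im; clear; lra.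
 by move: m1h' hn; clear; lra.
pose aH n := a n * (H n)%:C%C.
have habs : absum aH A.
 apply: absum_le hA => n _; rewrite normcM normcR_ge0 //.
 by rewrite ler_piMr ?normc_ge0.
have W : normc (dsum aH) <= (m0%:R + m1%:R) * B.
 pose b i n := a n * (fejer d M (lnn n - v i))%:C%C.
 have fle1 n i : (i < M)%N -> fejer d M (lnn n - v i) <= 1.
  move=> iM; rewrite -(full n) (bigD1_seq i) ?iota_uniq ?mem_index_iota //= lerDl.
  by apply: sumr_ge0 => j _; exact: fejer_ge0.
 have hb i : exists A', absum (if (i < M)%N then b i else fun=> 0) A'.
  case: ifP => [iM|_]; last by exists 0 => k; rewrite big1 // => j _; rewrite normc0.
  exists A; apply: absum_le hA => n _; rewrite normcM normcR_ge0 ?fejer_ge0 //.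
  by rewrite ler_piMr ?normc_ge0 ?fle1.
 have [_ e2] := dsum_sum (index_iota i0 i1) hb.
 have -> : dsum aH = dsum (fun n => \sum_(i <- index_iota i0 i1) (if (i < M)%N then b i else fun=> 0) n).
  apply: eq_dsum => n _; rewrite /aH /H realc_sum mulr_sumr; apply: eq_big_nat => i /andP[_ ii].
  by rewrite (ltn_trans ii).
 rewrite e2; apply: le_trans (normc_sum _ _ _) _.
 apply: le_trans (_ : \sum_(i0 <= i < i1) B <= _).
  apply: ler_sum_nat => i /andP[_ ii]; rewrite (ltn_trans ii) //.
  by apply: (fejer_window (A := A)) => // t; rewrite Md; exact: hB.
 rewrite sumr_const_nat -[B *+ _]mulr_natl ler_wpM2r // -natrD ler_nat /i1 /i0.
 by move: (m0) (m1) mm0; clear => b1 b2; lia.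
have tl : normc (dsum aH - \sum_(1 <= n < N) aH n) <= e.
 apply: (normc_dsum_head_tail habs) => // K NK; apply: le_trans (normc_sum _ _ _) _.
 apply: le_trans (hN0 N K (leq_maxl _ _)); apply: ler_sum => n _.
 by rewrite normcM normcR_ge0 // ler_piMr ?normc_ge0.
have yN : (y < N)%N by rewrite leq_max ltnSn orbT.
have main : normc (\sum_(1 <= n < y.+1) a n - \sum_(1 <= n < N) aH n) <= 256 * A / s + S.
 have -> : \sum_(1 <= n < y.+1) a n = \sum_(1 <= n < N) (if (n <= y)%N then a n else 0).
  rewrite [RHS](big_cat_nat _ (n := y.+1)) //=.
  have -> : \sum_(y.+1 <= n < N) (if (n <= y)%N then a n else 0) = 0.
   by rewrite big_nat_cond big1 // => n /andP[/andP[yn _] _]; rewrite leqNgt yn.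
  by rewrite addr0; apply: eq_big_nat => n /andP[_ ny]; rewrite -ltnS ny.
 rewrite -sumrB; apply: le_trans (normc_sum _ _ _) _.
 apply: le_trans (_ : \sum_(1 <= n < N) (256 / s * normc (a n) +
   if `|lnn n - lnn y| < s^-1 then normc (a n) else 0) <= _); last first.
  rewrite big_split /= -mulr_sumr -big_mkcond lerD //.
  by have := hA N; have := divr_ge0 (ler0n R 256) (ltW s0); clear; move=> c0 /(ler_wpM2l c0); lra.
 apply: ler_sum_nat => n nN.
 have an := normc_ge0 (a n).
 have c0 := mulr_ge0 (divr_ge0 (ler0n R 256) (ltW s0)) an.
 have -> : (if (n <= y)%N then a n else 0) - aH n =
   a n * ((if (n <= y)%N then 1 else 0) - H n)%:C%C.
  by rewrite /aH rmorphB mulrBr; case: ifP => _; rewrite ?mulr1 ?rmorph0 ?mulr0.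
 rewrite normcM normcR; have [near|far] := boolP (`|lnn n - lnn y| < s^-1).
  rewrite -[leLHS]add0r; apply: lerD => //; rewrite ler_piMr //.
  by case: ifP => _; rewrite ler_norml; have := H0 n; have := H1 n; clear; lra.
 rewrite addr0 mulrC ler_wpM2r //; rewrite -leNgt in far.
 case/andP: (nN) => n0 _; case: ifPn => [ny|]; last rewrite -ltnNge => yn.
  have l := ler_lnn R n0 ny; rewrite ler0_norm ?subr_le0 // in far.
  by rewrite ger0_norm ?subr_ge0 //; apply: low => //; move: far; clear; lra.
 have l := ler_lnn R y0 (ltnW yn); rewrite ger0_norm ?subr_ge0 // in far.
 by rewrite sub0r normrN ger0_norm //; apply: high => //; move: far; clear; lra.
have -> : \sum_(1 <= n < y.+1) a n = (\sum_(1 <= n < y.+1) a n - \sum_(1 <= n < N) aH n) -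
  (dsum aH - \sum_(1 <= n < N) aH n) + dsum aH by ring.
apply: le_trans (le_normcD _ _) _; apply: le_trans (lerD (normcB_le _ _) (lexx _)) _.
have := ler_wpM2r B0 m0m1; move: W tl main; clear.
by set b1 := normc _; set b2 := normc _; set b3 := normc _; lra.
Qed.

End FejerTauber.

(** * Removing the weights *)

Section TauberSum.
Variable R : realType.
Local Notation C := R[i].
Local Notation lnn := (@lnn R).
Local Notation npw := (@npw R).

Lemma abel_head (c w : nat -> C) N M : (N <= M)%N ->
 \sum_(N.+1 <= n < M.+1) c n * w n = (\sum_(N.+1 <= n < M.+1) c n) * w M +
 \sum_(N.+1 <= n < M) (\sum_(N.+1 <= m < n.+1) c m) * (w n - w n.+1).
Proof.
elim: M => [|M IH]; first by rewrite leqn0 => /eqP ->; rewrite !big_geq // mul0r addr0.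
rewrite leq_eqVlt => /orP[/eqP ->|]; first by rewrite !big_geq // mul0r addr0.
rewrite ltnS => NM; rewrite big_nat_recr //= IH // [in RHS]big_nat_recr //=.
case: (leqP M N) => [MN|MN].
 by rewrite !(big_geq (m := N.+1) (n := M.+1)) ?ltnS // !(big_geq (m := N.+1) (n := M)) ?mul0r ?add0r ?addr0 // (leq_trans MN).
rewrite [X in _ = _ + X]big_nat_recr //=.
by set S1 := \sum_(_ <= _ < M.+1) _; set S2 := \sum_(_ <= _ < M) _; ring.
Qed.

(** A monotone weight with values in [[0, W]] has total variation at most [W]; the boundary term
    contributes the second [E * W]. *)
Lemma abel_monotone (c : nat -> C) (w : nat -> R) (E W : R) N M : 0 <= W -> (N <= M)%N ->
 (forall u, (N <= u <= M)%N -> normc (\sum_(N.+1 <= n < u.+1) c n) <= E) ->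
 (forall n, (N < n <= M)%N -> 0 <= w n <= W) ->
 (forall n, (N < n < M)%N -> w n <= w n.+1) \/ (forall n, (N < n < M)%N -> w n.+1 <= w n) ->
 normc (\sum_(N.+1 <= n < M.+1) c n * (w n)%:C%C) <= 2 * E * W.
Proof.
move=> W0; rewrite leq_eqVlt => /orP[/eqP -> hE hw _|NM hE hw mono].
 have E0 : 0 <= E by apply: le_trans (hE M _); rewrite ?normc_ge0 ?leqnn.
 by rewrite big_geq // normc0 mulr_ge0 // mulr_ge0.
rewrite abel_head ?(ltnW NM) //; apply: le_trans (le_normcD _ _) _.
have E0 : 0 <= E by apply: le_trans (hE N _); rewrite ?normc_ge0 // leqnn ltnW.
have M0 : 0 <= w M <= W by apply: hw; rewrite NM leqnn.
have N0 : 0 <= w N.+1 <= W by apply: hw; rewrite ltnSn.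
rewrite normcM normcR_ge0; last by case/andP: M0.
apply: le_trans (_ : E * w M + E * `|w N.+1 - w M| <= _); last first.
 rewrite -mulrDr -mulrA mulrCA ler_wpM2l //.
 case/andP: M0 => a1 a2; case/andP: N0 => a3 a4; have [h|h] := leP (w N.+1) (w M).
  by rewrite ler0_norm ?subr_le0 //; move: a1 a2 a3 a4 h; clear; lra.
 by rewrite gtr0_norm ?subr_gt0 //; move: a1 a2 a3 a4 h; clear; lra.
apply: lerD.
 by rewrite ler_wpM2r ?(andP M0).1 //; apply: hE; rewrite leqnn ltnW.
apply: le_trans (normc_sum _ _ _) _.
apply: le_trans (_ : \sum_(N.+1 <= n < M) E * `|w n - w n.+1| <= _).
 apply: ler_sum_nat => n /andP[nN nM]; rewrite normcM -rmorphB normcR ler_wpM2r //.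
 by apply: hE; rewrite (ltnW nN) ltnW.
rewrite -mulr_sumr ler_wpM2l //.
have tele : \sum_(N.+1 <= n < M) (w n - w n.+1) = w N.+1 - w M.
 by rewrite -[LHS]opprK -sumrN (eq_bigr (fun n => w n.+1 - w n)) ?telescope_sumr // ?opprB // => n _; rewrite opprB.
case: mono => mono.
 rewrite -tele -normrN -sumrN ger0_norm; last first.
  by rewrite big_nat sumr_ge0 // => n hn; rewrite opprB subr_ge0 mono.
 apply: ler_sum_nat => n hn; rewrite opprB distrC ger0_norm // subr_ge0; exact: mono.
rewrite -tele ger0_norm; last first.
 by rewrite big_nat sumr_ge0 // => n hn; rewrite subr_ge0 mono.
apply: ler_sum_nat => n hn; rewrite ger0_norm // subr_ge0; exact: mono.
Qed.

Lemma expR1_le4 : expR 1 <= 4 :> R.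
Proof.
have h := expR_ge1Dx (- (1 / 2) : R); rewrite expRN in h.
have e0 := expR_gt0 (1 / 2 : R).
have h2 : expR (1 / 2) <= 2 :> R.
 have := ler_wpM2r (ltW e0) h; rewrite mulVf ?lt0r_neq0 //; clear; lra.
have -> : 1 = 1 / 2 + 1 / 2 :> R by lra.
by rewrite expRD; move: h2 e0; clear; set a := expR _; nra.
Qed.

(** [1 / n] is compared with the increment of [ln n], clipped to a slightly larger window so that
    the sum telescopes. The margin [8 / y] allows for the step that enters the window. *)
Lemma window_sum_inv (r : R) y N : 0 < r <= 1 -> (0 < y)%N ->
 \sum_(1 <= n < N | `|lnn n - lnn y| < r) (n%:R^-1 : R) <= 2 * r + 20 / y%:R.
Proof.
move=> /andP[r0 r1] y0; have y0' : 0 < (y%:R : R) by rewrite ltr0n.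
have yi : 0 < (y%:R^-1 : R) by rewrite invr_gt0.
have near n : (0 < n)%N -> `|lnn n - lnn y| < r -> (n%:R^-1 : R) <= 4 / y%:R.
 move=> n0; rewrite ltr_norml => /andP[h _]; have n0' : 0 < (n%:R : R) by rewrite ltr0n.
 rewrite ler_pdivlMr // mulrC ler_pdivrMr //.
 have : lnn y <= 1 + lnn n by move: h r1; clear; lra.
 rewrite -ler_expR expRD /lnn !lnK ?posrE // => h2; apply: le_trans h2 _.
 by rewrite ler_wpM2r ?ler0n // expR1_le4.
pose r' := r + 8 / y%:R; have r'0 : 0 < r' by rewrite addr_gt0 // divr_gt0.
pose phi n : R := Num.max (lnn y - r') (Num.min (lnn n) (lnn y + r')).
have phi_mono n : phi n <= phi n.+1.
 have : lnn n <= lnn n.+1.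
  by case: n => [|n]; [rewrite lnn1 /lnn ln0|exact: ler_lnn].
 rewrite /phi => h; rewrite ge_max le_max lexx /= le_max; apply/orP; right.
 by rewrite le_min !ge_min h lexx orbT.
have step n : (0 < n)%N -> `|lnn n.+1 - lnn y| < r -> n.+1%:R^-1 <= phi n.+1 - phi n.
 move=> n0 h; have d1 := lnnS_sub_ge R n0; have d2 := lnnS_sub R n0.
 have := near _ (ltn0Sn n) h; move: h; rewrite ltr_norml => /andP[h1 h2] h3.
 have n2 : (n%:R^-1 : R) <= 2 * n.+1%:R^-1.
  rewrite -[leLHS]mul1r ler_pdivrMr ?ltr0n // mulrAC ler_pdivlMr ?ltr0n // mul1r.
  by rewrite -natrM ler_nat mul2n -addnn -addn1 leq_add2l.
 have e1 : phi n.+1 = lnn n.+1.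
  rewrite /phi min_l ?max_r //.
   by move: h1 yi; rewrite /r'; clear; set a := _^-1; lra.
  by move: h2 yi; rewrite /r'; clear; set a := _^-1; lra.
 have e2 : phi n <= lnn n.
  rewrite /phi ge_max ge_min lexx andbT.
  by move: h1 yi d2 n2 h3; rewrite /r'; clear; set a := _^-1; set b := _^-1; set c := _^-1; lra.
 by rewrite e1; move: d1 e2; clear; set b := _^-1; lra.
case: N => [|N]; first by rewrite big_geq // addr_ge0 ?mulr_ge0 ?divr_ge0 // ltW.
case: N => [|N]; first by rewrite big_geq // addr_ge0 ?mulr_ge0 ?divr_ge0 // ltW.
rewrite big_mkcond big_ltn //=.
apply: le_trans (_ : 4 / y%:R + \sum_(1 <= n < N.+1) (phi n.+1 - phi n) <= _).
 apply: lerD; last first.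
  rewrite big_add1 /=; apply: ler_sum_nat => n /andP[n0 _]; case: ifP => h; first exact: step.
  by rewrite subr_ge0.
 by case: ifP => h; [exact: near|rewrite mulr_ge0 ?ler0n // ltW].
rewrite telescope_sumr // /r'.
have : phi N.+1 <= lnn y + r' by rewrite /phi ge_max ge_min lexx orbT andbT; move: r'0; clear; lra.
have : lnn y - r' <= phi 1%N by rewrite /phi le_max lexx.
by rewrite /r'; clear; set a := _^-1; lra.
Qed.

(** The Tauberian theorem is applied to [f n * ln n ^ k * n ^ (-1 - 1 / ln x)]. On [(sqrt x, x]]
    partial summation removes the power of [n] at the cost of [x ^ (1 + 1 / ln x) = e x <= 4 x], and
    [ln n ^ k] with a gain of [(2 / ln x) ^ k]; up to [sqrt x] the trivial bound is enough. The
    division by [ln x ^ k] turns a mere bound for the [k]-th derivative into a saving. *)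
Lemma tauber_sum (k : nat) : exists2 K : R, 0 < K & forall (f : nat -> C) (x T B : R),
 (forall n, (0 < n)%N -> normc (f n) <= 1 + lnn n) -> 1 <= ln x -> 1 <= T <= x ->
 (forall t, `|t| <= T -> normc (DS (tw t (lk f k)) (1 + (ln x)^-1)) <= B) ->
 forall y : nat, y%:R <= x ->
 normc (\sum_(1 <= n < y.+1) f n) <= K * x * (T * B * ln x / ln x ^+ k + ln x ^+ 2 / Num.sqrt T).
Proof.
pose CA : R := 3 * ((2 * k%:R) ^+ k + (2 * k.+1%:R) ^+ k.+1).
have CA0 : 0 <= CA by rewrite mulr_ge0 // addr_ge0 // exprn_ge0 // mulr_ge0 ?ler0n.
pose C' : R := 256 * CA + 42 * 3 ^+ k.+1.
have C'0 : 0 <= C' := addr_ge0 (mulr_ge0 (ler0n R 256) CA0)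
 (mulr_ge0 (ler0n R 42) (exprn_ge0 k.+1 (ler0n R 3))).
exists (32 * 2 ^+ k * (6 + C') + 2).
 by rewrite ltr_wpDl // !mulr_ge0 ?exprn_ge0 // addr_ge0.
move=> f x T B hf; set L := ln x => L1 /andP[T1 Tx] hB y yx.
have L0 := ge1_gt0 L1; have T0 := ge1_gt0 T1.
have x0 : 0 < x by exact: lt_le_trans Tx.
have x1 : 1 <= x by exact: le_trans Tx.
have B0 : 0 <= B by apply: le_trans (hB 0 _); rewrite ?normc_ge0 // normr0 ltW.
have Lk0 : 0 < L ^+ k by rewrite exprn_gt0.
set s := Num.sqrt T; have s1 : 1 <= s by rewrite -sqrtr1 ler_wsqrtr.
have s0 := ge1_gt0 s1; have si0 : 0 < s^-1 by rewrite invr_gt0.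
set X := Num.sqrt x; have X1 : 1 <= X by rewrite -sqrtr1 ler_wsqrtr.
have XX : X ^+ 2 = x by rewrite sqr_sqrtr // ltW.
have sX : s <= X by rewrite ler_wsqrtr.
have X0 := ge1_gt0 X1.
have Xx : X <= x by rewrite -XX expr2 ler_peMl // ltW.
have lnL n : (0 < n)%N -> n%:R <= x -> lnn n <= L.
 by move=> n0 nx; rewrite /lnn ler_ln ?posrE ?ltr0n.
have xs : X <= x / s.
 by rewrite ler_pdivlMr // -[leRHS]XX expr2 ler_wpM2l // ltW.
have triv (z : nat) : z%:R <= X -> normc (\sum_(1 <= n < z.+1) f n) <= 2 * x * (L ^+ 2 / s).
 move=> zX; apply: le_trans (normc_sum _ _ _) _.
 apply: le_trans (_ : \sum_(1 <= n < z.+1) (1 + L) <= _).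
  apply: ler_sum_nat => n /andP[n0 nz]; apply: le_trans (hf n n0) _; rewrite lerD2l lnL //.
  by apply: le_trans Xx; apply: le_trans zX; rewrite ler_nat -ltnS.
 rewrite sumr_const_nat subn1 /= -[_ *+ z]mulr_natl.
 have L2 : 1 + L <= 2 * L ^+ 2 by move: L1; clear; nra.
 apply: le_trans (_ : x / s * (2 * L ^+ 2) <= _); last by apply: eq_lew; ring.
 apply: ler_pM; rewrite ?ler0n //; last exact: le_trans zX xs.
 by rewrite addr_ge0 // ltW.
have q0 : 0 <= T * B * L / L ^+ k by rewrite divr_ge0 ?(ltW Lk0) // !mulr_ge0 // ltW.
have q1 : 0 <= L ^+ 2 / s by rewrite divr_ge0 ?sqr_ge0 // ltW.
have [yX|Xy] := leP (y%:R) X.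
 apply: le_trans (triv y yX) _; rewrite -[leRHS]mulrA -[leLHS]mulrA.
 apply: ler_pM; [exact: ler0n|exact: mulr_ge0 (ltW x0) q1| |].
  by rewrite lerDr !mulr_ge0 ?exprn_ge0 // addr_ge0.
 by rewrite (ler_wpM2l (ltW x0)) // lerDr.
pose z := Num.truncn X; have z0 : (0 < z)%N by rewrite truncn_gt0.
have zX : z%:R <= X by rewrite truncn_le // ltW.
have Xz : X < z.+1%:R by exact: truncn_gtS.
have zy : (z < y)%N by rewrite -(ltr_nat R); exact: le_lt_trans Xy.
set sg := 1 + L^-1; pose a n := wt sg (lk f k) n.
have Li0 : 0 < L^-1 by rewrite invr_gt0.
have sg1 : 1 <= sg by rewrite lerDl ltW.
have na n : (0 < n)%N -> normc (a n) <= (1 + lnn n) * lnn n ^+ k * npw sg n.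
 move=> n0; rewrite normc_wt normc_lk ler_wpM2r ?npw_ge0 // ler_wpM2r ?exprn_ge0 ?lnn_ge0 //.
 exact: hf.
have hA : absum a (CA * L ^+ k.+2).
 move=> N; apply: le_trans (_ : \sum_(1 <= n < N) (lnn n ^+ k * npw sg n + lnn n ^+ k.+1 * npw sg n) <= _).
  apply: ler_sum_nat => n /andP[n0 _]; apply: le_trans (na n n0) _.
  by rewrite le_eqVlt exprS; apply/orP; left; apply/eqP; ring.
 rewrite big_split /=; apply: le_trans (lerD (sum_lnnX_npw _ _ Li0) (sum_lnnX_npw _ _ Li0)) _.
 rewrite !invrK /CA !exprMn.
 have b1 : 1 + 2 * L <= 3 * L by move: L1; clear; lra.
 have b2 : L ^+ k <= L ^+ k.+1 by rewrite exprS ler_peMl // ltW.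
 have k1 : 0 <= 2 ^+ k * k%:R ^+ k :> R by rewrite mulr_ge0 ?exprn_ge0 ?ler0n.
 have k2 : 0 <= 2 ^+ k.+1 * k.+1%:R ^+ k.+1 :> R by rewrite mulr_ge0 ?exprn_ge0 ?ler0n.
 have := ler_wpM2l k1 b2; move: k1 k2; set p1 := 2 ^+ k * _; set p2 := 2 ^+ k.+1 * _ => k1 k2 b3.
 rewrite -mulrDl; apply: le_trans (_ : (p1 * L ^+ k.+1 + p2 * L ^+ k.+1) * (3 * L) <= _).
  apply: ler_pM => //; rewrite ?addr_ge0 ?mulr_ge0 ?exprn_ge0 ?(ltW L0) //.
  by rewrite lerD2r.
 by rewrite [L ^+ k.+2]exprS le_eqVlt; apply/orP; left; apply/eqP; ring.
have E0 u : (z <= u <= y)%N -> normc (\sum_(1 <= n < u.+1) a n) <= 6 * (T * B * L) + C' * L ^+ k.+2 / s.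
 move=> /andP[zu uy]; have u0 := leq_trans z0 zu.
 have ux : u%:R <= x by apply: le_trans yx; rewrite ler_nat.
 have lu := lnL u u0 ux.
 have hS N : \sum_(1 <= n < N | `|lnn n - lnn u| < s^-1) normc (a n) <=
   (3 * L) ^+ k.+1 * (42 / s).
  apply: le_trans (_ : (3 * L) ^+ k.+1 * \sum_(1 <= n < N | `|lnn n - lnn u| < s^-1) n%:R^-1 <= _).
   rewrite mulr_sumr big_nat_cond [leRHS]big_nat_cond; apply: ler_sum => n /andP[/andP[n0 _]].
   rewrite ltr_norml => /andP[_ h].
   have si1 : s^-1 <= 1 by rewrite invf_le1.
   apply: le_trans (na n n0) _; apply: ler_pM; rewrite ?mulr_ge0 ?exprn_ge0 ?addr_ge0 ?lnn_ge0 ?npw_ge0 //.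
    rewrite [(3 * L) ^+ _]exprS; have l0 := @lnn_ge0 R n; apply: ler_pM; rewrite ?addr_ge0 ?exprn_ge0 //.
     by move: h lu si1 L1; clear; lra.
    by apply: lerXn2r; rewrite ?nnegrE ?mulr_ge0 ?(ltW L0) //; move: h lu si1 L1; clear; lra.
   exact: npw_le_inv.
  rewrite ler_wpM2l ?exprn_ge0 ?mulr_ge0 ?(ltW L0) //.
  have s01 : 0 < s^-1 <= 1 by rewrite si0 invf_le1.
  apply: le_trans (window_sum_inv N s01 u0) _.
  have : 20 / u%:R <= 40 / s.
   rewrite ler_pdivrMr ?ltr0n // mulrAC ler_pdivlMr //.
   have h1 : X <= 2 * u%:R.
    apply: le_trans (ltW Xz) _; rewrite -natrM ler_nat mul2n -addnn.
    by apply: leq_trans (leq_add zu zu); rewrite -addn1 leq_add2l.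
   by move: sX h1; clear; lra.
  by clear; lra.
 have hB' t : `|t| <= T -> normc (dsum (tw t a)) <= B.
  move=> /hB; rewrite /DS; have -> : dsum (wt sg (tw t (lk f k))) = dsum (tw t a) by
   apply: eq_dsum => n _; rewrite /wt /tw /a mulrAC.
  by [].
 have := fejer_tauber hA T1 u0 hB' hS; rewrite -/s => h; apply: le_trans h _.
 rewrite -addrA; apply: lerD.
  have : 1 + lnn u <= 2 * L by move: lu L1; clear; lra.
  have TB : 0 <= T * B by rewrite mulr_ge0 // ltW.
  by move=> /(ler_wpM2l TB); clear; set l := lnn u; lra.
 rewrite /C' exprMn; have b2 : L ^+ k.+1 <= L ^+ k.+2 by rewrite [leRHS]exprS ler_peMl ?exprn_ge0 // ltW.
 have p3 : 0 <= 42 * 3 ^+ k.+1 / s by rewrite divr_ge0 ?(ltW s0) // mulr_ge0 // exprn_ge0.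
 by have := ler_wpM2l p3 b2; clear; set p1 := L ^+ k.+1; set p2 := L ^+ k.+2; lra.
set E := 6 * (T * B * L) + C' * L ^+ k.+2 / s in E0.
have E00 : 0 <= E by apply: le_trans (E0 z _); rewrite ?normc_ge0 // leqnn ltnW.
have S1 u : (z <= u <= y)%N -> normc (\sum_(z.+1 <= n < u.+1) a n) <= 2 * E.
 move=> zuy; have /andP[zu uy] := zuy.
 have -> : \sum_(z.+1 <= n < u.+1) a n = \sum_(1 <= n < u.+1) a n - \sum_(1 <= n < z.+1) a n.
  by rewrite [X in _ = X - _](big_cat_nat _ (n := z.+1)) //= addrAC subrr add0r.
 apply: le_trans (normcB_le _ _) _; rewrite mulr_natl mulr2n lerD // ?E0 // leqnn ltnW //.
have xe : x `^ sg = x * expR 1.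
 rewrite /sg powRD; last by rewrite lt0r_neq0 ?implybT.
 rewrite powRr1 ?(ltW x0) //; congr (_ * _).
 by rewrite /powR gt_eqF // -/L mulVf ?lt0r_neq0.
have S2 u : (z <= u <= y)%N -> normc (\sum_(z.+1 <= n < u.+1) a n * (npw (- sg) n)%:C%C) <= 2 * (2 * E) * (4 * x).
 move=> /andP[zu uy]; apply: abel_monotone => //.
 - by rewrite mulr_ge0 // ltW.
 - by move=> v /andP[zv vu]; apply: S1; rewrite zv (leq_trans vu).
 - move=> n /andP[zn nu]; rewrite npw_ge0 npwN /=.
  apply: le_trans (_ : x `^ sg <= _).
   apply: ler_wpowR; rewrite ?ler0n ?(le_trans ler01) //; apply: le_trans yx.
   by rewrite ler_nat (leq_trans nu).
  by rewrite xe mulrC ler_wpM2r ?(ltW x0) // expR1_le4.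
 - left=> n _; rewrite !npwN; apply: ler_wpowR; rewrite ?ler0n ?ler_nat ?(le_trans ler01) //.
have S3 : normc (\sum_(z.+1 <= n < y.+1) a n * (npw (- sg) n)%:C%C * ((lnn n ^+ k)^-1)%:C%C) <=
  2 * (2 * (2 * E) * (4 * x)) * (2 ^+ k / L ^+ k).
 have half n : (z < n)%N -> L / 2 <= lnn n.
  move=> zn; rewrite ler_pdivrMr // mulr_natr -lnXn ?ltr0n ?(leq_trans _ zn) //.
  rewrite ler_ln ?posrE ?exprn_gt0 ?ltr0n ?(leq_trans _ zn) // -XX.
  apply: lerXn2r; rewrite ?nnegrE ?ler0n ?(ltW X0) //.
  by apply: ltW; apply: lt_le_trans Xz _; rewrite ler_nat.
 have L20 : 0 < L / 2 by rewrite divr_gt0.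
 apply: abel_monotone => //.
 - by rewrite divr_ge0 ?exprn_ge0 // ltW.
 - exact: ltnW.
 - move=> n /andP[zn ny]; have h := half n zn; rewrite invr_ge0 exprn_ge0 ?lnn_ge0 //=.
  have -> : 2 ^+ k / L ^+ k = ((L / 2) ^+ k)^-1 by rewrite exprMn exprVn invfM invrK mulrC.
  rewrite lef_pV2 ?posrE ?exprn_gt0 ?(lt_le_trans L20) //.
  by apply: lerXn2r; rewrite ?nnegrE ?lnn_ge0 ?(ltW L20).
 - right=> n /andP[zn ny]; have h := half n zn.
  have ln0 := lt_le_trans L20 h; have h2 := ler_lnn R (leq_ltn_trans (leq0n _) zn) (leqnSn n).
  rewrite lef_pV2 ?posrE ?exprn_gt0 ?(lt_le_trans ln0) //.
  by apply: lerXn2r; rewrite ?nnegrE ?lnn_ge0.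
have fa n : (z < n)%N -> a n * (npw (- sg) n)%:C%C * ((lnn n ^+ k)^-1)%:C%C = f n.
 move=> zn; have n1 : (1 < n)%N by exact: leq_trans zn.
 have n0 := ltnW n1; have l0 : lnn n != 0 by rewrite gt_eqF // ln_gt0 // ltr1n.
 rewrite /a /wt /lk -!mulrA -!realcM.
 have -> : lnn n ^+ k * (npw sg n * (npw (- sg) n * (lnn n ^+ k)^-1)) =
  (npw sg n * npw (- sg) n) * (lnn n ^+ k / lnn n ^+ k) by ring.
 by rewrite -npwD // subrr divff ?expf_neq0 // /npw oppr0 powRr0 mulr1 mulr1.
have -> : \sum_(1 <= n < y.+1) f n = \sum_(1 <= n < z.+1) f n +
  \sum_(z.+1 <= n < y.+1) a n * (npw (- sg) n)%:C%C * ((lnn n ^+ k)^-1)%:C%C.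
 rewrite (big_cat_nat _ (n := z.+1)) //=; last exact: ltnW.
 by congr (_ + _); apply: eq_big_nat => n /andP[zn _]; rewrite fa.
apply: le_trans (le_normcD _ _) _; apply: le_trans (lerD (triv z zX) S3) _.
have -> : 2 * (2 * (2 * E) * (4 * x)) * (2 ^+ k / L ^+ k) =
  32 * 2 ^+ k * x * (6 * (T * B * L / L ^+ k) + C' * (L ^+ 2 / s)).
 rewrite /E; have -> : L ^+ k.+2 = L ^+ k * L ^+ 2 by rewrite -exprD addn2.
 by field; rewrite !lt0r_neq0.
have x2 : 0 <= 32 * 2 ^+ k * x by rewrite !mulr_ge0 ?exprn_ge0 // ltW.
have := mulr_ge0 x2 q0; have := mulr_ge0 x2 q1; have := mulr_ge0 (mulr_ge0 x2 q0) C'0.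
have := mulr_ge0 (ltW x0) q0.
by clear; set Q := _ / L ^+ k; set Q' := _ / s; set p := 2 ^+ k; lra.
Qed.

End TauberSum.

(** * The von Mangoldt function and the saving of powers of the logarithm *)

Section Mangoldt.
Variable R : realType.
Local Notation C := R[i].
Local Notation lnn := (@lnn R).

Lemma sum_nat_eq0 (V : nmodType) (F : nat -> V) (P : pred nat) m n :
 (forall i, (m <= i < n)%N -> P i -> F i = 0) -> \sum_(m <= i < n | P i) F i = 0.
Proof. by move=> h; rewrite big_nat_cond big1 // => i /andP[]; exact: h. Qed.

(** [T = ln x ^ D'] with [D' = 2 (D + 2)] makes [ln x ^ 2 / sqrt T] equal to [ln x ^ (-D)]. The
    exponent [e = 1 / (b + D' + 1)] makes [(q T) ^ e] at most a multiple of [ln x], and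
    [k = D' + D + 2] then outweighs [T * ln x ^ 2]. The pair [(k, e)] precedes [K1], which will
    depend on it. *)
Lemma power_saving (b D : nat) : exists (k : nat) (e : R), 0 < e /\ forall K1 : R, 0 <= K1 ->
 exists2 K2 : R, 0 < K2 & forall (f : nat -> C) (x q : R),
 (forall n, (0 < n)%N -> normc (f n) <= 1 + lnn n) -> 1 <= ln x -> 1 <= q -> q <= ln x ^+ b ->
 (forall t, normc (DS (tw t (lk f k)) (1 + (ln x)^-1)) <= K1 * (q * (1 + `|t|)) `^ e) ->
 forall y : nat, y%:R <= x -> normc (\sum_(1 <= n < y.+1) f n) <= K2 * x / ln x ^+ D.
Proof.
have [D' DE] : exists D', D' = (2 * (D + 2))%N by eexists.
pose k := (D' + D + 2)%N; pose e : R := (b + D' + 1)%:R^-1.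
have e0 : 0 < e by rewrite invr_gt0 ltr0n addn1.
exists k, e; split=> // K1 K10; have [K K0 hK] := tauber_sum R k.
pose m := (D' + D + 1)%N; pose Km : R := 2 * m%:R ^+ m.
have Km0 : 0 <= Km by rewrite mulr_ge0.
exists (K * (2 * K1 + 1) + Km).
 by rewrite ltr_wpDr // mulr_gt0 // ltr_wpDl // mulr_ge0.
move=> f x q hf L1 q1 qL hB y yx; set L := ln x in L1 qL hB *.
have L0 := ge1_gt0 L1; have LD : 0 < L ^+ D by rewrite exprn_gt0.
have x1 : 0 < x by rewrite ltNge; apply/negP => /ln0 h; rewrite /L h in L0; rewrite ltxx in L0.
have kk0 : 0 <= K * (2 * K1 + 1) by rewrite mulr_ge0 ?(ltW K0) // addr_ge0 // mulr_ge0.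
(* If [T] exceeds [x], then [L ^ m <= m ^ m * x] with [m = D' + D + 1] forces [L ^ (D + 1)] to be
   bounded, and the trivial bound is good enough. *)
have [Tx|xT] := leP (L ^+ D') x; last first.
 apply: le_trans (_ : 2 * L * x <= _).
  apply: le_trans (normc_sum _ _ _) _.
  apply: le_trans (_ : \sum_(1 <= n < y.+1) 2 * L <= _).
   apply: ler_sum_nat => n /andP[n0 ny]; apply: le_trans (hf n n0) _.
   have : lnn n <= L.
    by rewrite /lnn ler_ln ?posrE ?ltr0n //; apply: le_trans yx; rewrite ler_nat -ltnS.
   by move: L1; clear; lra.
  rewrite sumr_const_nat subn1 -[_ *+ y]mulr_natr ler_wpM2l ?mulr_ge0 ?(ltW L0) //.
 have h1 := @expr_le_expR R m L (ltW L0).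
 have h2 : expR L = x by rewrite /L lnK.
 have h3 : L ^+ D.+1 <= m%:R ^+ m.
  have lt : m%:R ^+ m * expR L <= m%:R ^+ m * L ^+ D'.
   by rewrite ler_wpM2l // h2 ltW.
  have := le_trans h1 lt; rewrite {1}/m -addnA addn1 exprD mulrC ler_pM2r // exprn_gt0 //.
 rewrite ler_pdivlMr //; apply: le_trans (_ : Km * x <= _); last first.
  by rewrite ler_wpM2r ?(ltW x1) // lerDr.
 have -> : 2 * L * x * L ^+ D = 2 * L ^+ D.+1 * x by rewrite exprS; ring.
 by rewrite /Km ler_wpM2r ?(ltW x1) // ler_wpM2l.
have T1 : 1 <= L ^+ D' by rewrite exprn_ege1.
have L2D : L ^+ D' = (L ^+ (D + 2)) ^+ 2 by rewrite DE -exprM mulnC.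
have hB' t : `|t| <= L ^+ D' -> normc (DS (tw t (lk f k)) (1 + L^-1)) <= 2 * K1 * L.
 move=> ht; apply: le_trans (hB t) _.
 apply: le_trans (_ : K1 * (2 * L) <= _); last by clear; lra.
 rewrite ler_wpM2l //; apply: le_trans (_ : (2 * L ^+ (b + D')) `^ e <= _).
  have q00 := le_trans ler01 q1.
  apply: ler_wpowR; rewrite ?(ltW e0) ?(mulr_ge0 q00) //.
  rewrite exprD mulrCA; apply: ler_pM; rewrite //.
  by move: ht T1; clear; lra.
 have e1 : e <= 1 by rewrite invf_le1 ?addn1 // ler1n.
 rewrite powRM ?exprn_ge0 ?(ltW L0) // powR_exprn ?(ltW L0) //.
 apply: ler_pM; rewrite ?exprn_ge0 ?powR_ge0 //.
  by rewrite -[leRHS]powRr1 // ler_powR // ler1n.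
 rewrite -powR_mulrn ?powR_ge0 // -powRrM -[leRHS]powRr1 ?(ltW L0) //; apply: ler_powR => //.
 by rewrite /e mulrC ler_pdivrMr ?addn1 // mul1r ler_nat.
have TT : 1 <= L ^+ D' <= x by rewrite T1.
have := hK f x (L ^+ D') (2 * K1 * L) hf L1 TT hB' y yx; rewrite -/L => h; apply: le_trans h _.
have -> : Num.sqrt (L ^+ D') = L ^+ (D + 2) by rewrite L2D sqrtr_sqr ger0_norm // exprn_ge0 // ltW.
have -> : L ^+ D' * (2 * K1 * L) * L / L ^+ k + L ^+ 2 / L ^+ (D + 2) = (2 * K1 + 1) / L ^+ D.
 rewrite /k !exprD; have : L ^+ D' != 0 by rewrite lt0r_neq0 // exprn_gt0.
 have := lt0r_neq0 LD; have := lt0r_neq0 L0; clear.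
 set A := L ^+ D'; set B := L ^+ D => l0 a0 b0.
 by field; rewrite l0 a0 b0.
rewrite mulrA ler_wpM2r ?invr_ge0 ?(ltW LD) // mulrAC ler_wpM2r ?(ltW x1) // lerDl //.
Qed.

(** The recursion raises a product of two powers [Q ^ e1] to the power [k + 1], whence
    [e1 = e / (2 (k + 1))]. *)
Lemma DS_quotient_bound (k : nat) (e : R) : 0 < e -> exists2 e1 : R, 0 < e1 &
 forall Kw Ku : R, 1 <= Kw -> 1 <= Ku -> exists2 K : R, 0 <= K &
 forall (s Q : R) (f c p : nat -> C), 1 <= Q -> smb s f -> smb s c ->
 (forall n, (0 < n)%N -> dconv f c n = p n) ->
 (Kw * Q `^ e1)^-1 <= normc (DS c s) ->
 (forall i, (0 < i <= k)%N -> normc (DS (lk c i) s) <= Ku * Q `^ e1) ->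
 (forall i, (i <= k)%N -> normc (DS (lk p i) s) <= Ku * Q `^ e1) ->
 normc (DS (lk f k) s) <= K * Q `^ e.
Proof.
move=> e0; pose e1 : R := e / (2 * k.+1%:R).
have e10 : 0 < e1 by rewrite divr_gt0 // mulr_gt0.
exists e1 => // Kw Ku w1 u1; have [K K1 hK] := DS_recursion_bound R k.
exists (K * (Kw * Ku) ^+ k.+1).
 by rewrite mulr_ge0 ?exprn_ge0 ?mulr_ge0 ?(le_trans ler01).
move=> s Q f c p Q1 sf sc fc lw uc up.
have Qe : 1 <= Q `^ e1 by rewrite one_le_powR // ltW.
have W1 : 1 <= Kw * Q `^ e1 by rewrite mulr_ege1.
have U1 : 1 <= Ku * Q `^ e1 by rewrite mulr_ege1.
have h := hK s f c p _ _ W1 U1 sf sc fc lw uc up; apply: le_trans h _.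
rewrite -[leRHS]mulrA (ler_wpM2l (le_trans ler01 K1)) // mulrACA exprMn ler_wpM2l //.
 by rewrite exprn_ge0 // mulr_ge0 // (le_trans ler01).
rewrite -powRD; last by lra.
rewrite -powR_mulrn ?powR_ge0 // -powRrM.
have -> : (e1 + e1) * k.+1%:R = e.
 have k0 : k.+1%:R != 0 :> R by [].
 by rewrite /e1; move: k0; set m := k.+1%:R => k0; field.
exact: lexx.
Qed.

(** The von Mangoldt function, written as a double sum over primes and exponents so that sums over
    [n] can be exchanged with it; [LamE] allows a common range for all [n]. *)
Definition Lam (n : nat) : R :=
 \sum_(1 <= p < n.+1 | prime p) \sum_(1 <= k < n.+1 | (p ^ k == n)%N) lnn p.

Lemma LamE (N n : nat) : (0 < n <= N)%N ->
 Lam n = \sum_(1 <= p < N.+1 | prime p) \sum_(1 <= k < N.+1 | (p ^ k == n)%N) lnn p.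
Proof.
move=> /andP[n0 nN].
have inner p M : prime p -> (n <= M)%N ->
  \sum_(1 <= k < M.+1 | (p ^ k == n)%N) lnn p = \sum_(1 <= k < n.+1 | (p ^ k == n)%N) lnn p.
 move=> pp nM; rewrite (big_cat_nat _ (n := n.+1)) //= [X in _ + X]sum_nat_eq0 ?addr0 //.
 move=> k /andP[nk _] /eqP pk; have := ltn_expl k (prime_gt1 pp).
 by rewrite pk ltnNge (ltnW nk).
rewrite /Lam [RHS](big_cat_nat _ (n := n.+1)) //= [X in _ = _ + X]sum_nat_eq0 ?addr0.
 rewrite big_nat_cond [RHS]big_nat_cond; apply: eq_bigr => p /andP[_ pp].
 by rewrite [RHS]inner.
move=> p /andP[np _] pp; rewrite inner // sum_nat_eq0 // => k /andP[k0 _] /eqP pk.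
by have := leq_pexp2l (prime_gt0 pp) k0; rewrite expn1 pk leqNgt np.
Qed.

Lemma Lam_ge0 n : 0 <= Lam n.
Proof. by apply: sumr_ge0 => p _; apply: sumr_ge0 => k _; exact: lnn_ge0. Qed.

Lemma lnn_prod_logn n : (0 < n)%N -> lnn n = \sum_(1 <= p < n.+1 | prime p) (logn p n)%:R * lnn p.
Proof.
move=> n0; rewrite -{1}(partnT n0) /partn.
have lnP (F : nat -> nat) (s : seq nat) : all (fun p => 0 < F p)%N s ->
  lnn (\prod_(p <- s) F p) = \sum_(p <- s) lnn (F p).
 elim: s => [|p s IH]; first by rewrite !big_nil lnn1.
 move=> /andP[F0 Fs]; rewrite !big_cons lnnM ?IH //.
 elim: s Fs {IH} => [|r s IH]; first by rewrite big_nil.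
 by move=> /andP[r0 rs]; rewrite big_cons muln_gt0 r0 IH.
rewrite big_mkcond (eq_bigr (fun p => p ^ logn p n)%N) // lnP; last first.
 apply/allP => p; rewrite mem_index_iota => _; case: p => [|p]; first by [].
 by [].
rewrite big_ltn // lognE /lnn ln1 add0r [RHS]big_mkcond; apply: eq_big_nat => p /andP[p0 _].
rewrite natrX lnXn ?ltr0n // mulr_natl; case: ifPn => // np.
by rewrite lognE (negPf np) mulr0n.
Qed.

Lemma sum_count_exp p n : prime p -> (0 < n)%N ->
 \sum_(1 <= k < n.+1) (if (p ^ k %| n)%N then 1 else 0) = (logn p n)%:R :> R.
Proof.
move=> pp n0; have ln : (logn p n <= n)%N.
 by apply: leq_trans (ltnW (ltn_expl _ (prime_gt1 pp))) (dvdn_leq n0 (pfactor_dvdnn p n)).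
rewrite (big_cat_nat _ (n := (logn p n).+1)) //= [X in _ + X]sum_nat_eq0 ?addr0; last first.
 by move=> k /andP[lk _] _; rewrite pfactor_dvdn // leqNgt lk.
rewrite (eq_big_nat _ _ (F2 := fun=> 1)); last first.
 by move=> k /andP[_ lk]; rewrite pfactor_dvdn // -ltnS lk.
by rewrite sumr_const_nat subn1.
Qed.

(** Unique factorisation: [ln p] is counted once for each [k >= 1] with [p ^ k] dividing [n]. *)
Lemma sum_Lam_dvd n : (0 < n)%N -> \sum_(1 <= d < n.+1 | (d %| n)%N) Lam d = lnn n.
Proof.
move=> n0; transitivity (\sum_(1 <= d < n.+1 | (d %| n)%N)
  \sum_(1 <= p < n.+1 | prime p) \sum_(1 <= k < n.+1 | (p ^ k == d)%N) lnn p).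
 rewrite big_nat_cond [RHS]big_nat_cond; apply: eq_bigr => d /andP[/andP[d0 dn] _].
 by apply: LamE; rewrite d0.
rewrite exchange_big /= lnn_prod_logn //; apply: eq_bigr => p pp.
under eq_bigr do rewrite big_mkcond.
rewrite exchange_big /= -(sum_count_exp pp n0) mulr_suml; apply: eq_big_nat => k /andP[k0 _].
case: ifPn => [pk|npk].
 rewrite mul1r big_mkcond (bigD1_seq (p ^ k)%N) ?iota_uniq //=; last first.
  by rewrite mem_index_iota expn_gt0 prime_gt0 //= ltnS dvdn_leq.
 rewrite pk eqxx big1 ?addr0 // => d dpk; rewrite eq_sym (negPf dpk); by case: ifP.
rewrite mul0r big1 // => d dn; case: eqP => // e; by rewrite e dn in npk.
Qed.

Lemma Lam_le n : (0 < n)%N -> Lam n <= lnn n.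
Proof.
move=> n0; rewrite -(sum_Lam_dvd n0) big_mkcond.
rewrite (bigD1_seq n) ?iota_uniq ?mem_index_iota ?n0 //= dvdnn.
by rewrite lerDl sumr_ge0 // => d _; case: ifP => // _; exact: Lam_ge0.
Qed.

Definition LamC (f : nat -> C) (n : nat) : C := (Lam n)%:C%C * f n.

Lemma normc_LamC f n : (forall n, normc (f n) <= 1) -> (0 < n)%N -> normc (LamC f n) <= lnn n.
Proof.
move=> f1 n0; rewrite normcM normcR_ge0 ?Lam_ge0 // -[leRHS]mulr1.
by apply: ler_pM; rewrite ?Lam_ge0 ?normc_ge0 ?Lam_le.
Qed.

(** The identity [(- L' / L) L = - L'] on coefficients; complete multiplicativity of [f] reduces it
    to [sum_Lam_dvd]. *)
Lemma dconv_LamC f n : cmul f -> (0 < n)%N -> dconv (LamC f) f n = lk f 1 n.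
Proof.
move=> [_ fM _] n0; rewrite /dconv /lk expr1 -(sum_Lam_dvd n0) realc_sum mulr_sumr.
rewrite big_nat_cond [RHS]big_nat_cond; apply: eq_bigr => d /andP[/andP[d0 _] dn].
have nd : (0 < n %/ d)%N by rewrite divn_gt0 dvdn_leq.
by rewrite /LamC -mulrA -fM // [(d * _)%N]mulnC divnK // mulrC.
Qed.

Lemma twist_bound (j : nat) (e : R) : 0 < e -> exists2 K : R, 1 <= K & forall (c : nat -> C) Y K0 s t,
 1 < s <= 2 -> 1 <= Y -> sqb c Y -> hdb c K0 -> smb s c ->
 normc (DS (tw t (lk c j)) s) <= K * (1 + K0) * (Y * (1 + `|t|)) `^ e.
Proof.
move=> e0; have [K K0 hK] := DS_lk_bound j e0.
exists (1 + K * 2 `^ e); first by rewrite lerDl mulr_ge0 // ltW.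
move=> c Y K' s t s12 Y1 sc hc smc.
have Y0 := le_trans ler01 Y1; have K'0 := hdb_ge0 hc.
have Y2 : 1 <= Y * (1 + 2 * `|t|) by rewrite mulr_ege1 // lerDl mulr_ge0.
have := hK _ _ _ _ s12 Y2 (sqb_tw t sc) (hdb_tw t hc) (smb_tw t smc).
have -> : DS (lk (tw t c) j) s = DS (tw t (lk c j)) s by apply: eq_DS => n _; rewrite lk_tw.
move=> h; apply: le_trans h _.
have h1 : (Y * (1 + 2 * `|t|)) `^ e <= 2 `^ e * (Y * (1 + `|t|)) `^ e.
 rewrite -powRM ?mulr_ge0 //; apply: ler_wpowR; rewrite ?(ltW e0) ?mulr_ge0 //.
 by lra.
apply: le_trans (ler_wpM2l (mulr_ge0 (ltW K0) (addr_ge0 ler01 K'0)) h1) _.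
rewrite mulrA ler_wpM2r ?powR_ge0 // mulrAC ler_wpM2r ?addr_ge0 //.
by rewrite lerDr.
Qed.

Lemma uniform_twist_bound (k : nat) (e : R) : 0 < e -> exists2 K : R, 1 <= K &
 forall j (c : nat -> C) Y K0 s t, (j <= k)%N ->
 1 < s <= 2 -> 1 <= Y -> sqb c Y -> hdb c K0 -> smb s c ->
 normc (DS (tw t (lk c j)) s) <= K * (1 + K0) * (Y * (1 + `|t|)) `^ e.
Proof.
move=> e0; elim: k => [|k [K1 K11 hK1]].
 have [K K1 hK] := twist_bound 0 e0; exists K => // j c Y K0 s t.
 by rewrite leqn0 => /eqP ->; exact: hK.
have [K2 K21 hK2] := twist_bound k.+1 e0; exists (K1 + K2).
 by lra.
move=> j c Y K0 s t; rewrite leq_eqVlt => /orP[/eqP -> | jk] s12 Y1 sc hc smc.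
 apply: le_trans (hK2 c Y K0 s t s12 Y1 sc hc smc) _; have K00 := hdb_ge0 hc.
 by rewrite ler_wpM2r ?powR_ge0 // ler_wpM2r ?addr_ge0 // lerDr (le_trans ler01).
apply: le_trans (hK1 j c Y K0 s t jk s12 Y1 sc hc smc) _; have K00 := hdb_ge0 hc.
by rewrite ler_wpM2r ?powR_ge0 // ler_wpM2r ?addr_ge0 // lerDl (le_trans ler01).
Qed.

(** [- L' / L] is the quotient of the series of [lk f 1] by that of [f]: the upper bounds come from
    [uniform_twist_bound], the lower bound for [L] is a hypothesis. The exponent [e1] is announced
    first, so that a lower bound with this exponent can be supplied. *)
Lemma LamC_sum_bound (b D : nat) : exists2 e1 : R, 0 < e1 & forall Kl : R, 1 <= Kl ->
 exists2 K2 : R, 0 < K2 & forall (f : nat -> C) (x q : R),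
 cmul f -> bsum f q -> 1 <= ln x -> 1 <= q -> q <= ln x ^+ b ->
 (forall t s, 1 < s <= 2 -> (Kl * (q * (1 + `|t|)) `^ e1)^-1 <= normc (DS (tw t f) s)) ->
 forall y : nat, y%:R <= x -> normc (\sum_(1 <= n < y.+1) LamC f n) <= K2 * x / ln x ^+ D.
Proof.
have [k [e [e0 hps]]] := power_saving b D.
have [e1 e10 hq] := DS_quotient_bound k e0.
have [Ku Ku1 hKu] := uniform_twist_bound k.+1 e10.
exists e1 => // Kl Kl1.
have Ku2 : 1 <= Ku * (1 + 1) by lra.
have [K1 K10 hK1] := hq Kl _ Kl1 Ku2.
have [K2 K20 hK2] := hps K1 K10; exists K2 => // f x q hf hbs L1 q1 qL low.
have L0 := ge1_gt0 L1; have f1 : forall n, normc (f n) <= 1 by case: hf.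
apply: (hK2 _ _ _ _ L1 q1 qL) => [n n0|t].
 by apply: le_trans (normc_LamC f1 n0) _; rewrite lerDr.
set s := 1 + _; have s12 : 1 < s <= 2.
 rewrite /s ltrDl invr_gt0 L0 /=; have : (ln x)^-1 <= 1 by rewrite invf_le1.
 lra.
have s1 : 1 < s by case/andP: s12.
have sf : smb s f by apply: (smb_bounded (B := 1)).
have sL : smb s (LamC f).
 apply: (smb_le (B := 1)) => // n n0; rewrite mul1r; apply: le_trans (normc_LamC f1 n0) _.
 by rewrite lerDr.
have Q1 : 1 <= q * (1 + `|t|) by rewrite mulr_ege1 // lerDl.
have hdf : hdb f 1 by exact: hdb_bounded.
have sqf : sqb f q by exact: sqb_bounded.
have -> : DS (tw t (lk (LamC f) k)) s = DS (lk (tw t (LamC f)) k) s.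
 by apply: eq_DS => n _; rewrite lk_tw.
apply: (hK1 s _ (tw t (LamC f)) (tw t f) (tw t (lk f 1))) => //.
- exact: smb_tw.
- exact: smb_tw.
- move=> n n0; rewrite dconv_tw // /tw dconv_LamC //.
- exact: low.
- move=> i /andP[_ ik]; have -> : DS (lk (tw t f) i) s = DS (tw t (lk f i)) s.
  by apply: eq_DS => n _; rewrite lk_tw.
 by apply: hKu => //; exact: leqW.
- move=> i ik; have -> : DS (lk (tw t (lk f 1)) i) s = DS (tw t (lk f i.+1)) s.
  apply: eq_DS => n _; rewrite lk_tw /tw /lk -[f n * _ * _]mulrA -realcM expr1.
  by rewrite exprS.
 exact: hKu.
Qed.

End Mangoldt.

(** * The prime number theorem with a power saving *)

Section PNT.
Variable R : realType.
Local Notation C := R[i].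
Local Notation lnn := (@lnn R).
Local Notation npw := (@npw R).
Local Notation Lam := (@Lam R).

Definition harm (N : nat) : R := \sum_(1 <= n < N.+1) n%:R^-1.

Lemma harm_limit : exists g : R, forall N, (0 < N)%N -> `|harm N - lnn N - g| <= N%:R^-1.
Proof.
apply: (@cauchy_limit R (fun N => harm N - lnn N) (fun N => N%:R^-1)) => N M /andP[N0 NM].
elim: M NM => [|M IH]; first by rewrite leqn0 => /eqP e; rewrite e in N0.
rewrite leq_eqVlt => /orP[/eqP <-|]; first by rewrite subrr normr0 invr_ge0 ler0n.
rewrite ltnS => NM.
suff : forall j, M.+1 = (N + j)%N -> - N%:R^-1 + M.+1%:R^-1 <= (harm M.+1 - lnn M.+1) - (harm N - lnn N) <= 0.
 move=> /(_ (M.+1 - N)%N); rewrite subnKC ?leqW // => /(_ erefl) /andP[h1 h2].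
 rewrite ler_norml; have : 0 <= (M.+1%:R^-1 : R) by [].
 by move: h1 h2; clear; set a := _^-1; set b := _^-1; lra.
move=> {IH NM} j; elim: j M => [|j IH] M eM; first by rewrite eM addn0 subrr; apply/andP; split; lra.
have {}eM : M = (N + j)%N by move: eM; lia.
case: M eM IH => [|M] eM IH; first by move: eM N0; clear; lia.
have := IH M eM; have := lnnS_sub R (ltn0Sn M); have := lnnS_sub_ge R (ltn0Sn M).
have -> : harm M.+2 = harm M.+1 + M.+2%:R^-1 by rewrite {1}/harm big_nat_recr.
by clear; set a := _^-1; set b := _^-1; set c := _^-1; lra.
Qed.

Lemma sum_lnn_stirling M : (0 < M)%N ->
 `|\sum_(1 <= n < M.+1) lnn n - (M%:R * lnn M - M%:R)| <= 2 + lnn M.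
Proof.
move=> M0; suff h : 1 <= \sum_(1 <= n < M.+1) lnn n - (M%:R * lnn M - M%:R) <= 1 + \sum_(2 <= n < M.+1) n%:R^-1.
 have h2 : \sum_(2 <= n < M.+1) (n%:R^-1 : R) <= lnn M.
  by have := sum_inv_le R M0; rewrite big_ltn // invr1 lerD2l.
 rewrite ger0_norm; first by lra.
 by lra.
case: M M0 => // M _; elim: M => [|M IH].
 by rewrite big_nat1 lnn1 mulr0 big_geq //; lra.
rewrite big_nat_recr //= [X in _ <= _ <= 1 + X]big_nat_recr //=.
have d1 := lnnS_sub R (ltn0Sn M); have d2 := lnnS_sub_ge R (ltn0Sn M).
rewrite -[M.+1%:R^-1]mul1r ler_pdivlMr // in d1; rewrite -[M.+2%:R^-1]mul1r ler_pdivrMr // in d2.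
have e : M.+2%:R = M.+1%:R + 1 :> R by lra.
have i2 : M.+2%:R * M.+2%:R^-1 = 1 :> R by rewrite divff // lt0r_neq0.
have d3 : (1 - M.+2%:R^-1) <= (lnn M.+2 - lnn M.+1) * M.+1%:R.
 have : M.+2%:R^-1 <= lnn M.+2 - lnn M.+1 by rewrite -[leLHS]mul1r ler_pdivrMr.
 have -> : 1 - M.+2%:R^-1 = M.+2%:R^-1 * M.+1%:R :> R.
  by rewrite -[M.+1%:R](addrK 1) -e mulrBr mulr1 mulrC i2.
 by move=> h; rewrite ler_wpM2r // ltW.
move: IH d1 d3; rewrite e; clear; set m := M.+1%:R; set l := lnn M.+1; set l' := lnn M.+2.
set i := _^-1; set S := \sum_(_ <= _ < _) _; set S' := \sum_(_ <= _ < _) _ => /andP[h1 h2] d1 d3.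
by lra.
Qed.

Lemma truncn_div (M d : nat) : (0 < d)%N -> (M %/ d)%:R <= M%:R / d%:R :> R /\
 M%:R / d%:R - 1 <= (M %/ d)%:R :> R.
Proof.
move=> d0; have d0' : 0 < (d%:R : R) by rewrite ltr0n.
rewrite ler_pdivlMr // -natrM ler_nat leq_trunc_div; split=> //.
rewrite lerBlDr ler_pdivrMr // natr1 -natrM ler_nat ltnW // ltn_ceil //.
Qed.

Definition tauR (n : nat) : R := rconv (fun=> 1) (fun=> 1) n.

(** Dirichlet's estimate for the divisor function: the hyperbola method is symmetric, so the sum is
    twice the part with [d <= u], minus the square [u * u] counted twice. *)
Lemma sum_tauR (g : R) : (forall N, (0 < N)%N -> `|harm N - lnn N - g| <= N%:R^-1) ->
 forall M, (0 < M)%N ->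
 `|\sum_(1 <= n < M.+1) tauR n - (M%:R * lnn M + 2 * g * M%:R - M%:R)| <= 25 * Num.sqrt M%:R.
Proof.
move=> hg M M0; have [u /andP[u1 u2]] := exists_sqrtn M.
have u0 : (0 < u)%N by case: u u2 {u1} => //; rewrite exp1n; lia.
have uM : (u <= M)%N by apply: leq_trans u1; rewrite expnS expn1 leq_pmulr.
have u0' : 0 < (u%:R : R) by rewrite ltr0n.
have sumc (k : nat) : \sum_(1 <= m < k.+1) (1 : R) = k%:R by rewrite sumr_const_nat subn1.
have e1 : \sum_(1 <= n < M.+1) tauR n = 2 * \sum_(1 <= d < u.+1) (M %/ d)%:R - u%:R * u%:R.
 rewrite /tauR (hyperbola _ _ uM); under eq_bigr do rewrite mul1r sumc.
 have tail m : (0 < m <= u)%N -> \sum_(u.+1 <= d < (M %/ m).+1) (1 : R) = (M %/ m)%:R - u%:R.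
  move=> /andP[m0 mu]; rewrite sumr_const_nat subSS natrB // leq_divRL //.
  by apply: leq_trans u1; rewrite expnS expn1 leq_mul2l mu orbT.
 have -> : \sum_(1 <= m < (M %/ u.+1).+1) 1 * \sum_(u.+1 <= d < (M %/ m).+1) 1 =
   \sum_(1 <= m < u.+1) ((M %/ m)%:R - u%:R) :> R.
  have vu : (M %/ u.+1 <= u)%N by rewrite -ltnS ltn_divLR // -expn2.
  rewrite [RHS](big_cat_nat _ (n := (M %/ u.+1).+1)) //= [X in _ = _ + X]sum_nat_eq0 ?addr0.
   apply: eq_big_nat => m /andP[m0 mv]; rewrite mul1r tail // m0 /=.
   by apply: leq_trans vu; rewrite -ltnS.
  move=> m /andP[vm mu] _; rewrite ltnS in mu.
  have e : (M %/ m = u)%N.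
   apply/eqP; rewrite eqn_leq; apply/andP; split.
    rewrite -ltnS ltn_divLR ?(leq_ltn_trans _ vm) //.
    by move: vm; rewrite ltn_divLR // mulnC.
   rewrite leq_divRL ?(leq_ltn_trans _ vm) //; apply: leq_trans u1.
   by rewrite expnS expn1 leq_mul2l mu orbT.
  by rewrite e subrr.
 rewrite sumrB sumr_const_nat subn1 /= -[_ *+ u]mulr_natr.
 by set S := \sum_(_ <= _ < _) _; ring.
have h1 : `|\sum_(1 <= d < u.+1) (M %/ d)%:R - M%:R * harm u| <= u%:R.
 rewrite /harm mulr_sumr -sumrB; apply: le_trans (ler_norm_sum _ _ _) _.
 rewrite -[leRHS]sumc; apply: ler_sum_nat => d /andP[d0 _].
 by have [] := truncn_div M d0; rewrite ler_norml; clear; lra.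
have M4 : M%:R / u%:R <= 4 * u%:R :> R.
 rewrite ler_pdivrMr // -!natrM ler_nat; move: u2; rewrite expnS expn1; move: u0; clear; nia.
have Mp : 0 <= (M%:R : R) by rewrite ler0n.
have h2 : `|M%:R * harm u - M%:R * (lnn u + g)| <= 4 * u%:R.
 rewrite -mulrBr normrM ger0_norm //; apply: le_trans M4; rewrite ler_wpM2l //.
 by have := hg u u0; rewrite opprD addrA.
have h3 : `|2 * (M%:R * lnn u) - M%:R * lnn M| <= 8 * u%:R.
 have l1 : 2 * lnn u <= lnn M.
  have -> : 2 * lnn u = lnn (u ^ 2) by rewrite expnS expn1 lnnM //; ring.
  by apply: ler_lnn => //; rewrite expn_gt0 u0.
 have l2 : lnn M <= 2 * (lnn u + u%:R^-1).
  apply: le_trans (_ : 2 * lnn u.+1 <= _); last by have := lnnS_sub R u0; clear; set a := _^-1; lra.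
  have -> : 2 * lnn u.+1 = lnn (u.+1 ^ 2) by rewrite expnS expn1 lnnM //; ring.
  by apply: ler_lnn => //; exact: ltnW.
 have := ler_wpM2l Mp l1; have := ler_wpM2l Mp l2; move: M4; clear => M4 a1 a2.
 rewrite ler_norml; move: M4 a1 a2; set a := _^-1; set l := lnn u; set l' := lnn M; lra.
have h4 : `|M%:R - u%:R * u%:R| <= 3 * u%:R :> R.
 rewrite -!natrM ger0_norm ?subr_ge0 ?ler_nat ?mulnn //.
 rewrite lerBlDr -natrD ler_nat; move: u2 u0; rewrite !expnS !expn0; clear; nia.
have us : u%:R <= Num.sqrt M%:R :> R.
 by rewrite -(ler_pXn2r (n := 2)) ?nnegrE ?sqrtr_ge0 // sqr_sqrtr // -natrX ler_nat.
rewrite e1; move: h1 h2 h3 h4 us; set S := \sum_(_ <= _ < _) _; set H := harm u.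
clear; rewrite !ler_norml => /andP[a1 a2] /andP[a3 a4] /andP[a5 a6] /andP[a7 a8] a9.
by apply/andP; split; lra.
Qed.

Lemma sum_tauR_inv N : (0 < N)%N -> \sum_(1 <= n < N.+1) tauR n / n%:R <= (1 + lnn N) ^+ 2.
Proof.
move=> N0; have -> : \sum_(1 <= n < N.+1) tauR n / n%:R =
  \sum_(1 <= n < N.+1) rconv (fun m => 1 * npw 1 m) (fun m => 1 * npw 1 m) n.
 by apply: eq_bigr => n _; rewrite rconv_npw npw_1.
rewrite (hyperbola _ _ (leqnn N)) divn_small // [X in _ + X]big_geq // addr0.
have h := sum_inv_le R N0; have h0 : 0 <= 1 + lnn N by rewrite addr_ge0 ?lnn_ge0.
rewrite expr2; apply: le_trans (ler_wpM2r h0 h); rewrite mulr_suml.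
apply: ler_sum_nat => d /andP[d0 dN]; rewrite mul1r npw_1 ler_wpM2l //.
under eq_bigr do rewrite mul1r npw_1.
have v0 : (0 < N %/ d)%N by rewrite divn_gt0.
apply: le_trans (sum_inv_le R v0) _; rewrite lerD2l ler_lnn // leq_div //.
Qed.

Section Gamma.
Variable g : R.
Hypothesis hg : forall N, (0 < N)%N -> `|harm N - lnn N - g| <= N%:R^-1.

Lemma gamma_bounds : 0 <= g <= 1.
Proof.
have h N : (0 < N)%N -> - N%:R^-1 <= g <= 1 + N%:R^-1.
 move=> N0; have := hg N0; rewrite ler_norml => /andP[h1 h2].
 have h3 := sum_inv_le R N0; rewrite -/(harm N) in h3.
 have h4 := lnn_le_sum_inv R N; rewrite -/(harm N) in h4.
 have h5 := ler_lnn R N0 (leqnSn N); move: h1 h2 h3 h4 h5; clear; set a := _^-1; lra.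
have small (e : R) : 0 < e -> exists2 N, (0 < N)%N & N%:R^-1 <= e.
 move=> e0; exists (Num.truncn e^-1).+1 => //; rewrite -[leRHS]invrK lef_pV2 ?posrE ?invr_gt0 //.
 exact/ltW/truncn_gtS.
apply/andP; split; apply/ler_addgt0Pr => e /small[N N0 hN]; have /andP[h1 h2] := h N N0.
 by lra.
by lra.
Qed.

(** The coefficients of [zeta * (- zeta' / zeta - zeta + 2 g)]. With [g] Euler's constant, the term
    [2 g] cancels the linear terms of the partial sums and leaves an error of order [sqrt M]. *)
Definition hR (n : nat) : R := lnn n - tauR n + 2 * g.

(** The coefficients of [- zeta' / zeta - zeta + 2 g], in which the poles at 1 cancel; small sums of
    [fR] are the prime number theorem. *)
Definition fR (n : nat) : R := Lam n - 1 + (if n == 1%N then 2 * g else 0).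

Lemma fR_le n : (0 < n)%N -> `|fR n| <= 1 + lnn n.
Proof.
move=> n0; rewrite /fR; have := Lam_ge0 R n; have := Lam_le R n0; have := gamma_bounds.
case: eqP => [->|_] /andP[g0 g1]; last by rewrite ler_norml => ? ?; lra.
by rewrite lnn1 ler_norml => ? ?; lra.
Qed.

Lemma sum_fR_dvd n : (0 < n)%N -> \sum_(1 <= d < n.+1 | (d %| n)%N) fR d = hR n.
Proof.
move=> n0; rewrite /fR big_split sumrB /= sum_Lam_dvd // /hR; congr (_ - _ + _).
 by rewrite /tauR /rconv; apply: eq_bigr => d _; rewrite mulr1.
rewrite big_mkcond big_ltn //= dvd1n sum_nat_eq0 ?addr0 // => d /andP[d1 _] _.
by case: ifP => // _; case: eqP d1 => // ->.
Qed.

Lemma sum_hR_le M : `|\sum_(1 <= n < M.+1) hR n| <= 30 * Num.sqrt M%:R.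
Proof.
have [->|M0] := posnP M; first by rewrite big_geq // normr0 mulr_ge0.
have h1 := sum_lnn_stirling M0; have h2 := sum_tauR hg M0.
have s1 : 1 <= Num.sqrt (M%:R : R) by rewrite -[leLHS]sqrtr1 ler_wsqrtr // ler1n.
have l2 : lnn M <= 2 * Num.sqrt M%:R.
 have -> : lnn M = 2 * ln (Num.sqrt (M%:R : R)).
  rewrite mulr_natl -lnXn ?(lt_le_trans ltr01) // sqr_sqrtr //.
 rewrite ler_wpM2l //; have s0 := ge1_gt0 s1.
 have := @le_ln1Dx R (Num.sqrt M%:R - 1); have -> : 1 + (Num.sqrt M%:R - 1) = Num.sqrt M%:R :> R by ring.
 by lra.
rewrite /hR big_split sumrB sumr_const_nat subn1 /= -[_ *+ M]mulr_natr.
move: h1 h2 s1 l2; set S := \sum_(_ <= _ < _) _; set T := \sum_(_ <= _ < _) _; set r := Num.sqrt _.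
clear; rewrite !ler_norml => /andP[a1 a2] /andP[a3 a4] a5 a6; apply/andP; split; lra.
Qed.

Lemma sum_hR_inv N : (0 < N)%N -> \sum_(1 <= n < N.+1) `|hR n| / n%:R <= 4 * (1 + lnn N) ^+ 2.
Proof.
move=> N0; have l0 := @lnn_ge0 R N.
apply: le_trans (_ : \sum_(1 <= n < N.+1) ((lnn N + 2) * n%:R^-1 + tauR n / n%:R) <= _).
 apply: ler_sum_nat => n /andP[n0 nN]; rewrite -mulrDl ler_wpM2r //.
 have t0 : 0 <= tauR n by rewrite /tauR /rconv sumr_ge0 // => d _; rewrite mulr1.
 have l1 := @lnn_ge0 R n; have l2 : lnn n <= lnn N by apply: ler_lnn.
 by rewrite /hR; have /andP[g0 g1] := gamma_bounds; rewrite ler_norml; move: t0 l1 l2 g0 g1; clear; lra.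
rewrite big_split /= -mulr_sumr; have h1 := sum_tauR_inv N0.
have := sum_inv_le R N0; have l3 : 0 <= lnn N + 2 by lra.
move=> /(ler_wpM2l l3); move: h1 l0; clear; set S := \sum_(_ <= _ < _) _; set T := \sum_(_ <= _ < _) _.
by set l := lnn N; rewrite !expr2; nra.
Qed.

(** The series of [hR] multiplied by [1 - m ^ (1 - s)]. The series of [fR] is then the quotient of
    those of [pC m] and [cm m], which both have controlled partial sums, unlike zeta itself. *)
Definition pC (m n : nat) : C := (hR n - (if (m %| n)%N then m%:R * hR (n %/ m) else 0))%:C%C.

Lemma dconv_fR_cm m n : (0 < m)%N -> (0 < n)%N -> dconv (fun n => (fR n)%:C%C) (cm R m) n = pC m n.
Proof.
move=> m0 n0; rewrite /dconv /pC; have -> : forall x y : R, (x - y)%:C%C = x%:C%C - y%:C%C :> C.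
 by move=> x y; exact: rmorphB.
under eq_bigr do rewrite /cm mulrBr mulr1.
rewrite sumrB; congr (_ - _).
 by rewrite -realc_sum sum_fR_dvd.
case: ifPn => [mn|nmn]; last first.
 rewrite rmorph0; apply: sum_nat_eq0 => d _ dn; case: ifPn => [md|_]; last by rewrite mulr0.
 by move: nmn; rewrite (dvdn_trans md) // dvdn_div.
have nm0 : (0 < n %/ m)%N by rewrite divn_gt0 dvdn_leq.
rewrite realcM -sum_fR_dvd // realc_sum mulr_sumr.
have le : ((n %/ m).+1 <= n.+1)%N by rewrite ltnS leq_div.
rewrite [RHS]big_mkcond [RHS](big_nat_widen _ _ n.+1) //=.
rewrite big_mkcond [RHS]big_mkcond; apply: eq_big_nat => d /andP[d0 dn].
have [dnm|dnm] := boolP (d %| n %/ m)%N.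
 have dn' : (d %| n)%N by apply: dvdn_trans dnm _; rewrite dvdn_div.
 rewrite dn' ltnS dvdn_leq //; have -> : (m %| n %/ d)%N.
  by rewrite dvdn_divRL // mulnC -dvdn_divRL.
 by rewrite mulrC realc_nat.
have [dn'|] := boolP (d %| n)%N; last by case: ifP.
have -> : (m %| n %/ d)%N = false by rewrite dvdn_divRL // mulnC -dvdn_divRL // (negPf dnm).
by rewrite mulr0; case: ifP.
Qed.

Lemma sqb_pC m : (0 < m)%N -> sqb (pC m) (60 * m%:R).
Proof.
move=> m0 M; rewrite -realc_sum normcR sumrB -big_mkcond -mulr_sumr.
have -> : \sum_(1 <= i < M.+1 | (m %| i)%N) hR (i %/ m) = \sum_(1 <= i < (M %/ m).+1) hR i.
 by rewrite -(sum_mult_div _ _ m0) big_mkcond.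
have h1 := sum_hR_le M; have h2 := sum_hR_le (M %/ m).
have s1 : Num.sqrt (M %/ m)%:R <= Num.sqrt M%:R :> R by rewrite ler_wsqrtr // ler_nat leq_div.
have s0 := sqrtr_ge0 (M%:R : R); have m1 : 1 <= (m%:R : R) by rewrite ler1n.
apply: le_trans (ler_normB _ _) _; rewrite normrM [`|m%:R|]ger0_norm //.
have h3 : m%:R * `|\sum_(1 <= n < (M %/ m).+1) hR n| <= m%:R * (30 * Num.sqrt M%:R).
 by rewrite ler_wpM2l // (le_trans h2) // ler_wpM2l.
have h4 := ler_wpM2r s0 m1.
by lra.
Qed.

Lemma hdb_pC m : (0 < m)%N -> hdb (pC m) 8.
Proof.
move=> m0 N N0; have h := sum_hR_inv N0.
apply: le_trans (_ : \sum_(1 <= n < N.+1) (`|hR n| / n%:R +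
  (if (m %| n)%N then `|hR (n %/ m)| / (n %/ m)%:R else 0)) <= _).
 apply: ler_sum_nat => n /andP[n0 _]; rewrite normcR.
 case: ifPn => [mn|_]; last by rewrite subr0 addr0.
 have -> : `|hR (n %/ m)| / (n %/ m)%:R = m%:R * `|hR (n %/ m)| / n%:R.
  have -> : n%:R = (n %/ m)%:R * m%:R :> R by rewrite -natrM divnK.
  have m0' : m%:R != 0 :> R by rewrite pnatr_eq0 -lt0n.
  by rewrite invfM; set a := `|_|; set b := _^-1; field.
 rewrite -mulrDl ler_wpM2r //; apply: le_trans (ler_normB _ _) _.
 by rewrite normrM [`|m%:R|]ger0_norm.
rewrite big_split /= (sum_mult_div (fun n => `|hR n| / n%:R)) //.
have h2 : \sum_(1 <= n < (N %/ m).+1) `|hR n| / n%:R <= \sum_(1 <= n < N.+1) `|hR n| / n%:R.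
 rewrite [leRHS](big_cat_nat _ (n := (N %/ m).+1)) ?ltnS ?leq_div //= lerDl.
 by apply: sumr_ge0 => n _; rewrite divr_ge0.
by lra.
Qed.

(** [m] varies with [t] as in [zeta_cm_lower]. As [m <= 3 (1 + |t|)], the parameter [60 m] brings in
    a second factor [1 + |t|], whence the exponent [e1 / 2] and the constant [180]. *)
Lemma fR_sum_bound (D : nat) : exists2 K : R, 0 < K & forall x, 1 <= ln x -> forall y : nat, y%:R <= x ->
 `|\sum_(1 <= n < y.+1) fR n| <= K * x / ln x ^+ D.
Proof.
have [k [e [e0 hps]]] := power_saving R 0 D.
have [e1 e10 hq] := DS_quotient_bound k e0.
have e20 : 0 < e1 / 2 by lra.
have [Ku Ku1 hKu] := uniform_twist_bound k e20.
have [Kl Kl1 hKl] := zeta_cm_lower e10.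
pose P : R := 180 `^ (e1 / 2).
have P1 : 1 <= P by rewrite one_le_powR ?(ltW e20) // ler1n.
have Ku2 : 1 <= Ku * 9 * P.
 by rewrite mulr_ege1 // mulr_ege1 // ler1n.
have [K1 K10 hK1] := hq Kl _ Kl1 Ku2.
have [K2 K20 hK2] := hps K1 K10; exists K2 => // x L1 y yx.
have L0 := ge1_gt0 L1.
have := hK2 (fun n => (fR n)%:C%C) x 1 _ L1 (lexx _) _ _ y yx.
rewrite -realc_sum normcR; apply => [n n0||t].
- by rewrite normcR fR_le.
- by [].
set s := 1 + _; have s12 : 1 < s <= 2.
 rewrite /s ltrDl invr_gt0 L0 /=; have : (ln x)^-1 <= 1 by rewrite invf_le1.
 lra.
have s1 : 1 < s by case/andP: s12.
have [m m1 [mt low]] := hKl t; have m0 := ltnW m1.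
set f := (fun n => (fR n)%:C%C); rewrite mul1r.
have sL : smb s f.
 by apply: (smb_le (B := 1)) => // n n0; rewrite mul1r normcR fR_le.
have sc : smb s (cm R m) by exact: smb_cm.
have sp : smb s (pC m).
 by apply: (eq_smb (c := dconv f (cm R m))) (smb_dconv sL sc) => n n0; exact: dconv_fR_cm.
have t1 : 1 <= 1 + `|t| by rewrite lerDl.
have m1' : 1 <= (m%:R : R) by rewrite ler1n.
have Y60 : 1 <= 60 * m%:R :> R by move: m1'; clear; lra.
have pw Y : 0 <= Y -> Y <= 180 * (1 + `|t|) -> (Y * (1 + `|t|)) `^ (e1 / 2) <= P * (1 + `|t|) `^ e1.
 move=> Y0 hY; have -> : (1 + `|t|) `^ e1 = ((1 + `|t|) ^+ 2) `^ (e1 / 2).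
  by rewrite -powR_mulrn // -powRrM; congr powR; field.
 rewrite -powRM //; apply: ler_wpowR; rewrite ?(ltW e20) ?mulr_ge0 //.
 by rewrite expr2 mulrA ler_wpM2r.
have -> : DS (tw t (lk f k)) s = DS (lk (tw t f) k) s by apply: eq_DS => n _; rewrite lk_tw.
apply: (hK1 s _ (tw t f) (tw t (cm R m)) (tw t (pC m))) => //.
- exact: smb_tw.
- exact: smb_tw.
- by move=> n n0; rewrite dconv_tw // /tw dconv_fR_cm.
- exact: low.
- move=> i /andP[_ ik]; have -> : DS (lk (tw t (cm R m)) i) s = DS (tw t (lk (cm R m) i)) s.
  by apply: eq_DS => n _; rewrite lk_tw.
 apply: le_trans (hKu _ _ _ _ _ t ik s12 m1' (sqb_cm R m0) (hdb_cm R m0) sc) _.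
 rewrite -mulrA; apply: le_trans (_ : Ku * 9 * (P * (1 + `|t|) `^ e1) <= _); last by rewrite mulrA.
 rewrite -[leRHS]mulrA (ler_wpM2l (le_trans ler01 Ku1)) //; apply: ler_pM; rewrite //; first by lra.
 by apply: pw => //; move: mt t1; clear; lra.
- move=> i ik; have -> : DS (lk (tw t (pC m)) i) s = DS (tw t (lk (pC m) i)) s.
  by apply: eq_DS => n _; rewrite lk_tw.
 apply: le_trans (hKu _ _ _ _ _ t ik s12 Y60 (sqb_pC m0) (hdb_pC m0) sp) _.
 rewrite -mulrA; apply: le_trans (_ : Ku * 9 * (P * (1 + `|t|) `^ e1) <= _); last by rewrite mulrA.
 have -> : 1 + 8 = 9 :> R by lra.
 rewrite -[leRHS]mulrA ler_wpM2l ?(le_trans ler01) // ler_wpM2l //.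
 by apply: pw; [rewrite mulr_ge0|move: mt; clear; lra].
Qed.

End Gamma.

Lemma ln_pow_le (D : nat) (x : R) : 1 <= ln x -> ln x ^+ D <= D%:R ^+ D * x.
Proof.
move=> L1; have := @expr_le_expR R D (ln x) (le_trans ler01 L1).
rewrite lnK // posrE ltNge; apply/negP => /ln0 h; move: L1; rewrite h; lra.
Qed.

Lemma PNT (D : nat) : exists2 K : R, 0 < K & forall x, 1 <= ln x -> forall y : nat, y%:R <= x ->
 `|\sum_(1 <= n < y.+1) Lam n - y%:R| <= K * x / ln x ^+ D.
Proof.
have [g hg] := harm_limit; have [K K0 hK] := fR_sum_bound hg D.
exists (K + 2 * D%:R ^+ D); first by rewrite ltr_wpDr // mulr_ge0.
move=> x L1 y yx; have L0 := ge1_gt0 L1.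
have e : \sum_(1 <= n < y.+1) Lam n - y%:R = \sum_(1 <= n < y.+1) fR g n -
  (if (0 < y)%N then 2 * g else 0).
 rewrite /fR big_split sumrB sumr_const_nat subn1 /=.
 case: y yx => [|y] yx; first by rewrite !big_geq //= !subr0 addr0.
 rewrite [X in _ = _ + X - _]big_ltn //= [X in _ = _ + (_ + X) - _]sum_nat_eq0 ?addr0 ?addrK //.
 by move=> n /andP[n1 _] _; case: eqP n1 => // ->.
rewrite e; apply: le_trans (ler_normB _ _) _; have -> : (K + 2 * D%:R ^+ D) * x / ln x ^+ D = K * x / ln x ^+ D + 2 * D%:R ^+ D * (x / ln x ^+ D) by ring.
apply: lerD; first exact: hK.
have h := ln_pow_le D L1; rewrite -mulrA; have /andP[g0 g1] := gamma_bounds hg.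
apply: le_trans (_ : 2 * 1 <= _); first by case: ifP => _; rewrite ?ger0_norm ?mulr_ge0 //; lra.
by rewrite ler_wpM2l // mulrA ler_pdivlMr ?exprn_gt0 // mul1r.
Qed.

End PNT.

(** * Dirichlet characters *)

Section Characters.
Variable R : realType.
Local Notation C := R[i].

(** A character is a periodic function on all of [nat], zero off the units, so that it can serve
    directly as a sequence of coefficients. *)
Definition dchar (q : nat) (f : nat -> C) := [/\ f 1%N = 1,
 forall m n, f (m * n)%N = f m * f n, forall n, f (n %% q)%N = f n
 & forall n, ~~ coprime n q -> f n = 0].

Lemma dchar_mod q f m n : dchar q f -> m = n %[mod q] -> f m = f n.
Proof. by case=> _ _ fp _ e; rewrite -[LHS]fp e fp. Qed.

Lemma dcharX q f m n : dchar q f -> f (m ^ n)%N = f m ^+ n.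
Proof.
case=> f1 fM _ _; elim: n => [|n IH]; first by [].
by rewrite expnS fM IH exprS.
Qed.

Lemma dchar_norm q f n : (0 < q)%N -> dchar q f -> coprime n q -> normc (f n) = 1.
Proof.
move=> q0 hf nq; have e : f n ^+ totient q = 1.
 by rewrite -(dcharX _ _ hf) (dchar_mod hf (Euler_exp_totient nq)); case: hf.
have := congr1 (@normc R) e; rewrite normcX normc1 => /eqP.
by rewrite pexpr_eq1 ?totient_gt0 ?normc_ge0 // => /eqP.
Qed.

Lemma dchar_norm_le1 q f n : (0 < q)%N -> dchar q f -> normc (f n) <= 1.
Proof.
move=> q0 hf; have [nq|nq] := boolP (coprime n q); first by rewrite (dchar_norm q0 hf).
by case: hf => _ _ _ ->; rewrite ?normc0.
Qed.

Lemma dchar_conjK q f n : (0 < q)%N -> dchar q f -> coprime n q -> f n * conjc (f n) = 1.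
Proof. by move=> q0 hf nq; rewrite mulc_conj (dchar_norm q0 hf) // expr1n. Qed.

Lemma dchar_ext q f g : dchar q f -> dchar q g -> (forall n, coprime n q -> f n = g n) -> f = g.
Proof.
move=> hf hg e; apply/funext => n; have [nq|nq] := boolP (coprime n q); first exact: e.
by case: hf => _ _ _ ->; case: hg => // _ _ _ ->.
Qed.

Section Mod.
Variable k : nat.
Local Notation q := k.+1.

Definition rmul (b : nat) (x : 'I_q) : 'I_q := inZp (b * x).

Lemma rmul_inj b : coprime b q -> injective (rmul b).
Proof.
move=> bq x y /(congr1 val) /= e; apply/val_inj.
wlog xy : x y e / (x <= y)%N.
 by move=> H; have [/H|/ltnW /H] := leqP x y; [apply|move=> h1; apply/esym/h1].
move/eqP: e; rewrite eq_sym eqn_mod_dvd ?leq_mul2l ?xy ?orbT // -mulnBr Gauss_dvdr 1?coprime_sym //.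
move=> d; apply/eqP; rewrite eqn_leq xy -subn_eq0 /=.
have [//|p] := posnP (y - x); have := dvdn_leq p d.
by rewrite leqNgt (leq_ltn_trans (leq_subr _ _)).
Qed.

Lemma sum_rmul (b : nat) (F : 'I_q -> C) : coprime b q -> \sum_x F (rmul b x) = \sum_x F x.
Proof. by move=> bq; rewrite [RHS](reindex_inj (rmul_inj bq)). Qed.

(** A unit [b] with [f b != g b] permutes the residues and multiplies the sum by
    [f b * conjc (g b)], which is not 1. *)
Lemma dchar_orth f g : dchar q f -> dchar q g ->
 \sum_(x < q) f x * conjc (g x) = if f == g then (totient q)%:R else 0.
Proof.
move=> hf hg; case: eqP => [<-|/eqP fg].
 rewrite totient_count_coprime natr_sum big_mkord; apply: eq_bigr => x _.
 rewrite coprime_sym; have [xq|xq] := boolP (coprime x q); first by rewrite (dchar_conjK _ hf).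
 by case: hf => _ _ _ ->; rewrite ?mul0r.
have [b bq fgb] : exists2 b, coprime b q & f b != g b.
 apply/not_exists2P => H; move/eqP: fg; apply; apply: (dchar_ext hf hg) => n nq.
 by apply/eqP/negPn/negP; case: (H n).
set S := \sum_(x < q) _; have eS : S = f b * conjc (g b) * S.
 rewrite {1}/S -(sum_rmul (fun x => f x * conjc (g x)) bq) mulr_sumr; apply: eq_bigr => x _.
 rewrite /rmul (dchar_mod hf (modn_mod _ _)) (dchar_mod hg (modn_mod _ _)).
 by case: hf => _ -> _ _; case: hg => _ -> _ _; rewrite rmorphM; ring.
have : (1 - f b * conjc (g b)) * S = 0 by rewrite mulrBl mul1r -eS subrr.
move=> /eqP; rewrite mulf_eq0 subr_eq0 => /orP[/eqP e|/eqP //].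
have := dchar_conjK (ltn0Sn k) hg bq => e2.
have gb : conjc (g b) != 0 by apply/eqP => z; move: e2; rewrite z mulr0 => /eqP; rewrite eq_sym oner_eq0.
by move: fgb; rewrite -(inj_eq (mulIf gb)) -e e2 eqxx.
Qed.

(** On row vectors, indexed by residues, it acts as the translation that replaces [v x] by
    [v (b x)]. *)
Definition trans_mx (b : nat) : 'M[C]_q := \matrix_(y, x) (y == rmul b x)%:R.

Lemma mulmx_trans_mx m (A : 'M[C]_(m, q)) b i x : (A *m trans_mx b) i x = A i (rmul b x).
Proof.
rewrite mxE (bigD1 (rmul b x)) //= mxE eqxx mulr1 big1 ?addr0 // => y yx.
by rewrite mxE (negPf yx) mulr0.
Qed.

Lemma rmulM b c x : rmul b (rmul c x) = rmul (b * c) x.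
Proof. by apply/val_inj; rewrite /= modnMmr mulnA. Qed.

Lemma trans_mxM b c : trans_mx b *m trans_mx c = trans_mx (b * c).
Proof. by apply/matrixP => y x; rewrite mulmx_trans_mx !mxE rmulM. Qed.

Lemma trans_mx1 b : b = 1 %[mod q] -> trans_mx b = 1%:M.
Proof.
move=> b1; apply/matrixP => y x; rewrite !mxE; congr (_ == _)%:R.
by apply/val_inj; rewrite /= -modnMml b1 modnMml mul1n modn_small.
Qed.

Lemma trans_mxX b n : trans_mx b ^+ n = trans_mx (b ^ n).
Proof.
elim: n => [|n IH]; first by rewrite expr0 expn0 trans_mx1.
by rewrite exprS IH expnS -trans_mxM.
Qed.

Lemma prim_root_expi n : (0 < n)%N -> n.-primitive_root (expi (2 * pi / n%:R) : C).
Proof.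
move=> n0; have n0' : (n%:R : R) != 0 by rewrite pnatr_eq0 -lt0n.
rewrite /primitive_root_of_unity n0; apply/forallP => i; rewrite unity_rootE -expiMn.
apply/eqP; have [->|ne] := eqVneq i.+1 n.
 have -> : n%:R * (2 * pi / n%:R) = 2 * pi * 1%:R :> R by field.
 by rewrite expi_2pin eqxx.
apply/negbTE; have -> : i.+1%:R * (2 * pi / n%:R) = 2 * pi * (i.+1%:R / n%:R) :> R by ring.
apply: expi_2pi_neq1; rewrite divr_gt0 ?ltr0n //= ltr_pdivrMr ?ltr0n // mul1r ltr_nat.
by rewrite ltn_neqAle ne ltn_ord.
Qed.

(** The matrix is annihilated by [X ^ n - 1] with [n = totient q], which has distinct roots. *)
Lemma diag_trans_mx b : coprime b q -> diagonalizable (trans_mx b).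
Proof.
move=> bq; apply/diagonalizableP; pose n := totient q.
have n0 : (0 < n)%N by rewrite totient_gt0.
have pz := prim_root_expi n0; set z := expi _ in pz.
exists [seq z ^+ i | i <- index_iota 0 n].
 rewrite map_inj_in_uniq ?iota_uniq // => i j; rewrite !mem_index_iota => hi hj /eqP.
 by rewrite (eq_prim_root_expr pz) !modn_small // => /eqP.
rewrite big_map factor_Xn_sub_1 //; apply/mxminpoly_minP.
rewrite rmorphB rmorph1 rmorphXn /= horner_mx_X trans_mxX trans_mx1 ?subrr //.
exact: Euler_exp_totient.
Qed.

(** Simultaneous diagonalisation of commuting operators; the rows of [P] are their joint
    eigenvectors. *)
Lemma char_basis : exists P : 'M[C]_q, P \in unitmx /\ forall b, coprime b q ->
 exists d : 'rV[C]_q, forall i x, P i (rmul b x) = d 0 i * P i x.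
Proof.
pose As := [seq trans_mx b | b <- iota 0 q & coprime b q].
have [H _] := @codiagonalizableP _ _ As.
have [|P Pu /allP PA] := H.
 split=> [A B /mapP[b _ ->] /mapP[c _ ->]|A /mapP[b]].
  by rewrite /comm_mx !trans_mxM mulnC.
 by rewrite mem_filter => /andP[bq _] ->; exact: diag_trans_mx.
exists P; split=> // b bq.
have bA : trans_mx (b %% q) \in As.
 by apply/mapP; exists (b %% q)%N; rewrite // mem_filter coprime_modl bq mem_iota ltn_mod.
have /diagonalizable_forPex[d /(simmxP Pu) e] := PA _ bA.
exists d => i x; have := congr1 (fun A : 'M[C]_k.+1 => A i x) e.
rewrite mulmx_trans_mx mul_diag_mx mxE => <-; congr (P i _).
by apply/val_inj; rewrite /= modnMml.
Qed.

(** A joint eigenvector that does not vanish at 1, divided by its value there, is a character on the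
    units; one that vanishes at 1 vanishes on all units. As [P] is invertible, the indicator of a
    unit class is a combination of these characters. Together with [dchar_orth] this gives the
    second orthogonality relation, and a further character would be orthogonal to all the others,
    contradicting that relation at 1. *)
Lemma chars_exist : exists X : seq (nat -> C), [/\ uniq X, forall f, f \in X <-> dchar q f &
 forall a b, coprime a q ->
 \sum_(f <- X) f b * conjc (f a) = if (a == b %[mod q])%N then (totient q)%:R else 0].
Proof.
have [P [Pu hP]] := char_basis.
pose o : 'I_q := inZp 1.
pose chi i (n : nat) : C := if coprime n q then P i (inZp n) / P i o else 0.
have Pmul i m n : coprime m q -> P i o != 0 -> P i (inZp (m * n)) = chi i m * P i (inZp n).
 move=> mq Pio; have [d hd] := hP m mq.
 have e y : rmul m (inZp y) = inZp (m * y) by apply/val_inj; rewrite /= modnMmr.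
 have e1 := hd i (inZp n); rewrite e in e1; have e2 := hd i o; rewrite e muln1 in e2.
 by rewrite /chi mq e1 e2 mulfK.
have chiP i : P i o != 0 -> dchar q (chi i).
 move=> Pio; split.
 - by rewrite /chi coprime1n divff.
 - move=> m n; rewrite {1}/chi coprimeMl; have [mq|mq] := boolP (coprime m q); last first.
   by rewrite {1}/chi (negPf mq) mul0r.
  have [nq|nq] := boolP (coprime n q); last by rewrite [chi i n]/chi (negPf nq) mulr0.
  by rewrite Pmul // [chi i n]/chi nq mulrA.
 - move=> n; rewrite /chi coprime_modl; congr (if _ then P i _ / _ else _).
  by apply/val_inj; rewrite /= modn_mod.
 - by move=> n nq; rewrite /chi (negPf nq).
pose I := [seq i <- enum 'I_q | P i o != 0].
pose X := undup [seq chi i | i <- I].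
have XP f : f \in X -> dchar q f.
 rewrite mem_undup => /mapP[j].
 by rewrite mem_filter => /andP[Pio _] ->; exact: chiP.
have span a : coprime a q -> exists u : 'I_q -> C, forall b,
  (if (a == b %[mod q])%N then 1 else 0) = \sum_(i <- I) u i * chi i b.
 move=> aq; pose w := delta_mx 0 (inZp a) *m invmx P : 'rV_q.
 exists (fun i => w 0 i * P i o) => b.
 have [bq|nbq] := boolP (coprime b q); last first.
  rewrite big1; last by move=> i _; rewrite /chi (negPf nbq) mulr0.
  case: eqP => // e; by move: nbq; rewrite -coprime_modl -e coprime_modl aq.
 have e0 : (w *m P) 0 (inZp b) = (inZp a == inZp b :> 'I_q)%:R.
  by rewrite /w -mulmxA mulVmx // mulmx1 mxE eqxx eq_sym.
 have -> : (if (a == b %[mod q])%N then 1 else 0) = (inZp a == inZp b :> 'I_q)%:R :> C.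
  by rewrite -val_eqE /=; case: eqP.
 rewrite -e0 mxE big_filter big_enum_cond /= [RHS]big_mkcond /=; apply: eq_bigr => i _.
 have [Pio|Pio] := eqVneq (P i o) 0.
  have [d hd] := hP b bq; have := hd i o; rewrite Pio mulr0 => e.
  have -> : inZp b = rmul b o by apply/val_inj; rewrite /= modnMmr muln1.
  by rewrite e mulr0.
 by rewrite /chi bq mulrAC -mulrA divfK // mulrA.
have orth2 a c : coprime a q ->
 \sum_(f <- X) f c * conjc (f a) = if (a == c %[mod q])%N then (totient q)%:R else 0.
 move=> aq; have [u hu] := span a aq.
 pose K b := \sum_(f <- X) f c * conjc (f b).
 transitivity (\sum_(b < q) (if (a == b %[mod q])%N then 1 else 0) * K b).
  rewrite [RHS](bigD1 (inZp a)) //= modn_mod eqxx mul1r [X in _ = _ + X]big1 ?addr0 => [|b ba].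
   rewrite /K; apply: eq_big_seq => f fX; congr (_ * conjc _).
   by apply: (dchar_mod (XP _ fX)); rewrite modn_mod.
  case: eqP => [e|_]; last by rewrite mul0r.
  by case/eqP: ba; apply/val_inj; rewrite /= e modn_small.
 under eq_bigr do rewrite hu mulr_suml.
 rewrite exchange_big /=; transitivity (\sum_(i <- I) u i * chi i c * (totient q)%:R); last first.
  by rewrite -mulr_suml -hu; case: ifP; rewrite ?mul1r ?mul0r.
 apply: eq_big_seq => i iI; have ci : chi i \in X by rewrite mem_undup map_f.
 transitivity (\sum_(f <- X) u i * f c * \sum_(b < q) chi i b * conjc (f b)).
  under [RHS]eq_bigr do rewrite mulr_sumr.
  rewrite exchange_big /=; apply: eq_bigr => b _; rewrite /K mulr_sumr; apply: eq_bigr => f _.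
  by ring.
 rewrite (bigD1_seq (chi i)) ?undup_uniq //= (dchar_orth (XP _ ci) (XP _ ci)) eqxx.
 rewrite big_seq_cond big1 ?addr0 // => f /andP[fX ne].
 by rewrite (dchar_orth (XP _ ci) (XP _ fX)) eq_sym (negPf ne) mulr0.
exists X; split=> //; first exact: undup_uniq.
move=> f; split; first exact: XP.
move=> hf; apply/negPn/negP => nf.
have e : \sum_(b < q) (\sum_(g <- X) g b * conjc (g 1%N)) * conjc (f b) = 0.
 under eq_bigr do rewrite mulr_suml.
 rewrite exchange_big big_seq big1 //= => g gX; under eq_bigr do rewrite mulrAC.
 rewrite -mulr_suml (dchar_orth (XP _ gX) hf); case: eqP => [e|_]; last by rewrite mul0r.
 by rewrite -e gX in nf.
move: e; under eq_bigr do rewrite orth2 ?coprime1n //.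
rewrite (bigD1 o) //= modn_mod eqxx big1 ?addr0 => [|b bo]; last first.
 case: eqP => [e|_]; last by rewrite mul0r.
 by case/eqP: bo; apply/val_inj; rewrite /= e modn_small.
case: (hf) => f1 _ fp _; rewrite fp f1 rmorph1 mulr1 => /eqP.
by rewrite pnatr_eq0 -leqn0 leqNgt totient_gt0.
Qed.

End Mod.

End Characters.

(** * Additive characters and Ramanujan sums *)

Section Additive.
Variable R : realType.
Local Notation C := R[i].
Local Arguments conjc : simpl never.

Lemma conjcM (u v : C) : conjc (u * v) = conjc u * conjc v. Proof. exact: rmorphM. Qed.

Lemma conjc1 : conjc (1 : C) = 1. Proof. exact: rmorph1. Qed.

Definition ep (t : R) : C := expi (2 * pi * t).

Lemma epD s t : ep (s + t) = ep s * ep t.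
Proof. by rewrite /ep mulrDr expiD. Qed.

Lemma ep0 : ep 0 = 1. Proof. by rewrite /ep mulr0 expi0. Qed.

Lemma ep_nat n : ep n%:R = 1. Proof. exact: expi_2pin. Qed.

Lemma conj_ep t : conjc (ep t) = ep (- t).
Proof. by rewrite /ep conj_expi mulrN. Qed.

Lemma normc_ep t : normc (ep t) = 1. Proof. exact: normc_expi. Qed.

Lemma ep_natM t n : ep (n%:R * t) = ep t ^+ n.
Proof. by rewrite /ep mulrCA expiMn. Qed.

Lemma ep_mod a q (b : nat) : (0 < q)%N -> ep ((a %% q)%N%:R * b%:R / q%:R) = ep (a%:R * b%:R / q%:R).
Proof.
move=> q0; have q0' : (q%:R : R) != 0 by rewrite pnatr_eq0 -lt0n.
rewrite {2}(divn_eq a q) natrD natrM; have -> : ((a %/ q)%:R * q%:R + (a %% q)%N%:R) * b%:R / q%:R =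
 (a %/ q * b)%:R + (a %% q)%N%:R * b%:R / q%:R :> R by rewrite natrM; field.
by rewrite epD ep_nat mul1r.
Qed.

Lemma ep_orth q (a b : nat) : (a < q)%N -> (b < q)%N ->
 \sum_(0 <= j < q) ep (a%:R * j%:R / q%:R) * conjc (ep (b%:R * j%:R / q%:R)) =
 if a == b then q%:R else 0.
Proof.
move=> aq bq; have q0 : (0 < q)%N by exact: leq_ltn_trans aq.
have q0' : (q%:R : R) != 0 by rewrite pnatr_eq0 -lt0n.
have e j : ep (a%:R * j%:R / q%:R) * conjc (ep (b%:R * j%:R / q%:R)) = ep ((a%:R - b%:R) / q%:R) ^+ j.
 by rewrite conj_ep -epD -ep_natM; congr ep; ring.
under eq_bigr do rewrite e.
case: eqP => [->|/eqP ab].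
 under eq_bigr do rewrite subrr mul0r ep0 expr1n.
 by rewrite sumr_const_nat subn0.
rewrite big_mkord sum_geo_root //.
 rewrite -ep_natM; have -> : q%:R * ((a%:R - b%:R) / q%:R) = a%:R - b%:R :> R by field.
 by rewrite epD ep_nat mul1r -conj_ep ep_nat rmorph1.
clear e; wlog ba : a b aq bq ab / (b < a)%N.
 move=> H; case: (ltngtP a b) => [lt|lt|e]; last by rewrite e eqxx in ab.
  have := H b a bq aq _ lt; rewrite eq_sym ab => /(_ isT); apply: contraNneq => e1.
  rewrite -[ep _]conjcK conj_ep -mulNr opprB e1 rmorph1 //.
 exact: H.
have -> : (a%:R - b%:R) / q%:R = (a - b)%N%:R / q%:R :> R by rewrite natrB // ltnW.
apply: expi_2pi_neq1; rewrite divr_gt0 ?ltr0n ?subn_gt0 //= ltr_pdivrMr ?ltr0n // mul1r ltr_nat.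
exact: leq_ltn_trans (leq_subr _ _) aq.
Qed.

Lemma plancherel q (G : nat -> R) : (0 < q)%N -> \sum_(0 <= a < q) G a ^+ 2 =
 q%:R^-1 * \sum_(0 <= b < q) normc (\sum_(0 <= a < q) (G a)%:C%C * ep (a%:R * b%:R / q%:R)) ^+ 2.
Proof.
move=> q0; have q0' : (q%:R : R) != 0 by rewrite pnatr_eq0 -lt0n.
apply: (@complexI R); rewrite realcM !realc_sum mulrC; apply: (mulIf (_ : q%:R%:C%C != 0 :> C)).
 by rewrite realc_nat pnatr_eq0 -lt0n.
rewrite -mulrA -realcM mulVf // mulr1.
under [RHS]eq_bigr do rewrite -mulc_conj conjc_sum mulr_suml.
rewrite exchange_big /= mulr_suml; apply: eq_big_nat => a /andP[_ aq].
under [RHS]eq_bigr do rewrite mulr_sumr.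
rewrite [RHS]exchange_big /=.
transitivity (\sum_(0 <= b < q) (G a * G b)%:C%C * (if a == b then q%:R else 0 : C)).
 rewrite (bigD1_seq a) ?iota_uniq ?mem_index_iota //= eqxx realc_nat -expr2 big1 ?[RHS]addr0 // => b /negPf ba.
 by rewrite eq_sym ba mulr0.
apply: eq_big_nat => b /andP[_ bq]; rewrite -(ep_orth aq bq) mulr_sumr; apply: eq_bigr => j _.
rewrite conjcM conjc_real realcM; ring.
Qed.

Lemma sum_multiples (V : nmodType) (F : nat -> V) k d : (0 < k)%N ->
 \sum_(0 <= a < d * k | (k %| a)%N) F a = \sum_(0 <= b < d) F (b * k)%N.
Proof.
move=> k0; elim: d => [|d IH]; first by rewrite mul0n !big_geq.
rewrite big_nat_recr //= -IH mulSn addnC (big_cat_nat _ (n := (d * k)%N)) ?leq_addr //=.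
have lt : (d * k < d * k + k)%N by rewrite -[ltnLHS]addn0 ltn_add2l.
congr (_ + _); rewrite big_mkcond big_ltn // dvdn_mull //= big_nat_cond big1 ?[LHS]addr0 // => a /andP[/andP[h1 h2] _].
case: ifPn => // /dvdnP[c e]; move: h1 h2; rewrite e -[(d * k + k)%N]mulSnr !ltn_mul2r k0 /=.
by rewrite ltnS => /leq_trans h /h; rewrite ltnn.
Qed.

(** Each fraction [a / q] is attributed to its reduced denominator [q / gcd (a, q)]. *)
Lemma sum_farey (V : nmodType) (F : R -> V) q : (0 < q)%N ->
 \sum_(0 <= a < q) F (a%:R / q%:R) =
 \sum_(1 <= d < q.+1 | (d %| q)%N) \sum_(0 <= b < d | coprime b d) F (b%:R / d%:R).
Proof.
move=> q0.
have one a : F (a%:R / q%:R) = \sum_(1 <= d < q.+1 | (d %| q)%N)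
  (if d == (q %/ gcdn a q)%N then F (a%:R / q%:R) else 0).
 have g0 : (0 < gcdn a q)%N by rewrite gcdn_gt0 q0 orbT.
 have dv : (q %/ gcdn a q %| q)%N by rewrite dvdn_div // dvdn_gcdr.
 have d0 : (0 < q %/ gcdn a q)%N by rewrite divn_gt0 dvdn_leq // dvdn_gcdr.
 have mi : (q %/ gcdn a q)%N \in index_iota 1 q.+1 by rewrite mem_index_iota d0 ltnS leq_div.
 rewrite big_mkcond (bigD1_seq _ mi (iota_uniq _ _)) /=.
 by rewrite dv eqxx big1 ?addr0 // => d /negPf ->; case: ifP.
under eq_bigr do rewrite one.
rewrite exchange_big /= big_nat_cond [RHS]big_nat_cond; apply: eq_bigr => d /andP[/andP[d0 _] /dvdnP[k qk]].
have k0 : (0 < k)%N by move: q0; rewrite qk; case: k {qk}.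
rewrite qk mulnC; transitivity (\sum_(0 <= a < d * k | (k %| a)%N)
  (if d == (d * k %/ gcdn a (d * k))%N then F (a%:R / (d * k)%:R) else 0)).
 rewrite [RHS]big_mkcond; apply: eq_big_nat => a _; have [//|kd] := boolP (k %| a)%N; case: ifP => // e.
 have g0 : (0 < gcdn a (d * k))%N by rewrite gcdn_gt0 muln_gt0 d0 k0 orbT.
 have : (d * k = d * gcdn a (d * k))%N by rewrite {2}(eqP e) divnK // dvdn_gcdr.
 by move/eqP; rewrite eqn_pmul2l // => /eqP kg; move: kd; rewrite kg dvdn_gcdl.
rewrite sum_multiples // [RHS]big_mkcond; apply: eq_bigr => b _.
rewrite -muln_gcdl divnMr // natrM [in F _]natrM.
have k0' : (k%:R : R) != 0 by rewrite pnatr_eq0 -lt0n.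
have d0' : (d%:R : R) != 0 by rewrite pnatr_eq0 -lt0n.
have -> : b%:R * k%:R / (d%:R * k%:R) = b%:R / d%:R :> R by field; rewrite k0' d0'.
congr (if _ then _ else _); rewrite /coprime.
apply/eqP/eqP => [e|->]; last by rewrite divn1.
have : (d = d * gcdn b d)%N by rewrite {2}e divnK // dvdn_gcdr.
by rewrite -{1}[d]muln1 => /eqP; rewrite eqn_pmul2l // eq_sym => /eqP.
Qed.

Definition mob (n : nat) : R := \prod_(p <- primes n) (if logn p n == 1%N then -1 else 0).

Lemma mob_norm n : `|mob n| <= 1.
Proof.
rewrite /mob; elim: (primes n) => [|p s IH]; first by rewrite big_nil normr1.
rewrite big_cons normrM -[leRHS]mulr1 ler_pM //; case: ifP => _; first by rewrite normrN1.
by rewrite normr0.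
Qed.

Lemma mfun_mob : mfun mob.
Proof.
split=> [|m n m0 n0 mn]; first by rewrite /mob big_nil.
have pe : perm_eq (primes (m * n)) (primes m ++ primes n).
 apply: uniq_perm; rewrite ?cat_uniq ?primes_uniq ?andbT //=.
  apply/hasPn => p; rewrite !mem_primes m0 n0 /= => /andP[pp pn]; apply/negP => /andP[_ pm].
  by have := coprime_dvdl pm (coprime_dvdr pn mn); rewrite prime_coprime // dvdnn.
 by move=> p; rewrite mem_cat primesM.
rewrite /mob (perm_big _ pe) big_cat; congr (_ * _); apply: eq_big_seq => p; rewrite mem_primes => /and3P[pp _ pd].
 rewrite lognM // (lognE p n) pp n0 [(p %| n)%N]negbTE ?addn0 //.
 by rewrite -prime_coprime // (coprime_dvdl pd).
rewrite lognM // (lognE p m) pp m0 [(p %| m)%N]negbTE //.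
by rewrite -prime_coprime // coprime_sym (coprime_dvdr pd).
Qed.

Lemma sum_mob n : (0 < n)%N -> \sum_(1 <= d < n.+1 | (d %| n)%N) mob d = if n == 1%N then 1 else 0.
Proof.
move=> n0; have -> : \sum_(1 <= d < n.+1 | (d %| n)%N) mob d = rconv mob (fun=> 1) n.
 by apply: eq_bigr => d _; rewrite mulr1.
have m1 : mfun (fun=> 1 : R) by split=> // *; rewrite mulr1.
have hm := mfun_rconv mfun_mob m1.
case: eqP => [->|/eqP n1]; first by case: hm.
have ngt : (1 < n)%N by rewrite ltn_neqAle eq_sym n1.
pose p := pdiv n; have pp := pdiv_prime ngt.
have -> : n = (n`_p * n`_p^')%N by rewrite partnC.
case: hm => _ ->; rewrite ?coprime_partC // p_part rconv_pfactor // big_ord_recl.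
have l0 : (0 < logn p n)%N by rewrite logn_gt0 mem_primes pp n0 pdiv_dvd.
case: (logn p n) l0 => // l _; rewrite big_ord_recl big1 => [|i _].
 rewrite expn0 expn1 /mob !mulr1 addr0 (primes_prime pp) big_nil big_seq1.
 by rewrite (logn_prime _ pp) eqxx subrr mul0r.
by rewrite /mob primesX // primes_prime // big_seq1 pfactorK // mul0r.
Qed.

Definition ramanujan (d b : nat) : C := \sum_(0 <= a < d | coprime a d) ep (a%:R * b%:R / d%:R).

Lemma sum_ep_full q : (0 < q)%N -> \sum_(0 <= a < q) ep (a%:R / q%:R) = if q == 1%N then 1 else 0.
Proof.
move=> q0; have [->|q1] := eqVneq q 1%N; first by rewrite big_nat1 mul0r ep0.
have q2 : (1 < q)%N by rewrite ltn_neqAle eq_sym q1.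
have h := ep_orth q2 q0; rewrite /= in h; rewrite -[RHS]h; apply: eq_bigr => a _.
by rewrite !mul0r ep0 conjc1 mulr1 mul1r.
Qed.

(** Over the divisors of [n], both sides sum to 1 if [n = 1] and to 0 otherwise; by strong induction
    these sums determine the function. *)
Lemma ramanujan1 d : (0 < d)%N -> ramanujan d 1 = (mob d)%:C%C.
Proof.
have [n] := ubnP d; elim: n d => // n IH d /ltnSE dn d0.
have s1 : \sum_(1 <= e < d.+1 | (e %| d)%N) ramanujan e 1 = if d == 1%N then 1 else 0.
 rewrite -(sum_ep_full d0) (sum_farey ep d0); apply: eq_bigr => e _.
 by apply: eq_bigr => b _; rewrite mulr1.
have s2 := sum_mob d0.
move: s1 s2; rewrite !(big_mkcond (fun e => e %| d)%N) !big_nat_recr //= dvdnn => s1 s2.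
have e : \sum_(1 <= e < d) (if (e %| d)%N then ramanujan e 1 else 0) =
  (\sum_(1 <= e < d) (if (e %| d)%N then mob e else 0))%:C%C.
 rewrite realc_sum; apply: eq_big_nat => e /andP[e0 ed]; case: ifP => // _; rewrite IH //.
 exact: leq_trans dn.
rewrite e in s1; apply: (addrI (\sum_(1 <= e < d) (if (e %| d)%N then mob e else 0))%:C%C).
rewrite s1; have -> : forall x y : R, x%:C%C + y%:C%C = (x + y)%:C%C :> C.
 by move=> x y; rewrite -rmorphD.
by rewrite s2; case: ifP.
Qed.

Lemma ramanujan_coprime k b : coprime b k.+1 -> ramanujan k.+1 b = ramanujan k.+1 1.
Proof.
move=> bq; rewrite /ramanujan [LHS]big_mkcond [RHS]big_mkcond !big_mkord /=.
rewrite -(sum_rmul (fun a : 'I_k.+1 => if coprime a k.+1 then ep (a%:R * 1%:R / k.+1%:R) else 0) bq).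
apply: eq_bigr => a _; rewrite /rmul coprime_modl coprimeMl bq /=; case: ifP => // _.
rewrite ep_mod // natrM mulr1; congr ep; ring.
Qed.

Lemma ramanujan_norm d b : (0 < d)%N -> coprime b d -> normc (ramanujan d b) <= 1.
Proof.
case: d => // k _ bd; rewrite ramanujan_coprime // ramanujan1 // normcR; exact: mob_norm.
Qed.

End Additive.

(** * The large sieve *)

Section LargeSieve.
Variable R : realType.
Local Notation C := R[i].
Local Arguments conjc : simpl never.

Lemma normc_epB1_half (t : R) : `|t| <= 1 / 2 -> `|t| <= normc (ep t - 1).
Proof.
move=> ht; have p2 := pi_ge2 R; have p4 := pihalf_lt2 R.
have e : `|2 * pi * t| = 2 * pi * `|t| by rewrite !normrM [`|pi|]ger0_norm ?pi_ge0 // normr_nat.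
have t0 := normr_ge0 t.
apply: le_trans (normc_expiB1_lower _); rewrite e; nra.
Qed.

Lemma normc_epB1_lower (t u : R) : u <= `|t| -> u <= 1 - `|t| -> u <= normc (ep t - 1).
Proof.
wlog t0 : t / 0 <= t.
 move=> H; case: (leP 0 t) => [/H //|/ltW tn] h1 h2.
 have := H (- t); rewrite normrN oppr_ge0 => /(_ tn h1 h2).
 by rewrite -conj_ep -[X in conjc _ - X]conjc1 -[conjc _ - _]rmorphB normc_conj.
rewrite ger0_norm // => h1 h2; have [th|th] := leP t (1 / 2).
 by apply: le_trans (normc_epB1_half _); rewrite ger0_norm.
have [/ltW t1|t1] := ltP 1 t.
 by apply: le_trans (normc_ge0 _); lra.
have -> : ep t = ep (t - 1) by rewrite epD -conj_ep (ep_nat R 1) conjc1 mulr1.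
by apply: le_trans (normc_epB1_half _); rewrite ler0_norm; lra.
Qed.

Definition dker (N : nat) (t : R) : C := \sum_(0 <= j < N) ep (j%:R * t).

Lemma normc_dker N t : normc (dker N t) <= N%:R.
Proof.
apply: le_trans (normc_sum _ _ _) _; under eq_bigr do rewrite normc_ep.
by rewrite sumr_const_nat subn0.
Qed.

Lemma dker_bound N t : normc (dker N t) * normc (ep t - 1) <= 2.
Proof.
rewrite /dker; under eq_bigr do rewrite ep_natM.
by rewrite big_mkord sum_geo_bound // normc_ep.
Qed.

(** Bound for the kernel between two points whose cells, out of [P] on the circle, are [k] apart.
    Neighbouring cells, including those on both sides of 0 ([k = P.-1]), get the trivial bound.
    Otherwise the two distances along the circle are at least [(k - 1) / P] and [(P - 1 - k) / P];
    terms with denominator 0 are 0, and the trivial bound covers those cases. *)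
Definition cellw (N P k : nat) : R :=
 2 * N%:R ^+ 2 * ((k == 0)%:R + (k == 1)%:R + (k == P.-1)%:R) +
 4 * P%:R ^+ 2 * ((((k - 1)%:R ^+ 2)^-1) + ((P.-1 - k)%:R ^+ 2)^-1).

Lemma cellw_ge0 N P k : 0 <= cellw N P k.
Proof.
by rewrite addr_ge0 // mulr_ge0.
Qed.

Lemma dker_cellw N P (r s : nat) (a b : R) : (r < P)%N -> (s < P)%N ->
 r%:R <= P%:R * a < r.+1%:R -> s%:R <= P%:R * b < s.+1%:R ->
 normc (dker (N + N) (a - b)) * normc (dker N (a - b)) <= cellw N P ((r - s) + (s - r)).
Proof.
move=> rP sP ha hb; have P0 : 0 < (P%:R : R) by rewrite ltr0n; case: P rP {sP ha hb}.
have triv : normc (dker (N + N) (a - b)) * normc (dker N (a - b)) <= 2 * N%:R ^+ 2.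
 apply: (le_trans (ler_pM (normc_ge0 _) (normc_ge0 _) (normc_dker _ _) (normc_dker _ _))).
 by lra.
have [kk kE] : exists k, k = ((r - s) + (s - r))%N by eexists.
rewrite -kE; have inv0 (m : nat) : 0 <= (m%:R ^+ 2)^-1 :> R by [].
have [kc|] := boolP [|| kk == 0, kk == 1 | kk == P.-1]%N.
 apply: (le_trans triv); rewrite /cellw -[leLHS]addr0 lerD //.
 rewrite -[leLHS]mulr1 ler_wpM2l //.
 by case/or3P: kc => /eqP ->; rewrite eqxx; do ![case: (_ == _)]; rewrite /=; lra.
rewrite !negb_or => /and3P[k0 k1 kP].
have [u uE] := ex_named ((kk - 1)%:R / P%:R : R).
have [v vE] := ex_named ((P.-1 - kk)%:R / P%:R : R).
have kb : (1 < kk)%N && (kk < P.-1)%N by move: kE k0 k1 kP rP sP; clear; lia.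
case/andP: kb => kb1 kb2.
have u0 : 0 < u by rewrite uE divr_gt0 // ltr0n subn_gt0.
have v0 : 0 < v by rewrite vE divr_gt0 // ltr0n subn_gt0.
have Pu : P%:R * u = kk%:R - 1 by rewrite uE mulrC divfK ?lt0r_neq0 // natrB // ltnW.
have Pv : P%:R * v = P%:R - 1 - kk%:R.
 rewrite vE mulrC divfK ?lt0r_neq0 // natrB; last exact: ltnW.
 by rewrite -subn1 natrB; case: (P) kb2.
have Pabs : P%:R * `|a - b| = `|P%:R * a - P%:R * b| by rewrite -mulrBr normrM [`|P%:R|]ger0_norm // ltW.
have kR : kk%:R = `|r%:R - s%:R| :> R.
 rewrite kE; have [rs|/ltnW sr] := leqP r s.
  by rewrite (eqP (_ : r - s == 0)%N) // add0n natrB // distrC ger0_norm // subr_ge0 ler_nat.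
 by rewrite (eqP (_ : s - r == 0)%N) // addn0 natrB // ger0_norm // subr_ge0 ler_nat.
have near : kk%:R - 1 <= `|P%:R * a - P%:R * b| <= kk%:R + 1.
 move: ha hb; rewrite kR -!natr1 => /andP[h1 h2] /andP[h3 h4].
 move: h1 h2 h3 h4; clear; move: (P%:R * a) (P%:R * b) => c e h1 h2 h3 h4.
 by case: (ger0P (r%:R - s%:R : R)) => h5; case: (ger0P (c - e)) => h6; apply/andP; split; lra.
case/andP: near => n1 n2.
have hu : u <= `|a - b| by rewrite -(ler_pM2l P0) Pu Pabs.
have hv : v <= 1 - `|a - b| by rewrite -(ler_pM2l P0) Pv mulrBr mulr1 Pabs; lra.
have [w [w0 wm wuv]] : exists w, [/\ 0 < w, w <= normc (ep (a - b) - 1) &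
  (w ^+ 2)^-1 <= (u ^+ 2)^-1 + (v ^+ 2)^-1].
 have [uv|/ltW vu] := leP u v.
  exists u; split=> //; last by rewrite lerDl invr_ge0 exprn_ge0 // ltW.
  by apply: normc_epB1_lower => //; apply: le_trans hv.
 exists v; split=> //; last by rewrite lerDr invr_ge0 exprn_ge0 // ltW.
 by apply: normc_epB1_lower => //; apply: le_trans hu.
apply: (@le_trans _ _ (4 * (w ^+ 2)^-1)).
 rewrite ler_pdivlMr ?exprn_gt0 // -mulrA.
 have h1 : normc (dker (N + N) (a - b)) * w <= 2.
  by apply: le_trans (dker_bound (N + N) (a - b)); rewrite ler_wpM2l ?normc_ge0.
 have h2 : normc (dker N (a - b)) * w <= 2.
  by apply: le_trans (dker_bound N (a - b)); rewrite ler_wpM2l ?normc_ge0.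
 have h3 := normc_ge0 (dker (N + N) (a - b)); have h4 := normc_ge0 (dker N (a - b)).
 have := ler_pM (mulr_ge0 h3 (ltW w0)) (mulr_ge0 h4 (ltW w0)) h1 h2.
 by lra.
rewrite /cellw -[leLHS]add0r lerD //.
rewrite -mulrA ler_wpM2l //; apply: le_trans wuv _; rewrite uE vE !expr_div_n !invfM !invrK.
by rewrite mulrDr ![P%:R ^+ 2 * _]mulrC.
Qed.

Lemma sum_eq_le1 P c : \sum_(0 <= k < P) (k == c)%:R <= 1 :> R.
Proof.
have [cP|cP] := ltnP c P.
 rewrite (bigD1_seq c) ?iota_uniq ?mem_index_iota //= eqxx big1 ?addr0 // => k /negPf ->; exact: mulr0n.
rewrite big_nat_cond big1 // => k /andP[/andP[_ kP] _].
by rewrite ltn_eqF // (leq_trans kP).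
Qed.

Lemma sum_inv_sqr n : \sum_(0 <= k < n.+1) (k%:R ^+ 2)^-1 <= 2 - n%:R^-1 :> R.
Proof.
elim: n => [|n IH]; first by rewrite big_nat1 expr0n invr0 subr0.
rewrite big_nat_recr //=; case: n IH => [|n] IH.
 by rewrite big_nat1 expr0n invr0 add0r expr1n invr1; lra.
apply: le_trans (lerD IH (lexx _)) _.
have n0 : 0 < (n.+1%:R : R) by [].
have e : (n.+2%:R : R) = n.+1%:R + 1 by lra.
rewrite e -subr_ge0; set y := n.+1%:R in n0 *.
have -> : 2 - (y + 1)^-1 - (2 - y^-1 + ((y + 1) ^+ 2)^-1) = (y * (y + 1) ^+ 2)^-1.
 by field; rewrite lt0r_neq0; lra.
by rewrite invr_ge0 mulr_ge0 ?exprn_ge0; lra.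
Qed.

Lemma sum_inv_sqr_le2 n : \sum_(0 <= k < n) (k%:R ^+ 2)^-1 <= 2 :> R.
Proof.
case: n => [|n]; first by rewrite big_geq.
by apply: le_trans (sum_inv_sqr n) _; rewrite gerBl invr_ge0 ler0n.
Qed.

Lemma sum_cellw N P : \sum_(0 <= k < P) cellw N P k <= 6 * N%:R ^+ 2 + 16 * P%:R ^+ 2.
Proof.
rewrite /cellw big_split -!mulr_sumr !big_split /=.
have N2 : 0 <= 2 * N%:R ^+ 2 :> R by [].
have P2 : 0 <= 4 * P%:R ^+ 2 :> R by [].
have h1 := sum_eq_le1 P 0; have h2 := sum_eq_le1 P 1; have h3 := sum_eq_le1 P P.-1.
have h4 : \sum_(0 <= k < P) ((k - 1)%:R ^+ 2)^-1 <= 2 :> R.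
 case: (P) => [|p]; first by rewrite big_geq.
 rewrite big_nat_recl //= sub0n expr0n invr0 add0r.
 by under eq_bigr do rewrite subn1; exact: sum_inv_sqr_le2.
have h5 : \sum_(0 <= k < P) ((P.-1 - k)%:R ^+ 2)^-1 <= 2 :> R.
 apply: le_trans (sum_inv_sqr_le2 P); rewrite big_nat_rev /= big_nat_cond [leRHS]big_nat_cond.
 by apply/ler_sum => k /andP[/andP[_ kP] _]; have -> : (P.-1 - (0 + P - k.+1))%N = k by move: kP; clear; lia.
have g1 := ler_wpM2l N2 (lerD (lerD h1 h2) h3).
have g2 := ler_wpM2l P2 (lerD h4 h5).
apply: le_trans (lerD g1 g2) _; lra.
Qed.

Lemma sum_cellw_dist N P r : (r < P)%N ->
 \sum_(0 <= s < P) cellw N P ((r - s) + (s - r)) <= 12 * N%:R ^+ 2 + 32 * P%:R ^+ 2.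
Proof.
move=> rP; rewrite (big_cat_nat _ (n := r)) //=; last exact: ltnW.
have W := sum_cellw N P.
have s1 : \sum_(0 <= s < r) cellw N P ((r - s) + (s - r)) <= \sum_(0 <= k < P) cellw N P k.
 rewrite big_nat_rev /= add0n.
 have -> : \sum_(0 <= i < r) cellw N P (r - (r - i.+1) + (r - i.+1 - r)) = \sum_(1 <= i < r.+1) cellw N P i.
  rewrite [RHS]big_add1; apply: eq_big_nat => j /andP[_ jr]; congr cellw; lia.
 rewrite [leRHS](big_cat_nat _ (n := r.+1)) //= [X in _ <= X + _]big_ltn // -addrA addrCA lerDl.
 by rewrite addr_ge0 ?cellw_ge0 ?sumr_ge0 // => k _; exact: cellw_ge0.
have s2 : \sum_(r <= s < P) cellw N P ((r - s) + (s - r)) <= \sum_(0 <= k < P) cellw N P k.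
 rewrite -{1}[r]add0n big_addn.
 rewrite [leRHS](big_cat_nat _ (n := (P - r)%N)) ?leq_subr //=.
 have -> : \sum_(0 <= i < P - r) cellw N P (r - (i + r) + (i + r - r)) = \sum_(0 <= i < P - r) cellw N P i.
  by apply: eq_bigr => j _; congr cellw; lia.
 by rewrite lerDl sumr_ge0 // => k _; exact: cellw_ge0.
apply: le_trans (lerD s1 s2) _; lra.
Qed.

(** Smoothing by averages: every [n < H] is [j - k] for each of the [N] values of [k], with some
    [j < 2 N]. The kernel becomes a product of two Dirichlet kernels, which decays quadratically, so
    that its row sums are of order [N ^ 2 + P ^ 2] without a logarithm. The off-diagonal
    coefficients are split by [2 |c_r c_s| <= |c_r| ^ 2 + |c_s| ^ 2], and [44 = 12 + 32]. *)
Lemma large_sieve_dual H P (al : nat -> R) (c : nat -> C) (M : R) : (0 < P)%N ->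
 (forall r, (r < P)%N -> r%:R <= P%:R * al r < r.+1%:R) ->
 \sum_(0 <= n < H) normc (\sum_(0 <= r < P) c r * ep ((M + n%:R) * al r)) ^+ 2 <=
 44 * (H + P)%:R * \sum_(0 <= r < P) normc (c r) ^+ 2.
Proof.
move=> P0 hal; have [N NE] := ex_named ((H + P)%N).
rewrite -NE; have N0 : 0 < (N%:R : R) by rewrite NE ltr0n addn_gt0 P0 orbT.
have [S SE] := ex_named (\sum_(0 <= r < P) normc (c r) ^+ 2 : R).
rewrite -SE; have S0 : 0 <= S by rewrite SE sumr_ge0 // => r _; rewrite exprn_ge0 ?normc_ge0.
pose T (t : R) := \sum_(0 <= r < P) c r * ep ((M + t) * al r).
have [X XE] := ex_named (\sum_(0 <= n < H) normc (T n%:R) ^+ 2).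
rewrite -[leLHS]XE; have [Y YE] : exists Y, Y = \sum_(0 <= k < N) \sum_(0 <= j < N + N) normc (T (j%:R - k%:R)) ^+ 2.
 by eexists.
have XY : N%:R * X <= Y.
 rewrite YE mulr_natl -[X in _ *+ X]subn0 -sumr_const_nat.
 apply: ler_sum_nat => k /andP[_ kN].
 rewrite (big_cat_nat _ (n := k)) //=; last by rewrite (leq_trans (ltnW kN)) ?leq_addr.
 rewrite [X in _ <= _ + X](big_cat_nat _ (n := (H + k)%N)) ?leq_addl //=; last first.
  by rewrite leq_add ?NE ?leq_addr // -NE ltnW.
 rewrite -[X in _ <= _ + (\sum_(X <= j < _) _ + _)]add0n [X in _ <= _ + (X + _)]big_addn addnK XE addrCA.
 have -> : \sum_(0 <= i < H) normc (T ((i + k)%:R - k%:R)) ^+ 2 = \sum_(0 <= n < H) normc (T n%:R) ^+ 2.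
  by apply: eq_bigr => j _; rewrite natrD addrK.
 by rewrite lerDl addr_ge0 // sumr_ge0 // => j _; rewrite exprn_ge0 ?normc_ge0.
have Yc : Y%:C%C = \sum_(0 <= r < P) \sum_(0 <= s < P) (c r * conjc (c s) * ep (M * (al r - al s))) *
  (dker (N + N) (al r - al s) * conjc (dker N (al r - al s))).
 rewrite YE realc_sum.
 transitivity (\sum_(0 <= k < N) \sum_(0 <= j < N + N) \sum_(0 <= r < P) \sum_(0 <= s < P)
   (c r * conjc (c s) * ep (M * (al r - al s))) * (ep (j%:R * (al r - al s)) * conjc (ep (k%:R * (al r - al s))))).
  apply: eq_bigr => k _; rewrite realc_sum; apply: eq_bigr => j _.
  rewrite -mulc_conj conjc_sum mulr_suml; apply: eq_bigr => r _.
  rewrite mulr_sumr; apply: eq_bigr => s _; rewrite conjcM !conj_ep.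
  have -> : ep ((M + (j%:R - k%:R)) * al r) = ep (M * al r) * ep (j%:R * al r) * ep (- (k%:R * al r)).
   by rewrite -!epD; congr ep; ring.
  have -> : ep (- ((M + (j%:R - k%:R)) * al s)) = ep (- (M * al s)) * ep (- (j%:R * al s)) * ep (k%:R * al s).
   by rewrite -!epD; congr ep; ring.
  have -> : ep (M * (al r - al s)) = ep (M * al r) * ep (- (M * al s)) by rewrite -!epD; congr ep; ring.
  have -> : ep (j%:R * (al r - al s)) = ep (j%:R * al r) * ep (- (j%:R * al s)) by rewrite -!epD; congr ep; ring.
  have -> : ep (- (k%:R * (al r - al s))) = ep (- (k%:R * al r)) * ep (k%:R * al s) by rewrite -!epD; congr ep; ring.
  ring.
 under eq_bigr do rewrite exchange_big /=.
 rewrite exchange_big /=; apply: eq_bigr => r _.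
 under eq_bigr do rewrite exchange_big /=.
 rewrite exchange_big /=; apply: eq_bigr => s _.
 rewrite /dker conjc_sum mulr_sumr mulr_sumr; apply: eq_bigr => k _.
 by rewrite mulr_suml mulr_sumr.
have Y0 : 0 <= Y by rewrite YE sumr_ge0 // => k _; rewrite sumr_ge0 // => j _; rewrite exprn_ge0 ?normc_ge0.
have YS : Y <= (12 * N%:R ^+ 2 + 32 * P%:R ^+ 2) * S.
 rewrite -(normcR_ge0 Y0) Yc; apply: le_trans (normc_sum _ _ _) _.
 have B r s : (r < P)%N -> (s < P)%N ->
  normc (c r * conjc (c s) * ep (M * (al r - al s)) * (dker (N + N) (al r - al s) * conjc (dker N (al r - al s))))
  <= (normc (c r) ^+ 2 / 2 + normc (c s) ^+ 2 / 2) * cellw N P ((r - s) + (s - r)).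
  move=> rP sP; rewrite !normcM !normc_conj normc_ep mulr1.
  apply: ler_pM; rewrite ?mulr_ge0 ?normc_ge0 //; last by apply: dker_cellw => //; exact: hal.
  by have := sqr_ge0 (normc (c r) - normc (c s)); nra.
 apply: (@le_trans _ _ (\sum_(0 <= r < P) \sum_(0 <= s < P)
   (normc (c r) ^+ 2 / 2 + normc (c s) ^+ 2 / 2) * cellw N P ((r - s) + (s - r)))).
  apply: ler_sum_nat => r /andP[_ rP].
  apply: le_trans (normc_sum _ _ _) _.
  apply: ler_sum_nat => s /andP[_ sP]; exact: B.
 have half : \sum_(0 <= r < P) \sum_(0 <= s < P) normc (c r) ^+ 2 / 2 * cellw N P ((r - s) + (s - r)) <=
   (6 * N%:R ^+ 2 + 16 * P%:R ^+ 2) * S.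
  rewrite SE mulr_sumr; apply: ler_sum_nat => r /andP[_ rP].
  rewrite -mulr_sumr; have := ler_wpM2l (exprn_ge0 2 (normc_ge0 (c r))) (sum_cellw_dist N rP); lra.
 under eq_bigr do (under eq_bigr do rewrite mulrDl; rewrite big_split /=).
 rewrite big_split /= [X in _ + X]exchange_big /=.
 have -> : \sum_(0 <= j < P) \sum_(0 <= i < P) normc (c j) ^+ 2 / 2 * cellw N P (i - j + (j - i)) =
   \sum_(0 <= j < P) \sum_(0 <= i < P) normc (c j) ^+ 2 / 2 * cellw N P (j - i + (i - j)).
  by apply: eq_bigr => j _; apply: eq_bigr => k _; rewrite addnC.
 apply: le_trans (lerD half half) _; lra.
rewrite -(ler_pM2l N0); apply: (le_trans XY); apply: (le_trans YS).
have PN : P%:R <= N%:R :> R by rewrite ler_nat NE leq_addl.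
have P2 : P%:R ^+ 2 <= N%:R ^+ 2 :> R by rewrite lerXn2r ?nnegrE.
have -> : N%:R * (44 * N%:R * S) = (44 * N%:R ^+ 2) * S by ring.
by rewrite ler_wpM2r //; lra.
Qed.

(** Duality: the sum [X] is a bilinear form in [a] and the dual sums [T], whose squares add up to at
    most [K X]. Then [u v <= K u ^ 2 / 2 + v ^ 2 / (2 K)] leaves half of [X] on the right. *)
Lemma large_sieve_cells H P (al : nat -> R) (a : nat -> R) (M : nat) : (0 < P)%N ->
 (forall r, (r < P)%N -> r%:R <= P%:R * al r < r.+1%:R) ->
 \sum_(0 <= r < P) normc (\sum_(0 <= n < H) (a n)%:C%C * ep ((M + n)%:R * al r)) ^+ 2 <=
 44 * (H + P)%:R * \sum_(0 <= n < H) a n ^+ 2.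
Proof.
move=> P0 hal; pose S r := \sum_(0 <= n < H) (a n)%:C%C * ep ((M + n)%:R * al r).
have D := large_sieve_dual H (fun r => conjc (S r)) M%:R P0 hal.
have [K KE] := ex_named (44 * (H + P)%:R : R).
have K0 : 0 < K by rewrite KE mulr_gt0 ?ltr0n ?addn_gt0 ?P0 ?orbT.
have [X XE] := ex_named (\sum_(0 <= r < P) normc (S r) ^+ 2).
have [Y YE] := ex_named (\sum_(0 <= n < H) a n ^+ 2).
rewrite -[leLHS]XE -KE -YE; rewrite -KE in D.
have e0 : \sum_(0 <= r < P) normc (conjc (S r)) ^+ 2 = X by rewrite XE; apply: eq_bigr => r _; rewrite normc_conj.
rewrite e0 in D.
pose T n := \sum_(0 <= r < P) conjc (S r) * ep ((M%:R + n%:R) * al r).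
have e : X%:C%C = \sum_(0 <= n < H) (a n)%:C%C * T n.
 rewrite XE realc_sum; under eq_bigr do rewrite -mulc_conj {1}/S mulr_suml.
 rewrite exchange_big; apply: eq_bigr => n _; rewrite mulr_sumr; apply: eq_bigr => r _.
 by rewrite natrD -!mulrA; congr (_ * _); rewrite mulrC.
have X0 : 0 <= X by rewrite XE sumr_ge0 // => r _; rewrite exprn_ge0 ?normc_ge0.
have h : X <= K / 2 * Y + (2 * K)^-1 * \sum_(0 <= n < H) normc (T n) ^+ 2.
 rewrite -(normcR_ge0 X0) e YE !mulr_sumr -big_split /=; apply: le_trans (normc_sum _ _ _) _.
 apply: ler_sum => n _; rewrite normcM normcR -[a n ^+ 2]real_normK ?num_real //.
 set u := `|a n|; set v := normc (T n).
 rewrite -subr_ge0; have -> : K / 2 * u ^+ 2 + (2 * K)^-1 * v ^+ 2 - u * v = (2 * K)^-1 * (K * u - v) ^+ 2.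
  by field; rewrite lt0r_neq0.
 by rewrite mulr_ge0 ?sqr_ge0 // invr_ge0 mulr_ge0 // ltW.
have h2 : (2 * K)^-1 * \sum_(0 <= n < H) normc (T n) ^+ 2 <= X / 2.
 have -> : X / 2 = (2 * K)^-1 * (K * X) by field; rewrite lt0r_neq0.
 by rewrite ler_wpM2l // invr_ge0 mulr_ge0 // ltW.
have := lerD (lexx (K / 2 * Y)) h2; lra.
Qed.

(** Two distinct fractions with denominators at most [D] are at least [1 / D ^ 2] apart and cannot
    share a half-open cell of that length. *)
Lemma farey_cell_uniq D r d b d0 b0 : (0 < d <= D)%N -> (0 < d0 <= D)%N -> coprime b d -> coprime b0 d0 ->
 (b * D ^ 2 %/ d = r)%N -> (b0 * D ^ 2 %/ d0 = r)%N -> d = d0 /\ b = b0.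
Proof.
have le d1 b1 d2 b2 : (0 < d1 <= D)%N -> (0 < d2 <= D)%N -> (b1 * D ^ 2 %/ d1 = r)%N ->
  (b2 * D ^ 2 %/ d2 = r)%N -> (b1 * d2 <= b2 * d1)%N.
 move=> /andP[d10 d1D] /andP[d20 d2D] e1 e2; rewrite leqNgt; apply/negP => lt.
 have l1 : (b1 * D ^ 2 < r.+1 * d1)%N by rewrite -ltn_divLR // e1.
 have l2 : (r * d2 <= b2 * D ^ 2)%N by rewrite -leq_divRL // e2.
 have l3 : (d1 * d2 <= D ^ 2)%N by rewrite -mulnn leq_mul.
 move: l1 l2 l3 lt d10 d20; move: (D ^ 2)%N => P; clear => l1 l2 l3 lt d10 d20.
 nia.
move=> hd hd0 c1 c2 e1 e2; have e : (b * d0 = b0 * d)%N by apply/eqP; rewrite eqn_leq !le.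
have dd : d = d0.
 apply/eqP; rewrite eqn_dvd -(Gauss_dvdr d0 (m := d) (n := b)) 1?coprime_sym // e dvdn_mull //=.
 by rewrite -(Gauss_dvdr d (m := d0) (n := b0)) 1?coprime_sym // -e dvdn_mull.
split=> //; move: e; rewrite dd => /eqP; rewrite eqn_pmul2r; last by case/andP: hd0.
by move/eqP.
Qed.

(** The sieve takes one point in every cell: the Farey fraction if there is one, any point
    otherwise. The additional terms are non-negative. *)
Lemma farey_cells D (F : R -> R) : (0 < D)%N -> (forall t, 0 <= F t) ->
 exists al : nat -> R, (forall r, r%:R <= (D ^ 2)%:R * al r < r.+1%:R) /\
 \sum_(1 <= d < D.+1) \sum_(0 <= b < d | coprime b d) F (b%:R / d%:R) <= \sum_(0 <= r < D ^ 2) F (al r).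
Proof.
move=> D0 F0; have P0 : 0 < ((D ^ 2)%:R : R) by rewrite ltr0n expn_gt0 D0.
pose f r := \sum_(1 <= d < D.+1) \sum_(0 <= b < d | coprime b d)
  (if (b * D ^ 2 %/ d)%N == r then F (b%:R / d%:R) else 0).
have ex r : exists a : R, r%:R <= (D ^ 2)%:R * a < r.+1%:R /\ f r <= F a.
 have [[[d0 b0] [hd0 hc0 hr0]]|no] :=
   pselect (exists p : nat * nat, [/\ (0 < p.1 <= D)%N, coprime p.2 p.1 & (p.2 * D ^ 2 %/ p.1 = r)%N]).
  rewrite /= in hd0 hc0 hr0; case/andP: (hd0) => d00 d0D.
  have d0R : 0 < (d0%:R : R) by rewrite ltr0n.
  exists (b0%:R / d0%:R); split.
   rewrite mulrCA mulrA ler_pdivlMr // ltr_pdivrMr // -!natrM ler_nat ltr_nat.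
   by rewrite -leq_divRL // -ltn_divLR // hr0 leqnn ltnSn.
  rewrite /f (bigD1_seq d0) ?iota_uniq ?mem_index_iota //= -[leRHS]addr0 lerD //.
   have [b0d|b0d] := ltnP b0 d0; last first.
    rewrite big_nat_cond big1 // => b /andP[/andP[_ bd] cb]; case: eqP => // e.
    by have [_ bb] := farey_cell_uniq hd0 hd0 cb hc0 e hr0; move: bd; rewrite bb ltnNge b0d.
   rewrite big_mkcond (bigD1_seq b0) ?iota_uniq ?mem_index_iota //= hc0 hr0 eqxx big1 ?addr0 // => b bn.
   case: ifP => // cb; case: eqP => // e.
   by have [_ bb] := farey_cell_uniq hd0 hd0 cb hc0 e hr0; rewrite bb eqxx in bn.
  rewrite big_nat_cond big1 // => d /andP[hd dn]; rewrite big1 // => b cb; case: eqP => // e.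
  by have [dd _] := farey_cell_uniq hd hd0 cb hc0 e hr0; rewrite dd eqxx in dn.
 exists (r%:R / (D ^ 2)%:R); split.
  by rewrite mulrC divfK ?lt0r_neq0 // lexx ltr_nat ltnSn.
 suff -> : f r = 0 by [].
 rewrite /f big_nat_cond big1 // => d /andP[hd _]; rewrite big1 // => b cb; case: eqP => // e.
 by case: no; exists (d, b).
have [al hal] := choice ex; exists al; split=> [r|]; first by case: (hal r).
apply: (@le_trans _ _ (\sum_(0 <= r < D ^ 2) f r)); last by apply: ler_sum => r _; case: (hal r).
rewrite /f exchange_big /=; apply: ler_sum_nat => d /andP[d0 _].
rewrite exchange_big /= big_nat_cond [leRHS]big_nat_cond; apply: ler_sum => b /andP[/andP[_ bd] _].
rewrite (bigD1_seq (b * D ^ 2 %/ d)%N) ?iota_uniq ?mem_index_iota //=.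
 by rewrite eqxx lerDl sumr_ge0 // => r _; case: ifP.
by rewrite ltn_divLR // [ltnLHS]mulnC ltn_pmul2l // expn_gt0 D0.
Qed.

Lemma large_sieve H D (a : nat -> R) (M : nat) : (0 < D)%N ->
 \sum_(1 <= d < D.+1) \sum_(0 <= b < d | coprime b d)
  normc (\sum_(0 <= n < H) (a n)%:C%C * ep ((M + n)%:R * (b%:R / d%:R))) ^+ 2 <=
 44 * (H + D ^ 2)%:R * \sum_(0 <= n < H) a n ^+ 2.
Proof.
move=> D0; pose F t := normc (\sum_(0 <= n < H) (a n)%:C%C * ep ((M + n)%:R * t)) ^+ 2.
have F0 t : 0 <= F t by rewrite exprn_ge0 ?normc_ge0.
have [al [hal le]] := farey_cells D0 F0; apply: (le_trans le).
by apply: large_sieve_cells => //; rewrite expn_gt0 D0.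
Qed.

End LargeSieve.

(** To [a] is added [d] times the part of [q] prime to [a]: a prime divisor of [q] divides exactly
    one of the two summands. If [a = 0], it is replaced by [d] beforehand. *)
Lemma coprime_lift a d q : (0 < d)%N -> (0 < q)%N -> coprime a d ->
 exists2 u, coprime u q & u = a %[mod d].
Proof.
move=> d0 q0; wlog a0 : a / (0 < a)%N.
 move=> H ad; have [/H h|] := ltnP 0 a; first exact: h.
 rewrite leqn0 => /eqP a0; have ad' : coprime (a + d) d by rewrite /coprime gcdnC gcdnDr gcdnC.
 have [|u uq e] := H (a + d)%N _ ad'; first by rewrite addn_gt0 d0 orbT.
 by exists u; rewrite // e modnDr.
move=> ad; exists (a + d * q`_(\pi(a)^'))%N; last by rewrite addnC mulnC modnMDl.
apply/negPn/negP => nc; set u := (a + _)%N in nc.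
have g1 : (1 < gcdn u q)%N.
 by rewrite ltn_neqAle eq_sym nc gcdn_gt0 q0 orbT.
have pp := pdiv_prime g1; have pg := pdiv_dvd (gcdn u q); set p := pdiv _ in pp pg.
have pu : (p %| u)%N by apply: dvdn_trans pg (dvdn_gcdl _ _).
have pq : (p %| q)%N by apply: dvdn_trans pg (dvdn_gcdr _ _).
have [pa|pa] := boolP (p %| a)%N.
 move: pu; rewrite /u dvdn_addr // Euclid_dvdM // => /orP[pd|pw].
  by have := coprime_dvdl pa (coprime_dvdr pd ad); rewrite prime_coprime // dvdnn.
 have pin : p \in \pi((q`_(\pi(a)^'))%N) by rewrite mem_primes pp part_gt0.
 by have := pnatPpi (part_pnat (\pi(a)^') q) pin; rewrite !inE mem_primes pp a0 pa.
have pw : (p %| q`_(\pi(a)^'))%N.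
 apply: (@dvdn_trans (q`_p)); first by rewrite p_part -[X in (X %| _)%N]expn1 dvdn_exp2l // logn_gt0 mem_primes pp q0.
 by apply: sub_in_partn => r _; rewrite !inE => /eqP ->; rewrite mem_primes pp a0 (negPf pa).
by move: pu; rewrite /u dvdn_addl ?(negPf pa) // dvdn_mull.
Qed.

(** * Sums over units; characters as bounded coefficients *)

Section Residues.
Variable R : realType.
Local Notation C := R[i].
Local Arguments conjc : simpl never.

Lemma sum_units_mul q u (F : nat -> C) : (0 < q)%N -> (forall n, F (n %% q)%N = F n) -> coprime u q ->
 \sum_(0 <= a < q | coprime a q) F (u * a)%N = \sum_(0 <= a < q | coprime a q) F a.
Proof.
case: q => // k _ Fq uq; rewrite big_mkcond [RHS]big_mkcond !big_mkord /=.
rewrite -(sum_rmul (fun a : 'I_k.+1 => if coprime a k.+1 then F a else 0) uq); apply: eq_bigr => a _.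
by rewrite /rmul coprime_modl coprimeMl uq Fq.
Qed.

Lemma sum_units_const (S : nzSemiRingType) q (c : S) : \sum_(0 <= a < q | coprime a q) c = (totient q)%:R * c.
Proof.
rewrite totient_count_coprime natr_sum mulr_suml big_mkcond; apply: eq_bigr => a _.
by rewrite coprime_sym; case: coprime; rewrite ?mul1r ?mul0r.
Qed.

(** Both sides equal the double sum of [F (c * a)] over units [c] modulo [d] and [a] modulo [q]:
    multiplication by a lift of [c] permutes the units modulo [q], multiplication by [a] those
    modulo [d]. *)
Lemma sum_units_dvd q d (F : nat -> C) : (0 < q)%N -> (d %| q)%N -> (forall n, F (n %% d)%N = F n) ->
 (totient d)%:R * \sum_(0 <= a < q | coprime a q) F a =
 (totient q)%:R * \sum_(0 <= a < d | coprime a d) F a.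
Proof.
move=> q0 dq Fd; have d0 : (0 < d)%N by case: d dq {Fd} => //; rewrite dvd0n => /eqP e; rewrite e in q0.
have Fq n : F (n %% q)%N = F n by rewrite -Fd modn_dvdm // Fd.
rewrite -sum_units_const -sum_units_const.
transitivity (\sum_(0 <= c < d | coprime c d) \sum_(0 <= a < q | coprime a q) F (c * a)%N).
 apply: eq_bigr => c cd; have [u uq e] := coprime_lift d0 q0 cd.
 rewrite -(sum_units_mul q0 Fq uq); apply: eq_bigr => a _.
 by rewrite -Fd -modnMml e modnMml Fd.
rewrite exchange_big /=; apply: eq_bigr => a aq.
have ad : coprime a d by exact: coprime_dvdr dq aq.
by rewrite -(sum_units_mul d0 Fd ad); apply: eq_bigr => c _; rewrite mulnC.
Qed.

(** The mean of an additive character over the units modulo [q] depends on the fraction [b / d]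
    only. The expected term at this frequency is therefore common to all multiples [q] of [d], which
    permits summing over [q] first. *)
Lemma ramanujan_dvd q d b : (0 < q)%N -> (d %| q)%N ->
 (\sum_(0 <= a < q | coprime a q) ep (a%:R * (b%:R / d%:R)) : C) / (totient q)%:R =
 ramanujan R d b / (totient d)%:R.
Proof.
move=> q0 dq; have d0 : (0 < d)%N by case: d dq => //; rewrite dvd0n => /eqP e; rewrite e in q0.
have tq : ((totient q)%:R : C) != 0 by rewrite pnatr_eq0 -lt0n totient_gt0.
have td : ((totient d)%:R : C) != 0 by rewrite pnatr_eq0 -lt0n totient_gt0.
pose F n : C := ep (n%:R * b%:R / d%:R).
have Fd n : F (n %% d)%N = F n by exact: ep_mod.
have := sum_units_dvd q0 dq Fd; rewrite -/(ramanujan R d b) => h.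
have -> : \sum_(0 <= a < q | coprime a q) ep (a%:R * (b%:R / d%:R)) = \sum_(0 <= a < q | coprime a q) F a :> C.
 by apply: eq_bigr => a _; rewrite mulrA.
by apply: (mulfI td); rewrite mulrA h mulrC mulrA mulVf // mul1r mulrC divfK.
Qed.

Definition chi0 (q n : nat) : C := (coprime n q)%:R.

Lemma dchar_chi0 q : dchar q (chi0 q).
Proof.
split=> [|m n|n|n /negPf]; rewrite /chi0 ?coprime1n ?coprimeMl ?coprime_modl //; last by move->.
by case: coprime; rewrite ?mul1r ?mul0r.
Qed.

Lemma bsum_dchar q f : (0 < q)%N -> dchar q f -> f != chi0 q -> bsum f q%:R.
Proof.
case: q => // k _ hf fn M.
have o := dchar_orth hf (dchar_chi0 k.+1); rewrite (negPf fn) in o.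
have z : \sum_(0 <= x < k.+1) f x = 0.
 rewrite -[RHS]o big_mkord; apply: eq_bigr => x _; rewrite /chi0; have [c|c] := boolP (coprime x k.+1).
  by rewrite conjc1 mulr1.
 by case: hf => _ _ _ ->; rewrite ?mul0r.
have f0 : \sum_(0 <= n < M.+1) f n = \sum_(1 <= n < M.+1) f n + f 0%N.
 by rewrite big_ltn // addrC.
have per m : \sum_(0 <= n < m * k.+1) f n = 0.
 elim: m => [|m IH]; first by rewrite mul0n big_geq.
 rewrite mulSn addnC (big_cat_nat _ (n := (m * k.+1)%N)) ?leq_addr //= IH add0r.
 rewrite -{1}[(m * k.+1)%N]add0n big_addn addnC addnK -[RHS]z; apply: eq_bigr => j _.
 by case: hf => _ _ h _; rewrite -h addnC modnMDl h.
have e : \sum_(1 <= n < M.+1) f n = \sum_(1 <= n < (M %% k.+1).+1) f n.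
 apply: (addIr (f 0%N)); rewrite -f0 -[RHS]addrC -[RHS]big_ltn //.
 rewrite {1}(divn_eq M k.+1) -addnS (big_cat_nat _ (n := (M %/ k.+1 * k.+1)%N)) ?leq_addr //= per add0r.
 rewrite -{1}[(_ %/ _ * k.+1)%N]add0n big_addn addnC addnK; apply: eq_bigr => j _.
 by case: hf => _ _ h _; rewrite -h addnC modnMDl h.
rewrite e; apply: le_trans (normc_sum _ _ _) _.
apply: (@le_trans _ _ (\sum_(1 <= n < (M %% k.+1).+1) 1)).
 by apply: ler_sum => n _; exact: dchar_norm_le1 hf.
by rewrite sumr_const_nat subn1 ler_nat ltnW // ltn_mod.
Qed.

Lemma dcharM q r (f g : nat -> C) : dchar q f -> dchar r g -> dchar (q * r) (fun n => f n * g n).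
Proof.
move=> hf hg; split.
- by case: hf => -> _ _ _; case: hg => -> _ _ _; rewrite mulr1.
- by move=> m n; case: hf => _ -> _ _; case: hg => _ -> _ _; ring.
- move=> n; congr (_ * _); first by apply: (dchar_mod hf); rewrite modn_dvdm ?dvdn_mulr.
 by apply: (dchar_mod hg); rewrite modn_dvdm ?dvdn_mull.
- move=> n; rewrite coprimeMr negb_and => /orP[h|h].
  by case: hf => _ _ _ ->; rewrite ?mul0r.
 by case: hg => _ _ _ ->; rewrite ?mulr0.
Qed.

Lemma dchar_sqr q (f : nat -> C) : dchar q f -> dchar q (fun n => f n ^+ 2).
Proof.
move=> [f1 fM fq f0]; split=> [|m n|n|n h]; rewrite ?f1 ?expr1n ?fM ?exprMn ?fq //.
by rewrite f0 // expr0n.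
Qed.

Lemma cmul_dchar q (f : nat -> C) : (0 < q)%N -> dchar q f -> cmul f.
Proof.
move=> q0 hf; split=> [|m n _ _|n]; [by case: hf|by case: hf|exact: dchar_norm_le1 hf].
Qed.

End Residues.

(** * Character sums over prime powers *)

Section SiegelWalfisz.
Variable R : realType.
Local Notation C := R[i].

Definition real_nonprincipal (q : nat) (f : nat -> C) :=
 [/\ (0 < q)%N, dchar q f, f != chi0 R q & forall n, coprime n q -> f n ^+ 2 = 1].

(** For characters this means that both are induced by the same primitive one. *)
Definition same_char (q r : nat) (f g : nat -> C) := forall n, coprime n q -> coprime n r -> f n = g n.

(** [n] need not be prime to the middle modulus; it is first moved, within its class modulo [q * s],
    to an integer that is. *)
Lemma same_char_trans q r s f g h : (0 < q)%N -> (0 < r)%N -> (0 < s)%N ->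
 dchar q f -> dchar s h -> same_char q r f g -> same_char r s g h -> same_char q s f h.
Proof.
move=> q0 r0 s0 hf hh fg gh n nq ns.
have nqs : coprime n (q * s) by rewrite coprimeMr nq.
have qs0 : (0 < q * s)%N by rewrite muln_gt0 q0.
have [u ur e] := coprime_lift qs0 r0 nqs.
have eq : u = n %[mod q] by rewrite -(modn_dvdm u (dvdn_mulr s (dvdnn q))) e modn_dvdm ?dvdn_mulr.
have es : u = n %[mod s] by rewrite -(modn_dvdm u (dvdn_mull q (dvdnn s))) e modn_dvdm ?dvdn_mull.
have uq : coprime u q by rewrite -coprime_modl eq coprime_modl.
have us : coprime u s by rewrite -coprime_modl es coprime_modl.
by rewrite -(dchar_mod hf eq) -(dchar_mod hh es) fg // gh.
Qed.

(** Takes the place of primitivity: the least modulus among real characters that agree with [f] on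
    common units. Distinct characters in one such class have a principal product, which a Siegel
    family must exclude. *)
Definition minimal_real (q : nat) (f : nat -> C) := real_nonprincipal q f /\
 forall r g, real_nonprincipal r g -> same_char q r f g -> (q <= r)%N.

Lemma exists_minimal_real q f : real_nonprincipal q f ->
 exists r g, [/\ minimal_real r g, same_char q r f g & (r <= q)%N].
Proof.
move=> hf; pose P r := `[< exists g, real_nonprincipal r g /\ same_char q r f g >].
have exP : exists r, P r by exists q; apply/asboolP; exists f; split=> // n.
case: (ex_minnP exP) => r /asboolP[g [hg fg]] rmin.
exists r, g; split=> //; last by apply: rmin; apply/asboolP; exists f; split=> // n.
split=> // s h hh gh; apply: rmin; apply/asboolP; exists h; split=> //.
by case: hf => q0 df _ _; case: hg => r0 _ _ _; case: (hh) => s0 dh _ _; exact: same_char_trans gh.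
Qed.

Lemma real_nonprincipalE q f n : real_nonprincipal q f -> f n = (complex.Re (f n))%:C%C /\
 [\/ complex.Re (f n) = 0, complex.Re (f n) = 1 | complex.Re (f n) = -1].
Proof.
case=> q0 hf _ f2; have [nq|nq] := boolP (coprime n q).
 have : (f n - 1) * (f n + 1) = 0 by rewrite -subr_sqr_1 f2 // subrr.
 move/eqP; rewrite mulf_eq0 subr_eq0 addr_eq0 => /orP[] /eqP ->; split=> //=; [exact: Or32| |exact: Or33].
 by apply/eqP; rewrite eq_complex /= oppr0 !eqxx.
by case: hf => _ _ _ -> //; split=> //; exact: Or31.
Qed.

Definition real_family (g : nat -> R) (q : R) := exists r f,
 [/\ minimal_real r f, q = r%:R & g = (fun n => complex.Re (f n))].

Lemma real_family_siegel : siegel_family real_family.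
Proof.
have rb (g : nat -> R) (f : nat -> C) (q : R) : (forall n, f n = (g n)%:C%C) -> bsum f q -> rbsum g q.
 by move=> e h M; rewrite -normcR realc_sum; under eq_bigr do rewrite -e; exact: h.
split=> [g q [r [f [[hf mf] -> ->]]]|g q h s [r [f [[hf mf] -> ->]]] [r' [f' [[hf' mf'] -> ->]]]].
 case: (hf) => r0 df fn _; split; last by rewrite ler1n.
  split=> [|m n _ _|n]; first by case: df => ->.
   have [e1 _] := real_nonprincipalE m hf; have [e2 _] := real_nonprincipalE n hf.
   by case: df => _ -> _ _; rewrite e1 e2 -realcM.
  by case: (real_nonprincipalE n hf).
 apply: (rb _ f); first by move=> n; case: (real_nonprincipalE n hf).
 exact: bsum_dchar.
case: (hf) => r0 df fn f2; case: (hf') => r0' df' fn' f2'.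
have [eqv|neq] := pselect (same_char r r' f f').
 left=> n _; congr complex.Re.
 have rr : r = r'.
  apply/eqP; rewrite eqn_leq (mf _ _ hf' eqv) (mf' _ _ hf) //.
  by move=> m h1 h2; rewrite eqv.
 rewrite -rr in df' eqv; congr (_ n); apply: (dchar_ext df df') => m mr; exact: eqv.
right; rewrite -natrM.
apply: (rb _ (fun n => f n * f' n)).
 by move=> n; have [e1 _] := real_nonprincipalE n hf; have [e2 _] := real_nonprincipalE n hf'; rewrite realcM -e1 -e2.
apply: bsum_dchar; rewrite ?muln_gt0 ?r0 //; first exact: dcharM.
(* A principal product would give [f n = f n * f' n ^ 2 = f' n] on the common units. *)
apply/eqP => e; apply: neq => n nr nr'.
have := congr1 (fun F : nat -> C => F n) e; rewrite /chi0 coprimeMr nr nr' /= => ff.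
by rewrite -[f n]mulr1 -(f2' n nr') expr2 mulrA ff mul1r.
Qed.

Lemma lnn_le_ln (x : R) n : 1 <= ln x -> n%:R <= x -> lnn n <= ln x.
Proof.
move=> L1 nx; have [->|n0] := posnP n; first by rewrite /lnn ln0 // (le_trans ler01).
by rewrite /lnn ler_ln ?posrE ?ltr0n // (lt_le_trans _ nx) ?ltr0n.
Qed.

Lemma sum_Lam_weight (w : nat -> R) y : \sum_(1 <= n < y.+1) Lam R n * w n =
 \sum_(1 <= p < y.+1 | prime p) \sum_(1 <= k < y.+1 | (p ^ k <= y)%N) w (p ^ k)%N * @lnn R p.
Proof.
transitivity (\sum_(1 <= n < y.+1) \sum_(1 <= p < y.+1 | prime p)
  \sum_(1 <= k < y.+1) (if (p ^ k == n)%N then w (p ^ k)%N * @lnn R p else 0)).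
 apply: eq_big_nat => n /andP[n0 ny]; rewrite (LamE R (N := y)) ?n0 // mulr_suml.
 apply: eq_bigr => p _; rewrite mulr_suml big_mkcond; apply: eq_bigr => k _.
 by case: eqP => // ->; rewrite mulrC.
rewrite exchange_big /=; apply: eq_bigr => p pp.
rewrite exchange_big /= [RHS]big_mkcond; apply: eq_bigr => k _.
have pk0 : (0 < p ^ k)%N by rewrite expn_gt0 prime_gt0.
case: ifP => h.
 rewrite (bigD1_seq (p ^ k)%N) ?iota_uniq ?mem_index_iota ?pk0 //= eqxx big1 ?addr0 // => n.
 by rewrite eq_sym => /negPf ->.
rewrite big_nat_cond big1 // => n /andP[/andP[_ ny] _]; case: eqP => // e.
by move: ny; rewrite -e ltnS h.
Qed.

Lemma sum_powers_lnn p y N : prime p -> \sum_(1 <= k < N.+1 | (p ^ k <= y)%N) @lnn R p <= @lnn R y.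
Proof.
move=> pp; have [->|y0] := posnP y.
 by rewrite big1 ?lnn_ge0 // => k; rewrite leqn0 expn_eq0 eqn0Ngt prime_gt0.
have l0 := lnn_ge0 R p; have tr := trunc_logP (prime_gt1 pp) y0.
apply: (@le_trans _ _ (\sum_(1 <= k < (trunc_log p y).+1) @lnn R p)); last first.
 rewrite sumr_const_nat subn1 /= /lnn -lnXn ?ltr0n ?prime_gt0 // -natrX.
 have pk0 : (0 < p ^ trunc_log p y)%N by rewrite expn_gt0 prime_gt0.
 by rewrite ler_ln ?posrE ?ltr0n // ler_nat.
have imp k : (p ^ k <= y)%N -> (k <= trunc_log p y)%N by move=> h; apply: trunc_log_max => //; exact: prime_gt1.
rewrite [leRHS](_ : _ = \sum_(1 <= k < (maxn N (trunc_log p y)).+1 | (k <= trunc_log p y)%N) @lnn R p); last first.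
 rewrite [RHS](big_cat_nat _ (n := (trunc_log p y).+1)) //= ?ltnS ?leq_maxr //.
 rewrite [X in _ + X]sum_nat_eq0 ?addr0.
  rewrite big_nat_cond [RHS]big_nat_cond; apply: eq_bigl => k.
  by rewrite andbT ltnS -[LHS]andbT -!andbA; case: (k <= _)%N; rewrite ?andbF.
 by move=> k /andP[h _]; rewrite leqNgt h.
rewrite [leRHS](big_cat_nat _ (n := N.+1)) //= ?ltnS ?leq_maxl //.
rewrite -[leLHS]addr0 lerD //; last by rewrite sumr_ge0.
rewrite big_mkcond [leRHS]big_mkcond /=; apply: ler_sum => k _.
by case: ifP => [/imp ->|_] //; case: ifP.
Qed.

(** At most [q] primes divide [q], and the powers of one prime up to [y] carry at most [ln y]. *)
Lemma sum_Lam_noncoprime q y : (0 < q)%N ->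
 \sum_(1 <= n < y.+1) Lam R n * (~~ coprime n q)%:R <= q%:R * @lnn R y.
Proof.
move=> q0; rewrite sum_Lam_weight.
have cp p k : prime p -> (0 < k)%N -> coprime (p ^ k) q = ~~ (p %| q)%N.
 by move=> pp k0; rewrite coprime_pexpl // prime_coprime.
apply: (@le_trans _ _ (\sum_(1 <= p < y.+1 | prime p && (p %| q)%N) @lnn R y)).
 rewrite big_mkcondr; apply: ler_sum => p pp; case: ifP => pq.
  apply: le_trans (sum_powers_lnn y y pp); rewrite big_nat_cond [leRHS]big_nat_cond.
  by apply: ler_sum => k /andP[/andP[k0 _] _]; rewrite cp // pq mul1r.
 by rewrite big_nat_cond big1 // => k /andP[/andP[k0 _] _]; rewrite cp // pq mul0r.
rewrite -big_filter big_const_seq count_predT iter_addr_0 -[_ *+ _]mulr_natl ler_wpM2r ?lnn_ge0 // ler_nat.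
have sub : {subset [seq p <- index_iota 1 y.+1 | prime p && (p %| q)%N] <= index_iota 1 q.+1}.
 move=> p; rewrite mem_filter !mem_index_iota => /andP[/andP[pp pq] _].
 by rewrite prime_gt0 // ltnS dvdn_leq.
apply: leq_trans (uniq_leq_size _ sub) _; first exact/filter_uniq/iota_uniq.
by rewrite /index_iota size_iota subn1.
Qed.

Lemma sum_Lam_nonprime y :
 \sum_(1 <= n < y.+1) Lam R n * (~~ prime n)%:R <= Num.sqrt y%:R * @lnn R y.
Proof.
rewrite sum_Lam_weight.
apply: (@le_trans _ _ (\sum_(1 <= p < y.+1 | prime p && (p ^ 2 <= y)%N) @lnn R y)).
 rewrite big_mkcondr; apply: ler_sum => p pp; case: ifP => pq.
  apply: le_trans (sum_powers_lnn y y pp); apply: ler_sum => k _.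
  by case: prime; rewrite ?mul1r // mul0r lnn_ge0.
 rewrite big_nat_cond big1 // => -[|[|k]] /andP[/andP[k0 _] ky] //; first by rewrite expn1 pp mul0r.
 suff : (p ^ 2 <= y)%N by rewrite pq.
 exact: leq_trans (leq_pexp2l (prime_gt0 pp) (_ : 1 < k.+2)%N) ky.
rewrite -big_filter big_const_seq count_predT iter_addr_0 -[_ *+ _]mulr_natl ler_wpM2r ?lnn_ge0 //.
set s := [seq _ <- _ | _]; have [->|s0] := posnP (size s); first exact: sqrtr_ge0.
have us : uniq s by rewrite filter_uniq ?iota_uniq.
have [p ps sp] : exists2 p, p \in s & (size s <= p)%N.
 have [|h] := pselect (exists2 p, p \in s & (size s <= p)%N) => //.
 have sub : {subset s <= index_iota 1 (size s)}.
  move=> p ps; rewrite mem_index_iota; apply/andP; split.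
   by move: ps; rewrite mem_filter mem_index_iota => /andP[_ /andP[]].
  by rewrite ltnNge; apply/negP => sp; apply: h; exists p.
 by have := uniq_leq_size us sub; rewrite size_iota subn1; case: (size s) s0 => // m _; rewrite ltnn.
move: ps; rewrite mem_filter => /andP[/andP[_ p2] _].
rewrite -[leLHS](ger0_norm (ler0n _ _)) -sqrtr_sqr ler_wsqrtr // -natrX ler_nat (leq_trans _ p2) //.
by rewrite leq_exp2r.
Qed.

Lemma Lam_prime p : prime p -> Lam R p = @lnn R p.
Proof.
move=> pp; apply/le_anti; rewrite Lam_le ?prime_gt0 //= (LamE R (N := p)) ?prime_gt0 ?leqnn //.
rewrite big_mkcond (bigD1_seq p) ?iota_uniq ?mem_index_iota ?prime_gt0 //= pp.
rewrite big_mkcond (bigD1_seq 1%N) ?iota_uniq ?mem_index_iota ?ltnS ?prime_gt0 //= expn1 eqxx -addrA lerDl addr_ge0 //.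
 by apply: sumr_ge0 => k _; case: ifP => // _; exact: lnn_ge0.
by apply: sumr_ge0 => r _; case: ifP => // _; apply: sumr_ge0 => k _; exact: lnn_ge0.
Qed.

(** If [f ^ 2] is non-principal, the 3-4-1 bound suffices. Otherwise [f] is traded for the minimal
    real character [g] in its class, to which Siegel's bound applies; the two sums differ at powers
    of primes dividing [q * r] only, hence by at most a multiple of [q r ln y]. *)
Lemma LamC_char_bound (b D : nat) : exists2 K : R, 0 < K & forall q (f : nat -> C) (x : R) (y : nat),
 (0 < q)%N -> dchar q f -> f != chi0 R q -> 1 <= ln x -> q%:R <= ln x ^+ b -> y%:R <= x ->
 normc (\sum_(1 <= n < y.+1) LamC f n) <= K * (x / ln x ^+ D).
Proof.
have [e1 e10 hL] := LamC_sum_bound R b D.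
have [Kc Kc1 hc] := chi_lower_complex e10.
have e2 : 0 < e1 / 2 by lra.
(* Siegel's bound enters [chi_lower_real] with the power 14, so the exponents [e1 / 2] and
   [14 * e1 / 28] add up to [e1]. *)
have e28 : 0 < e1 / 28 by lra.
have [Kr Kr1 hr] := chi_lower_real e2.
have [c c0 hs] := siegel_DS real_family_siegel e28.
pose c1 := Num.min 1 c; have c10 : 0 < c1 by rewrite lt_min ltr01.
have c11 : c1 <= 1 by rewrite ge_min lexx.
have Kl1 : 1 <= Kr / c1 ^+ 14.
 by rewrite ler_pdivlMr ?exprn_gt0 // mul1r (le_trans _ Kr1) // exprn_ile1 // ltW.
have [K1 K10 h1] := hL _ Kc1; have [K2 K20 h2] := hL _ Kl1.
pose K3 : R := 2 * ((b + b).+1 + D)%:R ^+ ((b + b).+1 + D).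
have K30 : 0 <= K3 by rewrite mulr_ge0.
exists (K1 + K2 + K3) => [|q f x y q0 df fn L1 qL yx]; first by rewrite ltr_wpDr // addr_gt0.
have L0 := ge1_gt0 L1.
have x0 := ln_ge1_gt0 L1.
have X0 : 0 <= x / ln x ^+ D by rewrite divr_ge0 ?exprn_ge0 // ltW.
have q1 : 1 <= (q%:R : R) by rewrite ler1n.
have fp q' (g : nat -> C) p : (0 < q')%N -> dchar q' g -> g p = 0 \/ normc (g p) = 1.
 move=> q0' dg; have [pq|pq] := boolP (coprime p q'); first by right; exact: dchar_norm dg pq.
 by left; case: dg => _ _ _ ->.
have [f2|f2] := eqVneq (fun n => f n ^+ 2) (chi0 R q); last first.
 apply: (@le_trans _ _ (K1 * x / ln x ^+ D)).
  apply: (h1 f x q%:R (cmul_dchar q0 df) (bsum_dchar q0 df fn) L1 q1 qL _ y yx) => t s hs'.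
  apply: hc => //; [exact: cmul_dchar df|move=> p _; exact: fp df|exact: bsum_dchar|].
  by apply: bsum_dchar f2 => //; exact: dchar_sqr.
 by rewrite -mulrA ler_wpM2r // -addrA lerDl addr_ge0 // ltW.
have rf : real_nonprincipal q f.
 split=> // n nq; have := congr1 (fun F : nat -> C => F n) f2; by rewrite /chi0 nq.
have [r [g [mg fg rq]]] := exists_minimal_real rf.
case: (mg) => rg _; case: (rg) => r0 dg gn g2.
have r1 : 1 <= (r%:R : R) by rewrite ler1n.
have rL : r%:R <= ln x ^+ b by apply: le_trans qL; rewrite ler_nat.
have gR n : g n = (complex.Re (g n))%:C%C by case: (real_nonprincipalE n rg).
have sg : normc (\sum_(1 <= n < y.+1) LamC g n) <= K2 * x / ln x ^+ D.
 apply: (h2 g x r%:R (cmul_dchar r0 dg) (bsum_dchar r0 dg gn) L1 r1 rL _ y yx) => t s hs'.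
 have re0 : 0 < r%:R `^ (e1 / 28) by rewrite powR_gt0 // ltr0n.
 pose l := c1 / r%:R `^ (e1 / 28).
 have l01 : 0 < l <= 1.
  rewrite /l divr_gt0 //= ler_pdivrMr // mul1r (le_trans c11) // one_le_powR // ltW //.
 have lD s' : 1 < s' <= 2 -> l <= normc (DS g s').
  move=> hs2; have := hs (fun n => complex.Re (g n)) r%:R s' (ex_intro _ r (ex_intro _ g (And3 mg erefl erefl))) hs2.
  have -> : (fun n => (complex.Re (g n))%:C%C) = g by apply/funext => n; rewrite -gR.
  by apply: le_trans; rewrite ler_pM2r ?invr_gt0 // ge_min lexx orbT.
 have g2' p : prime p -> g p = 0 \/ g p ^+ 2 = 1.
  move=> pp; have [pr|pr] := boolP (coprime p r); first by right; exact: g2.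
  by left; case: dg => _ _ _ ->.
 apply: le_trans (hr g r%:R t s l hs' r1 (cmul_dchar r0 dg) g2' (bsum_dchar r0 dg gn) l01 lD).
 have t1 : 1 <= 1 + `|t| by rewrite lerDl.
 have rt1 : 1 <= r%:R * (1 + `|t|) by rewrite -[leLHS]mulr1 ler_pM.
 have rt0 := ge1_gt0 rt1.
 have Kr0 := ge1_gt0 Kr1; have [l0 _] := andP l01.
 have A0 : 0 < Kr / c1 ^+ 14 * (r%:R * (1 + `|t|)) `^ e1.
  by rewrite mulr_gt0 ?powR_gt0 // divr_gt0 ?exprn_gt0.
 have B0 : 0 < Kr * (r%:R * (1 + `|t|)) `^ (e1 / 2) / l ^+ 14.
  by rewrite divr_gt0 ?exprn_gt0 // mulr_gt0 ?powR_gt0.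
 rewrite lef_pV2 //.
 have lE : (l ^+ 14)^-1 = (c1 ^+ 14)^-1 * (r%:R `^ (e1 / 28)) ^+ 14 by rewrite /l expr_div_n invf_div mulrC.
 rewrite lE mulrACA ler_wpM2l ?divr_ge0 ?exprn_ge0 ?(ltW c10) ?(ltW Kr0) //.
 have {3}-> : e1 = e1 / 2 + e1 / 28 *+ 14 by rewrite -mulr_natr; field.
 rewrite powRD ?(lt0r_neq0 rt0) ?implybT // ler_wpM2l //.
 rewrite -[X in _ <= _ `^ X]mulr_natr [leRHS]powRrM powR_mulrn // lerXn2r ?nnegrE //.
 by rewrite ge0_ler_powR ?nnegrE ?(ltW e28) // ler_peMr.
have df2 : normc (\sum_(1 <= n < y.+1) LamC f n - \sum_(1 <= n < y.+1) LamC g n) <= K3 * (x / ln x ^+ D).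
 rewrite -sumrB; apply: le_trans (normc_sum _ _ _) _.
 apply: (@le_trans _ _ (\sum_(1 <= n < y.+1) 2 * (Lam R n * (~~ coprime n (q * r))%:R))).
  apply: ler_sum => n _; rewrite -mulrBr normcM normcR_ge0 ?Lam_ge0 // mulrCA ler_wpM2l ?Lam_ge0 //.
  rewrite coprimeMr; have [/andP[h3 h4]|_] := boolP (coprime n q && coprime n r).
   by rewrite fg // subrr normc0 mulr0.
  rewrite mulr1; apply: le_trans (normcB_le _ _) _.
  by have := lerD (dchar_norm_le1 n q0 df) (dchar_norm_le1 n r0 dg); rewrite -[1 + 1]/2.
 rewrite -mulr_sumr -mulrA; apply: ler_wpM2l => //.
 apply: le_trans (sum_Lam_noncoprime _ _) _; first by rewrite muln_gt0 q0.
 have Ly := lnn_le_ln L1 yx.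
 rewrite natrM [leRHS]mulrA ler_pdivlMr ?exprn_gt0 //.
 have LL := ln_pow_le ((b + b).+1 + D) L1.
 apply: le_trans LL; apply: (@le_trans _ _ (ln x ^+ b * ln x ^+ b * ln x * ln x ^+ D)).
  by rewrite ler_wpM2r ?exprn_ge0 ?(ltW L0) // ler_pM ?lnn_ge0 // ler_pM.
 by rewrite [leRHS]exprD exprSr exprD.
have := le_normcD (\sum_(1 <= n < y.+1) LamC f n - \sum_(1 <= n < y.+1) LamC g n) (\sum_(1 <= n < y.+1) LamC g n).
rewrite subrK => h; apply: (le_trans h); apply: (le_trans (lerD df2 sg)).
by rewrite -mulrA -mulrDl ler_wpM2r // addrC lerD2r lerDr ltW.
Qed.

End SiegelWalfisz.

(** * Primes in arithmetic progressions *)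

Section ThetaAP.
Variable R : realType.
Local Notation C := R[i].

Lemma ln_pow_sqrt (D : nat) (x : R) : 1 <= ln x ->
 ln x ^+ D <= (D + D)%:R ^+ D * Num.sqrt x.
Proof.
move=> L1; have L0 := ge1_gt0 L1.
have x0 := ln_ge1_gt0 L1.
rewrite -(ler_pXn2r (n := 2)) ?nnegrE ?exprn_ge0 ?(ltW L0) //.
rewrite exprMn sqr_sqrtr ?(ltW x0) // -!exprM muln2 -addnn; exact: ln_pow_le.
Qed.

(** Orthogonality of characters. The principal one contributes the prime number theorem up to primes
    dividing [q]; the others number less than [totient q], so that division by [totient q] leaves
    the error of a single one. *)
Lemma psi_AP (b D : nat) : exists2 K : R, 0 < K & forall (x : R) (q a y : nat),
 1 <= ln x -> (0 < q)%N -> q%:R <= ln x ^+ b -> coprime a q -> y%:R <= x ->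
 `|\sum_(1 <= n < y.+1) Lam R n * (a == n %[mod q])%N%:R - y%:R / (totient q)%:R| <= K * (x / ln x ^+ D).
Proof.
have [K1 K10 h1] := LamC_char_bound R b D; have [K2 K20 h2] := PNT R D.
pose K3 : R := (b.+1 + D)%:R ^+ (b.+1 + D).
have K30 : 0 <= K3 by rewrite exprn_ge0.
exists (K1 + (K2 + K3)) => [|x q a y L1 q0 qL aq yx]; first by rewrite ltr_wpDr // addr_ge0 // ltW.
have L0 := ge1_gt0 L1.
have x0 := ln_ge1_gt0 L1.
have [X XE] := ex_named (x / ln x ^+ D).
have X0 : 0 <= X by rewrite XE divr_ge0 ?exprn_ge0 // ltW.
rewrite -XE; have t0 : 0 < ((totient q)%:R : R) by rewrite ltr0n totient_gt0.
have t1 : 1 <= ((totient q)%:R : R) by rewrite ler1n totient_gt0.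
have [ps psE] := ex_named (\sum_(1 <= n < y.+1) Lam R n * (a == n %[mod q])%N%:R : R).
have [pc pcE] := ex_named (\sum_(1 <= n < y.+1) Lam R n * (coprime n q)%:R : R).
rewrite -psE; have main : `|(totient q)%:R * ps - pc| <= (totient q)%:R * (K1 * X).
 have [S [Su SP So]] : exists S : seq (nat -> C), [/\ uniq S, forall f, f \in S <-> dchar q f &
   forall a b, coprime a q -> \sum_(f <- S) f b * conjc (f a) = if (a == b %[mod q])%N then (totient q)%:R else 0].
  by case: (q) q0 => // k _; exact: chars_exist.
 have sz : size S = totient q.
  have := So 1%N 1%N (coprime1n q); rewrite eqxx => e; apply/eqP; rewrite -(eqr_nat C) -e.
  rewrite -sum1_size natr_sum big_seq [X in _ == X]big_seq; apply/eqP; apply: eq_bigr => f /SP df.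
  by case: df => -> _ _ _; rewrite conjc1 mulr1.
 have e : ((totient q)%:R * ps)%:C%C = \sum_(f <- S) conjc (f a) * \sum_(1 <= n < y.+1) LamC f n.
  under [RHS]eq_bigr do rewrite mulr_sumr.
  rewrite exchange_big /= realcM psE realc_sum mulr_sumr; apply: eq_bigr => n _.
  have -> : \sum_(f <- S) conjc (f a) * LamC f n = (Lam R n)%:C%C * \sum_(f <- S) f n * conjc (f a).
   by rewrite mulr_sumr; apply: eq_bigr => f _; rewrite /LamC; ring.
  rewrite (So a n aq) realcM !realc_nat; case: ifP => _; rewrite ?mulr1 ?mulr0 //.
  by rewrite mulrC.
 have cS : chi0 R q \in S by apply/SP; exact: dchar_chi0.
 rewrite (bigD1_seq _ cS Su) /= in e.
 have pcC : conjc (chi0 R q a) * \sum_(1 <= n < y.+1) LamC (chi0 R q) n = pc%:C%C.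
  rewrite /chi0 aq conjc1 mul1r pcE realc_sum; apply: eq_bigr => n _.
  by rewrite /LamC realcM realc_nat.
 rewrite pcC in e.
 have -> : `|(totient q)%:R * ps - pc| = normc (((totient q)%:R * ps)%:C%C - pc%:C%C : C).
  by rewrite -normcR; congr normc; exact: rmorphB.
 rewrite e addrAC subrr add0r; apply: le_trans (normc_sum _ _ _) _.
 rewrite -sz -sum1_size natr_sum mulr_suml big_mkcond big_seq [leRHS]big_seq; apply: ler_sum => f fS.
 rewrite mul1r; have df : dchar q f by apply/SP.
 case: ifP => fn; last by rewrite mulr_ge0 // ltW.
 rewrite normcM normc_conj -[leRHS]mul1r ler_pM ?normc_ge0 //; first exact: dchar_norm_le1 df.
 by rewrite XE; apply: h1 df _ L1 qL yx.
have pcy : `|pc - y%:R| <= (K2 + K3) * X.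
 have -> : pc - y%:R = (\sum_(1 <= n < y.+1) Lam R n - y%:R) - \sum_(1 <= n < y.+1) Lam R n * (~~ coprime n q)%:R.
  rewrite addrAC; congr (_ - _); rewrite pcE -sumrB; apply: eq_bigr => n _.
  by case: coprime; rewrite ?mulr1 ?mulr0 ?subrr ?subr0.
 rewrite mulrDl; apply: le_trans (ler_normB _ _) _; apply: lerD; first by rewrite XE mulrA; exact: h2.
 rewrite ger0_norm; last by apply: sumr_ge0 => n _; rewrite mulr_ge0 ?Lam_ge0.
 apply: le_trans (sum_Lam_noncoprime R y q0) _.
 have Ly := lnn_le_ln L1 yx.
 rewrite XE mulrA ler_pdivlMr ?exprn_gt0 //; apply: le_trans (ln_pow_le (b.+1 + D) L1).
 rewrite exprD ler_wpM2r ?exprn_ge0 ?(ltW L0) // exprSr ler_pM ?lnn_ge0 //.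
rewrite -(ler_pM2l t0) -{1}[(totient q)%:R]gtr0_norm // -normrM mulrBr.
have -> : (totient q)%:R * (y%:R / (totient q)%:R) = y%:R :> R by rewrite mulrC divfK // lt0r_neq0.
have -> : (totient q)%:R * ps - y%:R = ((totient q)%:R * ps - pc) + (pc - y%:R) by ring.
apply: le_trans (ler_normD _ _) _; rewrite mulrDl mulrDr; apply: lerD => //.
by apply: (le_trans pcy); rewrite ler_peMl // mulr_ge0 // addr_ge0 // ltW.
Qed.

(** Compared with [psi_AP] only the higher prime powers are missing, and they carry at most
    [sqrt y * ln y]. *)
Lemma theta_AP (b D : nat) : exists2 K : R, 0 < K & forall (x : R) (q a y : nat),
 1 <= ln x -> (0 < q)%N -> q%:R <= ln x ^+ b -> coprime a q -> y%:R <= x ->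
 `|\sum_(1 <= p < y.+1 | prime p && (p == a %[mod q])%N) lnn p - y%:R / (totient q)%:R| <= K * (x / ln x ^+ D).
Proof.
have [K K0 h] := psi_AP b D; pose K3 : R := (D.+1 + D.+1)%:R ^+ D.+1.
have K30 : 0 <= K3 by rewrite exprn_ge0.
exists (K + K3) => [|x q a y L1 q0 qL aq yx]; first by rewrite ltr_wpDr.
have L0 := ge1_gt0 L1.
have x0 := ln_ge1_gt0 L1.
have -> : \sum_(1 <= p < y.+1 | prime p && (p == a %[mod q])%N) @lnn R p =
 \sum_(1 <= n < y.+1) Lam R n * (a == n %[mod q])%N%:R -
 \sum_(1 <= n < y.+1) Lam R n * ((~~ prime n)%:R * (a == n %[mod q])%N%:R).
 rewrite -sumrB big_mkcond; apply: eq_bigr => n _; rewrite eq_sym.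
 have [pn|pn] := boolP (prime n); last by rewrite mul1r subrr.
 by rewrite mul0r mulr0 subr0 Lam_prime //; case: eqP => _; rewrite ?mulr1 ?mulr0.
rewrite addrAC mulrDl; apply: le_trans (ler_normB _ _) _; apply: lerD; first exact: h.
rewrite ger0_norm; last by apply: sumr_ge0 => n _; rewrite !mulr_ge0 ?Lam_ge0.
apply: (@le_trans _ _ (\sum_(1 <= n < y.+1) Lam R n * (~~ prime n)%:R)).
 by apply: ler_sum => n _; rewrite ler_wpM2l ?Lam_ge0 // -[leRHS]mulr1 ler_wpM2l // lern1 leq_b1.
apply: le_trans (sum_Lam_nonprime R y) _.
have Ly := lnn_le_ln L1 yx.
rewrite mulrA ler_pdivlMr ?exprn_gt0 // -mulrA.
apply: (@le_trans _ _ (Num.sqrt x * ln x ^+ D.+1)).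
 rewrite ler_pM ?mulr_ge0 ?lnn_ge0 ?exprn_ge0 ?(ltW L0) ?ler_wsqrtr //.
 by rewrite exprS ler_wpM2r ?exprn_ge0 ?(ltW L0).
have xs : x = Num.sqrt x * Num.sqrt x by rewrite -expr2 sqr_sqrtr // ltW.
rewrite [X in _ <= _ * X]xs mulrCA ler_wpM2l //.
exact: ln_pow_sqrt.
Qed.

Lemma theta_chebyshev : exists2 K : R, 0 < K & forall (x : R) (y : nat),
 1 <= ln x -> y%:R <= x -> \sum_(1 <= p < y.+1 | prime p) lnn p <= K * x.
Proof.
have [K K0 h] := PNT R 0; exists (K + 1) => [|x y L1 yx]; first by lra.
have := h x L1 y yx; rewrite expr0 divr1 ler_norml => /andP[_ h2].
apply: (@le_trans _ _ (\sum_(1 <= n < y.+1) Lam R n)); last by lra.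
rewrite big_mkcond; apply: ler_sum => n _; case: ifP => pn; last exact: Lam_ge0.
by rewrite Lam_prime.
Qed.

End ThetaAP.

(** * Chaining over dyadic levels *)

Section Chaining.
Variable R : realType.

Definition pairs (c : nat) (s : seq nat) : seq (nat * nat) := pairmap pair c s.

(** A partition is the same as an increasing list of end points; the interval from [l] to [r]
    becomes the pair [(l - 1, r)], so that sums over it are differences of values at the two
    ends. *)
Lemma partition_pairs (pi : seq (nat * nat)) s M : all (fun J => (J.1 <= J.2)%N) pi ->
 flatten [seq iota J.1 (J.2 - J.1).+1 | J <- pi] = iota s.+1 M ->
 exists cs, [/\ path ltn s cs, last s cs = (s + M)%N & pi = [seq (p.1.+1, p.2) | p <- pairs s cs]].
Proof.
elim: pi s M => [|[l r] pi IH] s M /=.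
 by case: M => // _ _; exists [::]; rewrite addn0.
move=> /andP[lr hpi] e; case: M e => [|M] //= [ls e].
have rs : (s < r)%N by rewrite -ls.
have hM : (r - s.+1 <= M)%N.
 by have := congr1 size e; rewrite size_cat !size_iota ls => <-; rewrite leq_addr.
move: e; rewrite -ls -(subnKC hM) iotaD => /eqP; rewrite eqseq_cat ?ls // => /andP[_ /eqP e].
have e2 : (s.+2 + (r - s.+1) = r.+1)%N by rewrite addSn subnKC.
rewrite e2 in e; have [cs [h1 h2 h3]] := IH r _ hpi e.
exists (r :: cs); split; rewrite /= ?rs //; first by rewrite h2; lia.
by rewrite h3.
Qed.

Lemma pairs_bound c s p : path ltn c s -> p \in pairs c s -> (c <= p.1)%N && (p.1 < p.2 <= last c s)%N.
Proof.
elim: s c => //= x s IH c /andP[cx xs]; rewrite inE => /orP[/eqP ->|/(IH _ xs) /=].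
 rewrite leqnn cx; elim: s x xs {IH cx} => //= y s IH x /andP[xy /IH]; exact/leq_trans/ltnW.
by case/and3P=> h1 h2 h3; rewrite (leq_trans (ltnW cx) h1) h2 h3.
Qed.

(* A nondecreasing h makes the values h b, over the pairs with h a < h b, distinct. *)
Lemma pairs_sqdiff (G : nat -> R) (h : nat -> nat) c s : {homo h : m n / (m <= n)%N} -> path ltn c s ->
 \sum_(p <- pairs c s) (G (h p.2) - G (h p.1)) ^+ 2 <=
 4 * \sum_(h c <= j < (h (last c s)).+1) G j ^+ 2 - 2 * G (h c) ^+ 2.
Proof.
move=> hh; elim: s c => [|x s IH] c /=.
 by rewrite big_nil big_nat1 => _; have := sqr_ge0 (G (h c)); lra.
move=> /andP[cx xs]; rewrite big_cons /=; apply: le_trans (lerD (lexx _) (IH _ xs)) _.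
have hx : (h c <= h x)%N by apply/hh/ltnW.
have hl : (h x <= h (last x s))%N.
 apply: hh; elim: s x xs {IH cx hx} => //= y s IH x /andP[xy /IH]; exact/leq_trans/ltnW.
have [e|lt] : (h c = h x) \/ (h c < h x)%N by move: hx; rewrite leq_eqVlt => /orP[/eqP|]; [left|right].
 by rewrite e subrr expr0n add0r.
rewrite [in leRHS](big_cat_nat _ (n := h x)) //=; last exact: leqW.
rewrite [X in _ <= 4 * (X + _) - _]big_ltn //.
have r0 : 0 <= \sum_((h c).+1 <= j < h x) G j ^+ 2 by apply: sumr_ge0 => j _; exact: sqr_ge0.
have := sqr_ge0 (G (h x) + G (h c)); move: (\sum_(h x <= _ < _) _) => u; nra.
Qed.

Definition flr (k n : nat) : nat := (2 ^ k * (n %/ 2 ^ k))%N.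

Lemma flr_le k n : (flr k n <= n)%N.
Proof. by rewrite /flr mulnC leq_trunc_div. Qed.

Lemma flr_le_homo k : {homo flr k : m n / (m <= n)%N}.
Proof. by move=> m n mn; rewrite /flr leq_mul2l leq_div2r ?orbT. Qed.

Lemma ltn_flr k n : (n < flr k n + 2 ^ k)%N.
Proof. by rewrite /flr mulnC -mulSnr -ltn_divLR ?expn_gt0. Qed.

Lemma flr_idem k n : flr k (flr k n) = flr k n.
Proof. by rewrite {1}/flr /flr mulKn ?expn_gt0. Qed.

Lemma flr_neq_le k a b : (a <= b)%N -> flr k a != flr k b -> (a <= flr k b)%N.
Proof.
move=> ab ne; rewrite leqNgt; apply/negP => lt; case/negP: ne; rewrite eqn_leq flr_le_homo //=.
by rewrite -(flr_idem k b) flr_le_homo // ltnW.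
Qed.

(** One step of the chain, from rounding at level [k.+1] to rounding at level [k]. It depends on [n]
    through [j = n %/ 2 ^ k] alone; it is the increment over one block of length [2 ^ k] if [j] is
    odd, and 0 if [j] is even. *)
Definition lev (T : nat -> R) (k j : nat) : R := T (2 ^ k * j)%N - T (2 ^ k.+1 * (j %/ 2))%N.

Lemma levE T k n : lev T k (n %/ 2 ^ k) = T (flr k n) - T (flr k.+1 n).
Proof. by rewrite /lev /flr -divnMA expnSr. Qed.

Lemma sum_lev T k M : \sum_(0 <= j < M.+1) lev T k j ^+ 2 <=
 \sum_(0 <= j < M) (T (2 ^ k * j.+1)%N - T (2 ^ k * j)%N) ^+ 2.
Proof.
rewrite big_nat_recl // {1}/lev div0n !muln0 subrr expr0n add0r; apply: ler_sum => j _.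
rewrite /lev expnSr -mulnA; have [/eqP h|h] := boolP (2 * (j.+1 %/ 2) == j)%N; first by rewrite h.
have -> : (2 * (j.+1 %/ 2) = j.+1)%N by move: h; clear; lia.
by rewrite subrr expr0n sqr_ge0.
Qed.

Lemma sum_pairs_lev T k N cs : path ltn 0%N cs -> last 0%N cs = N ->
 \sum_(p <- pairs 0 cs) (lev T k (p.2 %/ 2 ^ k) - lev T k (p.1 %/ 2 ^ k)) ^+ 2 <=
 4 * \sum_(0 <= j < N %/ 2 ^ k) (T (2 ^ k * j.+1)%N - T (2 ^ k * j)%N) ^+ 2.
Proof.
move=> hp hl; have hh : {homo (fun n => n %/ 2 ^ k)%N : m n / (m <= n)%N} by move=> m n; exact: leq_div2r.
apply: le_trans (pairs_sqdiff (lev T k) hh hp) _; rewrite hl div0n.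
have := sqr_ge0 (lev T k 0); have := sum_lev T k (N %/ 2 ^ k); lra.
Qed.

Lemma weighted_cauchy (w u : nat -> R) m n : (forall k, 0 < w k) ->
 (\sum_(m <= k < n) u k) ^+ 2 <= (\sum_(m <= k < n) (w k)^-1) * \sum_(m <= k < n) w k * u k ^+ 2.
Proof.
move=> w0; have := cauchy_schwarz_seq (index_iota m n) xpredT (fun k => Num.sqrt (w k)^-1) (fun k => Num.sqrt (w k) * u k).
have -> : \sum_(m <= k < n) Num.sqrt (w k)^-1 * (Num.sqrt (w k) * u k) = \sum_(m <= k < n) u k.
 by apply: eq_bigr => k _; rewrite mulrA -sqrtrM ?invr_ge0 ?ltW // mulVf ?lt0r_neq0 // sqrtr1 mul1r.
have -> : \sum_(m <= k < n) Num.sqrt (w k)^-1 ^+ 2 = \sum_(m <= k < n) (w k)^-1.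
 by apply: eq_bigr => k _; rewrite sqr_sqrtr // invr_ge0 ltW.
have -> : \sum_(m <= k < n) (Num.sqrt (w k) * u k) ^+ 2 = \sum_(m <= k < n) w k * u k ^+ 2 => //.
by apply: eq_bigr => k _; rewrite exprMn sqr_sqrtr // ltW.
Qed.

(** [T n - T 0] is the part below level [k0] plus the steps [lev] for [k0 <= k < K], because
    rounding at level [K] gives 0. Weighted Cauchy-Schwarz separates the levels, and on each of them
    [pairs_sqdiff] replaces the end points by all blocks. The constant is [2] for splitting off the
    low part, times [c], times the [4] of that lemma. *)
Lemma chaining T (w : nat -> R) cs N k0 K c : (forall k, 0 < w k) -> (k0 <= K)%N -> (N < 2 ^ K)%N ->
 path ltn 0%N cs -> last 0%N cs = N -> \sum_(k0 <= k < K) (w k)^-1 <= c ->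
 \sum_(p <- pairs 0 cs) (T p.2 - T p.1) ^+ 2 <=
 2 * \sum_(p <- pairs 0 cs) ((T p.2 - T (flr k0 p.2)) - (T p.1 - T (flr k0 p.1))) ^+ 2 +
 8 * c * \sum_(k0 <= k < K) w k * \sum_(0 <= j < N %/ 2 ^ k) (T (2 ^ k * j.+1)%N - T (2 ^ k * j)%N) ^+ 2.
Proof.
move=> w0 k0K NK hp hl wc.
have tele n : (n <= N)%N -> T (flr k0 n) = T 0%N + \sum_(k0 <= k < K) lev T k (n %/ 2 ^ k).
 move=> nN; under eq_bigr do rewrite levE.
 have -> : \sum_(k0 <= k < K) (T (flr k n) - T (flr k.+1 n)) = T (flr k0 n) - T (flr K n).
  have := telescope_sumr (fun k => - T (flr k n)) k0K; rewrite opprK [RHS]addrC => <-.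
  by apply: eq_bigr => k _; rewrite opprK addrC.
 by rewrite {3}/flr divn_small ?muln0 ?(leq_ltn_trans nN) // addrC subrK.
have c0 : 0 <= c by apply: le_trans wc; apply: sumr_ge0 => k _; rewrite invr_ge0 ltW.
apply: (@le_trans _ _ (\sum_(p <- pairs 0 cs) (2 * ((T p.2 - T (flr k0 p.2)) - (T p.1 - T (flr k0 p.1))) ^+ 2 +
  2 * c * \sum_(k0 <= k < K) w k * (lev T k (p.2 %/ 2 ^ k) - lev T k (p.1 %/ 2 ^ k)) ^+ 2))).
 rewrite big_seq [leRHS]big_seq; apply: ler_sum => p pp.
 have /and3P[_ h1 h2] := pairs_bound hp pp; rewrite hl in h2.
 have e : T (flr k0 p.2) - T (flr k0 p.1) = \sum_(k0 <= k < K) (lev T k (p.2 %/ 2 ^ k) - lev T k (p.1 %/ 2 ^ k)).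
  rewrite (tele _ h2) (tele _ (leq_trans (ltnW h1) h2)) [RHS]sumrB.
  by lra.
 have W := weighted_cauchy (fun k => lev T k (p.2 %/ 2 ^ k) - lev T k (p.1 %/ 2 ^ k)) k0 K w0.
 rewrite -e in W; set Y := \sum_(k0 <= k < K) w k * _ in W *.
 have Y0 : 0 <= Y by apply: sumr_ge0 => k _; rewrite mulr_ge0 ?sqr_ge0 // ltW.
 have W2 := le_trans W (ler_wpM2r Y0 wc).
 set u := T p.2 - T (flr k0 p.2) - _.
 have -> : T p.2 - T p.1 = u + (T (flr k0 p.2) - T (flr k0 p.1)) by rewrite /u; ring.
 move: W2; set v := T (flr k0 p.2) - T (flr k0 p.1) => W2.
 by have := sqr_ge0 (u - v); nra.
rewrite big_split -!mulr_sumr lerD2l exchange_big /=.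
have -> : 8 * c = 2 * c * 4 by ring.
rewrite -[leRHS]mulrA ler_wpM2l ?mulr_ge0 // mulr_sumr; apply: ler_sum => k _.
by rewrite -mulr_sumr mulrCA ler_wpM2l ?(ltW (w0 k)) // sum_pairs_lev.
Qed.

(** [Psi] measures a charge. A pair within one cell of length [2 ^ k] is charged to itself, a pair
    across a border only to the two pieces between its ends and the cell borders below them. The
    second summand starts at [flr k c] because the first pair may charge the part of the cell to the
    left of [c]. *)
Lemma short_pairs (f : nat -> nat -> R) (Psi : nat -> R) k c s :
 {homo Psi : m n / (m <= n)%N >-> m <= n} -> path ltn c s ->
 (forall a b, (a <= b)%N -> flr k a = flr k b -> f a b <= Psi b - Psi a) ->
 (forall a b, (a <= b)%N -> f a b <= 2 * (Psi b - Psi (flr k b)) + 2 * (Psi a - Psi (flr k a))) ->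
 \sum_(p <- pairs c s) f p.1 p.2 <=
 2 * (Psi (last c s) - Psi c) + 2 * (Psi (last c s) - Psi (flr k c)).
Proof.
move=> hP; elim: s c => [|b s IH] a /=.
 by rewrite big_nil => _ _ _; have := hP _ _ (flr_le k a); lra.
move=> /andP[ab bs] h1 h2; rewrite big_cons /=; apply: le_trans (lerD (lexx _) (IH _ bs h1 h2)) _.
have [e|ne] := eqVneq (flr k a) (flr k b).
 have := h1 _ _ (ltnW ab) e; rewrite e; have := hP _ _ (ltnW ab); lra.
have := h2 _ _ (ltnW ab); have := hP _ _ (flr_neq_le (ltnW ab) ne); lra.
Qed.

End Chaining.

(** In an increasing list of integers above 1 the [i]-th entry is at least [i + 1], so the product
    of the quotients [p / (p - 1)] is bounded by a telescoping one. *)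
Lemma prod_le_pred s : sorted ltn s -> all (fun p => 1 < p)%N s ->
 (\prod_(p <- s) p <= (size s).+1 * \prod_(p <- s) p.-1)%N.
Proof.
elim/last_ind: s => [|s p IH]; first by rewrite !big_nil.
rewrite all_rcons sorted_pairwise ?pairwise_rcons; last exact: ltn_trans.
move=> /andP[/allP lt pw] /andP[p1 /allP s1].
have ss : sorted ltn s by rewrite sorted_pairwise //; exact: ltn_trans.
have sz : (size s <= p - 2)%N.
 have sub : {subset s <= iota 2 (p - 2)}.
  by move=> r rs; rewrite mem_iota subnKC // s1 //=; exact: lt.
 have us : uniq s by apply: (sorted_uniq ltn_trans ltnn).
 by have := uniq_leq_size us sub; rewrite size_iota.
have := IH ss; move/(_ (introT allP s1)); rewrite -!cats1 !big_cat /= !big_seq1 size_cat addn1.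
move: (\prod_(_ <- s) _)%N (\prod_(_ <- s) _)%N => u v h.
have h1 : (v * p <= (size s).+1 * u * p)%N by rewrite leq_mul2r h orbT.
have h2 : ((size s).+1 * p <= (size s).+2 * p.-1)%N by move: sz p1; clear; nia.
apply: (leq_trans h1); rewrite mulnAC [leqRHS]mulnCA mulnC leq_mul2l h2 orbT //.
Qed.

Lemma prod_primes_logn n : (0 < n)%N -> (\prod_(p <- primes n) p ^ logn p n)%N = n.
Proof. by move=> n0; rewrite [RHS](prod_prime_decomp n0) prime_decompE big_map. Qed.

Lemma size_primes_le n : (0 < n)%N -> (size (primes n) <= trunc_log 2 n)%N.
Proof.
move=> n0; apply: trunc_log_max => //; rewrite -{2}(prod_primes_logn n0).
have : all (fun p => 2 <= p ^ logn p n)%N (primes n).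
 apply/allP => p pn; have pp : prime p by move: pn; rewrite mem_primes => /andP[].
 by apply: leq_trans (prime_gt1 pp) _; rewrite -{1}(expn1 p); apply: leq_pexp2l; rewrite ?logn_gt0 // prime_gt0.
elim: (primes n) => [|p s IH] /=; first by rewrite big_nil.
by move=> /andP[h /IH h2]; rewrite big_cons expnS leq_mul.
Qed.

(** At most [trunc_log 2 n] primes divide [n]. The loss of a logarithm against the true order is
    affordable for short pieces. *)
Lemma totient_lower n : (0 < n)%N -> (n <= (trunc_log 2 n).+1 * totient n)%N.
Proof.
move=> n0; have e : (n * \prod_(p <- primes n) p.-1 = totient n * \prod_(p <- primes n) p)%N.
 rewrite -{1}(prod_primes_logn n0) (totientE n0) -!big_split /= big_seq [RHS]big_seq; apply: eq_bigr => p.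
 rewrite -logn_gt0; case: (logn p n) => // l _; rewrite expnS /= mulnC -mulnA.
 by congr (_ * _)%N; rewrite mulnC.
have P0 : (0 < \prod_(p <- primes n) p.-1)%N.
 rewrite big_seq; apply: prodn_cond_gt0 => p; rewrite mem_primes => /andP[pp _].
 by case: p pp => -[].
rewrite -(leq_pmul2r P0) e mulnC -mulnA [leqRHS]mulnCA [leqRHS]mulnC leq_mul2r; apply/orP; right.
apply: leq_trans (prod_le_pred (sorted_primes n) _) _.
 by apply/allP => p; rewrite mem_primes => /andP[/prime_gt1].
by rewrite leq_mul2r ltnS size_primes_le // orbT.
Qed.

(** * Pieces shorter than the modulus *)

Section Short.
Variable R : realType.

Definition thq (q a n : nat) : R := \sum_(1 <= p < n.+1 | prime p && (p == a %[mod q])%N) lnn p.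

(** The error term as a function of the end point: the interval from [u + 1] to [v] contributes
    [TT q a v - TT q a u]. *)
Definition TT (q a n : nat) : R := thq q a n - n%:R / (totient q)%:R.

Definition sql (n : nat) : R := \sum_(1 <= p < n.+1 | prime p) lnn p ^+ 2.

(** Its increments majorise the trivial bound on intervals of length [h <= q]: the squares of
    [ln p], and [h ^ 2 / totient q], which [totient_lower] bounds by [(trunc_log 2 q + 1) h]. *)
Definition Psi (q n : nat) : R := sql n + (trunc_log 2 q).+1%:R * n%:R.

Lemma sum_nat_shift (F : nat -> R) (P : pred nat) u v : (u <= v)%N ->
 \sum_(1 <= p < v.+1 | P p) F p - \sum_(1 <= p < u.+1 | P p) F p = \sum_(u.+1 <= p < v.+1 | P p) F p.
Proof. by move=> uv; rewrite [X in X - _](big_cat_nat _ (n := u.+1)) //= addrAC subrr add0r. Qed.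

Lemma Psi_homo q : {homo Psi q : m n / (m <= n)%N >-> m <= n}.
Proof.
move=> m n mn; rewrite /Psi lerD ?ler_wpM2l ?ler_nat // -subr_ge0 sum_nat_shift //.
by apply: sumr_ge0 => p _; exact: sqr_ge0.
Qed.

Lemma sum_class_le1 q a u v : (0 < q)%N -> (u <= v)%N -> (v <= u + q)%N ->
 (\sum_(u.+1 <= p < v.+1 | prime p && (p == a %[mod q])%N) lnn p : R) ^+ 2 <=
 \sum_(u.+1 <= p < v.+1 | prime p && (p == a %[mod q])%N) lnn p ^+ 2.
Proof.
move=> q0 uv vu; set P := fun p => prime p && (p == a %[mod q])%N.
have [[p [pr hP]]|no] := pselect (exists p, (u.+1 <= p < v.+1)%N /\ P p); last first.
 rewrite ![\sum_(_ <= _ < _ | _) _]sum_nat_eq0 ?expr0n // => p pr hP; case: no; by exists p.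
have one (F : nat -> R) : \sum_(u.+1 <= p < v.+1 | P p) F p = F p.
 rewrite big_mkcond (bigD1_seq p) ?iota_uniq ?mem_index_iota //= hP big_seq_cond big1 ?addr0 // => r.
 rewrite mem_index_iota => /andP[rr rp]; case: ifP => // hr; case/negP: rp; move: hP hr.
 rewrite /P => /andP[_ /eqP e1] /andP[_ /eqP e2]; have e : r = p %[mod q] by rewrite e1 e2.
 apply/eqP; wlog rlep : r p rr pr e {e1 e2} / (r <= p)%N.
  by move=> H; have [/H|/ltnW /H] := leqP r p; [apply|move=> h1; apply/esym/h1].
 have : (q %| p - r)%N by rewrite -eqn_mod_dvd // e.
 move/dvdnP=> [t et]; case: t et => [|t] et.
  by move: et rlep; clear; lia.
 have : (q <= p - r)%N by rewrite et mulSn leq_addr.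
 by move: rr pr vu q0; clear; lia.
by rewrite !one.
Qed.

(** In an interval of length at most [q] each class contains at most one prime, so the square of a
    class sum is a sum of squares. The cross term with the expected value has the favourable
    sign. *)
Lemma short_block q u v : (0 < q)%N -> (u <= v)%N -> (v <= u + q)%N ->
 \sum_(0 <= a < q | coprime a q) (TT q a v - TT q a u) ^+ 2 <= Psi q v - Psi q u.
Proof.
move=> q0 uv vu; have t0 : 0 < ((totient q)%:R : R) by rewrite ltr0n totient_gt0.
pose A a : R := \sum_(u.+1 <= p < v.+1 | prime p && (p == a %[mod q])%N) lnn p.
have A0 a : 0 <= A a by apply: sumr_ge0 => p _; exact: lnn_ge0.
have [h hE] := ex_named ((v - u)%:R : R).
have h0 : 0 <= h by rewrite hE ler0n.
have hq : h <= q%:R by rewrite hE ler_nat leq_subLR.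
have TE a : TT q a v - TT q a u = A a - h / (totient q)%:R.
 rewrite /A -sum_nat_shift // /TT /thq hE natrB // mulrBl; ring.
have -> : Psi q v - Psi q u = \sum_(u.+1 <= p < v.+1 | prime p) lnn p ^+ 2 + (trunc_log 2 q).+1%:R * h.
 by rewrite /Psi -sum_nat_shift // hE natrB //; rewrite /sql; ring.
apply: (@le_trans _ _ (\sum_(0 <= a < q | coprime a q) (A a ^+ 2 + (h / (totient q)%:R) ^+ 2))).
 apply: ler_sum => a _; rewrite TE; have := mulr_ge0 (A0 a) (divr_ge0 h0 (ltW t0)).
 by lra.
rewrite big_split /=; apply: lerD.
 apply: (@le_trans _ _ (\sum_(0 <= a < q) A a ^+ 2)).
  by rewrite big_mkcond; apply: ler_sum => a _; case: ifP => // _; exact: sqr_ge0.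
 apply: (@le_trans _ _ (\sum_(0 <= a < q) \sum_(u.+1 <= p < v.+1 | prime p && (p == a %[mod q])%N) lnn p ^+ 2)).
  by apply: ler_sum => a _; exact: sum_class_le1.
 have e a : \sum_(u.+1 <= p < v.+1 | prime p && (p == a %[mod q])%N) lnn p ^+ 2 =
   \sum_(u.+1 <= p < v.+1 | prime p) (if (p == a %[mod q])%N then lnn p ^+ 2 else 0) :> R by rewrite big_mkcondr.
 under [leLHS]eq_bigr do rewrite e.
 rewrite exchange_big /=; apply: ler_sum => p _.
 rewrite (bigD1_seq (p %% q)%N) ?iota_uniq ?mem_index_iota ?ltn_mod //= modn_mod eqxx big_seq_cond big1 ?addr0 //.
 move=> a; rewrite mem_index_iota => /andP[/andP[_ aq]].
 by rewrite eq_sym (modn_small aq) => /negPf ->.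
have -> : \sum_(0 <= a < q | coprime a q) (h / (totient q)%:R) ^+ 2 = h * (h / (totient q)%:R) :> R.
 by rewrite sum_units_const; field; rewrite lt0r_neq0.
rewrite mulrC ler_wpM2r // ler_pdivrMr //; apply: le_trans hq _; rewrite -natrM ler_nat.
exact: totient_lower.
Qed.

Lemma short_total q cs N : (0 < q)%N -> path ltn 0%N cs -> last 0%N cs = N ->
 \sum_(0 <= a < q | coprime a q) \sum_(p <- pairs 0 cs)
  ((TT q a p.2 - TT q a (flr (trunc_log 2 q) p.2)) - (TT q a p.1 - TT q a (flr (trunc_log 2 q) p.1))) ^+ 2
 <= 4 * Psi q N.
Proof.
move=> q0 hp hl; set k := trunc_log 2 q; have kq : (2 ^ k <= q)%N by exact: trunc_logP.
rewrite exchange_big /=.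
pose f u v := \sum_(0 <= a < q | coprime a q) ((TT q a v - TT q a (flr k v)) - (TT q a u - TT q a (flr k u))) ^+ 2.
have sh u : \sum_(0 <= a < q | coprime a q) (TT q a u - TT q a (flr k u)) ^+ 2 <= Psi q u - Psi q (flr k u).
 apply: short_block => //; first exact: flr_le.
 by apply: ltnW; apply: leq_trans (ltn_flr k u) _; rewrite leq_add2l.
have h1 u v : (u <= v)%N -> flr k u = flr k v -> f u v <= Psi q v - Psi q u.
 move=> uv e; apply: le_trans (short_block q0 uv _).
  by rewrite /f e; apply: ler_sum => a _; apply: eq_lew; congr (_ ^+ 2); ring.
 apply: ltnW; apply: leq_trans (ltn_flr k v) _; rewrite -e leq_add //; exact: flr_le.
have h2 u v : (u <= v)%N -> f u v <= 2 * (Psi q v - Psi q (flr k v)) + 2 * (Psi q u - Psi q (flr k u)).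
 move=> _; apply: le_trans (lerD (ler_wpM2l _ (sh v)) (ler_wpM2l _ (sh u))) => //.
 rewrite !mulr_sumr -big_split /=; apply: ler_sum => a _.
 move: (TT q a v - _) (TT q a u - _) => y z; have := sqr_ge0 (y + z); nra.
have := short_pairs (@Psi_homo q) hp h1 h2; rewrite hl /f => /le_trans; apply.
have -> : flr k 0 = 0%N by rewrite /flr div0n muln0.
have : 0 <= Psi q 0 by rewrite /Psi addr_ge0 // sumr_ge0 // => p _; exact: sqr_ge0.
lra.
Qed.

End Short.

(** * One dyadic block: Plancherel and the large sieve *)

Section Block.
Variable R : realType.
Local Notation C := R[i].

Lemma realcV (x : R) : (x^-1)%:C%C = (x%:C%C)^-1 :> C. Proof. exact: fmorphV. Qed.

Definition SI (u v : nat) (t : R) : C := \sum_(u.+1 <= p < v.+1 | prime p) (lnn p)%:C%C * ep (p%:R * t).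

Definition XI (u v d b : nat) : C :=
 SI u v (b%:R / d%:R) - (v - u)%:R * (ramanujan R d b / (totient d)%:R).

Definition beta (u v d : nat) : R := \sum_(0 <= b < d | coprime b d) normc (XI u v d b) ^+ 2.

Lemma beta_ge0 u v d : 0 <= beta u v d.
Proof. by apply: sumr_ge0 => b _; rewrite exprn_ge0 ?normc_ge0. Qed.

Lemma sum_classes (q u v : nat) (F : nat -> C) : (0 < q)%N ->
 \sum_(0 <= a < q) (\sum_(u.+1 <= p < v.+1 | prime p && (p == a %[mod q])%N) lnn p)%:C%C * F a =
 \sum_(u.+1 <= p < v.+1 | prime p) (lnn p)%:C%C * F (p %% q)%N.
Proof.
move=> q0; transitivity (\sum_(0 <= a < q) \sum_(u.+1 <= p < v.+1 | prime p)
  (if (p == a %[mod q])%N then (lnn p)%:C%C * F a else 0)).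
 apply: eq_bigr => a _; rewrite realc_sum mulr_suml big_mkcondr; apply: eq_bigr => p _.
 by [].
rewrite exchange_big /=; apply: eq_bigr => p _.
rewrite (bigD1_seq (p %% q)%N) ?iota_uniq ?mem_index_iota ?ltn_mod //= modn_mod eqxx big_seq_cond big1 ?addr0 //.
move=> a; rewrite mem_index_iota => /andP[/andP[_ aq]].
by rewrite eq_sym (modn_small aq) => /negPf ->.
Qed.

(** Finite Fourier transform of the errors in the residue classes; the classes recombine into one
    exponential sum because [ep (p * b / q)] depends on [p] modulo [q] only. *)
Lemma fourier_block q u v b : (0 < q)%N ->
 \sum_(0 <= a < q) (\sum_(u.+1 <= p < v.+1 | prime p && (p == a %[mod q])%N) lnn p -
   (if coprime a q then (v - u)%:R / (totient q)%:R else 0))%:C%C * ep (a%:R * b%:R / q%:R) =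
 SI u v (b%:R / q%:R) - (v - u)%:R *
  ((\sum_(0 <= a < q | coprime a q) ep (a%:R * (b%:R / q%:R))) / (totient q)%:R).
Proof.
move=> q0; have [h hE] := ex_named ((v - u)%:R : R).
rewrite -hE; pose A a : R := \sum_(u.+1 <= p < v.+1 | prime p && (p == a %[mod q])%N) lnn p.
transitivity (\sum_(0 <= a < q) ((A a)%:C%C * ep (a%:R * b%:R / q%:R) -
   (if coprime a q then (h / (totient q)%:R)%:C%C * ep (a%:R * (b%:R / q%:R)) else 0))).
 apply: eq_bigr => a _.
 have -> (y z : R) : (y - z)%:C%C = y%:C%C - z%:C%C :> C by exact: rmorphB.
 by rewrite mulrBl; case: ifP => _; rewrite ?mulrA // mul0r.
rewrite sumrB sum_classes //; congr (_ - _).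
 by apply: eq_bigr => p _; congr (_ * _); rewrite ep_mod //; congr ep; rewrite mulrA.
rewrite -realc_nat -hE; have -> (z : C) : h%:C%C * (z / (totient q)%:R) = (h / (totient q)%:R)%:C%C * z.
 by rewrite realcM realcV realc_nat; ring.
by rewrite mulr_sumr [RHS]big_mkcond.
Qed.

(** The sum is first extended to all residues, with expected value 0 at the non-units. After
    Plancherel the frequencies [b / q] are sorted by reduced denominators, where by [ramanujan_dvd]
    the transform no longer depends on [q]. *)
Lemma block_plancherel q u v : (0 < q)%N -> (u <= v)%N ->
 \sum_(0 <= a < q | coprime a q) (TT R q a v - TT R q a u) ^+ 2 <=
 q%:R^-1 * \sum_(1 <= d < q.+1 | (d %| q)%N) beta u v d.
Proof.
move=> q0 uv.
pose A a : R := \sum_(u.+1 <= p < v.+1 | prime p && (p == a %[mod q])%N) lnn p.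
have [h hE] := ex_named ((v - u)%:R : R).
have TE a : TT R q a v - TT R q a u = A a - h / (totient q)%:R.
 rewrite /A -sum_nat_shift // /TT /thq hE natrB // mulrBl; ring.
pose G a := A a - (if coprime a q then h / (totient q)%:R else 0).
apply: (@le_trans _ _ (\sum_(0 <= a < q) G a ^+ 2)).
 rewrite big_mkcond; apply: ler_sum => a _; case: ifP => ca; last exact: sqr_ge0.
 by rewrite TE /G ca.
rewrite plancherel // ler_wpM2l //.
pose F t : C := SI u v t - (v - u)%:R * ((\sum_(0 <= a < q | coprime a q) ep (a%:R * t)) / (totient q)%:R).
have e b : \sum_(0 <= a < q) (G a)%:C%C * ep (a%:R * b%:R / q%:R) = F (b%:R / q%:R).
 by rewrite /F -fourier_block // -hE.
under eq_bigr do rewrite e.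
rewrite (sum_farey (fun t => normc (F t) ^+ 2) q0) big_nat_cond [leRHS]big_nat_cond.
apply: ler_sum => d /andP[_ dq]; apply: ler_sum => b _.
suff -> : F (b%:R / d%:R) = XI u v d b by [].
by rewrite /F /XI (ramanujan_dvd R b q0 dq).
Qed.

(** The total weight with which the denominator [d] occurs among the moduli below [Y]. *)
Definition om (Y d : nat) : R := \sum_(1 <= q < Y | (d %| q)%N) q%:R^-1.

Lemma om_ge0 Y d : 0 <= om Y d.
Proof. by apply: sumr_ge0 => q _; rewrite invr_ge0 ler0n. Qed.

Lemma sum_om (be : nat -> R) Y : \sum_(1 <= q < Y) q%:R^-1 * \sum_(1 <= d < q.+1 | (d %| q)%N) be d =
 \sum_(1 <= d < Y) om Y d * be d.
Proof.
transitivity (\sum_(1 <= q < Y) \sum_(1 <= d < Y) (if (d %| q)%N then q%:R^-1 * be d else 0)).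
 apply: eq_big_nat => q /andP[q0 qY]; rewrite mulr_sumr [RHS](big_cat_nat _ (n := q.+1)) //=.
 rewrite [X in _ + X]big_nat_cond [X in _ + X]big1 ?addr0 => [|d /andP[/andP[qd _] _]].
  by rewrite big_mkcond.
 by case: ifP => // /(dvdn_leq q0); rewrite leqNgt qd.
rewrite exchange_big /=; apply: eq_bigr => d _; rewrite /om mulr_suml [RHS]big_mkcond.
by [].
Qed.

Lemma sum_harmonic_dyadic n : \sum_(0 <= m < 2 ^ n) m%:R^-1 <= n%:R :> R.
Proof.
elim: n => [|n IH]; first by rewrite expn0 big_nat1 invr0.
have lt : (2 ^ n <= 2 ^ n.+1)%N by rewrite leq_exp2l.
rewrite (big_cat_nat _ (n := (2 ^ n)%N)) //= -natr1 lerD //.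
apply: (@le_trans _ _ (\sum_(2 ^ n <= m < 2 ^ n.+1) (2 ^ n)%:R^-1)).
 apply: ler_sum_nat => m /andP[h _].
 have p0 : (0 < 2 ^ n)%N by rewrite expn_gt0.
 by rewrite lef_pV2 ?posrE ?ltr0n ?ler_nat // (leq_trans p0).
by rewrite sumr_const_nat expnS mul2n -addnn addnK -[_ *+ _]mulr_natr mulVf // pnatr_eq0 expn_eq0.
Qed.

(** The multiples of [d >= 2 ^ i] below [2 ^ J] are [d * m] with [m < 2 ^ (J - i)], and the harmonic
    sum over such [m] is at most [J - i]. *)
Lemma om_le J i d : (i <= J)%N -> (2 ^ i <= d)%N -> om (2 ^ J) d <= (J - i)%:R / d%:R.
Proof.
move=> iJ di; have d0 : (0 < d)%N by apply: leq_trans di; rewrite expn_gt0.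
apply: (@le_trans _ _ (\sum_(0 <= q < 2 ^ (J - i) * d | (d %| q)%N) q%:R^-1)).
 have le : (2 ^ J <= 2 ^ (J - i) * d)%N by rewrite -{1}(subnK iJ) expnD leq_mul2l di orbT.
 rewrite /om [leRHS](big_cat_nat _ (n := (2 ^ J)%N)) //=.
 have J1 : (1 <= 2 ^ J)%N by rewrite expn_gt0.
 rewrite [X in _ <= X + _](big_cat_nat _ (n := 1%N)) //= -addrA addrCA lerDl.
 by rewrite addr_ge0 // sumr_ge0 // => q _; rewrite invr_ge0 ler0n.
rewrite sum_multiples //; under eq_bigr do rewrite natrM invfM.
rewrite -mulr_suml ler_wpM2r //; exact: sum_harmonic_dyadic.
Qed.

Lemma sum_dyadic (f : nat -> R) j0 J : (j0 <= J)%N ->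
 \sum_(2 ^ j0 <= d < 2 ^ J) f d = \sum_(j0 <= i < J) \sum_(2 ^ i <= d < 2 ^ i.+1) f d.
Proof.
elim: J => [|J IH]; first by rewrite leqn0 => /eqP ->; rewrite !big_geq.
rewrite leq_eqVlt => /orP[/eqP ->|]; first by rewrite !big_geq.
rewrite ltnS => h; rewrite [RHS]big_nat_recr //= -IH //.
by rewrite (big_cat_nat _ (n := (2 ^ J)%N)) //= leq_exp2l.
Qed.

Lemma sum_geo_down (J : nat) : \sum_(0 <= i < J) (J - i)%:R * 2 ^+ i <= 2 * 2 ^+ J :> R.
Proof.
suff h : \sum_(0 <= i < J) (J - i)%:R * 2 ^+ i = 2 * 2 ^+ J - J%:R - 2 :> R.
 by rewrite h; have := ler0n R J; lra.
elim: J => [|J IH]; first by rewrite big_geq // expr0; ring.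
have g n : \sum_(0 <= i < n) 2 ^+ i = 2 ^+ n - 1 :> R.
 elim: n => [|n IHn]; first by rewrite big_geq // expr0 subrr.
 by rewrite big_nat_recr //= IHn exprS; ring.
have -> : \sum_(0 <= i < J.+1) (J.+1 - i)%:R * 2 ^+ i = \sum_(0 <= i < J.+1) (J - i)%:R * 2 ^+ i +
  \sum_(0 <= i < J.+1) 2 ^+ i :> R.
 rewrite -big_split /=; apply: eq_big_nat => j /andP[_ jJ].
 by rewrite subSn // -natr1 mulrDl mul1r.
by rewrite big_nat_recr //= subnn mul0r addr0 IH g -natr1 exprS; ring.
Qed.

Lemma sum_geo_tail j0 J : \sum_(j0 <= i < J) (2 ^+ i)^-1 <= 2 / 2 ^+ j0 :> R.
Proof.
have [jJ|jJ] := leqP j0 J; last by rewrite big_geq // ltnW.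
suff h : \sum_(j0 <= i < J) (2 ^+ i)^-1 = 2 / 2 ^+ j0 - 2 / 2 ^+ J :> R.
 by rewrite h gerBl divr_ge0.
have := telescope_sumr (fun i => - (2 / 2 ^+ i) : R) jJ; rewrite opprK [RHS]addrC => <-.
apply: eq_bigr => k _; rewrite exprS; field.
by [].
Qed.

Lemma sum_SI_sieve u v D : (0 < D)%N -> (u <= v)%N ->
 \sum_(1 <= d < D.+1) \sum_(0 <= b < d | coprime b d) normc (SI u v (b%:R / d%:R)) ^+ 2 <=
 44 * ((v - u) + D ^ 2)%:R * \sum_(u.+1 <= p < v.+1 | prime p) lnn p ^+ 2.
Proof.
move=> D0 uv; pose a n : R := if prime (n + u.+1) then lnn (n + u.+1) else 0.
have := large_sieve (v - u) a u.+1 D0.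
have e1 : \sum_(0 <= n < v - u) a n ^+ 2 = \sum_(u.+1 <= p < v.+1 | prime p) lnn p ^+ 2.
 rewrite -{1}[u.+1]add0n big_addn subSS [RHS]big_mkcond; apply: eq_bigr => n _.
 by rewrite /a; case: ifP => // _; rewrite expr0n.
rewrite e1; apply: le_trans; apply: ler_sum => d _; apply: ler_sum => b _.
suff -> : SI u v (b%:R / d%:R) = \sum_(0 <= n < v - u) (a n)%:C%C * ep ((u.+1 + n)%:R * (b%:R / d%:R)) by [].
rewrite /SI -{1}[u.+1]add0n big_addn subSS big_mkcond; apply: eq_bigr => n _.
by rewrite /a addnC; case: ifP => // _; rewrite mul0r.
Qed.

Lemma sum_model_dyadic (H : R) i : \sum_(2 ^ i <= d < 2 ^ i.+1) H ^+ 2 / (totient d)%:R <= H ^+ 2 * i.+1%:R.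
Proof.
rewrite -mulr_sumr ler_wpM2l ?sqr_ge0 //.
have p0 : (0 < 2 ^ i)%N by rewrite expn_gt0.
apply: (@le_trans _ _ (\sum_(2 ^ i <= d < 2 ^ i.+1) i.+1%:R / (2 ^ i)%:R)).
 apply: ler_sum_nat => d /andP[h1 h2].
 have d0 := leq_trans p0 h1.
 rewrite -[leLHS]mul1r ler_pdivrMr ?ltr0n ?totient_gt0 // mulrAC ler_pdivlMr // mul1r -natrM ler_nat.
 apply: (leq_trans h1); apply: leq_trans (totient_lower d0) _.
 rewrite leq_mul2r; apply/orP; right; rewrite ltnS -ltnS -(ltn_exp2l _ _ (ltnSn 1)).
 by apply: leq_ltn_trans h2; exact: trunc_logP.
by rewrite sumr_const_nat expnS mul2n -addnn addnK -[_ *+ _]mulr_natr divfK // pnatr_eq0 -lt0n.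
Qed.

(** Ramanujan sums at units are at most 1 in norm, so the model has norm at most [h / totient d] at
    each of [totient d] frequencies; one factor [1 / totient d] survives. *)
Lemma beta_le u v d : (0 < d)%N -> beta u v d <=
 2 * \sum_(0 <= b < d | coprime b d) normc (SI u v (b%:R / d%:R)) ^+ 2 + 2 * ((v - u)%:R ^+ 2 / (totient d)%:R).
Proof.
move=> d0; have t0 : 0 < ((totient d)%:R : R) by rewrite ltr0n totient_gt0.
set h : R := (v - u)%:R.
apply: (@le_trans _ _ (\sum_(0 <= b < d | coprime b d)
  (2 * normc (SI u v (b%:R / d%:R)) ^+ 2 + 2 * (h / (totient d)%:R) ^+ 2))).
 apply: ler_sum => b bd; rewrite /XI; set s := SI _ _ _.
 have m1 : normc ((v - u)%:R * (ramanujan R d b / (totient d)%:R)) <= h / (totient d)%:R.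
  rewrite normcM normc_nat normcM -/h ler_wpM2l // -[leRHS]mul1r.
  have -> : normc ((totient d)%:R^-1 : C) = (totient d)%:R^-1.
   by rewrite -realc_nat -realcV normcR_ge0 // invr_ge0 ltW.
  by rewrite ler_wpM2r // ramanujan_norm.
 have n1 := normcB_le s ((v - u)%:R * (ramanujan R d b / (totient d)%:R)).
 have n2 := le_trans n1 (lerD (lexx _) m1).
 have n0 := normc_ge0 (s - (v - u)%:R * (ramanujan R d b / (totient d)%:R)).
 move: n0 n2; set y := normc _; set z := normc s; set w := h / _ => n0 n2.
 have zw : 0 <= z + w by lra.
 have := lerXn2r 2 n0 zw n2; have := sqr_ge0 (z - w); nra.
rewrite big_split mulr_sumr lerD2l sum_units_const; apply: eq_lew.
by field; rewrite lt0r_neq0.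
Qed.

(** On [2 ^ i <= d < 2 ^ i.+1] the weight is at most [(J - i) / 2 ^ i], and the large sieve costs
    [H + 4 * 4 ^ i] up to its constant. The factor [J - i], instead of [J], keeps the term [2 ^ J]
    free of a logarithm, since the sum of [(J - i) * 2 ^ i] is at most [2 * 2 ^ J]. *)
Lemma block_large u v j0 J : (u <= v)%N ->
 \sum_(2 ^ j0 <= d < 2 ^ J) om (2 ^ J) d * beta u v d <=
 88 * (\sum_(u.+1 <= p < v.+1 | prime p) lnn p ^+ 2) * (2 * J%:R * (v - u)%:R / 2 ^+ j0 + 8 * 2 ^+ J) +
 4 * (v - u)%:R ^+ 2 * J%:R ^+ 2 / 2 ^+ j0.
Proof.
move=> uv; have [Z ZE] := ex_named (\sum_(u.+1 <= p < v.+1 | prime p) lnn p ^+ 2 : R).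
have [H HE] := ex_named ((v - u)%:R : R).
rewrite -ZE -HE; have Z0 : 0 <= Z by rewrite ZE sumr_ge0 // => p _; exact: sqr_ge0.
have H0 : 0 <= H by rewrite HE ler0n.
have [jJ|Jj] := leqP j0 J; last first.
 rewrite big_geq; last by rewrite leq_exp2l // ltnW.
 by rewrite addr_ge0 ?mulr_ge0 ?addr_ge0 ?mulr_ge0.
rewrite sum_dyadic //.
apply: (@le_trans _ _ (\sum_(j0 <= i < J) (J - i)%:R / 2 ^+ i *
  (88 * (H + 4 * (2 ^+ i) ^+ 2) * Z + 2 * (H ^+ 2 * J%:R)))).
 apply: ler_sum_nat => i /andP[_ iJ].
 have p0 : (0 < 2 ^ i)%N by rewrite expn_gt0.
 apply: (@le_trans _ _ ((J - i)%:R / 2 ^+ i * \sum_(2 ^ i <= d < 2 ^ i.+1) beta u v d)).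
  rewrite mulr_sumr; apply: ler_sum_nat => d /andP[d1 _].
  rewrite ler_wpM2r ?beta_ge0 //; apply: le_trans (om_le (ltnW iJ) d1) _.
  by rewrite ler_wpM2l // -natrX lef_pV2 ?posrE ?ltr0n ?ler_nat // (leq_trans p0).
 rewrite ler_wpM2l //.
 apply: (@le_trans _ _ (\sum_(2 ^ i <= d < 2 ^ i.+1) (2 * (\sum_(0 <= b < d | coprime b d)
   normc (SI u v (b%:R / d%:R)) ^+ 2) + 2 * (H ^+ 2 / (totient d)%:R)))).
  apply: ler_sum_nat => d /andP[d1 _].
  by rewrite HE; apply: beta_le; exact: leq_trans d1.
 rewrite big_split -!mulr_sumr; apply: lerD; last first.
  rewrite ler_wpM2l // mulr_sumr (le_trans (sum_model_dyadic _ _)) // ler_wpM2l ?sqr_ge0 // ler_nat //.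
 have D0 : (0 < 2 ^ i.+1)%N by rewrite expn_gt0.
 have := sum_SI_sieve D0 uv; rewrite -ZE natrD -HE.
 have -> : ((2 ^ i.+1) ^ 2)%:R = 4 * (2 ^+ i) ^+ 2 :> R by rewrite (expnS 2 i) natrX natrM natrX; ring.
 move=> h; have -> : 88 * (H + 4 * (2 ^+ i) ^+ 2) * Z = 2 * (44 * (H + 4 * (2 ^+ i) ^+ 2) * Z) by ring.
 rewrite ler_wpM2l //; apply: le_trans h.
 rewrite [leRHS](big_cat_nat _ (n := (2 ^ i)%N)) //=; last by rewrite leqW // leq_exp2l.
 rewrite [X in _ <= _ + X](big_cat_nat _ (n := (2 ^ i.+1)%N)) ?leq_exp2l //= addrCA lerDl.
 by rewrite addr_ge0 // sumr_ge0 // => d _; rewrite sumr_ge0 // => b _; rewrite exprn_ge0 ?normc_ge0.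
have e i : (J - i)%:R / 2 ^+ i * (88 * (H + 4 * (2 ^+ i) ^+ 2) * Z + 2 * (H ^+ 2 * J%:R)) =
  (88 * H * Z + 2 * (H ^+ 2 * J%:R)) * ((J - i)%:R / 2 ^+ i) + 352 * Z * ((J - i)%:R * 2 ^+ i) :> R.
 by field; rewrite expf_neq0.
under eq_bigr do rewrite e.
rewrite big_split /= -!mulr_sumr.
have g1 : \sum_(j0 <= i < J) (J - i)%:R / 2 ^+ i <= J%:R * (2 / 2 ^+ j0) :> R.
 apply: (@le_trans _ _ (\sum_(j0 <= i < J) J%:R * (2 ^+ i)^-1)).
  by apply: ler_sum => i _; rewrite ler_wpM2r // ler_nat leq_subr.
 by rewrite -mulr_sumr ler_wpM2l // sum_geo_tail.
have g2 : \sum_(j0 <= i < J) (J - i)%:R * 2 ^+ i <= 2 * 2 ^+ J :> R.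
 apply: le_trans (sum_geo_down J); rewrite [leRHS](big_cat_nat _ (n := j0)) //= lerDr.
 by apply: sumr_ge0 => i _; rewrite mulr_ge0.
have c1 : 0 <= 88 * H * Z + 2 * (H ^+ 2 * J%:R) by rewrite addr_ge0 ?mulr_ge0 ?ler0n.
have c2 : 0 <= 352 * Z by exact: mulr_ge0 (ler0n _ _) Z0.
apply: le_trans (lerD (ler_wpM2l c1 g1) (ler_wpM2l c2 g2)) _.
apply: eq_lew; ring.
Qed.

End Block.

(** * All blocks of one level *)

Section Level.
Variable R : realType.
Local Notation C := R[i].

(** [XI] is the Fourier transform of the errors in the classes modulo [d]. For a unit class the
    error is bounded by [theta_AP]; a class of non-units contains only primes dividing [d]. The
    trivial bound over at most [ln x ^ m] classes is then enough. *)
Lemma beta_small (m D : nat) : exists2 K : R, 0 < K & forall (x : R) (d u v : nat), 1 <= ln x ->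
 (0 < d)%N -> d%:R <= ln x ^+ m -> (u <= v)%N -> v%:R <= x ->
 beta R u v d <= K * d%:R * (ln x ^+ m * (x / ln x ^+ D)) ^+ 2.
Proof.
have [K K0 h] := theta_AP R m D; pose K3 : R := (m.+1 + D)%:R ^+ (m.+1 + D).
have K30 : 0 <= K3 by rewrite exprn_ge0.
exists ((2 * K + K3) ^+ 2) => [|x d u v L1 d0 dL uv vx]; first by rewrite exprn_gt0 // ltr_wpDr // mulr_gt0.
have L0 := ge1_gt0 L1.
have x0 := ln_ge1_gt0 L1.
have [X XE] := ex_named (x / ln x ^+ D).
have X0 : 0 <= X by rewrite XE divr_ge0 ?exprn_ge0 // ltW.
rewrite -XE; have Kn : 0 <= 2 * K + K3 by lra.
have ux : u%:R <= x by apply: le_trans vx; rewrite ler_nat.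
pose A a : R := \sum_(u.+1 <= p < v.+1 | prime p && (p == a %[mod d])%N) lnn p.
pose G a : R := A a - (if coprime a d then (v - u)%:R / (totient d)%:R else 0).
have Gb a : `|G a| <= (2 * K + K3) * X.
 rewrite mulrDl /G; case: ifP => ca.
  have e : A a - (v - u)%:R / (totient d)%:R =
    (\sum_(1 <= p < v.+1 | prime p && (p == a %[mod d])%N) lnn p - v%:R / (totient d)%:R) -
    (\sum_(1 <= p < u.+1 | prime p && (p == a %[mod d])%N) lnn p - u%:R / (totient d)%:R).
   by rewrite /A -sum_nat_shift // natrB // mulrBl; ring.
  rewrite e; apply: le_trans (ler_normB _ _) _; rewrite -[leLHS]addr0 lerD ?mulr_ge0 //.
  have -> : 2 * K * X = K * X + K * X by ring.
  by rewrite XE lerD //; exact: h.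
 rewrite subr0 ger0_norm; last by apply: sumr_ge0 => p _; exact: lnn_ge0.
 rewrite -[leLHS]add0r lerD //; first by rewrite !mulr_ge0 // ltW.
 apply: (@le_trans _ _ (\sum_(1 <= n < v.+1) Lam R n * (~~ coprime n d)%:R)).
  rewrite [leRHS](big_cat_nat _ (n := u.+1)) //= -[leLHS]add0r lerD //.
   by apply: sumr_ge0 => n _; rewrite mulr_ge0 ?Lam_ge0.
  rewrite /A big_mkcond; apply: ler_sum => n _; case: ifP => [/andP[pn /eqP e]|_].
   by rewrite -coprime_modl e coprime_modl ca mulr1 Lam_prime.
  by rewrite mulr_ge0 ?Lam_ge0.
 apply: le_trans (sum_Lam_noncoprime R v d0) _.
 have Ly := lnn_le_ln L1 vx.
 rewrite XE mulrA ler_pdivlMr ?exprn_gt0 //; apply: le_trans (ln_pow_le (m.+1 + D) L1).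
 by rewrite exprD ler_wpM2r ?exprn_ge0 ?(ltW L0) // exprSr ler_pM ?lnn_ge0.
have Xb b : normc (XI R u v d b) <= ln x ^+ m * ((2 * K + K3) * X).
 have -> : XI R u v d b = \sum_(0 <= a < d) (G a)%:C%C * ep (a%:R * b%:R / d%:R).
  rewrite /XI fourier_block // /ramanujan; congr (_ - _ * (_ / _)).
  by apply: eq_bigr => a _; rewrite mulrA.
 apply: le_trans (normc_sum _ _ _) _.
 apply: (@le_trans _ _ (\sum_(0 <= a < d) (2 * K + K3) * X)).
  by apply: ler_sum => a _; rewrite normcM normc_ep mulr1 normcR.
 rewrite sumr_const_nat subn0 -[_ *+ _]mulr_natl ler_wpM2r // mulr_ge0 //.
apply: (@le_trans _ _ (\sum_(0 <= b < d) (ln x ^+ m * ((2 * K + K3) * X)) ^+ 2)).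
 rewrite /beta big_mkcond; apply: ler_sum => b _; case: ifP => _; last exact: sqr_ge0.
 by rewrite lerXn2r ?nnegrE ?normc_ge0 ?mulr_ge0 ?exprn_ge0 ?(ltW L0).
rewrite sumr_const_nat subn0 -[_ *+ _]mulr_natl le_eqVlt; apply/orP; left; apply/eqP; ring.
Qed.

Lemma sum_small_moduli (m D : nat) : exists2 K : R, 0 < K & forall (x : R) (j0 J u v : nat), 1 <= ln x ->
 2 ^+ j0 <= ln x ^+ m -> (u <= v)%N -> v%:R <= x ->
 \sum_(1 <= d < 2 ^ j0) om R (2 ^ J) d * beta R u v d <= K * J%:R * ln x ^+ m * (ln x ^+ m * (x / ln x ^+ D)) ^+ 2.
Proof.
have [K K0 h] := beta_small m D; exists K => // x j0 J u v L1 jL uv vx.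
set Y := (ln x ^+ m * _) ^+ 2.
have Y0 : 0 <= Y by exact: sqr_ge0.
apply: (@le_trans _ _ (\sum_(1 <= d < 2 ^ j0) K * J%:R * Y)).
 apply: ler_sum_nat => d /andP[d0 dj].
 have dL : d%:R <= ln x ^+ m by apply: le_trans jL; rewrite -natrX ler_nat ltnW.
 have d0R : 0 < (d%:R : R) by rewrite ltr0n.
 have o : om R (2 ^ J) d <= J%:R / d%:R by have := @om_le R J 0 d (leq0n _) d0; rewrite subn0.
 apply: le_trans (ler_pM (om_ge0 _ _ _) (beta_ge0 _ _ _ _) o (h x d u v L1 d0 dL uv vx)) _.
 by rewrite -/Y le_eqVlt; apply/orP; left; apply/eqP; field; rewrite lt0r_neq0.
rewrite sumr_const_nat -[_ *+ _]mulr_natl.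
have -> : K * J%:R * ln x ^+ m * Y = ln x ^+ m * (K * J%:R * Y) by ring.
have c0 : 0 <= K * J%:R * Y by exact: mulr_ge0 (mulr_ge0 (ltW K0) (ler0n _ _)) Y0.
rewrite ler_wpM2r //; apply: le_trans jL.
by rewrite -natrX ler_nat leq_subr.
Qed.

(** The blocks are disjoint, so their sums of [ln p ^ 2] add up to at most [sql R N]. The bound [B]
    for small denominators is multiplied by the number of blocks, which is why it can only be
    afforded for long ones. *)
Lemma level_bound N k J j0 (B : R) :
 (forall u v, (u <= v)%N -> (v <= N)%N -> \sum_(1 <= d < 2 ^ j0) om R (2 ^ J) d * beta R u v d <= B) ->
 \sum_(1 <= q < 2 ^ J) \sum_(0 <= a < q | coprime a q) \sum_(0 <= j < N %/ 2 ^ k)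
  (TT R q a (2 ^ k * j.+1) - TT R q a (2 ^ k * j)) ^+ 2 <=
 (N %/ 2 ^ k)%:R * B + 88 * sql R N * (2 * J%:R * 2 ^+ k / 2 ^+ j0 + 8 * 2 ^+ J) +
 4 * N%:R * 2 ^+ k * J%:R ^+ 2 / 2 ^+ j0.
Proof.
move=> hB; set M := (N %/ 2 ^ k)%N; have MN : (2 ^ k * M <= N)%N by rewrite mulnC leq_trunc_div.
pose Z j : R := \sum_((2 ^ k * j).+1 <= p < (2 ^ k * j.+1).+1 | prime p) lnn p ^+ 2.
have hw j : (2 ^ k * j.+1 - 2 ^ k * j = 2 ^ k)%N by rewrite mulnS addnK.
apply: (@le_trans _ _ (\sum_(0 <= j < M) (B + (88 * Z j * (2 * J%:R * 2 ^+ k / 2 ^+ j0 + 8 * 2 ^+ J) +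
  4 * (2 ^+ k) ^+ 2 * J%:R ^+ 2 / 2 ^+ j0)))).
 apply: (@le_trans _ _ (\sum_(0 <= j < M) \sum_(1 <= q < 2 ^ J) \sum_(0 <= a < q | coprime a q)
   (TT R q a (2 ^ k * j.+1) - TT R q a (2 ^ k * j)) ^+ 2)).
  by rewrite [leRHS]exchange_big; apply: ler_sum => q _; rewrite exchange_big.
 apply: ler_sum_nat => j /andP[_ jM].
 have uv : (2 ^ k * j <= 2 ^ k * j.+1)%N by rewrite leq_mul2l leqnSn orbT.
 have vN : (2 ^ k * j.+1 <= N)%N by apply: leq_trans MN; rewrite leq_mul2l jM orbT.
 apply: (@le_trans _ _ (\sum_(1 <= q < 2 ^ J) q%:R^-1 * \sum_(1 <= d < q.+1 | (d %| q)%N)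
   beta R (2 ^ k * j) (2 ^ k * j.+1) d)).
  apply: ler_sum_nat => q /andP[q0 _].
  exact: block_plancherel.
 rewrite sum_om.
 apply: (@le_trans _ _ (\sum_(1 <= d < 2 ^ j0) om R (2 ^ J) d * beta R (2 ^ k * j) (2 ^ k * j.+1) d +
   \sum_(2 ^ j0 <= d < 2 ^ J) om R (2 ^ J) d * beta R (2 ^ k * j) (2 ^ k * j.+1) d)).
  have f0 d : 0 <= om R (2 ^ J) d * beta R (2 ^ k * j) (2 ^ k * j.+1) d.
   by rewrite mulr_ge0 ?om_ge0 ?beta_ge0.
  have j1 : (1 <= 2 ^ j0)%N by rewrite expn_gt0.
  have [jJ|Jj] := leqP (2 ^ j0) (2 ^ J).
   by rewrite [leLHS](big_cat_nat _ (n := (2 ^ j0)%N)).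
  rewrite [X in _ <= _ + X]big_geq ?addr0; last exact: ltnW.
  rewrite [leRHS](big_cat_nat _ (n := (2 ^ J)%N)) ?expn_gt0 //=; last exact: ltnW.
  by rewrite lerDl sumr_ge0.
 apply: lerD; first exact: hB.
 apply: le_trans (block_large R j0 J uv) _; rewrite hw natrX -/(Z j) //.
rewrite big_split big_split /= -!mulr_sumr -mulr_suml !sumr_const_nat !subn0 -addrA.
rewrite -[B *+ _]mulr_natl lerD2l; apply: lerD.
 rewrite -mulr_sumr ler_wpM2r // ler_wpM2l ?ler0n //.
 have sz n : \sum_(0 <= j < n) Z j = sql R (2 ^ k * n)%N.
  elim: n => [|n IH]; first by rewrite muln0 big_geq // /sql big_geq.
  rewrite big_nat_recr //= IH /Z -sum_nat_shift; last by rewrite leq_mul2l leqnSn orbT.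
  by rewrite /sql addrC subrK.
 rewrite sz -subr_ge0 sum_nat_shift //; apply: sumr_ge0 => p _; exact: sqr_ge0.
have -> : 4 * 2 ^+ k ^+ 2 * J%:R ^+ 2 * (2 ^- j0 *+ M) = 4 * ((2 ^ k * M)%:R) * 2 ^+ k * J%:R ^+ 2 / 2 ^+ j0 :> R.
 by rewrite natrM natrX -[_ *+ M]mulr_natl; ring.
rewrite ler_wpM2r // ler_wpM2r // ler_wpM2r //.
by rewrite ler_wpM2l // ler_nat.
Qed.

End Level.

(** * Geometric sums for the weights *)

Section Geometric.
Variable R : realType.

Lemma exists_root2 (m : nat) : (1 < m)%N -> exists r : R, [/\ 1 < r, r <= 3 / 2 & r ^+ m = 2].
Proof.
move=> m1; have m0 : 0 < (m%:R : R) by rewrite ltr0n ltnW.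
have [r rE] := ex_named (2 `^ (m%:R^-1) : R).
have r0 : 0 <= r by rewrite rE powR_ge0.
have rm : r ^+ m = 2 by rewrite rE -powR_mulrn // -powRrM mulVf ?lt0r_neq0 // powRr1.
have r1 : 1 < r.
 rewrite ltNge; apply/negP => h; have := exprn_ile1 m r0 h; rewrite rm.
 lra.
exists r; split=> //; rewrite leNgt; apply/negP => h.
have : r ^+ 2 <= r ^+ m by rewrite ler_weXn2l // ltW.
by rewrite rm; nra.
Qed.

Variables (r : R) (r1 : 1 < r) (r32 : r <= 3 / 2).

Let r0 : 0 < r. Proof. exact: lt_trans r1. Qed.

(** The induction step is [8 r <= 12]; this ties the constant 6 to [r <= 3/2]. *)
Lemma sum_geo_mix n : \sum_(0 <= k < n) r ^+ (n - k) * 2 ^+ k <= 6 * 2 ^+ n.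
Proof.
elim: n => [|n IH]; first by rewrite big_geq // mulr_ge0 exprn_ge0.
rewrite big_nat_recr //= subSn // subnn expr1.
have -> : \sum_(0 <= k < n) r ^+ (n.+1 - k) * 2 ^+ k = r * \sum_(0 <= k < n) r ^+ (n - k) * 2 ^+ k.
 rewrite mulr_sumr; apply: eq_big_nat => k /andP[_ kn]; rewrite subSn; last exact: ltnW.
 by rewrite exprS mulrA.
have p0 : 0 <= 2 ^+ n :> R by [].
have := ler_wpM2l (ltW r0) IH; have := ler_wpM2r p0 r32; rewrite exprS; lra.
Qed.

Lemma sum_geo_pos n : \sum_(0 <= k < n) r ^+ (n - k) <= r / (r - 1) * r ^+ n.
Proof.
suff -> : \sum_(0 <= k < n) r ^+ (n - k) = r / (r - 1) * (r ^+ n - 1).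
 have g0 : 0 <= r / (r - 1) by rewrite divr_ge0 ?subr_ge0 ?(ltW r0) ?(ltW r1).
 by lra.
have n1 : r - 1 != 0 by rewrite subr_eq0 gt_eqF.
elim: n => [|n IH]; first by rewrite big_geq // expr0 subrr mulr0.
rewrite big_nat_recr //= subSn // subnn expr1.
have -> : \sum_(0 <= k < n) r ^+ (n.+1 - k) = r * \sum_(0 <= k < n) r ^+ (n - k).
 rewrite mulr_sumr; apply: eq_big_nat => k /andP[_ kn]; rewrite subSn; last exact: ltnW.
 by rewrite exprS.
by rewrite IH exprS; field.
Qed.

Lemma sum_geo_inv n : \sum_(0 <= k < n) (r ^+ (n - k))^-1 <= (r - 1)^-1.
Proof.
have n1 : 0 < r - 1 by rewrite subr_gt0.
elim: n => [|n IH]; first by rewrite big_geq // invr_ge0 ltW.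
rewrite big_nat_recr //= subSn // subnn expr1.
have -> : \sum_(0 <= k < n) (r ^+ (n.+1 - k))^-1 = r^-1 * \sum_(0 <= k < n) (r ^+ (n - k))^-1.
 rewrite mulr_sumr; apply: eq_big_nat => k /andP[_ kn]; rewrite subSn; last exact: ltnW.
 by rewrite exprS invfM.
have ri : 0 <= r^-1 by rewrite invr_ge0 ltW.
apply: (@le_trans _ _ (r^-1 * (r - 1)^-1 + r^-1)); first by rewrite lerD2r ler_wpM2l.
by apply: eq_lew; field; rewrite !lt0r_neq0.
Qed.

Lemma sum_geo_shift a K : (a <= K)%N -> \sum_(a <= k < K) r ^+ (K - k) <= r / (r - 1) * r ^+ (K - a).
Proof.
move=> aK; apply: le_trans (sum_geo_pos (K - a)); rewrite -{1}[a]add0n big_addn.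
by apply: eq_lew; apply: eq_bigr => k _; rewrite subnDA subnAC.
Qed.

Lemma sum_geo_mix_shift a K : (a <= K)%N ->
 \sum_(0 <= k < a) r ^+ (K - k) * 2 ^+ k <= 6 * r ^+ (K - a) * 2 ^+ a.
Proof.
move=> aK; have p0 : 0 <= r ^+ (K - a) by rewrite exprn_ge0 // ltW.
have := ler_wpM2l p0 (sum_geo_mix a); rewrite mulrCA mulrA; apply: le_trans.
rewrite mulr_sumr; apply: ler_sum_nat => k /andP[_ ka].
by rewrite mulrA -exprD addnBA ?subnK // ltnW.
Qed.

End Geometric.

(** * The levels for one modulus and for all moduli *)

Section Final.
Variable R : realType.

Lemma exists_pow2 (y : R) : 1 <= y -> exists j, 2 ^+ j <= y < 2 ^+ j.+1.
Proof.
move=> y1; have y0 : 0 <= y by lra.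
have /andP[h1 h2] := truncn_itv y0.
have t0 : (0 < Num.truncn y)%N by rewrite -ltnS -(ltr_nat R); exact: le_lt_trans h2.
exists (trunc_log 2 (Num.truncn y)); apply/andP; split.
 by apply: le_trans h1; rewrite -natrX ler_nat trunc_logP.
by apply: lt_le_trans h2 _; rewrite -natrX ler_nat trunc_log_ltn.
Qed.

Lemma trunc_log_le_ln (x : R) N : 1 <= ln x -> (0 < N)%N -> N%:R <= x -> (trunc_log 2 N).+1%:R <= 3 * ln x.
Proof.
move=> L1 N0 Nx; have x0 : 0 < x by apply: lt_le_trans Nx; rewrite ltr0n.
have h : (trunc_log 2 N)%:R * ln 2 <= ln x.
 rewrite mulr_natl -lnXn // ler_ln ?posrE //; apply: le_trans Nx.
 by rewrite -natrX ler_nat trunc_logP.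
have l2 : 1 / 2 <= ln 2 := lnn2_ge R; rewrite -natr1; have t0 := ler0n R (trunc_log 2 N).
by have := ler_wpM2l t0 l2; lra.
Qed.

Lemma sql_le : exists2 c : R, 0 < c & forall x N, 1 <= ln x -> N%:R <= x -> sql R N <= c * x * ln x.
Proof.
have [c c0 h] := theta_chebyshev R; exists c => // x N L1 Nx; have L0 := ge1_gt0 L1.
apply: le_trans (ler_wpM2r (ltW L0) (h x N L1 Nx)); rewrite mulr_suml /sql.
rewrite big_nat_cond [leRHS]big_nat_cond; apply: ler_sum => p /andP[/andP[p0 pN] _].
rewrite expr2 ler_wpM2l ?lnn_ge0 // /lnn ler_ln ?posrE ?ltr0n //.
 by apply: le_trans Nx; rewrite ler_nat.
by apply: lt_le_trans Nx; rewrite ltr0n (leq_trans p0).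
Qed.

Definition Uk (N k q : nat) : R := \sum_(0 <= a < q | coprime a q) \sum_(0 <= j < N %/ 2 ^ k)
 (TT R q a (2 ^ k * j.+1) - TT R q a (2 ^ k * j)) ^+ 2.

Lemma Uk_ge0 N k q : 0 <= Uk N k q.
Proof. by apply: sumr_ge0 => a _; apply: sumr_ge0 => j _; exact: sqr_ge0. Qed.

(** At level [k] only moduli with [trunc_log 2 q] at most [k] and at most [kQ] occur, since shorter
    blocks belong to the trivial part; they all lie below [2 ^ Jk kQ k]. *)
Definition Jk (kQ k : nat) : nat := (minn k kQ).+1.

Lemma pairs_bound_sum (r : R) q cs N K : 1 < r -> (0 < q)%N -> (trunc_log 2 q <= K)%N -> (N < 2 ^ K)%N ->
 path ltn 0%N cs -> last 0%N cs = N ->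
 \sum_(0 <= a < q | coprime a q) \sum_(p <- pairs 0 cs) (TT R q a p.2 - TT R q a p.1) ^+ 2 <=
 8 * Psi R q N + 8 / (r - 1) * \sum_(trunc_log 2 q <= k < K) r ^+ (K - k) * Uk N k q.
Proof.
move=> r1 q0 qK NK hp hl; have r0 := lt_trans ltr01 r1.
have wc : \sum_(trunc_log 2 q <= k < K) (r ^+ (K - k))^-1 <= (r - 1)^-1.
 apply: le_trans (sum_geo_inv r1 K); rewrite [leRHS](big_cat_nat _ (n := trunc_log 2 q)) //= lerDr.
 by apply: sumr_ge0 => k _; rewrite invr_ge0 exprn_ge0 // ltW.
have w0 k : 0 < r ^+ (K - k) by rewrite exprn_gt0.
apply: (@le_trans _ _ (\sum_(0 <= a < q | coprime a q) (2 * (\sum_(p <- pairs 0 cs)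
  ((TT R q a p.2 - TT R q a (flr (trunc_log 2 q) p.2)) - (TT R q a p.1 - TT R q a (flr (trunc_log 2 q) p.1))) ^+ 2) +
  8 / (r - 1) * \sum_(trunc_log 2 q <= k < K) r ^+ (K - k) * \sum_(0 <= j < N %/ 2 ^ k)
  (TT R q a (2 ^ k * j.+1) - TT R q a (2 ^ k * j)) ^+ 2))).
 by apply: ler_sum => a _; exact: (chaining (TT R q a) w0 qK NK hp hl wc).
rewrite big_split -!mulr_sumr; apply: lerD.
 have := short_total R q0 hp hl; lra.
have c0 : 0 <= 8 / (r - 1) by rewrite divr_ge0 // subr_ge0 ltW.
rewrite ler_wpM2l // exchange_big /=; apply: ler_sum => k _.
by rewrite -mulr_sumr.
Qed.

(** Exchanging the summations gives each level a complete range of moduli below a power of two, the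
    form that [level_bound] requires. *)
Lemma sum_levels (r : R) N K Q : 1 < r -> (0 < Q)%N ->
 \sum_(1 <= q < Q.+1) \sum_(trunc_log 2 q <= k < K) r ^+ (K - k) * Uk N k q <=
 \sum_(0 <= k < K) r ^+ (K - k) * \sum_(1 <= q < 2 ^ Jk (trunc_log 2 Q) k) Uk N k q.
Proof.
move=> r1 Q0; have r0 := lt_trans ltr01 r1.
have w0 k : 0 <= r ^+ (K - k) by rewrite exprn_ge0 // ltW.
apply: (@le_trans _ _ (\sum_(1 <= q < Q.+1) \sum_(0 <= k < K)
  (if (trunc_log 2 q <= k)%N then r ^+ (K - k) * Uk N k q else 0))).
 apply: ler_sum => q _; rewrite -big_mkcond /=; have [qK|qK] := leqP (trunc_log 2 q) K.
  rewrite [leRHS](big_cat_nat _ (n := trunc_log 2 q)) //= -[leLHS]add0r lerD //.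
   by apply: sumr_ge0 => k _; rewrite mulr_ge0 ?Uk_ge0.
  by rewrite big_nat_cond [leRHS]big_nat_cond le_eqVlt; apply/orP; left; apply/eqP;
   apply: eq_bigl => k; case: (trunc_log 2 q <= k)%N; rewrite ?andbT.
 rewrite big_geq; last exact: ltnW.
 by apply: sumr_ge0 => k _; rewrite mulr_ge0 ?Uk_ge0.
rewrite exchange_big; apply: ler_sum => k _; rewrite -big_mkcond -mulr_sumr ler_wpM2l //=.
have le : (\sum_(1 <= q < Q.+1 | (trunc_log 2 q <= k)%N) Uk N k q <=
  \sum_(1 <= q < (Q + 2 ^ Jk (trunc_log 2 Q) k).+1 | (q < 2 ^ Jk (trunc_log 2 Q) k)%N) Uk N k q).
 rewrite [leRHS](big_cat_nat _ (n := Q.+1)) ?leq_addr //= -[leLHS]addr0 lerD //; last first.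
  by apply: sumr_ge0 => q _; exact: Uk_ge0.
 rewrite big_mkcond [leRHS]big_mkcond /= big_nat_cond [leRHS]big_nat_cond.
 apply: ler_sum => q /andP[/andP[q0 qQ] _]; case: ifP => qk; last by case: ifP => // _; exact: Uk_ge0.
 suff -> : (q < 2 ^ Jk (trunc_log 2 Q) k)%N by [].
 apply: leq_trans (trunc_log_ltn q (ltnSn 1)) _; rewrite leq_exp2l // /Jk ltnS leq_min qk /=.
 by apply: leq_trunc_log; rewrite -ltnS.
apply: (le_trans le); rewrite (big_cat_nat _ (n := (2 ^ Jk (trunc_log 2 Q) k)%N)) ?expn_gt0 //=; last first.
 by rewrite leqW // leq_addl.
rewrite [X in _ + X]sum_nat_eq0 ?addr0; last by move=> q /andP[h _]; rewrite ltnNge h.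
by rewrite big_mkcond; apply: ler_sum => q _; case: ifP => // _; exact: Uk_ge0.
Qed.

End Final.

(** * The estimate of one level *)

Section Total.
Variable R : realType.

(* Levels below K - j1 carry blocks shorter than about x / L^(2m), where the trivial cutoff
  2^j0 = 1 is affordable; above it the moduli d < 2^j0 ~ L^m are treated by Siegel-Walfisz. *)
Lemma level_estimate (m : nat) : (1 < m)%N -> exists2 C : R, 0 < C &
 forall (x : R) (K kQ j1 k : nat), 1 <= ln x -> K%:R <= 3 * ln x -> (k < K)%N ->
 (Num.truncn x < 2 ^ K)%N -> 2 ^+ j1 <= ln x ^+ (m + m) ->
 \sum_(1 <= q < 2 ^ Jk kQ k) Uk R (Num.truncn x) k q <=
 C * x * ln x * 2 ^+ Jk kQ k + C * x * ln x ^+ 2 / ln x ^+ m * 2 ^+ k +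
 (if (k < K - j1)%N then C * x * ln x ^+ 2 * 2 ^+ k else C * x ^+ 2 / ln x ^+ m).
Proof.
(* The saving [3 m + 1]: at most [ln x ^ (2 m)] long blocks, times [ln x ^ (1 + m)], times the
   square of [ln x ^ m * x / ln x ^ (3 m + 1)], stays below [x ^ 2 / ln x ^ m]. *)
move=> m1; have [c1 c10 hs] := sql_le R; have [Kb Kb0 hb] := sum_small_moduli R m (3 * m).+1.
(* [704 = 88 * 8], [528 = 88 * 6] and [36 = 4 * 9] collect the constants of [level_bound] once [J]
   is replaced by [3 L]. *)
have [c2 c2E] := ex_named (704 * c1 : R).
have [c3 c3E] := ex_named (528 * c1 + 36 : R).
have c30 : 0 <= c3 by rewrite c3E; lra.
have [C [C0 c2C c3C cKb]] : exists C, [/\ 0 < C, c2 <= C, c3 * 2 <= C & 3 * Kb <= C].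
 by exists (c2 + c3 * 2 + 3 * Kb); split; lra.
exists C => // x K kQ j1 k L1 KL kK NK jL; have L0 := ge1_gt0 L1.
have x0 := ln_ge1_gt0 L1.
have [L LE] := ex_named (ln x).
have [N NE] := ex_named (Num.truncn x).
have Nx : N%:R <= x by rewrite NE truncn_le ltW.
have S0 : 0 <= sql R N by apply: sumr_ge0 => p _; exact: sqr_ge0.
have Sx : sql R N <= c1 * x * L by rewrite LE; exact: hs.
rewrite -NE in NK *; set J := Jk kQ k.
have JL : J%:R <= 3 * L.
 by rewrite LE; apply: le_trans KL; rewrite ler_nat /J /Jk (leq_ltn_trans (geq_minl _ _)).
have J0 : 0 <= (J%:R : R) by rewrite ler0n.
have pJ : 0 <= 2 ^+ J :> R by rewrite exprn_ge0.
have pk : 0 <= 2 ^+ k :> R by rewrite exprn_ge0.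
have Lm0 : 0 < L ^+ m by rewrite LE exprn_gt0.
have Lm1 : 1 <= L ^+ m by rewrite LE exprn_ege1.
have cx0 : 0 <= c1 * x * L by rewrite LE !mulr_ge0 ?ltW.
rewrite -LE in L1 L0 jL *.
have big (j0 : nat) (B : R) : (forall u v, (u <= v)%N -> (v <= N)%N ->
   \sum_(1 <= d < 2 ^ j0) om R (2 ^ J) d * beta R u v d <= B) ->
  \sum_(1 <= q < 2 ^ J) Uk R N k q <= (N %/ 2 ^ k)%:R * B + c2 * x * L * 2 ^+ J +
   c3 * x * L ^+ 2 * 2 ^+ k / 2 ^+ j0.
 move=> hB; apply: le_trans (level_bound k hB) _; rewrite -!addrA lerD2l.
 have p0 : 0 <= (2 ^+ j0)^-1 :> R by rewrite invr_ge0 exprn_ge0.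
 have [t tE] := ex_named (2 ^+ k / 2 ^+ j0 : R).
 have t0 : 0 <= t by rewrite tE mulr_ge0.
 have -> : 2 * J%:R * 2 ^+ k / 2 ^+ j0 = 2 * (J%:R * t) :> R by rewrite tE; ring.
 have -> : 4 * N%:R * 2 ^+ k * J%:R ^+ 2 / 2 ^+ j0 = 4 * (N%:R * t * J%:R ^+ 2) :> R by rewrite tE; ring.
 have -> : c3 * x * L ^+ 2 * 2 ^+ k / 2 ^+ j0 = 528 * c1 * x * L * (L * t) + 36 * (x * t * L ^+ 2).
  by rewrite tE c3E; ring.
 have e1 : J%:R * t <= 3 * L * t by rewrite ler_wpM2r.
 have e2 : N%:R * t * J%:R ^+ 2 <= x * t * (3 * L) ^+ 2.
  rewrite ler_pM ?mulr_ge0 ?exprn_ge0 ?ler0n // ?ler_wpM2r // lerXn2r ?nnegrE ?mulr_ge0 ?(ltW L0) //.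
 have Lt : 0 <= L * t by rewrite mulr_ge0 // ltW.
 have e3 : 88 * sql R N * (2 * (J%:R * t) + 8 * 2 ^+ J) <= 88 * (c1 * x * L) * (2 * (3 * L * t) + 8 * 2 ^+ J).
  by rewrite ler_pM ?mulr_ge0 ?addr_ge0 ?mulr_ge0 ?ler0n // ?ler_wpM2l ?lerD2r ?ler_wpM2l ?ler0n.
 have -> : 528 * c1 * x * L * (L * t) = 88 * (c1 * x * L) * (2 * (3 * L * t)) by ring.
 have -> : c2 * x * L * 2 ^+ J = 88 * (c1 * x * L) * (8 * 2 ^+ J) by rewrite c2E; ring.
 move: e2 e3; rewrite exprMn; set a := N%:R * t * _; set b := 88 * sql R N * _; lra.
have xL : 0 <= x * L by rewrite mulr_ge0 // ltW.
have T1 : c2 * x * L * 2 ^+ J <= C * x * L * 2 ^+ J.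
 by rewrite ler_wpM2r // ler_wpM2r ?(ltW L0) // ler_wpM2r ?(ltW x0).
have xLk : 0 <= x * L ^+ 2 * 2 ^+ k by rewrite !mulr_ge0 ?exprn_ge0 ?(ltW L0) ?(ltW x0).
have C0' := ltW C0.
(* Short blocks: with [j0 = 0] the range of small denominators is empty, so [B = 0]. *)
case: ifP => kj.
 have := big 0%N 0 _; rewrite expr0 divr1 mulr0 add0r => /(_ _)/le_trans; apply.
  by move=> u v _ _; rewrite expn0 big_geq.
 have T2 : c3 * x * L ^+ 2 * 2 ^+ k <= C * x * L ^+ 2 * 2 ^+ k.
  have e (c : R) : c * x * L ^+ 2 * 2 ^+ k = c * (x * L ^+ 2 * 2 ^+ k) by ring.
  by rewrite !e ler_wpM2r //; move: c30 c3C; clear; lra.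
 have T3 : 0 <= C * x * L ^+ 2 / L ^+ m * 2 ^+ k.
  by rewrite !mulr_ge0 ?invr_ge0 ?exprn_ge0 ?(ltW L0) ?(ltW x0).
 move: T1 T2 T3; clear; lra.
have [j0 /andP[j0L j0U]] := exists_pow2 Lm1.
have P0 : 0 < 2 ^+ j0 :> R by rewrite exprn_gt0.
have [X XE] := ex_named (x / L ^+ (3 * m).+1).
have X0 : 0 <= X by rewrite XE divr_ge0 ?exprn_ge0 ?ltW.
have hB u v : (u <= v)%N -> (v <= N)%N ->
  \sum_(1 <= d < 2 ^ j0) om R (2 ^ J) d * beta R u v d <= Kb * (3 * L) * L ^+ m * (L ^+ m * X) ^+ 2.
 move=> uv vN; have vx : v%:R <= x by apply: le_trans Nx; rewrite ler_nat.
 have L1' : 1 <= ln x by rewrite -LE.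
 apply: le_trans (hb x j0 J u v L1' _ uv vx) _; first by rewrite -LE.
 rewrite -LE -XE ler_wpM2r ?sqr_ge0 // ler_wpM2r ?(ltW Lm0) // ler_wpM2l ?(ltW Kb0) //.
apply: le_trans (big j0 _ hB) _.
have T2 : c3 * x * L ^+ 2 * 2 ^+ k / 2 ^+ j0 <= C * x * L ^+ 2 / L ^+ m * 2 ^+ k.
 have i1 : (2 ^+ j0)^-1 <= 2 / L ^+ m :> R.
  by rewrite ler_pdivlMr // mulrC ler_pdivrMr // -exprS ltW.
 have -> : c3 * x * L ^+ 2 * 2 ^+ k / 2 ^+ j0 = c3 * (x * L ^+ 2 * 2 ^+ k) / 2 ^+ j0 by ring.
 apply: (le_trans (ler_wpM2l (mulr_ge0 c30 xLk) i1)).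
 have -> : C * x * L ^+ 2 / L ^+ m * 2 ^+ k = C * (x * L ^+ 2 * 2 ^+ k / L ^+ m) by ring.
 have -> : c3 * (x * L ^+ 2 * 2 ^+ k) * (2 / L ^+ m) = (c3 * 2) * (x * L ^+ 2 * 2 ^+ k / L ^+ m) by ring.
 by rewrite ler_wpM2r ?divr_ge0 ?(ltW Lm0).
have T3 : (N %/ 2 ^ k)%:R * (Kb * (3 * L) * L ^+ m * (L ^+ m * X) ^+ 2) <= C * x ^+ 2 / L ^+ m.
 have M1 : (N %/ 2 ^ k)%:R <= L ^+ (m + m).
  apply: le_trans jL; rewrite -natrX ler_nat; apply: ltnW; rewrite ltn_divLR ?expn_gt0 //.
  apply: leq_trans NK _; rewrite -expnD leq_exp2l //; move: kj; clear; lia.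
 have Y0 : 0 <= Kb * (3 * L) * L ^+ m * (L ^+ m * X) ^+ 2.
  by rewrite !mulr_ge0 ?exprn_ge0 ?mulr_ge0 ?exprn_ge0 ?(ltW Kb0) ?(ltW L0).
 apply: le_trans (ler_wpM2r Y0 M1) _.
 have Ln : L ^+ m != 0 by rewrite lt0r_neq0.
 have -> : L ^+ (m + m) * (Kb * (3 * L) * L ^+ m * (L ^+ m * X) ^+ 2) = 3 * Kb * (x ^+ 2 / L ^+ m) / L.
  have E : L ^+ (3 * m).+1 = L * (L ^+ m) ^+ 3 by rewrite exprS mulnC exprM.
  rewrite XE E exprD; move: (L ^+ m) Ln => l Ln.
  by field; rewrite Ln lt0r_neq0.
 have q0 : 0 <= x ^+ 2 / L ^+ m by rewrite divr_ge0 ?exprn_ge0 ?(ltW L0) ?(ltW x0).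
 rewrite ler_pdivrMr // -[C * _ / _]mulrA.
 apply: (@le_trans _ _ (C * (x ^+ 2 / L ^+ m))); first by rewrite ler_wpM2r.
 by rewrite ler_peMr // mulr_ge0.
move: T1 T2 T3; clear; lra.
Qed.

End Total.

(** * Summation over the levels *)

Section Conclusion.
Variable R : realType.

(** At the critical level the weight is [r ^ (K - kQ) <= 4 L], from [2 ^ (K - kQ) <= 4 L ^ m] and
    [r ^ m = 2]. Below it the range of moduli grows like [2 ^ k] against [r < 2], above it the
    weights decrease geometrically, so [SA] loses just this factor. For the other terms
    [x / L ^ m <= Q] and [L ^ 2 <= L ^ m] are enough. *)
Lemma levels_total (m : nat) (r : R) : (1 < m)%N -> 1 < r -> r <= 3 / 2 -> r ^+ m = 2 ->
 exists2 C : R, 0 < C & forall (x Q : R) (K : nat), 1 <= ln x -> x / ln x ^+ m <= Q -> Q <= x ->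
 (0 < Num.truncn Q)%N -> K = (trunc_log 2 (Num.truncn x)).+1 ->
 \sum_(0 <= k < K) r ^+ (K - k) *
  \sum_(1 <= q < 2 ^ Jk (trunc_log 2 (Num.truncn Q)) k) Uk R (Num.truncn x) k q <= C * x * Q * ln x ^+ 2.
Proof.
move=> m1 r1 r32 rm; have [C C0 hC] := level_estimate R m1.
have r0 := lt_trans ltr01 r1; have [g gE] := ex_named (r / (r - 1)).
have g0 : 0 <= g by rewrite gE divr_ge0 ?subr_ge0 ?(ltW r0) ?(ltW r1).
exists (C * (48 + 8 * g) + C * 12 + C * 24 + C * g).
 have p1 : 0 <= C * g by rewrite mulr_ge0 // ltW.
 have -> : C * (48 + 8 * g) + C * 12 + C * 24 + C * g = 84 * C + 9 * (C * g) by ring.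
 by move: C0 p1; clear; lra.
move=> x Q K L1 xQ Qx Q0 KE; have L0 := ge1_gt0 L1.
have x0 := ln_ge1_gt0 L1.
have [N NE] := ex_named (Num.truncn x).
have [q qE] := ex_named (Num.truncn Q).
rewrite -NE -qE in Q0 KE *.
have Qp : 0 < Q by apply: lt_le_trans xQ; rewrite divr_gt0 ?exprn_gt0.
have /andP[Nx _] : N%:R <= x < N.+1%:R by rewrite NE truncn_itv // ltW.
have /andP[qQ Qq] : q%:R <= Q < q.+1%:R by rewrite qE truncn_itv // ltW.
have qN : (q <= N)%N by rewrite qE NE; apply: le_truncn.
have N0 := leq_trans Q0 qN.
have KN : (2 ^ K <= 2 * N)%N by rewrite KE expnS leq_mul2l trunc_logP.
have NK : (N < 2 ^ K)%N by rewrite KE trunc_log_ltn.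
have Kx : 2 ^+ K <= 2 * x by apply: (@le_trans _ _ (2 * N%:R)); [rewrite -natrX -natrM ler_nat|rewrite ler_wpM2l].
have KL : K%:R <= 3 * ln x by rewrite KE; exact: trunc_log_le_ln.
have [kQ kQE] := ex_named (trunc_log 2 q).
have kQK : (kQ <= K)%N by rewrite kQE KE leqW // leq_trunc_log.
have kQ1 : 2 ^+ kQ <= Q by apply: le_trans qQ; rewrite -natrX ler_nat kQE trunc_logP.
have kQ2 : Q <= 2 * 2 ^+ kQ.
 by apply: le_trans (ltW Qq) _; rewrite -exprS -natrX ler_nat kQE trunc_log_ltn.
rewrite -kQE; have [L LE] := ex_named (ln x).
rewrite -LE in L1 L0 KL xQ *.
have Lm0 : 0 < L ^+ m by rewrite exprn_gt0.
have m0 : (0 < m)%N by exact: ltnW.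
have rKQ : r ^+ (K - kQ) <= 4 * L.
 rewrite -(ler_pXn2r m0) ?nnegrE ?exprn_ge0 ?mulr_ge0 ?(ltW r0) ?(ltW L0) //.
 rewrite exprAC rm.
 have h1 : 2 ^+ (K - kQ) * 2 ^+ kQ <= 2 * x by rewrite -exprD subnK.
 have h2 : x <= Q * L ^+ m by rewrite -ler_pdivrMr.
 have h3 : 2 ^+ (K - kQ) <= 4 * L ^+ m.
  have p1 : 0 < 2 ^+ kQ :> R by rewrite exprn_gt0.
  rewrite -(ler_pM2r p1); apply: (le_trans h1).
  have := ler_wpM2r (ltW Lm0) kQ2; lra.
 apply: (le_trans h3); rewrite exprMn ler_wpM2r ?(ltW Lm0) // -[leLHS]expr1 ler_weXn2l // ler1n //.
have L2m1 : 1 <= L ^+ (m + m) by rewrite exprn_ege1.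
(* The top [j1] levels are the long blocks, at most about [L ^ (2 m)] per level; their weights are
   at most [r ^ j1 <= L ^ 2]. *)
have [j1 /andP[j1L j1U]] := exists_pow2 L2m1.
have rj1 : r ^+ j1 <= L ^+ 2.
 rewrite -(ler_pXn2r m0) ?nnegrE ?exprn_ge0 ?(ltW r0) ?(ltW L0) // exprAC rm -exprM mul2n -addnn //.
have w0 k : 0 <= r ^+ (K - k) by rewrite exprn_ge0 // ltW.
have [a1 a1E] := ex_named (C * x * L).
have [a3 a3E] := ex_named (C * x * L ^+ 2).
have [a2 a2E] := ex_named (a3 / L ^+ m).
have [a4 a4E] := ex_named (C * x ^+ 2 / L ^+ m).
have a10 : 0 <= a1 by rewrite a1E !mulr_ge0 ?ltW.
have a30 : 0 <= a3 by rewrite a3E !mulr_ge0 ?exprn_ge0 ?ltW.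
have a20 : 0 <= a2 by rewrite a2E divr_ge0 ?(ltW Lm0).
have a40 : 0 <= a4 by rewrite a4E; apply: divr_ge0 (ltW Lm0); rewrite mulr_ge0 ?exprn_ge0 ?ltW.
have W k : (k < K)%N -> \sum_(1 <= q < 2 ^ Jk kQ k) Uk R N k q <=
  a1 * 2 ^+ Jk kQ k + a2 * 2 ^+ k + (if (k < K - j1)%N then a3 * 2 ^+ k else a4).
 move=> kK; have L1' : 1 <= ln x by rewrite -LE.
 have h := hC x K kQ j1 k L1'; rewrite -NE -LE in h.
 by rewrite a1E a2E a3E a4E; exact: h.
have SA : \sum_(0 <= k < K) r ^+ (K - k) * 2 ^+ Jk kQ k <= (48 + 8 * g) * (Q * L).
 rewrite (big_cat_nat _ (n := kQ)) //=.
 have s1 : \sum_(0 <= k < kQ) r ^+ (K - k) * 2 ^+ Jk kQ k <= 48 * (Q * L).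
  apply: (@le_trans _ _ (2 * (6 * r ^+ (K - kQ) * 2 ^+ kQ))).
   apply: le_trans (ler_wpM2l _ (sum_geo_mix_shift r1 r32 kQK)) => //.
   rewrite mulr_sumr; apply: ler_sum_nat => k /andP[_ kq].
   by rewrite /Jk (minn_idPl (ltnW kq)) exprS mulrCA.
  have := ler_pM (w0 kQ) (exprn_ge0 kQ (ler0n R 2)) rKQ kQ1; lra.
 have s2 : \sum_(kQ <= k < K) r ^+ (K - k) * 2 ^+ Jk kQ k <= 8 * g * (Q * L).
  apply: (@le_trans _ _ (\sum_(kQ <= k < K) r ^+ (K - k) * (2 * 2 ^+ kQ))).
   apply: ler_sum_nat => k /andP[kq _].
   by rewrite /Jk (minn_idPr kq) exprS.
  rewrite -mulr_suml; have h := sum_geo_shift r1 kQK; rewrite -gE in h.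
  have p2 : 0 <= 2 * 2 ^+ kQ :> R by rewrite mulr_ge0 // exprn_ge0.
  apply: le_trans (ler_wpM2r p2 h) _.
  have := ler_wpM2l g0 (ler_pM (w0 kQ) (exprn_ge0 kQ (ler0n R 2)) rKQ kQ1); lra.
 by rewrite mulrDl lerD.
have SB : \sum_(0 <= k < K) r ^+ (K - k) * 2 ^+ k <= 12 * x.
 by apply: le_trans (sum_geo_mix r1 r32 K) _; lra.
have SC : \sum_(0 <= k < K - j1) r ^+ (K - k) * 2 ^+ k <= 24 * x * L ^+ 2 / L ^+ (m + m).
 have [jK|Kj] := leqP j1 K; last first.
  rewrite (eqP (_ : K - j1 == 0)%N) ?subn_eq0 1?ltnW // big_geq //.
  by rewrite divr_ge0 ?mulr_ge0 ?exprn_ge0 ?ltW.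
 have := sum_geo_mix_shift r1 r32 (leq_subr j1 K); rewrite subKn // => h; apply: (le_trans h).
 have p1 : 0 < 2 ^+ j1 :> R by rewrite exprn_gt0.
 have h1 : 2 ^+ (K - j1) * 2 ^+ j1 <= 2 * x by rewrite -exprD subnK.
 have h2 : 2 ^+ (K - j1) <= 4 * x / L ^+ (m + m).
  rewrite ler_pdivlMr ?exprn_gt0 //; apply: le_trans (ler_wpM2l _ (ltW j1U)) _; first by rewrite exprn_ge0.
  by rewrite exprS; lra.
 have := ler_pM (exprn_ge0 j1 (ltW r0)) (exprn_ge0 (K - j1) (ler0n R 2)) rj1 h2; lra.
have SD : \sum_(K - j1 <= k < K) r ^+ (K - k) <= g * L ^+ 2.
 have h := sum_geo_shift r1 (leq_subr j1 K); rewrite -gE in h; apply: (le_trans h).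
 rewrite ler_wpM2l //; apply: le_trans rj1; rewrite ler_weXn2l ?(ltW r1) //.
 by clear; lia.
apply: (@le_trans _ _ (a1 * ((48 + 8 * g) * (Q * L)) + a2 * (12 * x) +
  (a3 * (24 * x * L ^+ 2 / L ^+ (m + m)) + a4 * (g * L ^+ 2)))).
 apply: (@le_trans _ _ (\sum_(0 <= k < K) (a1 * (r ^+ (K - k) * 2 ^+ Jk kQ k) + a2 * (r ^+ (K - k) * 2 ^+ k) +
   r ^+ (K - k) * (if (k < K - j1)%N then a3 * 2 ^+ k else a4)))).
  apply: ler_sum_nat => k /andP[_ kK].
  apply: le_trans (ler_wpM2l (w0 k) (W k kK)) _.
  by apply: eq_lew; ring.
 rewrite !big_split /= -!mulr_sumr; apply: lerD; first by apply: lerD; rewrite ler_wpM2l.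
 rewrite (big_cat_nat _ (n := (K - j1)%N)) ?leq_subr //=; apply: lerD.
  apply: le_trans (ler_wpM2l a30 SC); rewrite mulr_sumr big_nat_cond [leRHS]big_nat_cond.
  by apply: ler_sum => k /andP[/andP[_ ->] _]; rewrite mulrCA.
 apply: le_trans (ler_wpM2l a40 SD); rewrite mulr_sumr big_nat_cond [leRHS]big_nat_cond.
 by apply: ler_sum => k /andP[/andP[kj _] _]; rewrite ltnNge kj mulrC.
have Cx : 0 <= C * x by rewrite mulr_ge0 ?ltW.
have L20 : 0 <= L ^+ 2 by rewrite exprn_ge0 // ltW.
have y0 : 0 <= C * x * L ^+ 2 by rewrite mulr_ge0.
have Lm2 : L ^+ 2 / L ^+ m <= 1 by rewrite ler_pdivrMr // mul1r ler_weXn2l.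
have z1 : a1 * ((48 + 8 * g) * (Q * L)) = C * (48 + 8 * g) * x * Q * L ^+ 2 by rewrite a1E; ring.
have z2 : a2 * (12 * x) <= C * 12 * x * Q * L ^+ 2.
 have -> : a2 * (12 * x) = 12 * (C * x * L ^+ 2) * (x / L ^+ m) by rewrite a2E a3E; ring.
 have -> : C * 12 * x * Q * L ^+ 2 = 12 * (C * x * L ^+ 2) * Q by ring.
 by rewrite ler_wpM2l // mulr_ge0.
have z3 : a3 * (24 * x * L ^+ 2 / L ^+ (m + m)) <= C * 24 * x * Q * L ^+ 2.
 have -> : a3 * (24 * x * L ^+ 2 / L ^+ (m + m)) = 24 * (C * x * L ^+ 2) * (x / L ^+ m * (L ^+ 2 / L ^+ m)).
  by rewrite a3E exprD invfM; ring.
 have -> : C * 24 * x * Q * L ^+ 2 = 24 * (C * x * L ^+ 2) * Q by ring.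
 have y24 : 0 <= 24 * (C * x * L ^+ 2) by exact: mulr_ge0 (ler0n _ _) y0.
 rewrite ler_wpM2l //; apply: le_trans xQ.
 by rewrite -[leRHS]mulr1 ler_wpM2l // divr_ge0 ?ltW.
have z4 : a4 * (g * L ^+ 2) <= C * g * x * Q * L ^+ 2.
 have -> : a4 * (g * L ^+ 2) = g * (C * x * L ^+ 2) * (x / L ^+ m) by rewrite a4E; ring.
 have -> : C * g * x * Q * L ^+ 2 = g * (C * x * L ^+ 2) * Q by ring.
 by rewrite ler_wpM2l // mulr_ge0.
have -> : (C * (48 + 8 * g) + C * 12 + C * 24 + C * g) * x * Q * L ^+ 2 = C * (48 + 8 * g) * x * Q * L ^+ 2 +
  C * 12 * x * Q * L ^+ 2 + (C * 24 * x * Q * L ^+ 2 + C * g * x * Q * L ^+ 2) by ring.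
by rewrite z1; apply: lerD; [rewrite lerD2l|apply: lerD].
Qed.

End Conclusion.

(** * From partitions to lists of end points *)

Section Partitions.
Variable R : realType.

Lemma thq_mod q a n : thq R q (a %% q) n = thq R q a n.
Proof. by rewrite /thq; apply: eq_bigl => p; rewrite modn_mod. Qed.

(** The residues [1, ..., q] are exchanged for [0, ..., q - 1]; only [a = q] changes its
    representative. *)
Lemma var_sum_pairs q cs : (0 < q)%N -> path ltn 0%N cs ->
 var_sum q [seq (p.1.+1, p.2) | p <- pairs 0 cs] =
 \sum_(0 <= a < q | coprime a q) \sum_(p <- pairs 0 cs) (TT R q a p.2 - TT R q a p.1) ^+ 2.
Proof.
move=> q0 hp; pose F a := \sum_(p <- pairs 0 cs) (TT R q a p.2 - TT R q a p.1) ^+ 2.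
transitivity (\sum_(1 <= a < q.+1 | coprime a q) F a).
 apply: eq_bigr => a _; rewrite big_map big_seq [RHS]big_seq; apply: eq_bigr => -[u v] pp.
 have /and3P[_ /= uv _] := pairs_bound hp pp; congr (_ ^+ 2).
 have e : (v - u.+1).+1 = (v - u)%N by rewrite -subSn.
 have ie : ival_elems (u.+1, v) = index_iota u.+1 v.+1 by rewrite /index_iota subSS -e.
 have ce : ival_card (u.+1, v) = (v - u)%N by [].
 rewrite /theta_ival ie ce /TT /thq natrB; last exact: ltnW.
 have := @sum_nat_shift R (@lnn R) (fun p => prime p && (p == a %[mod q])%N) u v (ltnW uv).
 by lra.
rewrite big_mkcond [RHS]big_mkcond big_nat_recr //= [RHS]big_ltn // addrC; congr (_ + _).
have Fe : F q = F 0%N.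
 by apply: eq_bigr => p _; rewrite /TT -!(thq_mod q q) modnn.
by rewrite Fe -(coprime_modl q q) modnn.
Qed.

(** An upper bound of a set bounds its supremum if the set is inhabited: by the partition into a
    single interval, or by the empty one when there is no integer to cover. *)
Lemma max_var_sum_le x q (B : R) : (0 < q)%N ->
 (forall cs, path ltn 0%N cs -> last 0%N cs = Num.truncn x ->
   \sum_(0 <= a < q | coprime a q) \sum_(p <- pairs 0 cs) (TT R q a p.2 - TT R q a p.1) ^+ 2 <= B) ->
 max_var_sum x q <= B.
Proof.
move=> q0 h; apply: ge_sup => [|_ [pi [hpi e] <-]].
 have [N0|N0] := posnP (Num.truncn x); [exists (var_sum q [::])|exists (var_sum q [:: (1%N, Num.truncn x)])].
  by exists [::] => //; split=> //; rewrite N0.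
 exists [:: (1%N, Num.truncn x)] => //; split; first by rewrite /= N0.
 change (iota 1 (Num.truncn x - 1).+1 ++ [::] = iota 1 (Num.truncn x)).
 by rewrite cats0 subn1 prednK.
have [cs [h1 h2 ->]] := partition_pairs hpi e.
by rewrite var_sum_pairs //; apply: h.
Qed.

End Partitions.

Theorem theorem5 (R : realType) (A : R) (hA : 0 < A) :
 exists C : R, 0 < C /\
  forall x Q : R, 0 < x -> 0 < Q -> 1 < x ->
   x * (ln x) `^ (- A) <= Q -> Q <= x ->
   \sum_(1 <= q < (Num.truncn Q).+1) max_var_sum x q
    <= C * x * Q * (ln x) ^+ 2.
Proof.
(* [m >= A] turns the hypothesis into [x / ln x ^ m <= Q]; [m >= 2] gives [r <= 3/2] and
   [ln x ^ 2 <= ln x ^ m]. *)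
pose m := (Num.truncn A).+2; have m1 : (1 < m)%N by [].
have Am : A <= m%:R.
 have /andP[_ h] := truncn_itv (ltW hA); apply: le_trans (ltW h) _; by rewrite ler_nat.
have [r [r1 r32 rm]] := exists_root2 R m1.
have [C1 C10 h1] := levels_total m1 r1 r32 rm.
have [c c0 hs] := sql_le R.
have g0 : 0 < (r - 1)^-1 by rewrite invr_gt0 subr_gt0.
exists (8 * (c + 3) + 8 / (r - 1) * C1); split.
 by rewrite addr_gt0 ?mulr_gt0 // addr_gt0.
move=> x Q x0 Q0 x1 xAQ Qx; have l0 : 0 < ln x by rewrite ln_gt0.
(* The two bounds on [Q] force [ln x ^ (-A) <= 1], which excludes [ln x < 1]. *)
have L1 : 1 <= ln x.
 have h : 0 <= ln (ln x).
  have : ln x `^ (- A) <= 1 by rewrite -(ler_pM2l x0) mulr1; exact: le_trans Qx.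
  by rewrite /powR gt_eqF // -expR0 ler_expR mulNr oppr_le0 pmulr_rge0.
 by rewrite -ler_ln ?posrE // ln1.
have xmQ : x / ln x ^+ m <= Q.
 apply: le_trans xAQ; rewrite ler_wpM2l ?(ltW x0) // -powR_mulrn ?(ltW l0) // -powRN.
 by rewrite ler_powR // lerN2.
(* For [Q < 1] there is no modulus to sum over. *)
have [q0|q0] := posnP (Num.truncn Q).
 rewrite q0 big_geq // !mulr_ge0 ?(ltW x0) ?(ltW Q0) ?(ltW l0) // addr_ge0 ?mulr_ge0 ?(ltW g0) ?(ltW C10) //.
 by rewrite addr_ge0 // ltW.
have [K KE] := ex_named ((trunc_log 2 (Num.truncn x)).+1).
have H1 := h1 x Q K L1 xmQ Qx q0 KE.
have [N NE] := ex_named (Num.truncn x).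
have Nx : N%:R <= x by rewrite NE truncn_le ltW.
have qN : (Num.truncn Q <= N)%N by rewrite NE; apply: le_truncn.
have qQ : (Num.truncn Q)%:R <= Q by rewrite truncn_le ltW.
have NK : (N < 2 ^ K)%N by rewrite KE -NE trunc_log_ltn.
have KL : K%:R <= 3 * ln x.
 by rewrite KE -NE; apply: trunc_log_le_ln => //; exact: leq_trans qN.
(* For each [q] the short pieces cost a multiple of [x ln x]; summed over [q <= Q] they remain a
   logarithm below the target, and only the levels reach it. *)
apply: (@le_trans _ _ (\sum_(1 <= q < (Num.truncn Q).+1) (8 * ((c + 3) * (x * ln x)) +
  8 / (r - 1) * \sum_(trunc_log 2 q <= k < K) r ^+ (K - k) * Uk R N k q))).
 apply: ler_sum_nat => q /andP[qp qb].
 have qK : (trunc_log 2 q < K)%N by rewrite KE -NE ltnS leq_trunc_log // (leq_trans _ qN).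
 apply: max_var_sum_le => // cs hp hl; rewrite -NE in hl.
 apply: le_trans (pairs_bound_sum r1 qp (ltnW qK) NK hp hl) _; rewrite lerD2r ler_wpM2l //.
 rewrite /Psi mulrDl lerD //; first by rewrite mulrA; exact: hs.
 have -> : 3 * (x * ln x) = 3 * ln x * x by ring.
 rewrite ler_pM //; apply: le_trans KL.
 by rewrite ler_nat.
rewrite big_split sumr_const_nat subn1 /= -mulr_sumr -[_ *+ _]mulr_natl.
have -> : (8 * (c + 3) + 8 / (r - 1) * C1) * x * Q * ln x ^+ 2 =
  Q * (8 * ((c + 3) * (x * ln x))) * ln x + 8 / (r - 1) * (C1 * x * Q * ln x ^+ 2) by ring.
apply: lerD.
 have y0 : 0 <= 8 * ((c + 3) * (x * ln x)).
  by rewrite !mulr_ge0 ?(ltW x0) ?(ltW l0) // addr_ge0 // ltW.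
 by apply: le_trans (ler_wpM2r y0 qQ) _; rewrite ler_peMr // mulr_ge0 // ltW.
have c80 : 0 <= 8 / (r - 1) by rewrite mulr_ge0 // ltW.
rewrite ler_wpM2l //; apply: le_trans H1; rewrite -NE; exact: sum_levels.
Qed.
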